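(* For each positive integer $n$, there exist $w_1,\ldots,w_n\in\mathfrak{H}$ such that \[ f_n(\tau)=\frac{\eta^4(\tau)}{\prod_{i=1}^n(J(\tau)-J(w_i))^2} \] is a weight $2$ modular form with a character of $\mathrm{SL}_2(\mathbb{Z})$ that is non-vanishing on $\mathfrak{H}$, has a double pole and zero residue at each $w_i$, and is holomorphic elsewhere in $\mathfrak{H}$ and at $\infty$.
   Context: $\mathfrak{H}$ is the complex upper half-plane, $q=e^{2\pi i\tau}$. $\eta(\tau)=q^{1/24}\prod_{m\geq1}(1-q^m)$ is the Dedekind eta function, $\Delta=\eta^{24}$, $E_4(\tau)=1+240\sum_{m\geq1}\sigma_3(m)q^m$ with $\sigma_3(m)=\sum_{0<d\mid m}d^3$, and $J=\dfrac{E_4^3}{1728\,\Delta}$ is the elliptic modular invariant. A (meromorphic) weight $2$ modular form with character $\chi:\mathrm{SL}_2(\mathbb{Z})\to\mathbb{C}^\times$ is a meromorphic function $g$ on $\mathfrak{H}$ with $g\left(\frac{a\tau+b}{c\tau+d}\right)=\chi(\gamma)(c\tau+d)^2g(\tau)$ for all $\gamma=\begin{pmatrix}a&b\\c&d\end{pmatrix}\in\mathrm{SL}_2(\mathbb{Z})$.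
   Formalization: ''Holomorphic elsewhere in H'' is taken off the SL_2(Z)-orbits of the w_i, since J is invariant and f_n has a pole at every point of these orbits (e.g. w_1+1); non-vanishing and the transformation law are likewise stated off these orbits. *)

(* Defs.v *)
From Stdlib Require Import Reals ZArith Lia ClassicalEpsilon.
From Coquelicot Require Import Coquelicot.
Open Scope C_scope.

Definition Cexp (z : C) : C :=
  (exp (Re z) * cos (Im z), exp (Re z) * sin (Im z))%R.

Definition upper_half (t : C) : Prop := (0 < Im t)%R.

Definition qexp (t : C) : C := Cexp (2 * RtoC PI * Ci * t).

Definition Clim (u : nat -> C) : C :=
  epsilon (inhabits (RtoC 0))
    (fun l : C => filterlim u eventually (locally (T := C_UniformSpace) l)).

Fixpoint eta_pp (q : C) (N : nat) : C :=
  match N with O => 1 | S k => eta_pp q k * (1 - Cpow q (S k)) end.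

Definition eta (t : C) : C :=
  Cexp (2 * RtoC PI * Ci * t / 24) * Clim (eta_pp (qexp t)).

Fixpoint sig3_aux (m d : nat) : nat :=
  match d with
  | O => O
  | S k => ((if Nat.eqb (m mod (S k)) 0 then (S k) ^ 3 else 0) + sig3_aux m k)%nat
  end.
Definition sigma3 (m : nat) : nat := sig3_aux m m.

Fixpoint E4_ps (q : C) (N : nat) : C :=
  match N with O => 0 | S k => E4_ps q k + RtoC (INR (sigma3 (S k))) * Cpow q (S k) end.

Definition E4 (t : C) : C := 1 + 240 * Clim (E4_ps (qexp t)).

Definition Delta (t : C) : C := Cpow (eta t) 24.

Definition J (t : C) : C := Cpow (E4 t) 3 / (1728 * Delta t).

Record SL2Z := mkSL2Z { sa : Z; sb : Z; sc : Z; sd : Z;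
                        sdet : (sa * sd - sb * sc = 1)%Z }.

Lemma SL2Z_mul_det (g h : SL2Z) :
  ((sa g * sa h + sb g * sc h) * (sc g * sb h + sd g * sd h)
   - (sa g * sb h + sb g * sd h) * (sc g * sa h + sd g * sc h) = 1)%Z.
Proof.
  destruct g as [a b c d Hg], h as [a' b' c' d' Hh]; simpl.
  replace ((a * a' + b * c') * (c * b' + d * d') - (a * b' + b * d') * (c * a' + d * c'))%Z
    with ((a * d - b * c) * (a' * d' - b' * c'))%Z by ring.
  rewrite Hg, Hh; reflexivity.
Qed.

Definition SL2Z_mul (g h : SL2Z) : SL2Z :=
  mkSL2Z (sa g * sa h + sb g * sc h) (sa g * sb h + sb g * sd h)
         (sc g * sa h + sd g * sc h) (sc g * sb h + sd g * sd h)
         (SL2Z_mul_det g h).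

Definition mob (g : SL2Z) (t : C) : C :=
  (RtoC (IZR (sa g)) * t + RtoC (IZR (sb g))) / (RtoC (IZR (sc g)) * t + RtoC (IZR (sd g))).

Definition jfac (g : SL2Z) (t : C) : C := RtoC (IZR (sc g)) * t + RtoC (IZR (sd g)).

Definition is_character (chi : SL2Z -> C) : Prop :=
  (forall g h, chi (SL2Z_mul g h) = chi g * chi h) /\ (forall g, chi g <> 0).

Definition holo_at (f : C -> C) (t : C) : Prop :=
  ex_derive (K := C_AbsRing) (V := C_NormedModule) f t.

Definition sl2_equiv (t w : C) : Prop := exists g : SL2Z, t = mob g w.

Definition double_pole_zero_residue (f : C -> C) (w : C) : Prop :=
  exists (a : C) (r : R), a <> 0 /\ (0 < r)%R /\
    exists h : C -> C,
      (forall z, (Cmod (z - w) < r)%R -> holo_at h z) /\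
      (forall z, (Cmod (z - w) < r)%R -> z <> w -> f z = a / Cpow (z - w) 2 + h z).

Fixpoint prodJ (w : nat -> C) (n : nat) (t : C) : C :=
  match n with O => 1 | S k => prodJ w k t * (J t - J (w (S k))) end.

Definition f_n (n : nat) (w : nat -> C) (t : C) : C :=
  Cpow (eta t) 4 / Cpow (prodJ w n t) 2.

(* Main.v *)
(* Write P, Q, R for the Eisenstein series E2, E4, E6 and D = q d/dq. Since J is invariant and eta^4 has weight 2 with
   a character, the content lies in the choice of the w_i. With x_i = J(w_i), Ramanujan's equations give
   DJ = - J R / Q, D^2 J / DJ = P/6 - 2R/(3Q) - Q^2/(2R) and D eta^4 / eta^4 = P/6, and Q^3/R^2 = J/(J-1); hence the
   residue at w_i vanishes iff
       sum_{j <> i} 2/(x_i - x_j) + (2/3)/x_i + (1/2)/(x_i - 1) = 0.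
   A maximizer in [0,1]^n of prod x_i^4 (1-x_i)^3 prod_{i<j} (x_i-x_j)^12 solves this system with distinct x_i in (0,1).
   On the arc of the unit circle between rho and i, J is real and takes every value in (0,1); w_i is taken there. That
   J takes the value x_i only on the orbit of w_i follows from Im J < 0 inside the half fundamental domain (maximum
   principle; J' <> 0 there because Q and R are univalent in q for small q) and from the signs of J on its boundary.
   The transformation laws of E2 and E4 are proved by exchanging the order of summation in lattice sums, that of
   eta^4 from E2 by logarithmic differentiation, and R' from the vanishing of a form of weight 8 with a double zero at
   the cusp. *)

Require Import Defs.
From Stdlib Require Import Reals ZArith.
From Coquelicot Require Import Coquelicot.
From Stdlib Require Import Lra Lia Psatz ClassicalEpsilon FunctionalExtensionality Eqdep_dec.
Open Scope C_scope.

(** * Series of complex numbers *)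

(** All analysis is done with power series in q and real calculus, without contour integrals.
    Inequalities for complex derivatives come from the real mean value theorem applied to a
    projection; Cauchy's estimates from averages over roots of unity; the maximum principle from the
    remark that [J'] vanishes at an interior maximum of [Im J]; and identities between forms from a
    zero derivative together with a limit at the cusp or the value at i. Zero residue is encoded as
    f = a/(z-w)^2 + h with h differentiable at w itself. The removable singularity is therefore
    treated by hand: [jet] records finitely many Taylor terms with a continuous remainder and
    survives division by z - w. The x_i must avoid 0 and 1, the values of J over which [J']
    vanishes; elsewhere J - x_i has simple zeros, which is what gives poles of order exactly two.
    The poles of f_n fill whole orbits of the group, so holomorphy and non-vanishing off these
    orbits require each fibre of J over x_i to be a single orbit. *)

Lemma Cmod_minus_sym (x y : C) : Cmod (x - y) = Cmod (y - x).
Proof. replace (x - y) with (- (y - x)) by ring. apply Cmod_opp. Qed.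

Lemma Cmod_triangle_minus (x y : C) : (Cmod (x - y) <= Cmod x + Cmod y)%R.
Proof. unfold Cminus. rewrite <- (Cmod_opp y). apply Cmod_triangle. Qed.

Lemma Cmod_triangle_rev (x y : C) : (Cmod x - Cmod y <= Cmod (x + y))%R.
Proof.
  pose proof (Cmod_triangle (x + y) (- y)) as H. rewrite Cmod_opp in H.
  replace (x + y + - y) with x in H by ring. lra.
Qed.

Lemma im_le_Cmod (c : C) : (Rabs (Im c) <= Cmod c)%R.
Proof. eapply Rle_trans; [apply Rmax_r | apply (Rmax_Cmod c)]. Qed.

Lemma Cmod_le_Re_Im (c : C) : (Cmod c <= Rabs (Re c) + Rabs (Im c))%R.
Proof.
  replace c with (RtoC (Re c) + RtoC (Im c) * Ci) at 1
    by (destruct c; apply injective_projections; simpl; ring).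
  eapply Rle_trans; [apply Cmod_triangle|].
  rewrite Cmod_mult, Cmod_Ci, !Cmod_R. lra.
Qed.

Lemma Cmod_sqr (c : C) : (Cmod c * Cmod c = Re c * Re c + Im c * Im c)%R.
Proof. pose proof (Cmod2_alt c). simpl in H. lra. Qed.

Lemma Cmod_RtoC_pos (x : R) : (0 <= x)%R -> Cmod (RtoC x) = x.
Proof. intros H. rewrite Cmod_R. apply Rabs_pos_eq, H. Qed.

Lemma RtoC_neq (x : R) : x <> 0%R -> RtoC x <> 0.
Proof. intros H E. apply H. now injection E. Qed.

Lemma Cmod_neq (x : C) : (0 < Cmod x)%R -> x <> 0.
Proof. intros H. now apply Cmod_gt_0. Qed.

Lemma Ci_sqr : Ci * Ci = -1.
Proof. apply injective_projections; simpl; ring. Qed.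

Lemma Ci_neq_0 : Ci <> 0.
Proof. apply Cmod_neq. rewrite Cmod_Ci. lra. Qed.

Fixpoint csum (a : nat -> C) (N : nat) : C :=
  match N with O => 0 | S k => csum a k + a k end.

Fixpoint rsum (a : nat -> R) (N : nat) : R :=
  match N with O => 0%R | S k => (rsum a k + a k)%R end.

(** Absolute convergence is the only notion of summability, so that rearrangement and Fubini are
    always available; sums over all integers are made absolutely convergent where necessary by
    pairing n with -n. *)
Definition summable (a : nat -> C) : Prop := ex_series (fun n => Cmod (a n)).

Definition Cser (a : nat -> C) : C :=
  (Series (fun n => Re (a n)), Series (fun n => Im (a n))).

(** Stated through the real sequence of distances, so that limits of real sequences can be reused;
    [is_clim_filterlim] connects it with the filter that occurs in [Clim]. *)
Definition is_clim (u : nat -> C) (l : C) : Prop :=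
  is_lim_seq (fun n => Cmod (u n - l)) 0%R.

Lemma rsum_sum_n (a : nat -> R) (N : nat) : rsum a (S N) = sum_n a N.
Proof.
  induction N as [|N IH]; simpl.
  - rewrite sum_O. ring.
  - rewrite sum_Sn, <- IH. reflexivity.
Qed.

Lemma rsum_ext (a b : nat -> R) (N : nat) :
  (forall n, (n < N)%nat -> a n = b n) -> rsum a N = rsum b N.
Proof.
  induction N as [|N IH]; intros H; simpl; [easy|].
  rewrite IH, H; [easy | lia | intros n Hn; apply H; lia].
Qed.

Lemma rsum_le (a b : nat -> R) (N : nat) :
  (forall n, (n < N)%nat -> (a n <= b n)%R) -> (rsum a N <= rsum b N)%R.
Proof.
  induction N as [|N IH]; intros H; simpl; [lra|].
  apply Rplus_le_compat; [apply IH; intros n Hn; apply H; lia | apply H; lia].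
Qed.

Lemma rsum_const (c : R) (N : nat) : rsum (fun _ => c) N = (INR N * c)%R.
Proof. induction N as [|N IH]; [simpl; ring|]. rewrite S_INR; simpl rsum; rewrite IH; ring. Qed.

Lemma rsum_scal (c : R) (a : nat -> R) (N : nat) :
  rsum (fun n => c * a n)%R N = (c * rsum a N)%R.
Proof. induction N as [|N IH]; simpl; [ring|]. rewrite IH; ring. Qed.

Lemma rsum_pos (a : nat -> R) (N : nat) :
  (forall n, (n < N)%nat -> (0 <= a n)%R) -> (0 <= rsum a N)%R.
Proof.
  intros H. rewrite <- (Rmult_0_r (INR N)), <- (rsum_const 0 N). now apply rsum_le.
Qed.

Lemma is_lim_rsum (a : nat -> R) : ex_series a -> is_lim_seq (rsum a) (Series a).
Proof.
  intros H. apply is_lim_seq_incr_1.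
  apply is_lim_seq_ext with (sum_n a); [intros n; now rewrite rsum_sum_n|].
  apply Series_correct, H.
Qed.

Lemma is_series_rsum (a : nat -> R) (l : R) : is_lim_seq (rsum a) l -> is_series a l.
Proof.
  intros H. apply is_lim_seq_incr_1 in H.
  apply is_lim_seq_ext with (v := sum_n a) in H; [exact H|].
  intros n; now rewrite rsum_sum_n.
Qed.

Lemma ex_series_bounded (a : nat -> R) (M : R) :
  (forall n, (0 <= a n)%R) -> (forall N, (rsum a N <= M)%R) -> ex_series a.
Proof.
  intros Ha HM.
  destruct (ex_finite_lim_seq_incr (rsum a) M) as [l Hl].
  - intros n; simpl. specialize (Ha n). lra.
  - exact HM.
  - exists l. now apply is_series_rsum.
Qed.

Lemma rsum_le_Series (a : nat -> R) (N : nat) :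
  (forall n, (0 <= a n)%R) -> ex_series a -> (rsum a N <= Series a)%R.
Proof.
  intros Ha He. apply (is_lim_seq_incr_compare (rsum a)).
  - now apply is_lim_rsum.
  - intros n; simpl. specialize (Ha n). lra.
Qed.

Lemma Series_pos (a : nat -> R) : (forall n, (0 <= a n)%R) -> ex_series a -> (0 <= Series a)%R.
Proof. intros Ha He. apply (rsum_le_Series a 0 Ha He). Qed.

Lemma term_le_Series (a : nat -> R) (n : nat) :
  (forall n, (0 <= a n)%R) -> ex_series a -> (a n <= Series a)%R.
Proof.
  intros Ha He. eapply Rle_trans; [|apply (rsum_le_Series a (S n) Ha He)].
  simpl. pose proof (rsum_pos a n (fun k _ => Ha k)). lra.
Qed.

Lemma csum_Re (a : nat -> C) (N : nat) : Re (csum a N) = rsum (fun n => Re (a n)) N.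
Proof. induction N as [|N IH]; [easy|]. simpl rsum. rewrite <- IH. reflexivity. Qed.

Lemma csum_Im (a : nat -> C) (N : nat) : Im (csum a N) = rsum (fun n => Im (a n)) N.
Proof. induction N as [|N IH]; [easy|]. simpl rsum. rewrite <- IH. reflexivity. Qed.

Lemma csum_ext (a b : nat -> C) (N : nat) :
  (forall n, (n < N)%nat -> a n = b n) -> csum a N = csum b N.
Proof.
  induction N as [|N IH]; intros H; simpl; [easy|].
  rewrite IH, H; [easy | lia | intros n Hn; apply H; lia].
Qed.

Lemma csum_plus (a b : nat -> C) (N : nat) :
  csum (fun n => a n + b n) N = csum a N + csum b N.
Proof. induction N as [|N IH]; simpl; [ring|]. rewrite IH; ring. Qed.

Lemma csum_scal (c : C) (a : nat -> C) (N : nat) :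
  csum (fun n => c * a n) N = c * csum a N.
Proof. induction N as [|N IH]; simpl; [ring|]. rewrite IH; ring. Qed.

Lemma Cmod_csum (a : nat -> C) (N : nat) : (Cmod (csum a N) <= rsum (fun n => Cmod (a n)) N)%R.
Proof.
  induction N as [|N IH]; simpl; [rewrite Cmod_0; lra|].
  eapply Rle_trans; [apply Cmod_triangle|]. lra.
Qed.

Lemma csum_add (a : nat -> C) (N M : nat) :
  csum a (N + M) = csum a N + csum (fun k => a (N + k)%nat) M.
Proof.
  induction M as [|M IH]; simpl; [rewrite Nat.add_0_r; ring|].
  rewrite Nat.add_succ_r; simpl. rewrite IH. ring.
Qed.

Lemma is_clim_le (u : nat -> C) (l : C) (e : nat -> R) :
  (forall n, (Cmod (u n - l) <= e n)%R) -> is_lim_seq e 0%R -> is_clim u l.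
Proof.
  intros H He. apply is_lim_seq_le_le with (u := fun _ => 0%R) (w := e).
  - intros n; split; [apply Cmod_ge_0 | apply H].
  - apply is_lim_seq_const.
  - exact He.
Qed.

Lemma is_clim_eps (u : nat -> C) (l : C) :
  is_clim u l <-> forall eps : R, (0 < eps)%R -> exists N, forall n, (N <= n)%nat -> (Cmod (u n - l) < eps)%R.
Proof.
  unfold is_clim. rewrite <- is_lim_seq_spec. simpl. split.
  - intros H eps He. destruct (H (mkposreal eps He)) as [N HN]. exists N. intros n Hn.
    specialize (HN n Hn). simpl in HN. rewrite Rminus_0_r, Rabs_pos_eq in HN; [easy|apply Cmod_ge_0].
  - intros H eps. destruct (H eps (cond_pos eps)) as [N HN]. exists N. intros n Hn.
    rewrite Rminus_0_r, Rabs_pos_eq; [now apply HN|apply Cmod_ge_0].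
Qed.

Lemma is_clim_ext (u v : nat -> C) (l : C) :
  (forall n, u n = v n) -> is_clim u l -> is_clim v l.
Proof. intros H. apply is_lim_seq_ext. intros n. now rewrite H. Qed.

Lemma is_clim_const (l : C) : is_clim (fun _ => l) l.
Proof.
  apply is_clim_le with (fun _ => 0%R); [|apply is_lim_seq_const].
  intros n. replace (l - l) with (RtoC 0) by ring. rewrite Cmod_0. lra.
Qed.

Lemma is_clim_plus (u v : nat -> C) (l m : C) :
  is_clim u l -> is_clim v m -> is_clim (fun n => u n + v n) (l + m).
Proof.
  intros Hu Hv.
  apply is_clim_le with (fun n => Cmod (u n - l) + Cmod (v n - m))%R.
  - intros n. replace (u n + v n - (l + m)) with (u n - l + (v n - m)) by ring. apply Cmod_triangle.
  - replace (Finite 0) with (Finite (0 + 0)) by (f_equal; ring). now apply is_lim_seq_plus'.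
Qed.

Lemma is_clim_scal (c : C) (u : nat -> C) (l : C) :
  is_clim u l -> is_clim (fun n => c * u n) (c * l).
Proof.
  intros Hu.
  apply is_clim_le with (fun n => Cmod c * Cmod (u n - l))%R.
  - intros n. replace (c * u n - c * l) with (c * (u n - l)) by ring. rewrite Cmod_mult. lra.
  - replace (Finite 0) with (Rbar_mult (Cmod c) 0%R) by (simpl; f_equal; ring).
    now apply is_lim_seq_scal_l.
Qed.

Lemma is_clim_minus (u v : nat -> C) (l m : C) :
  is_clim u l -> is_clim v m -> is_clim (fun n => u n - v n) (l - m).
Proof.
  intros Hu Hv. replace (l - m) with (l + (-1) * m) by ring.
  apply is_clim_ext with (fun n => u n + (-1) * v n); [intros n; ring|].
  apply is_clim_plus; [easy|]. now apply is_clim_scal.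
Qed.

Lemma is_clim_subseq (u : nat -> C) (l : C) (phi : nat -> nat) :
  filterlim phi eventually eventually -> is_clim u l -> is_clim (fun n => u (phi n)) l.
Proof. intros Hp Hu. unfold is_clim in *. exact (is_lim_seq_subseq _ _ phi Hp Hu). Qed.

Lemma is_clim_incr_1 (u : nat -> C) (l : C) : is_clim u l <-> is_clim (fun n => u (S n)) l.
Proof. unfold is_clim. apply (is_lim_seq_incr_1 (fun n => Cmod (u n - l))). Qed.

Lemma is_clim_unique (u : nat -> C) (l m : C) : is_clim u l -> is_clim u m -> l = m.
Proof.
  intros Hl Hm. pose proof (is_clim_minus _ _ _ _ Hl Hm) as H. unfold is_clim in H.
  apply is_lim_seq_ext with (v := fun _ => Cmod (l - m)) in H.
  - pose proof (is_lim_seq_unique _ _ H) as E. rewrite Lim_seq_const in E. injection E as E.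
    apply Cmod_eq_0 in E. replace l with (l - m + m) by ring. rewrite E. ring.
  - intros n. rewrite <- Cmod_opp. f_equal. ring.
Qed.

Lemma is_clim_Cmod_le (u : nat -> C) (l : C) (M : R) :
  (forall n, (Cmod (u n) <= M)%R) -> is_clim u l -> (Cmod l <= M)%R.
Proof.
  intros HM Hu. apply Rnot_lt_le. intros Hlt.
  apply is_clim_eps with (eps := (Cmod l - M)%R) in Hu; [|lra]. destruct Hu as [N HN].
  specialize (HN N (Nat.le_refl N)). specialize (HM N).
  pose proof (Cmod_triangle (u N) (l - u N)) as H.
  replace (u N + (l - u N)) with l in H by ring. rewrite Cmod_minus_sym in H. lra.
Qed.

Lemma is_clim_Re_Im (u : nat -> C) (l : C) :
  is_lim_seq (fun n => Re (u n)) (Re l) -> is_lim_seq (fun n => Im (u n)) (Im l) -> is_clim u l.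
Proof.
  intros Hr Hi.
  apply is_clim_le with (fun n => Rabs (Re (u n) - Re l) + Rabs (Im (u n) - Im l))%R.
  - intros n. apply (Cmod_le_Re_Im (u n - l)).
  - replace (Finite 0) with (Finite (Rabs 0 + Rabs 0)) by (f_equal; rewrite Rabs_R0; ring).
    apply is_lim_seq_plus'; apply (is_lim_seq_abs _ (Finite 0)).
    + replace (Finite 0) with (Finite (Re l - Re l)) by (f_equal; ring).
      apply is_lim_seq_minus'; [easy | apply is_lim_seq_const].
    + replace (Finite 0) with (Finite (Im l - Im l)) by (f_equal; ring).
      apply is_lim_seq_minus'; [easy | apply is_lim_seq_const].
Qed.

Lemma summable_le (a : nat -> C) (b : nat -> R) :
  (forall n, (Cmod (a n) <= b n)%R) -> ex_series b -> summable a.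
Proof.
  intros H Hb. apply (@ex_series_le R_AbsRing R_CompleteNormedModule) with b; [|easy].
  intros n. unfold norm; simpl. unfold abs; simpl. rewrite Rabs_pos_eq; [apply H|apply Cmod_ge_0].
Qed.

Lemma ex_series_le_pos (a b : nat -> R) :
  (forall n, (0 <= a n <= b n)%R) -> ex_series b -> ex_series a.
Proof.
  intros H Hb. apply (@ex_series_le R_AbsRing R_CompleteNormedModule) with b; [|easy].
  intros n. unfold norm; simpl. unfold abs; simpl. rewrite Rabs_pos_eq; apply H.
Qed.

Lemma summable_Re (a : nat -> C) : summable a -> ex_series (fun n => Re (a n)).
Proof.
  intros H. apply (@ex_series_le R_AbsRing R_CompleteNormedModule) with (fun n => Cmod (a n)); [|easy].
  intros n. apply re_le_Cmod.
Qed.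

Lemma summable_Im (a : nat -> C) : summable a -> ex_series (fun n => Im (a n)).
Proof.
  intros H. apply (@ex_series_le R_AbsRing R_CompleteNormedModule) with (fun n => Cmod (a n)); [|easy].
  intros n. apply im_le_Cmod.
Qed.

Lemma Cser_lim (a : nat -> C) : summable a -> is_clim (csum a) (Cser a).
Proof.
  intros H. apply is_clim_Re_Im.
  - apply is_lim_seq_ext with (rsum (fun n => Re (a n))).
    + intros n. now rewrite csum_Re.
    + apply is_lim_rsum, summable_Re, H.
  - apply is_lim_seq_ext with (rsum (fun n => Im (a n))).
    + intros n. now rewrite csum_Im.
    + apply is_lim_rsum, summable_Im, H.
Qed.

Lemma Cser_unique (a : nat -> C) (l : C) : summable a -> is_clim (csum a) l -> Cser a = l.
Proof. intros H Hl. eapply is_clim_unique; [apply Cser_lim, H | exact Hl]. Qed.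

Lemma Cser_ext (a b : nat -> C) : (forall n, a n = b n) -> Cser a = Cser b.
Proof. intros H. unfold Cser. f_equal; apply Series_ext; intros n; now rewrite H. Qed.

Lemma summable_ext (a b : nat -> C) : (forall n, a n = b n) -> summable a -> summable b.
Proof. intros H. apply ex_series_ext. intros n. now rewrite H. Qed.

Lemma summable_plus (a b : nat -> C) : summable a -> summable b -> summable (fun n => a n + b n).
Proof.
  intros Ha Hb. apply summable_le with (fun n => Cmod (a n) + Cmod (b n))%R.
  - intros n. apply Cmod_triangle.
  - apply (ex_series_plus (fun n => Cmod (a n)) (fun n => Cmod (b n))); easy.
Qed.

Lemma summable_scal (c : C) (a : nat -> C) : summable a -> summable (fun n => c * a n).
Proof.
  intros Ha. apply summable_le with (fun n => Cmod c * Cmod (a n))%R.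
  - intros n. rewrite Cmod_mult. lra.
  - apply (ex_series_scal (Cmod c) (fun n => Cmod (a n))); easy.
Qed.

Lemma Cser_plus (a b : nat -> C) :
  summable a -> summable b -> Cser (fun n => a n + b n) = Cser a + Cser b.
Proof.
  intros Ha Hb. apply Cser_unique; [now apply summable_plus|].
  apply is_clim_ext with (fun n => csum a n + csum b n); [intros n; now rewrite csum_plus|].
  now apply is_clim_plus; apply Cser_lim.
Qed.

Lemma Cser_scal (c : C) (a : nat -> C) : summable a -> Cser (fun n => c * a n) = c * Cser a.
Proof.
  intros Ha. apply Cser_unique; [now apply summable_scal|].
  apply is_clim_ext with (fun n => c * csum a n); [intros n; now rewrite csum_scal|].
  now apply is_clim_scal, Cser_lim.
Qed.

Lemma summable_minus (a b : nat -> C) : summable a -> summable b -> summable (fun n => a n - b n).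
Proof.
  intros Ha Hb. apply summable_ext with (fun n => a n + (-1) * b n); [intros n; ring|].
  apply summable_plus; [easy|now apply summable_scal].
Qed.

Lemma Cser_minus (a b : nat -> C) :
  summable a -> summable b -> Cser (fun n => a n - b n) = Cser a - Cser b.
Proof.
  intros Ha Hb. rewrite (Cser_ext _ (fun n => a n + (-1) * b n)) by (intros n; ring).
  rewrite Cser_plus, Cser_scal; [ring|easy|easy|now apply summable_scal].
Qed.

Lemma Cmod_Cser (a : nat -> C) :
  summable a -> (Cmod (Cser a) <= Series (fun n => Cmod (a n)))%R.
Proof.
  intros Ha. apply is_clim_Cmod_le with (csum a).
  - intros n. eapply Rle_trans; [apply Cmod_csum|].
    apply rsum_le_Series; [intros; apply Cmod_ge_0|easy].
  - now apply Cser_lim.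
Qed.

Lemma Cmod_Cser_le (a : nat -> C) (b : nat -> R) :
  (forall n, (Cmod (a n) <= b n)%R) -> ex_series b -> (Cmod (Cser a) <= Series b)%R.
Proof.
  intros H Hb. eapply Rle_trans; [apply Cmod_Cser; now apply summable_le with b|].
  apply Series_le; [|easy]. intros n; split; [apply Cmod_ge_0|apply H].
Qed.

Lemma summable_incr_1 (a : nat -> C) : summable a <-> summable (fun n => a (S n)).
Proof. apply (ex_series_incr_1 (fun n => Cmod (a n))). Qed.

Lemma csum_S_l (a : nat -> C) (N : nat) : csum a (S N) = a 0%nat + csum (fun n => a (S n)) N.
Proof. change (S N) with (1 + N)%nat. rewrite csum_add. simpl. ring. Qed.

Lemma Cser_incr_1 (a : nat -> C) : summable a -> Cser a = a 0%nat + Cser (fun n => a (S n)).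
Proof.
  intros Ha. apply Cser_unique; [easy|]. apply is_clim_incr_1.
  apply is_clim_ext with (fun N => a 0%nat + csum (fun n => a (S n)) N).
  - intros n. now rewrite csum_S_l.
  - apply is_clim_plus; [apply is_clim_const|].
    now apply Cser_lim, (summable_incr_1 a).
Qed.

Lemma Cser_conj (a : nat -> C) : Cser (fun n => Cconj (a n)) = Cconj (Cser a).
Proof.
  unfold Cser, Cconj; simpl. f_equal. rewrite <- Series_opp. apply Series_ext. now intros n.
Qed.

Lemma Series_0 : Series (fun _ => 0%R) = 0%R.
Proof.
  transitivity (0 * Series (fun _ => 0%R))%R; [|ring]. rewrite <- Series_scal_l.
  apply Series_ext. intros; ring.
Qed.

Lemma Cser_0 : Cser (fun _ => RtoC 0) = 0.
Proof.
  unfold Cser. change (fun _ : nat => Re 0) with (fun _ : nat => 0%R).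
  change (fun _ : nat => Im 0) with (fun _ : nat => 0%R). now rewrite Series_0.
Qed.

Lemma csum_zero (a : nat -> C) (N : nat) : (forall n, (n < N)%nat -> a n = 0) -> csum a N = 0.
Proof.
  induction N as [|N IH]; intros H; simpl; [easy|].
  rewrite IH, H; [ring|lia|intros n Hn; apply H; lia].
Qed.

Lemma csum_single (a : nat -> C) (k N : nat) :
  (k < N)%nat -> (forall n, n <> k -> a n = 0) -> csum a N = a k.
Proof.
  intros Hk H. induction N as [|N IH]; [lia|]. simpl.
  destruct (Nat.eq_dec N k) as [->|Hn].
  - rewrite csum_zero; [ring|]. intros n Hn. apply H. lia.
  - rewrite IH by lia. rewrite (H N) by easy. ring.
Qed.

Lemma csum_zero_tail (a : nat -> C) (K N : nat) :
  (K <= N)%nat -> (forall n, (K <= n)%nat -> a n = 0) -> csum a N = csum a K.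
Proof.
  intros Hk H. replace N with (K + (N - K))%nat by lia. rewrite csum_add.
  rewrite (csum_zero (fun k => a (K + k)%nat)); [ring|]. intros n _. apply H. lia.
Qed.

Lemma finite_support_summable (a : nat -> C) (K : nat) :
  (forall n, (K <= n)%nat -> a n = 0) -> summable a.
Proof.
  intros H. apply ex_series_incr_n with K. apply ex_series_ext with (fun _ => 0%R).
  - intros n. rewrite H by lia. now rewrite Cmod_0.
  - exists 0%R. apply is_series_rsum. apply is_lim_seq_ext with (fun _ => 0%R); [|apply is_lim_seq_const].
    intros n. rewrite rsum_const. ring.
Qed.

Lemma Cser_finite (a : nat -> C) (K : nat) :
  (forall n, (K <= n)%nat -> a n = 0) -> Cser a = csum a K.
Proof.
  intros H. apply Cser_unique; [now apply finite_support_summable with K|].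
  apply is_clim_eps. intros eps He. exists K. intros n Hn.
  rewrite (csum_zero_tail a K n Hn H). replace (csum a K - csum a K) with (RtoC 0) by ring.
  now rewrite Cmod_0.
Qed.

(** * Dominated convergence and Fubini for double series *)

Lemma rsum_tail_small (a : nat -> R) (eps : R) :
  ex_series a -> (0 < eps)%R ->
  exists N, (Series a - rsum a N < eps)%R.
Proof.
  intros Ha He. pose proof (is_lim_rsum a Ha) as H. apply is_lim_seq_spec in H.
  destruct (H (mkposreal eps He)) as [N HN]. exists N. specialize (HN N (Nat.le_refl N)).
  simpl in HN. apply Rabs_def2 in HN. lra.
Qed.

Lemma Series_split (a : nat -> R) (N : nat) :
  ex_series a -> Series a = (rsum a N + Series (fun k => a (N + k)%nat))%R.
Proof.
  intros Ha. destruct N as [|N]; [simpl; now rewrite Rplus_0_l|].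
  rewrite (Series_incr_n a (S N)); [|lia|easy]. f_equal. simpl Nat.pred.
  rewrite rsum_sum_n, sum_n_Reals. reflexivity.
Qed.

(** Dominated convergence: beyond some index K the majorant leaves a tail below eps/2, uniformly in
    N, and the first K terms tend to 0 one at a time. *)
Lemma tannery (t : nat -> nat -> C) (b : nat -> R) :
  (forall N i, (Cmod (t N i) <= b i)%R) -> ex_series b ->
  (forall i, is_clim (fun N => t N i) 0) -> is_clim (fun N => Cser (t N)) 0.
Proof.
  intros Hb He Ht.
  assert (Hpos : forall i, (0 <= b i)%R) by (intros i; eapply Rle_trans; [apply Cmod_ge_0|apply (Hb 0%nat)]).
  apply is_clim_eps. intros eps Heps.
  destruct (rsum_tail_small b (eps / 2) He) as [K HK]; [lra|].
  assert (Hfin : is_clim (fun N => csum (t N) K) 0).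
  { clear HK. induction K as [|K IH]; simpl; [apply is_clim_const|].
    replace (RtoC 0) with (RtoC 0 + 0) by ring. now apply is_clim_plus. }
  apply is_clim_eps with (eps := (eps / 2)%R) in Hfin; [|lra]. destruct Hfin as [N0 HN0].
  exists N0. intros n Hn. specialize (HN0 n Hn).
  replace (Cser (t n) - 0) with (csum (t n) K - 0 + (Cser (t n) - csum (t n) K)) by ring.
  eapply Rle_lt_trans; [apply Cmod_triangle|].
  assert (Cmod (Cser (t n) - csum (t n) K) <= Series b - rsum b K)%R; [|lra].
  assert (Hs : summable (t n)) by (apply summable_le with b; auto).
  apply is_clim_Cmod_le with (fun M => csum (t n) (K + M) - csum (t n) K).
  - intros M. rewrite csum_add. replace (csum (t n) K + _ - _) with (csum (fun k => t n (K + k)%nat) M) by ring.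
    eapply Rle_trans; [apply Cmod_csum|].
    rewrite (Series_split b K He).
    replace (rsum b K + Series (fun k => b (K + k)%nat) - rsum b K)%R with (Series (fun k => b (K + k)%nat)) by ring.
    eapply Rle_trans; [|apply (rsum_le_Series (fun k => b (K + k)%nat) M)].
    + apply rsum_le. intros; apply Hb.
    + intros; apply Hpos.
    + now apply ex_series_incr_n.
  - apply is_clim_minus; [|apply is_clim_const].
    apply is_clim_ext with (fun M => csum (t n) (M + K)); [intros; f_equal; lia|].
    apply is_clim_subseq with (phi := fun M => (M + K)%nat) (u := csum (t n)); [|now apply Cser_lim].
    intros P [N HP]. exists N. intros m Hm. apply HP. lia.
Qed.

Lemma summable_shift (a : nat -> C) (N : nat) : summable a -> summable (fun k => a (N + k)%nat).
Proof. intros Ha. apply (ex_series_incr_n (fun n => Cmod (a n)) N), Ha. Qed.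

Lemma Cser_split (a : nat -> C) (N : nat) :
  summable a -> Cser a = csum a N + Cser (fun k => a (N + k)%nat).
Proof.
  intros Ha. apply Cser_unique; [easy|]. apply is_clim_eps. intros eps He.
  pose proof (Cser_lim _ (summable_shift a N Ha)) as Hl. apply is_clim_eps with (eps := eps) in Hl; [|easy].
  destruct Hl as [M HM]. exists (N + M)%nat. intros n Hn.
  specialize (HM (n - N)%nat). replace n with (N + (n - N))%nat at 1 by lia. rewrite csum_add.
  replace (csum a N + csum (fun k => a (N + k)%nat) (n - N) - (csum a N + Cser (fun k => a (N + k)%nat)))
    with (csum (fun k => a (N + k)%nat) (n - N) - Cser (fun k => a (N + k)%nat)) by ring.
  apply HM. lia.
Qed.

Lemma Cser_tail_lim (a : nat -> C) : summable a -> is_clim (fun N => Cser (fun k => a (N + k)%nat)) 0.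
Proof.
  intros Ha.
  apply is_clim_ext with (fun N => Cser a - csum a N).
  - intros N. rewrite (Cser_split a N Ha). ring.
  - replace (RtoC 0) with (Cser a - Cser a) by ring.
    apply is_clim_minus; [apply is_clim_const|now apply Cser_lim].
Qed.

(** The total by rows minus the first N column sums is the sum over i of the tails of the rows from
    column N on. Each tail is at most b i and tends to 0, so [tannery] applies. *)
Lemma fubini_aux (a : nat -> nat -> C) (b : nat -> R) :
  (forall i, summable (a i)) -> (forall i, (Series (fun j => Cmod (a i j)) <= b i)%R) -> ex_series b ->
  (forall j, summable (fun i => a i j)) /\
  is_clim (csum (fun j => Cser (fun i => a i j))) (Cser (fun i => Cser (a i))).
Proof.
  intros Ha Hb He.
  assert (Hij : forall i j, (Cmod (a i j) <= b i)%R).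
  { intros i j. eapply Rle_trans; [|apply Hb]. apply (term_le_Series (fun j => Cmod (a i j))); [|apply Ha].
    intros; apply Cmod_ge_0. }
  assert (Hcol : forall j, summable (fun i => a i j)) by (intros j; now apply summable_le with b).
  assert (Hrow : summable (fun i => Cser (a i))).
  { apply summable_le with b; [|easy]. intros i. eapply Rle_trans; [apply Cmod_Cser, Ha|apply Hb]. }
  split; [easy|].
  assert (Hpart : forall N, csum (fun j => Cser (fun i => a i j)) N = Cser (fun i => csum (a i) N)
                  /\ summable (fun i => csum (a i) N)).
  { induction N as [|N [IH IH2]]; simpl.
    - split; [now rewrite Cser_0|]. apply finite_support_summable with 0%nat. easy.
    - rewrite IH. split; [now rewrite Cser_plus|now apply summable_plus]. }
  replace (Cser (fun i => Cser (a i))) with (Cser (fun i => Cser (a i)) - 0) by ring.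
  apply is_clim_ext with (fun N => Cser (fun i => Cser (a i)) - Cser (fun i => Cser (fun k => a i (N + k)%nat))).
  - intros N. rewrite (proj1 (Hpart N)).
    rewrite <- Cser_minus; [|easy|].
    + apply Cser_ext. intros i.
      rewrite (Cser_split (a i) N (Ha i)). ring.
    + apply summable_le with b; [|easy]. intros i.
      eapply Rle_trans; [apply Cmod_Cser, (summable_shift (a i)), Ha|].
      eapply Rle_trans; [|apply Hb]. rewrite (Series_split (fun j => Cmod (a i j)) N) by apply Ha.
      pose proof (rsum_pos (fun j => Cmod (a i j)) N (fun n _ => Cmod_ge_0 _)). lra.
  - apply is_clim_minus; [apply is_clim_const|].
    apply (tannery (fun N i => Cser (fun k => a i (N + k)%nat)) b); [|easy|].
    + intros N i.
      eapply Rle_trans; [apply Cmod_Cser, (summable_shift (a i)), Ha|].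
      eapply Rle_trans; [|apply Hb]. rewrite (Series_split (fun j => Cmod (a i j)) N) by apply Ha.
      pose proof (rsum_pos (fun j => Cmod (a i j)) N (fun n _ => Cmod_ge_0 _)). lra.
    + intros i. apply Cser_tail_lim, Ha.
Qed.

Lemma rsum_swap_Series (a : nat -> nat -> R) (N : nat) :
  (forall j, ex_series (fun i => a i j)) ->
  ex_series (fun i => rsum (a i) N) /\
  rsum (fun j => Series (fun i => a i j)) N = Series (fun i => rsum (a i) N).
Proof.
  intros H. induction N as [|N [IH1 IH2]]; simpl.
  - split.
    + exists 0%R. apply is_series_rsum. apply is_lim_seq_ext with (fun _ => 0%R); [|apply is_lim_seq_const].
      intros n. rewrite rsum_const. ring.
    + now rewrite Series_0.
  - split.
    + apply (ex_series_plus (fun i => rsum (a i) N) (fun i => a i N)); easy.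
    + rewrite Series_plus by easy. now rewrite IH2.
Qed.

Lemma fubini (a : nat -> nat -> C) (b : nat -> R) :
  (forall i, summable (a i)) -> (forall i, (Series (fun j => Cmod (a i j)) <= b i)%R) -> ex_series b ->
  (forall j, summable (fun i => a i j)) /\
  summable (fun i => Cser (a i)) /\
  summable (fun j => Cser (fun i => a i j)) /\
  Cser (fun i => Cser (a i)) = Cser (fun j => Cser (fun i => a i j)).
Proof.
  intros Ha Hb He. destruct (fubini_aux a b Ha Hb He) as [Hcol Hlim].
  assert (Hrow : summable (fun i => Cser (a i))).
  { apply summable_le with b; [|easy]. intros i. eapply Rle_trans; [apply Cmod_Cser, Ha|apply Hb]. }
  assert (Hc : summable (fun j => Cser (fun i => a i j))).
  (* Bounded partial sums: the moduli in the first N columns, added row by row, never exceed the sum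
     of the b i. *)
  { apply ex_series_bounded with (Series b); [intros; apply Cmod_ge_0|]. intros N.
    apply Rle_trans with (rsum (fun j => Series (fun i => Cmod (a i j))) N).
    - apply rsum_le. intros j _. apply Cmod_Cser, Hcol.
    - destruct (rsum_swap_Series (fun i j => Cmod (a i j)) N Hcol) as [E1 E2]. rewrite E2.
      apply Series_le; [|easy]. intros i. split; [apply rsum_pos; intros; apply Cmod_ge_0|].
      eapply Rle_trans; [|apply Hb]. apply rsum_le_Series; [intros; apply Cmod_ge_0|apply Ha]. }
  repeat split; try easy. symmetry. now apply Cser_unique.
Qed.

(** * Complex derivatives and the exponential *)

(** Multiplying by [Cmod h] instead of dividing by h keeps h = 0 admissible, which makes the chain
    rule and termwise differentiation free of case distinctions. *)
Definition cder (f : C -> C) (z l : C) : Prop :=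
  forall eps : R, (0 < eps)%R -> exists d : R, (0 < d)%R /\
    forall h, (Cmod h < d)%R -> (Cmod (f (z + h)%C - f z - h * l) <= eps * Cmod h)%R.

Lemma cder_ext_loc (f g : C -> C) (z l : C) (r : R) :
  (0 < r)%R -> (forall x, (Cmod (x - z) < r)%R -> f x = g x) -> cder f z l -> cder g z l.
Proof.
  intros Hr E H eps He. destruct (H eps He) as [d [Hd Hf]].
  exists (Rmin d r). split; [now apply Rmin_glb_lt|]. intros h Hh.
  rewrite <- !E.
  - apply Hf. eapply Rlt_le_trans; [exact Hh|apply Rmin_l].
  - replace (z - z) with (RtoC 0) by ring. now rewrite Cmod_0.
  - replace (z + h - z) with h by ring. eapply Rlt_le_trans; [exact Hh|apply Rmin_r].
Qed.

Lemma cder_ext (f g : C -> C) (z l : C) : (forall x, f x = g x) -> cder f z l -> cder g z l.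
Proof. intros E. apply cder_ext_loc with 1%R; [lra|]. intros; apply E. Qed.

Lemma cder_eq (f : C -> C) (z l m : C) : l = m -> cder f z l -> cder f z m.
Proof. now intros ->. Qed.

Lemma cder_is_derive (f : C -> C) (z l : C) :
  cder f z l -> is_derive (K := C_AbsRing) (V := C_NormedModule) f z l.
Proof.
  intros H. split; [apply is_linear_scal_l|].
  intros x Hx. apply (is_filter_lim_locally_unique (K := C_AbsRing) (V := AbsRing_NormedModule C_AbsRing)) in Hx. subst x.
  intros eps. destruct (H eps (cond_pos eps)) as [d [Hd Hf]].
  exists (mkposreal d Hd). intros y Hy.
  assert (H1 : forall y : C, (Cmod (y - z) < d)%R -> (Cmod (f y - f z - (y - z) * l) <= eps * Cmod (y - z))%R).
  { intros x Hx. specialize (Hf (x - z) Hx). now replace (z + (x - z)) with x in Hf by ring. }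
  exact (H1 y Hy).
Qed.

Lemma cder_cont (f : C -> C) (z l : C) : cder f z l ->
  forall eps : R, (0 < eps)%R -> exists d : R, (0 < d)%R /\
    forall h, (Cmod h < d)%R -> (Cmod (f (z + h)%C - f z) < eps)%R.
Proof.
  intros H eps He. destruct (H 1%R Rlt_0_1) as [d [Hd Hf]].
  pose proof (Cmod_ge_0 l) as Hl.
  exists (Rmin d (eps / (Cmod l + 2))).
  assert (Hq : (0 < eps / (Cmod l + 2))%R) by (apply Rdiv_lt_0_compat; lra).
  split; [now apply Rmin_glb_lt|]. intros h Hh.
  assert (H1 : (Cmod h < d)%R) by (eapply Rlt_le_trans; [exact Hh|apply Rmin_l]).
  assert (H2 : (Cmod h < eps / (Cmod l + 2))%R) by (eapply Rlt_le_trans; [exact Hh|apply Rmin_r]).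
  specialize (Hf h H1).
  replace (f (z + h) - f z) with (f (z + h) - f z - h * l + h * l) by ring.
  eapply Rle_lt_trans; [apply Cmod_triangle|]. rewrite Cmod_mult.
  apply Rlt_div_r in H2; [|lra]. pose proof (Cmod_ge_0 h). nra.
Qed.

Lemma cder_const (c z : C) : cder (fun _ => c) z 0.
Proof.
  intros eps He. exists 1%R. split; [lra|]. intros h _.
  replace (c - c - h * 0) with (RtoC 0) by ring. rewrite Cmod_0.
  pose proof (Cmod_ge_0 h). nra.
Qed.

Lemma cder_id (z : C) : cder (fun x => x) z 1.
Proof.
  intros eps He. exists 1%R. split; [lra|]. intros h _.
  replace (z + h - z - h * 1) with (RtoC 0) by ring. rewrite Cmod_0.
  pose proof (Cmod_ge_0 h). nra.
Qed.

Lemma cder_plus (f g : C -> C) (z l m : C) :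
  cder f z l -> cder g z m -> cder (fun x => f x + g x) z (l + m).
Proof.
  intros Hf Hg eps He.
  destruct (Hf (eps / 2)%R) as [d1 [Hd1 H1]]; [lra|].
  destruct (Hg (eps / 2)%R) as [d2 [Hd2 H2]]; [lra|].
  exists (Rmin d1 d2). split; [now apply Rmin_glb_lt|]. intros h Hh.
  specialize (H1 h (Rlt_le_trans _ _ _ Hh (Rmin_l _ _))).
  specialize (H2 h (Rlt_le_trans _ _ _ Hh (Rmin_r _ _))).
  replace (f (z + h) + g (z + h) - (f z + g z) - h * (l + m))
    with (f (z + h) - f z - h * l + (g (z + h) - g z - h * m)) by ring.
  eapply Rle_trans; [apply Cmod_triangle|]. lra.
Qed.

Lemma cder_comp (f g : C -> C) (z l m : C) :
  cder f z l -> cder g (f z) m -> cder (fun x => g (f x)) z (l * m).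
Proof.
  intros Hf Hg eps He.
  set (A := (Cmod l + 1)%R). set (B := (Cmod m + 1)%R).
  assert (HA : (0 < A)%R) by (unfold A; pose proof (Cmod_ge_0 l); lra).
  assert (HB : (0 < B)%R) by (unfold B; pose proof (Cmod_ge_0 m); lra).
  destruct (Hg (eps / (2 * A))%R) as [d1 [Hd1 H1]]; [apply Rdiv_lt_0_compat; lra|].
  destruct (Hf (Rmin 1 (eps / (2 * B)))%R) as [d2 [Hd2 H2]];
    [apply Rmin_glb_lt; [lra|apply Rdiv_lt_0_compat; lra]|].
  exists (Rmin d2 (d1 / A)). split; [apply Rmin_glb_lt; [easy|apply Rdiv_lt_0_compat; lra]|].
  intros h Hh.
  specialize (H2 h (Rlt_le_trans _ _ _ Hh (Rmin_l _ _))).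
  assert (Hh1 : (Cmod h < d1 / A)%R) by (eapply Rlt_le_trans; [exact Hh|apply Rmin_r]).
  apply Rlt_div_r in Hh1; [|lra].
  pose proof (Cmod_ge_0 h) as Hh0.
  set (k := f (z + h) - f z) in *.
  assert (Hk : (Cmod k <= A * Cmod h)%R).
  { replace k with (k - h * l + h * l) by ring. eapply Rle_trans; [apply Cmod_triangle|].
    rewrite Cmod_mult. unfold A. pose proof (Rmin_l 1 (eps / (2 * B))). nra. }
  assert (Hk1 : (Cmod k < d1)%R) by lra.
  specialize (H1 k Hk1). replace (f z + k) with (f (z + h)) in H1 by (unfold k; ring).
  replace (g (f (z + h)) - g (f z) - h * (l * m))
    with (g (f (z + h)) - g (f z) - k * m + (k - h * l) * m) by ring.
  eapply Rle_trans; [apply Cmod_triangle|]. rewrite Cmod_mult.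
  assert (E1 : (eps / (2 * A) * Cmod k <= eps / 2 * Cmod h)%R).
  { apply Rle_trans with (eps / (2 * A) * (A * Cmod h))%R.
    - apply Rmult_le_compat_l; [|easy]. apply Rlt_le, Rdiv_lt_0_compat; lra.
    - right. field. lra. }
  assert (E2 : (Cmod (k - h * l) * Cmod m <= eps / 2 * Cmod h)%R).
  { apply Rle_trans with ((eps / (2 * B) * Cmod h) * B)%R.
    - apply Rmult_le_compat; try apply Cmod_ge_0; [|unfold B; lra].
      eapply Rle_trans; [exact H2|]. apply Rmult_le_compat_r; [easy|apply Rmin_r].
    - right. field. lra. }
  lra.
Qed.

Lemma cder_scal (c : C) (f : C -> C) (z l : C) : cder f z l -> cder (fun x => c * f x) z (c * l).
Proof.
  intros Hf eps He. pose proof (Cmod_ge_0 c) as Hc.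
  destruct (Hf (eps / (Cmod c + 1))%R) as [d [Hd H]]; [apply Rdiv_lt_0_compat; lra|].
  exists d. split; [easy|]. intros h Hh. specialize (H h Hh).
  replace (c * f (z + h) - c * f z - h * (c * l)) with (c * (f (z + h) - f z - h * l)) by ring.
  rewrite Cmod_mult.
  apply Rle_trans with ((Cmod c + 1) * (eps / (Cmod c + 1) * Cmod h))%R.
  - apply Rmult_le_compat; try apply Cmod_ge_0; [lra|easy].
  - right. field. lra.
Qed.

Lemma cder_sqr (z : C) : cder (fun x => x * x) z (2 * z).
Proof.
  intros eps He. exists eps. split; [easy|]. intros h Hh.
  replace ((z + h) * (z + h) - z * z - h * (2 * z)) with (h * h) by ring.
  rewrite Cmod_mult. pose proof (Cmod_ge_0 h). nra.
Qed.

Lemma cder_opp (f : C -> C) (z l : C) : cder f z l -> cder (fun x => - f x) z (- l).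
Proof.
  intros H. apply cder_ext with (fun x => (-1) * f x); [intros; ring|].
  apply cder_eq with ((-1) * l); [ring|]. now apply cder_scal.
Qed.

Lemma cder_minus (f g : C -> C) (z l m : C) :
  cder f z l -> cder g z m -> cder (fun x => f x - g x) z (l - m).
Proof. intros Hf Hg. apply cder_plus; [easy|now apply cder_opp]. Qed.

(* Polarization reduces products to squares. *)
Lemma cder_mult (f g : C -> C) (z l m : C) :
  cder f z l -> cder g z m -> cder (fun x => f x * g x) z (l * g z + f z * m).
Proof.
  intros Hf Hg.
  assert (Hsq : forall u k, cder u z k -> cder (fun x => u x * u x) z (2 * u z * k)).
  { intros u k Hu. apply cder_eq with (k * (2 * u z)); [ring|].
    apply (cder_comp u (fun x => x * x)); [easy|apply cder_sqr]. }
  apply cder_ext with (fun x => / 4 * ((f x + g x) * (f x + g x) - (f x - g x) * (f x - g x))).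
  { intros x. field. }
  apply cder_eq with (/ 4 * (2 * (f z + g z) * (l + m) - 2 * (f z - g z) * (l - m))).
  { field. }
  apply cder_scal, cder_minus.
  - apply (Hsq (fun x => f x + g x)), cder_plus; easy.
  - apply (Hsq (fun x => f x - g x)), cder_minus; easy.
Qed.

Lemma cder_inv (z : C) : z <> 0 -> cder (fun x => / x) z (- / (z * z)).
Proof.
  intros Hz eps He. apply Cmod_gt_0 in Hz as Hz'. set (r := Cmod z) in *.
  exists (Rmin (r / 2) (eps * (r * r * r) / 2)).
  assert (H3 : (0 < r * r * r)%R) by (apply Rmult_lt_0_compat; [nra|lra]).
  split; [apply Rmin_glb_lt; [lra|]; apply Rdiv_lt_0_compat; nra|]. intros h Hh.
  assert (H1 : (Cmod h < r / 2)%R) by (eapply Rlt_le_trans; [exact Hh|apply Rmin_l]).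
  assert (H2 : (Cmod h < eps * (r * r * r) / 2)%R) by (eapply Rlt_le_trans; [exact Hh|apply Rmin_r]).
  assert (Hzh : (r / 2 <= Cmod (z + h))%R).
  { pose proof (Cmod_triangle_rev z h). unfold r in *; lra. }
  assert (Hn : z + h <> 0) by (apply Cmod_neq; lra).
  replace (/ (z + h) - / z - h * - / (z * z)) with (h * h / ((z + h) * (z * z))) by (field; easy).
  rewrite Cmod_div, !Cmod_mult by (repeat apply Cmult_neq_0; easy). fold r.
  pose proof (Cmod_ge_0 h) as Hh0.
  apply Rle_div_l; [apply Rmult_lt_0_compat; nra|].
  apply Rle_trans with (Cmod h * (eps * (r * r * r) / 2))%R; [nra|].
  replace (Cmod h * (eps * (r * r * r) / 2))%R with (eps * Cmod h * (r / 2 * (r * r)))%R by field.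
  apply Rmult_le_compat_l; [nra|]. apply Rmult_le_compat_r; nra.
Qed.

Lemma cder_Cinv (f : C -> C) (z l : C) :
  f z <> 0 -> cder f z l -> cder (fun x => / f x) z (- l / (f z * f z)).
Proof.
  intros Hz Hf. apply cder_eq with (l * - / (f z * f z)); [field; easy|].
  apply (cder_comp f (fun x => / x)); [easy|now apply cder_inv].
Qed.

Lemma cder_div (f g : C -> C) (z l m : C) :
  g z <> 0 -> cder f z l -> cder g z m ->
  cder (fun x => f x / g x) z ((l * g z - f z * m) / (g z * g z)).
Proof.
  intros Hz Hf Hg. apply cder_eq with (l * / g z + f z * (- m / (g z * g z))); [field; easy|].
  apply (cder_mult f (fun x => / g x)); [easy|now apply cder_Cinv].
Qed.

Lemma cder_pow (f : C -> C) (z l : C) (n : nat) :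
  cder f z l -> cder (fun x => Cpow (f x) (S n)) z (INR (S n) * Cpow (f z) n * l).
Proof.
  intros Hf. induction n as [|n IH].
  - apply cder_ext with f; [intros; simpl; ring|]. apply cder_eq with l; [simpl; ring|easy].
  - apply cder_ext with (fun x => f x * Cpow (f x) (S n)); [easy|].
    apply cder_eq with (l * Cpow (f z) (S n) + f z * (INR (S n) * Cpow (f z) n * l)).
    + rewrite (S_INR (S n)), RtoC_plus, Cpow_S. ring.
    + now apply cder_mult.
Qed.

(** Bridge to real calculus: along a line, Re (c f) is a real function of s, to which the mean value
    theorem, Rolle's theorem and Fermat's rule are applied later. The free factor c selects real
    part, imaginary part or any other projection. *)
Lemma cder_line_Re (c : C) (f : C -> C) (z h l : C) (s : R) :
  cder f (z + s * h) l -> is_derive (fun s : R => Re (c * f (z + s * h))) s (Re (c * (h * l))).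
Proof.
  intros H.
  split; [apply is_linear_scal_l|].
  intros x Hx. apply (is_filter_lim_locally_unique (K := R_AbsRing) (V := R_NormedModule)) in Hx. subst x.
  intros eps. pose proof (Cmod_ge_0 h) as Hh. pose proof (Cmod_ge_0 c) as Hc.
  set (K := ((Cmod c + 1) * (Cmod h + 1))%R). assert (HK : (0 < K)%R) by (unfold K; nra).
  destruct (H (eps / K)%R) as [d [Hd Hf]]; [apply Rdiv_lt_0_compat; [apply cond_pos|easy]|].
  assert (Hd' : (0 < d / (Cmod h + 1))%R) by (apply Rdiv_lt_0_compat; lra).
  exists (mkposreal _ Hd'). intros y Hy.
  change (Rabs (y - s) < d / (Cmod h + 1))%R in Hy. apply Rlt_div_r in Hy; [|lra].
  specialize (Hf (RtoC (y - s) * h)). rewrite Cmod_mult, Cmod_R in Hf.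
  pose proof (Rabs_pos (y - s)) as Hp.
  replace (z + s * h + (y - s)%R * h) with (z + y * h) in Hf by (rewrite RtoC_minus; ring).
  change (Rabs ((Re (c * f (z + RtoC y * h))%C - Re (c * f (z + RtoC s * h))%C) - (y - s) * Re (c * (h * l))%C) <= eps * Rabs (y - s))%R.
  assert (E : ((Re (c * f (z + RtoC y * h))%C - Re (c * f (z + RtoC s * h))%C) - (y - s) * Re (c * (h * l))%C)%R
     = Re (c * (f (z + y * h) - f (z + s * h) - RtoC (y - s) * h * l))).
  { unfold Re, Im; simpl. ring. }
  rewrite E. eapply Rle_trans; [apply re_le_Cmod|]. rewrite Cmod_mult.
  assert (H1 : (Rabs (y - s) * Cmod h < d)%R) by nra.
  specialize (Hf H1).
  apply Rle_trans with ((Cmod c + 1) * (eps / K * (Rabs (y - s) * (Cmod h + 1))))%R.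
  - apply Rmult_le_compat; try apply Cmod_ge_0; [lra|]. eapply Rle_trans; [exact Hf|].
    apply Rmult_le_compat_l; [apply Rlt_le, Rdiv_lt_0_compat; [apply cond_pos|easy]|]. nra.
  - right. unfold K. field. lra.
Qed.

Lemma real_MVI (f df : R -> R) (M : R) :
  (forall s, (0 <= s <= 1)%R -> is_derive f s (df s)) ->
  (forall s, (0 <= s <= 1)%R -> (df s <= M)%R) -> (f 1 - f 0 <= M)%R.
Proof.
  intros Hd HM. destruct (MVT_gen f 0 1 df) as [c [Hc E]].
  - intros x Hx. rewrite Rmin_left, Rmax_right in Hx by lra. apply Hd. lra.
  - intros x Hx. rewrite Rmin_left, Rmax_right in Hx by lra.
    apply continuity_pt_filterlim, (ex_derive_continuous f). exists (df x). now apply Hd.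
  - rewrite Rmin_left, Rmax_right in Hc by lra. rewrite E. specialize (HM c Hc). lra.
Qed.

(* Projecting on the direction of f(z+h) - f(z) reduces to the real mean value theorem. *)
Lemma cder_MVI (f df : C -> C) (z h : C) (M : R) :
  (forall s : R, (0 <= s <= 1)%R -> cder f (z + s * h) (df (z + s * h))) ->
  (forall s : R, (0 <= s <= 1)%R -> (Cmod (df (z + s * h)%C) <= M)%R) ->
  (Cmod (f (z + h)%C - f z) <= M * Cmod h)%R.
Proof.
  intros Hd HM. set (c := f (z + h) - f z).
  assert (HM0 : (0 <= M)%R) by (eapply Rle_trans; [apply Cmod_ge_0|apply (HM 0%R); lra]).
  assert (H := real_MVI (fun s : R => Re (Cconj c * f (z + s * h)))
    (fun s => Re (Cconj c * (h * df (z + s * h)))) (Cmod c * (Cmod h * M))).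
  assert (H1 : (Re (Cconj c * f (z + 1 * h))%C - Re (Cconj c * f (z + 0 * h))%C <= Cmod c * (Cmod h * M))%R).
  { apply H.
    - intros s Hs. now apply cder_line_Re, Hd.
    - intros s Hs. eapply Rle_trans; [apply Rle_abs|]. eapply Rle_trans; [apply re_le_Cmod|].
      rewrite !Cmod_mult, Cmod_conj. apply Rmult_le_compat_l; [apply Cmod_ge_0|].
      apply Rmult_le_compat_l; [apply Cmod_ge_0|now apply HM]. }
  clear H. replace (z + 1 * h) with (z + h) in H1 by ring. replace (z + 0 * h) with z in H1 by ring.
  assert (E : (Re (Cconj c * f (z + h)%C)%C - Re (Cconj c * f z)%C)%R = (Cmod c * Cmod c)%R).
  { rewrite Cmod_sqr. unfold c, Re, Im, Cconj; simpl. ring. }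
  rewrite E in H1. pose proof (Cmod_ge_0 c) as Hc. pose proof (Cmod_ge_0 h).
  destruct (Rle_lt_or_eq_dec _ _ Hc) as [Hp|Hz].
  - apply Rmult_le_reg_l with (Cmod c); [easy|]. nra.
  - rewrite <- Hz. nra.
Qed.

(** Termwise differentiation from a quadratic remainder that is summable in n: the total remainder
    is at most |h|^2 times [Series b]. *)
Lemma cder_series (f : nat -> C -> C) (f' : nat -> C) (b : nat -> R) (z : C) (d : R) :
  (0 < d)%R ->
  (forall h, (Cmod h < d)%R -> summable (fun n => f n (z + h))) ->
  summable f' -> ex_series b ->
  (forall n h, (Cmod h < d)%R -> (Cmod (f n (z + h)%C - f n z - h * f' n) <= Cmod h * Cmod h * b n)%R) ->
  cder (fun z => Cser (fun n => f n z)) z (Cser f').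
Proof.
  intros Hd Hs Hs' Hb H eps He.
  (* The sign of each b n is forced by the remainder estimate itself, tested at h = d/2. *)
  assert (Hb0 : (0 <= Series b)%R).
  { apply Series_pos; [|easy]. intros n. specialize (H n (RtoC (d / 2))).
    rewrite Cmod_RtoC_pos in H by lra. assert (Hq : (d / 2 < d)%R) by lra. specialize (H Hq).
    assert (H0 : (0 <= d / 2 * (d / 2) * b n)%R) by (eapply Rle_trans; [apply Cmod_ge_0|exact H]).
    apply Rnot_lt_le. intros Hn. assert (0 < d / 2 * (d / 2))%R by nra. nra. }
  exists (Rmin d (eps / (Series b + 1))).
  split; [apply Rmin_glb_lt; [easy|apply Rdiv_lt_0_compat; lra]|]. intros h Hh.
  assert (H1 : (Cmod h < d)%R) by (eapply Rlt_le_trans; [exact Hh|apply Rmin_l]).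
  assert (H2 : (Cmod h < eps / (Series b + 1))%R) by (eapply Rlt_le_trans; [exact Hh|apply Rmin_r]).
  apply Rlt_div_r in H2; [|lra].
  assert (Hz : summable (fun n => f n z)).
  { apply summable_ext with (fun n => f n (z + 0)); [intros; f_equal; ring|]. apply Hs. now rewrite Cmod_0. }
  rewrite <- Cser_scal, <- !Cser_minus; try easy; [|apply summable_minus; auto|now apply summable_scal|now apply Hs].
  eapply Rle_trans.
  - apply Cmod_Cser_le with (b := fun n => (Cmod h * Cmod h * b n)%R); [intros n; now apply H|].
    now apply (ex_series_scal (V := R_NormedModule) (Cmod h * Cmod h)%R b).
  - rewrite Series_scal_l. pose proof (Cmod_ge_0 h). nra.
Qed.

(** * The complex exponential and its Taylor remainders *)

Lemma Cexp_add (a b : C) : Cexp (a + b) = Cexp a * Cexp b.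
Proof.
  unfold Cexp. destruct a as [x y], b as [u v]. simpl.
  rewrite exp_plus, cos_plus, sin_plus. apply injective_projections; simpl; ring.
Qed.

Lemma Cexp_0 : Cexp 0 = 1.
Proof. unfold Cexp; simpl. rewrite exp_0, cos_0, sin_0. apply injective_projections; simpl; ring. Qed.

Lemma Cmod_Cexp (a : C) : Cmod (Cexp a) = exp (Re a).
Proof.
  unfold Cexp, Cmod; cbn [fst snd].
  replace ((exp (Re a) * cos (Im a)) ^ 2 + (exp (Re a) * sin (Im a)) ^ 2)%R
    with (exp (Re a) * exp (Re a) * (Rsqr (sin (Im a)) + Rsqr (cos (Im a))))%R by (unfold Rsqr; ring).
  rewrite sin2_cos2, Rmult_1_r. apply sqrt_square, Rlt_le, exp_pos.
Qed.

Lemma Cexp_neq_0 (a : C) : Cexp a <> 0.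
Proof. apply Cmod_neq. rewrite Cmod_Cexp. apply exp_pos. Qed.

Lemma Cexp_opp (a : C) : Cexp (- a) = / Cexp a.
Proof.
  assert (H : Cexp a * Cexp (- a) = 1) by (rewrite <- Cexp_add, Cplus_opp_r; apply Cexp_0).
  pose proof (Cexp_neq_0 a). transitivity (Cexp a * Cexp (- a) / Cexp a); [field; easy|]. rewrite H. field. easy.
Qed.

Lemma Cexp_nat (a : C) (n : nat) : Cexp (INR n * a) = Cpow (Cexp a) n.
Proof.
  induction n as [|n IH].
  - simpl. replace (0 * a) with (RtoC 0) by ring. apply Cexp_0.
  - rewrite S_INR, RtoC_plus, Cpow_S, <- IH, <- Cexp_add. f_equal. ring.
Qed.

Lemma Cexp_conj (a : C) : Cexp (Cconj a) = Cconj (Cexp a).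
Proof.
  destruct a as [x y]. unfold Cexp, Cconj, Re, Im; simpl. rewrite cos_neg, sin_neg.
  apply injective_projections; simpl; ring.
Qed.

Lemma Re_le_Cmod (c : C) : (Re c <= Cmod c)%R.
Proof. eapply Rle_trans; [apply Rle_abs|apply re_le_Cmod]. Qed.

Lemma Cexp_line_derive (c h : C) (s : R) :
  is_derive (fun s : R => Re (c * Cexp (s * h))) s (Re (c * (h * Cexp (s * h)))).
Proof.
  destruct h as [x y], c as [p q]. unfold Cexp, Re, Im; simpl.
  auto_derive; [easy|].
  replace (s * x + - (0 * y))%R with (s * x - 0 * y)%R by ring. ring.
Qed.

Lemma Cmod_Cexp_line (h : C) (s : R) : (0 <= s <= 1)%R -> (Cmod (Cexp (s * h)) <= exp (Cmod h))%R.
Proof.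
  intros Hs. rewrite Cmod_Cexp. destruct (Rle_lt_or_eq_dec (Re (s * h)) (Cmod h)) as [H|H].
  - rewrite re_scal_l. pose proof (Re_le_Cmod h). pose proof (Cmod_ge_0 h). nra.
  - now apply Rlt_le, exp_increasing.
  - rewrite H; lra.
Qed.

Lemma is_derive_Re_lin (c h : C) (s : R) : is_derive (fun s : R => Re (c * (s * h))) s (Re (c * h)).
Proof. destruct h, c. unfold Re, Im; simpl. auto_derive; [easy|ring]. Qed.

Lemma is_derive_Re_quad (c h : C) (s : R) :
  is_derive (fun s : R => Re (c * ((s * h) * (s * h) / 2))) s (Re (c * (h * (s * h)))).
Proof. destruct h, c. unfold Re, Im; simpl. auto_derive; [easy|field]. Qed.

(* The same projection trick along the segment [0,h] for the remainders of the exponential. *)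
Lemma Cmod_from_projection (F dF : R -> C) (M : R) :
  F 0%R = 0 ->
  (forall c (s : R), (0 <= s <= 1)%R -> is_derive (fun s => Re (c * F s)) s (Re (c * dF s))) ->
  (forall s : R, (0 <= s <= 1)%R -> (Cmod (dF s) <= M)%R) -> (Cmod (F 1%R) <= M)%R.
Proof.
  intros H0 Hd HM. set (c := F 1%R).
  assert (HM0 : (0 <= M)%R) by (eapply Rle_trans; [apply Cmod_ge_0|apply (HM 0%R); lra]).
  assert (H1 : (Re (Cconj c * F 1%R)%C - Re (Cconj c * F 0%R)%C <= Cmod c * M)%R).
  { apply (real_MVI (fun s => Re (Cconj c * F s)) (fun s => Re (Cconj c * dF s))).
    - intros s Hs. now apply Hd.
    - intros s Hs. eapply Rle_trans; [apply Re_le_Cmod|].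
      rewrite Cmod_mult, Cmod_conj. apply Rmult_le_compat_l; [apply Cmod_ge_0|now apply HM]. }
  rewrite H0 in H1. fold c in H1.
  assert (E : (Re (Cconj c * c)%C - Re (Cconj c * 0)%C)%R = (Cmod c * Cmod c)%R).
  { rewrite Cmod_sqr. unfold Re, Im, Cconj; simpl. ring. }
  rewrite E in H1. pose proof (Cmod_ge_0 c) as Hc.
  destruct (Rle_lt_or_eq_dec _ _ Hc) as [Hp|Hz].
  - apply Rmult_le_reg_l with (Cmod c); easy.
  - now rewrite <- Hz.
Qed.

Lemma exp_line_le (h : C) (s : R) : (0 <= s <= 1)%R -> (exp (Cmod (s * h)) <= exp (Cmod h))%R.
Proof.
  intros Hs. rewrite Cmod_mult, Cmod_RtoC_pos by lra. pose proof (Cmod_ge_0 h).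
  destruct (Rle_lt_or_eq_dec (s * Cmod h) (Cmod h)) as [E|E]; [nra| |rewrite E; lra].
  now apply Rlt_le, exp_increasing.
Qed.

Lemma Re_minus_mult (c a b : C) : Re (c * (a - b)) = (Re (c * a)%C - Re (c * b)%C)%R.
Proof. unfold Re; simpl. ring. Qed.

(** Integrate h e^(sh), of modulus at most |h| e^|h|, over s in [0,1]. The next two bounds integrate
    the preceding one in the same manner, each gaining a factor |h|. *)
Lemma Cexp_bound1 (h : C) : (Cmod (Cexp h - 1) <= Cmod h * exp (Cmod h))%R.
Proof.
  replace (Cexp h - 1) with (Cexp (1%R * h) - 1) by (f_equal; f_equal; ring).
  apply (Cmod_from_projection (fun s => Cexp (s * h) - 1) (fun s => h * Cexp (s * h))).
  - replace (RtoC 0 * h) with (RtoC 0) by ring. rewrite Cexp_0. ring.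
  - intros c s Hs. apply is_derive_ext with (fun s : R => minus (Re (c * Cexp (s * h))) (Re (c * 1))).
    + intros t. now rewrite Re_minus_mult.
    + replace (Re (c * (h * Cexp (s * h)))) with (minus (Re (c * (h * Cexp (s * h)))) 0%R)
        by (unfold minus, plus, opp; simpl; ring).
      apply (is_derive_minus (V := R_NormedModule)); [apply Cexp_line_derive|apply (is_derive_const (V := R_NormedModule))].
  - intros s Hs. rewrite Cmod_mult. apply Rmult_le_compat_l; [apply Cmod_ge_0|now apply Cmod_Cexp_line].
Qed.

Lemma Cexp_bound2 (h : C) : (Cmod (Cexp h - 1 - h) <= Cmod h * Cmod h * exp (Cmod h))%R.
Proof.
  replace (Cexp h - 1 - h) with (Cexp (1%R * h) - 1 - 1%R * h) by (rewrite Cmult_1_l; ring).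
  apply (Cmod_from_projection (fun s => Cexp (s * h) - 1 - s * h) (fun s => h * (Cexp (s * h) - 1))).
  - replace (RtoC 0 * h) with (RtoC 0) by ring. rewrite Cexp_0. ring.
  - intros c s Hs.
    apply is_derive_ext with (fun s : R => minus (minus (Re (c * Cexp (s * h))) (Re (c * 1))) (Re (c * (s * h)))).
    + intros t. now rewrite !Re_minus_mult.
    + replace (Re (c * (h * (Cexp (s * h) - 1)))) with (minus (minus (Re (c * (h * Cexp (s * h)))) 0%R) (Re (c * h)))
        by (unfold minus, plus, opp, Re; simpl; ring).
      apply (is_derive_minus (V := R_NormedModule)); [|apply is_derive_Re_lin].
      apply (is_derive_minus (V := R_NormedModule)); [apply Cexp_line_derive|apply (is_derive_const (V := R_NormedModule))].
  - intros s Hs. rewrite Cmod_mult, Rmult_assoc. apply Rmult_le_compat_l; [apply Cmod_ge_0|].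
    eapply Rle_trans; [apply Cexp_bound1|].
    apply Rmult_le_compat; [apply Cmod_ge_0|apply Rlt_le, exp_pos| |now apply exp_line_le].
    rewrite Cmod_mult, Cmod_RtoC_pos by lra. pose proof (Cmod_ge_0 h). nra.
Qed.

Lemma Cexp_bound3 (h : C) :
  (Cmod (Cexp h - 1 - h - h * h / 2) <= Cmod h * Cmod h * Cmod h * exp (Cmod h))%R.
Proof.
  replace (Cexp h - 1 - h - h * h / 2) with (Cexp (1%R * h) - 1 - 1%R * h - (1%R * h) * (1%R * h) / 2) by (rewrite Cmult_1_l; ring).
  apply (Cmod_from_projection (fun s => Cexp (s * h) - 1 - s * h - (s * h) * (s * h) / 2) (fun s => h * (Cexp (s * h) - 1 - s * h))).
  - replace (RtoC 0 * h) with (RtoC 0) by ring. rewrite Cexp_0. unfold Cdiv. ring.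
  - intros c s Hs.
    apply is_derive_ext with (fun s : R => minus (minus (minus (Re (c * Cexp (s * h))) (Re (c * 1))) (Re (c * (s * h)))) (Re (c * ((s * h) * (s * h) / 2)))).
    + intros t. now rewrite !Re_minus_mult.
    + replace (Re (c * (h * (Cexp (s * h) - 1 - s * h)))) with (minus (minus (minus (Re (c * (h * Cexp (s * h)))) 0%R) (Re (c * h))) (Re (c * (h * (s * h)))))
        by (unfold minus, plus, opp, Re; simpl; ring).
      apply (is_derive_minus (V := R_NormedModule)); [|apply is_derive_Re_quad].
      apply (is_derive_minus (V := R_NormedModule)); [|apply is_derive_Re_lin].
      apply (is_derive_minus (V := R_NormedModule)); [apply Cexp_line_derive|apply (is_derive_const (V := R_NormedModule))].
  - intros s Hs. rewrite Cmod_mult, !Rmult_assoc. apply Rmult_le_compat_l; [apply Cmod_ge_0|].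
    eapply Rle_trans; [apply Cexp_bound2|]. rewrite <- Rmult_assoc.
    assert (H : (Cmod (s * h) <= Cmod h)%R) by (rewrite Cmod_mult, Cmod_RtoC_pos by lra; pose proof (Cmod_ge_0 h); nra).
    apply Rmult_le_compat; [|apply Rlt_le, exp_pos| |now apply exp_line_le].
    + pose proof (Cmod_ge_0 (s * h)); nra.
    + apply Rmult_le_compat; easy || apply Cmod_ge_0.
Qed.

Lemma cder_Cexp (z : C) : cder Cexp z (Cexp z).
Proof.
  intros eps He. pose proof (exp_pos 1) as H1.
  set (K := (Cmod (Cexp z) * exp 1 + 1)%R).
  assert (HK : (0 < K)%R) by (unfold K; pose proof (Cmod_ge_0 (Cexp z)); nra).
  exists (Rmin 1 (eps / K)). split; [apply Rmin_glb_lt; [lra|now apply Rdiv_lt_0_compat]|].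
  intros h Hh.
  assert (Ha : (Cmod h < 1)%R) by (eapply Rlt_le_trans; [exact Hh|apply Rmin_l]).
  assert (Hb : (Cmod h < eps / K)%R) by (eapply Rlt_le_trans; [exact Hh|apply Rmin_r]).
  apply Rlt_div_r in Hb; [|easy].
  rewrite Cexp_add. replace (Cexp z * Cexp h - Cexp z - h * Cexp z) with (Cexp z * (Cexp h - 1 - h)) by ring.
  rewrite Cmod_mult. pose proof (Cexp_bound2 h) as Hc.
  assert (He1 : (exp (Cmod h) <= exp 1)%R) by (now apply Rlt_le, exp_increasing).
  pose proof (Cmod_ge_0 h) as Hh0. pose proof (Cmod_ge_0 (Cexp z)) as Hz0.
  apply Rle_trans with (Cmod (Cexp z) * (Cmod h * Cmod h * exp 1))%R.
  - apply Rmult_le_compat_l; [easy|]. eapply Rle_trans; [exact Hc|]. apply Rmult_le_compat_l; [nra|easy].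
  - replace (Cmod (Cexp z) * (Cmod h * Cmod h * exp 1))%R with (Cmod h * (Cmod h * (Cmod (Cexp z) * exp 1)))%R by ring.
    rewrite (Rmult_comm eps). apply Rmult_le_compat_l; [easy|]. unfold K in Hb. nra.
Qed.

Lemma cder_exp (f : C -> C) (z l : C) : cder f z l -> cder (fun x => Cexp (f x)) z (l * Cexp (f z)).
Proof. intros H. apply (cder_comp f Cexp); [easy|apply cder_Cexp]. Qed.

(** * Fourier series in q *)

Lemma is_lim_seq_succ_ratio_pow (k : nat) :
  is_lim_seq (fun n => ((INR (S n) + 1) / (INR n + 1)) ^ k)%R 1%R.
Proof.
  assert (H1 : is_lim_seq (fun n => (INR (S n) + 1) / (INR n + 1))%R 1%R).
  { apply is_lim_seq_ext with (fun n => 1 + / INR (S n))%R.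
    - intros n. rewrite !S_INR. pose proof (pos_INR n). field. lra.
    - replace (Finite 1) with (Finite (1 + 0)) by (f_equal; ring).
      apply is_lim_seq_plus'; [apply is_lim_seq_const|].
      apply (is_lim_seq_incr_1 (fun n => / INR n)%R).
      replace (Finite 0) with (Rbar_inv p_infty) by easy.
      apply is_lim_seq_inv; [apply is_lim_seq_INR|easy]. }
  induction k as [|k IH]; simpl; [apply is_lim_seq_const|].
  replace (Finite 1) with (Finite (1 * 1)) by (f_equal; ring). now apply is_lim_seq_mult'.
Qed.

Lemma ex_series_poly_geom (k : nat) (r : R) :
  (0 <= r < 1)%R -> ex_series (fun n => (INR n + 1) ^ k * r ^ n)%R.
Proof.
  intros Hr. destruct (Rle_lt_or_eq_dec 0 r (proj1 Hr)) as [Hp|<-].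
  - assert (Hpos : forall n, (0 < (INR n + 1) ^ k * r ^ n)%R).
    { intros n. pose proof (pos_INR n). apply Rmult_lt_0_compat; apply pow_lt; lra. }
    apply ex_series_ext with (fun n => Rabs ((INR n + 1) ^ k * r ^ n)).
    { intros n. apply Rabs_pos_eq, Rlt_le, Hpos. }
    apply ex_series_DAlembert with r; [easy|intros n; apply Rgt_not_eq, Hpos|].
    apply is_lim_seq_ext with (fun n => ((INR (S n) + 1) / (INR n + 1)) ^ k * r)%R.
    + intros n. pose proof (pos_INR n). pose proof (pos_INR (S n)).
      assert (0 < (INR n + 1) ^ k)%R by (apply pow_lt; lra).
      assert (0 < r ^ n)%R by (apply pow_lt; lra).
      rewrite Rabs_pos_eq.
      * unfold Rdiv. rewrite Rpow_mult_distr, pow_inv. simpl. field. lra.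
      * apply Rlt_le. apply Rdiv_lt_0_compat; apply Hpos.
    + replace (Finite r) with (Finite (1 * r)) by (f_equal; ring).
      apply is_lim_seq_mult'; [apply is_lim_seq_succ_ratio_pow|apply is_lim_seq_const].
  - apply ex_series_incr_1. apply ex_series_ext with (fun n => 0 ^ n * 0)%R.
    + intros n; simpl; ring.
    + apply ex_series_scal_r, ex_series_geom. rewrite Rabs_R0; lra.
Qed.

(** Polynomial growth gives convergence on the whole unit disc and is stable under sums, Cauchy
    products, q d/dq, shifts and divisor sums. The Eisenstein series and the logarithm of eta are
    all handled through such coefficient sequences. *)
Definition growth (a : nat -> C) : Prop :=
  exists (K : R) (k : nat), (0 <= K)%R /\ forall n, (Cmod (a n) <= K * (INR n + 1) ^ k)%R.

Definition Ps (a : nat -> C) (q : C) : C := Cser (fun n => a n * Cpow q n).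

Definition Fs (a : nat -> C) (t : C) : C := Ps a (qexp t).

Lemma pow_INR_ge_1 (n k : nat) : (1 <= (INR n + 1) ^ k)%R.
Proof. apply pow_R1_Rle. pose proof (pos_INR n). lra. Qed.

Lemma growth_ex_series (a : nat -> C) (r : R) :
  growth a -> (0 <= r < 1)%R -> ex_series (fun n => Cmod (a n) * r ^ n)%R.
Proof.
  intros (K & k & HK & H) Hr.
  apply ex_series_le_pos with (fun n => K * ((INR n + 1) ^ k * r ^ n))%R.
  - intros n. assert (0 <= r ^ n)%R by (apply pow_le; lra). split.
    + apply Rmult_le_pos; [apply Cmod_ge_0|easy].
    + rewrite <- Rmult_assoc. now apply Rmult_le_compat_r.
  - now apply (ex_series_scal (V := R_NormedModule) K), ex_series_poly_geom.
Qed.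

Lemma growth_summable (a : nat -> C) (q : C) :
  growth a -> (Cmod q < 1)%R -> summable (fun n => a n * Cpow q n).
Proof.
  intros Ha Hq. apply summable_le with (fun n => Cmod (a n) * Cmod q ^ n)%R.
  - intros n. rewrite Cmod_mult, Cmod_pow. lra.
  - apply growth_ex_series; [easy|]. split; [apply Cmod_ge_0|easy].
Qed.

Lemma growth_bounded (a : nat -> C) (k : nat) (K : R) :
  (forall n, (Cmod (a n) <= K * (INR n + 1) ^ k)%R) -> growth a.
Proof.
  intros H. exists K, k. split; [|easy]. specialize (H 0%nat). pose proof (Cmod_ge_0 (a 0%nat)).
  simpl in H. rewrite Rplus_0_l, pow1 in H. lra.
Qed.

Lemma growth_plus (a b : nat -> C) : growth a -> growth b -> growth (fun n => a n + b n).
Proof.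
  intros (K & k & HK & H) (L & l & HL & H').
  apply growth_bounded with (k + l)%nat (K + L)%R. intros n.
  eapply Rle_trans; [apply Cmod_triangle|]. rewrite pow_add.
  specialize (H n). specialize (H' n).
  pose proof (pow_INR_ge_1 n k) as Hk. pose proof (pow_INR_ge_1 n l) as Hl.
  set (x := ((INR n + 1) ^ k)%R) in *. set (y := ((INR n + 1) ^ l)%R) in *.
  assert (K * x <= K * (x * y))%R by (apply Rmult_le_compat_l; nra).
  assert (L * y <= L * (x * y))%R by (apply Rmult_le_compat_l; nra). lra.
Qed.

Lemma growth_scal (c : C) (a : nat -> C) : growth a -> growth (fun n => c * a n).
Proof.
  intros (K & k & HK & H). apply growth_bounded with k (Cmod c * K)%R. intros n.
  rewrite Cmod_mult, Rmult_assoc. apply Rmult_le_compat_l; [apply Cmod_ge_0|apply H].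
Qed.

(** The operator q d/dq on coefficients, which is d/dt divided by 2 pi i. *)
Definition Da (a : nat -> C) (n : nat) : C := INR n * a n.

Lemma growth_Da (a : nat -> C) : growth a -> growth (Da a).
Proof.
  intros (K & k & HK & H). apply growth_bounded with (S k) K. intros n. unfold Da.
  pose proof (pos_INR n). rewrite Cmod_mult, Cmod_RtoC_pos by easy.
  specialize (H n). simpl. pose proof (pow_INR_ge_1 n k). pose proof (Cmod_ge_0 (a n)). nra.
Qed.

Lemma growth_shift (a : nat -> C) : growth a -> growth (fun n => a (S n)).
Proof.
  intros (K & k & HK & H). apply growth_bounded with k (K * 2 ^ k)%R. intros n.
  eapply Rle_trans; [apply H|]. rewrite Rmult_assoc, <- Rpow_mult_distr.
  apply Rmult_le_compat_l; [easy|]. pose proof (pos_INR n). apply pow_incr. rewrite S_INR. lra.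
Qed.

Definition conv (a b : nat -> C) (N : nat) : C := csum (fun i => a i * b (N - i)%nat) (S N).

Lemma growth_conv (a b : nat -> C) : growth a -> growth b -> growth (conv a b).
Proof.
  intros (K & k & HK & H) (L & l & HL & H').
  apply growth_bounded with (S (k + l))%nat (K * L)%R. intros N. unfold conv.
  eapply Rle_trans; [apply Cmod_csum|].
  apply Rle_trans with (rsum (fun _ => K * L * (INR N + 1) ^ (k + l))%R (S N)).
  - apply rsum_le. intros i Hi. rewrite Cmod_mult, pow_add.
    replace (K * L * ((INR N + 1) ^ k * (INR N + 1) ^ l))%R
      with ((K * (INR N + 1) ^ k) * (L * (INR N + 1) ^ l))%R by ring.
    apply Rmult_le_compat; try apply Cmod_ge_0.
    + eapply Rle_trans; [apply H|]. apply Rmult_le_compat_l; [easy|]. apply pow_incr.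
      pose proof (pos_INR i). assert (INR i <= INR N)%R by (apply le_INR; lia). lra.
    + eapply Rle_trans; [apply H'|]. apply Rmult_le_compat_l; [easy|]. apply pow_incr.
      pose proof (pos_INR (N - i)). assert (INR (N - i) <= INR N)%R by (apply le_INR; lia). lra.
  - rewrite rsum_const, S_INR. simpl. right. ring.
Qed.

Lemma Ps_plus (a b : nat -> C) (q : C) : growth a -> growth b -> (Cmod q < 1)%R ->
  Ps (fun n => a n + b n) q = Ps a q + Ps b q.
Proof.
  intros Ha Hb Hq. unfold Ps. rewrite <- Cser_plus by now apply growth_summable.
  apply Cser_ext. intros n. ring.
Qed.

Lemma Ps_scal (c : C) (a : nat -> C) (q : C) : growth a -> (Cmod q < 1)%R ->
  Ps (fun n => c * a n) q = c * Ps a q.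
Proof.
  intros Ha Hq. unfold Ps. rewrite <- Cser_scal by now apply growth_summable.
  apply Cser_ext. intros n. ring.
Qed.

(** Padding with zeros below i indexes a row of a Cauchy product by the total exponent N;
    multiplying two power series then becomes an exchange of the order of summation. *)
Lemma Series_cut (a : nat -> R) (i : nat) :
  ex_series (fun k => a (i + k)%nat) ->
  ex_series (fun N => if Nat.leb i N then a N else 0%R) /\
  Series (fun N => if Nat.leb i N then a N else 0%R) = Series (fun k => a (i + k)%nat).
Proof.
  intros H.
  assert (E : forall k, (if Nat.leb i (i + k) then a (i + k)%nat else 0%R) = a (i + k)%nat).
  { intros k. now replace (i <=? i + k)%nat with true by (symmetry; apply Nat.leb_le; lia). }
  split.
  - apply ex_series_incr_n with i. now apply ex_series_ext with (fun k => a (i + k)%nat).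
  - rewrite (Series_incr_n_aux _ i).
    + now apply Series_ext.
    + intros k Hk. now replace (i <=? k)%nat with false by (symmetry; apply Nat.leb_gt; lia).
Qed.

Lemma Cser_cut (a : nat -> C) (i : nat) :
  summable (fun k => a (i + k)%nat) ->
  summable (fun N => if Nat.leb i N then a N else 0) /\
  Cser (fun N => if Nat.leb i N then a N else 0) = Cser (fun k => a (i + k)%nat).
Proof.
  intros H. split.
  - apply ex_series_ext with (fun N => if Nat.leb i N then Cmod (a N) else 0%R).
    + intros n. destruct (i <=? n)%nat; [easy|now rewrite Cmod_0].
    + now apply (Series_cut (fun n => Cmod (a n))).
  - unfold Cser. f_equal.
    + rewrite <- (proj2 (Series_cut (fun n => Re (a n)) i (summable_Re _ H))).
      apply Series_ext. intros n. now destruct (i <=? n)%nat.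
    + rewrite <- (proj2 (Series_cut (fun n => Im (a n)) i (summable_Im _ H))).
      apply Series_ext. intros n. now destruct (i <=? n)%nat.
Qed.

Lemma Ps_mult (a b : nat -> C) (q : C) : growth a -> growth b -> (Cmod q < 1)%R ->
  Ps a q * Ps b q = Ps (conv a b) q.
Proof.
  intros Ha Hb Hq.
  pose proof (growth_summable a q Ha Hq) as Sa. pose proof (growth_summable b q Hb Hq) as Sb.
  (* Rows of [c] add up to a_i q^i times the second series, columns to the convolution times q^N. *)
  set (c := fun i N => if Nat.leb i N then a i * b (N - i)%nat * Cpow q N else 0).
  assert (Hs : forall i k, a i * b (i + k - i)%nat * Cpow q (i + k) = a i * Cpow q i * (b k * Cpow q k)).
  { intros i k. replace (i + k - i)%nat with k by lia. rewrite Cpow_add_r. ring. }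
  assert (Hsum : forall i, summable (fun k => a i * b (i + k - i)%nat * Cpow q (i + k))).
  { intros i. apply summable_ext with (fun k => a i * Cpow q i * (b k * Cpow q k)); [intros; now rewrite Hs|].
    now apply summable_scal. }
  assert (Hrow : forall i, summable (c i) /\ Cser (c i) = a i * Cpow q i * Ps b q).
  { intros i. destruct (Cser_cut (fun N => a i * b (N - i)%nat * Cpow q N) i (Hsum i)) as [H1 H2].
    split; [exact H1|]. unfold c. rewrite H2. unfold Ps. rewrite <- Cser_scal by easy.
    apply Cser_ext. intros; apply Hs. }
  destruct (fubini c (fun i => Cmod (a i * Cpow q i) * Series (fun k => Cmod (b k * Cpow q k)))%R) as (_ & _ & _ & E).
  - apply Hrow.
  - intros i. rewrite <- Series_scal_l.
    rewrite (Series_ext _ (fun N => if Nat.leb i N then Cmod (a i * b (N - i)%nat * Cpow q N) else 0%R)).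
    + rewrite (proj2 (Series_cut (fun N => Cmod (a i * b (N - i)%nat * Cpow q N)) i (Hsum i))).
      right. apply Series_ext. intros k. now rewrite Hs, Cmod_mult.
    + intros n. unfold c. destruct (i <=? n)%nat; [easy|apply Cmod_0].
  - now apply ex_series_scal_r.
  - transitivity (Cser (fun i => Cser (c i))).
    + rewrite (Cser_ext (fun i => Cser (c i)) (fun i => Ps b q * (a i * Cpow q i))).
      * rewrite Cser_scal by easy. fold (Ps a q). ring.
      * intros i. rewrite (proj2 (Hrow i)). ring.
    + rewrite E. apply Cser_ext. intros N.
      rewrite (Cser_finite _ (S N)).
      * unfold conv. rewrite Cmult_comm, <- csum_scal. apply csum_ext. intros i Hi. unfold c.
        replace (i <=? N)%nat with true by (symmetry; apply Nat.leb_le; lia). ring.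
      * intros i Hi. unfold c. now replace (i <=? N)%nat with false by (symmetry; apply Nat.leb_gt; lia).
Qed.

Lemma Ps_incr (a : nat -> C) (q : C) : growth a -> (Cmod q < 1)%R ->
  Ps a q = a 0%nat + q * Ps (fun n => a (S n)) q.
Proof.
  intros Ha Hq. unfold Ps. rewrite Cser_incr_1 by now apply growth_summable.
  rewrite <- Cser_scal by (apply growth_summable; [now apply growth_shift|easy]).
  simpl. f_equal; [ring|]. apply Cser_ext. intros n. ring.
Qed.

Lemma Ps_bounded (a : nat -> C) (r : R) : growth a -> (0 <= r < 1)%R ->
  exists M, (0 <= M)%R /\ forall q, (Cmod q <= r)%R -> (Cmod (Ps a q) <= M)%R.
Proof.
  intros Ha Hr. exists (Series (fun n => Cmod (a n) * r ^ n)%R).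
  assert (H := growth_ex_series a r Ha Hr). split.
  - apply Series_pos; [|easy]. intros n. apply Rmult_le_pos; [apply Cmod_ge_0|apply pow_le; lra].
  - intros q Hq. apply Cmod_Cser_le; [|easy]. intros n. rewrite Cmod_mult, Cmod_pow.
    apply Rmult_le_compat_l; [apply Cmod_ge_0|]. apply pow_incr. split; [apply Cmod_ge_0|easy].
Qed.

Lemma Cmod_pow_minus (q p : C) (r : R) (n : nat) : (Cmod q <= r)%R -> (Cmod p <= r)%R ->
  (Cmod (Cpow q (S n) - Cpow p (S n)) <= Cmod (q - p)%C * (INR (S n) * r ^ n))%R.
Proof.
  intros Hq Hp. assert (Hr : (0 <= r)%R) by (eapply Rle_trans; [apply Cmod_ge_0|exact Hq]).
  induction n as [|n IH].
  - rewrite !Cpow_1_r. simpl. lra.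
  - replace (Cpow q (S (S n)) - Cpow p (S (S n)))
      with (q * (Cpow q (S n) - Cpow p (S n)) + (q - p) * Cpow p (S n)) by (rewrite (Cpow_S q (S n)), (Cpow_S p (S n)); ring).
    eapply Rle_trans; [apply Cmod_triangle|]. rewrite !Cmod_mult, Cmod_pow.
    apply Rle_trans with (r * (Cmod (q - p) * (INR (S n) * r ^ n)) + Cmod (q - p) * r ^ (S n))%R.
    + apply Rplus_le_compat.
      * apply Rmult_le_compat; try apply Cmod_ge_0; easy.
      * apply Rmult_le_compat_l; [apply Cmod_ge_0|]. apply pow_incr. split; [apply Cmod_ge_0|easy].
    + right. rewrite (S_INR (S n)). simpl pow. ring.
Qed.

(** Prepares the univalence of E4 and E6 in q: the Lipschitz constant of the terms beyond the first
    power has to be beaten by the coefficient of q. *)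
Lemma Ps_Lipschitz (a : nat -> C) (r : R) (q p : C) : growth a -> (r < 1)%R ->
  (Cmod q <= r)%R -> (Cmod p <= r)%R ->
  (Cmod (Ps a q - Ps a p) <= Cmod (q - p)%C * Series (fun n => INR (S n) * Cmod (a (S n)) * r ^ n))%R.
Proof.
  intros Ha Hr Hq Hp. assert (Hr0 : (0 <= r)%R) by (eapply Rle_trans; [apply Cmod_ge_0|exact Hq]).
  assert (Sq : summable (fun n => a n * Cpow q n)) by (apply growth_summable; [easy|lra]).
  assert (Sp : summable (fun n => a n * Cpow p n)) by (apply growth_summable; [easy|lra]).
  unfold Ps. rewrite (Cser_incr_1 _ Sq), (Cser_incr_1 _ Sp).
  apply summable_incr_1 in Sq, Sp. simpl Cpow at 1 3.
  match goal with |- (Cmod (?x + ?u - (?x + ?v)) <= _)%R => replace (x + u - (x + v)) with (u - v) by ring end.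
  rewrite <- Cser_minus by easy. rewrite <- Series_scal_l. apply Cmod_Cser_le.
  - intros n. replace (a (S n) * Cpow q (S n) - a (S n) * Cpow p (S n)) with (a (S n) * (Cpow q (S n) - Cpow p (S n))) by ring.
    rewrite Cmod_mult.
    eapply Rle_trans; [apply Rmult_le_compat_l; [apply Cmod_ge_0|now apply Cmod_pow_minus with (r := r)]|].
    right. ring.
  - apply (ex_series_scal (V := R_NormedModule)).
    apply ex_series_ext with (fun n => Cmod (Da a (S n)) * r ^ n)%R.
    + intros n. unfold Da. rewrite Cmod_mult, Cmod_RtoC_pos by apply pos_INR.
      match goal with |- @eq _ ?x ?y => change (@eq R x y) end. ring.
    + apply (growth_ex_series (fun n => Da a (S n))); [|easy]. now apply growth_shift, growth_Da.
Qed.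

(** * Fourier series as functions on the upper half-plane *)

Lemma Cmod_qexp (t : C) : Cmod (qexp t) = exp (- (2 * PI * Im t)).
Proof. unfold qexp. rewrite Cmod_Cexp. f_equal. unfold Re, Im; simpl. ring. Qed.

Lemma Cmod_qexp_lt_1 (t : C) : (0 < Im t)%R -> (Cmod (qexp t) < 1)%R.
Proof.
  intros H. rewrite Cmod_qexp, <- exp_0. apply exp_increasing. pose proof PI_RGT_0. nra.
Qed.

Lemma Cmod_qexp_le (t : C) (y : R) : (y <= Im t)%R -> (Cmod (qexp t) <= exp (- (2 * PI * y)))%R.
Proof.
  intros H. rewrite Cmod_qexp. pose proof PI_RGT_0.
  destruct (Rle_lt_or_eq_dec y (Im t) H) as [E|E]; [|now rewrite E].
  apply Rlt_le, exp_increasing. nra.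
Qed.

Lemma qexp_add (s t : C) : qexp (s + t) = qexp s * qexp t.
Proof. unfold qexp. rewrite <- Cexp_add. f_equal. ring. Qed.

Lemma qexp_1 : qexp 1 = 1.
Proof.
  unfold qexp, Cexp. replace (2 * PI * Ci * 1) with (RtoC 0 + RtoC (2 * PI) * Ci) by (rewrite RtoC_mult; ring).
  simpl. replace (0 + (2 * PI * 0 - 0 * 1))%R with 0%R by ring.
  replace (0 + (2 * PI * 1 + 0 * 0))%R with (2 * PI)%R by ring.
  rewrite exp_0, cos_2PI, sin_2PI. apply injective_projections; simpl; ring.
Qed.

Lemma qexp_neq_0 (t : C) : qexp t <> 0.
Proof. apply Cexp_neq_0. Qed.

Lemma qexp_nat (n : nat) (t : C) : qexp (INR n * t) = Cpow (qexp t) n.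
Proof. unfold qexp. rewrite <- Cexp_nat. f_equal. ring. Qed.

Lemma qexp_INR (n : nat) : qexp (INR n) = 1.
Proof.
  replace (RtoC (INR n)) with (INR n * 1) by ring. rewrite qexp_nat, qexp_1. apply Cpow_1_l.
Qed.

Lemma qexp_opp (t : C) : qexp (- t) = / qexp t.
Proof. unfold qexp. rewrite <- Cexp_opp. f_equal. ring. Qed.

Lemma qexp_shift (t : C) : qexp (t + 1) = qexp t.
Proof. rewrite qexp_add, qexp_1. ring. Qed.

Lemma qexp_reflect (t : C) : qexp (- Cconj t) = Cconj (qexp t).
Proof.
  unfold qexp. rewrite <- Cexp_conj. f_equal. destruct t as [x y].
  apply injective_projections; simpl; ring.
Qed.

Lemma Fs_shift (a : nat -> C) (t : C) : Fs a (t + 1) = Fs a t.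
Proof. unfold Fs. now rewrite qexp_shift. Qed.

Lemma Fs_reflect (a : nat -> C) (t : C) :
  (forall n, Cconj (a n) = a n) -> Fs a (- Cconj t) = Cconj (Fs a t).
Proof.
  intros H. unfold Fs, Ps. rewrite qexp_reflect, <- Cser_conj.
  apply Cser_ext. intros n. now rewrite Cmult_conj, H, Cpow_conj.
Qed.

Definition twopii : C := 2 * RtoC PI * Ci.

Lemma Cmod_twopii : Cmod twopii = (2 * PI)%R.
Proof.
  unfold twopii. rewrite !Cmod_mult, Cmod_Ci, !Cmod_RtoC_pos; [ring| |lra].
  apply Rlt_le, PI_RGT_0.
Qed.

Lemma twopii_neq_0 : twopii <> 0.
Proof. apply Cmod_neq. rewrite Cmod_twopii. pose proof PI_RGT_0. lra. Qed.

Lemma cder_qexp (t : C) : cder qexp t (twopii * qexp t).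
Proof.
  unfold qexp. apply (cder_exp (fun t => twopii * t)).
  apply cder_eq with (twopii * 1); [ring|]. apply cder_scal, cder_id.
Qed.

Lemma cder_Fs (a : nat -> C) (t : C) : growth a -> (0 < Im t)%R ->
  cder (Fs a) t (twopii * Fs (Da a) t).
Proof.
  intros Ha Ht. pose proof PI_RGT_0 as Hpi.
  pose proof (growth_Da a Ha) as HDa. pose proof (growth_Da _ HDa) as HDDa.
  unfold Fs, Ps.
  rewrite <- Cser_scal by (apply growth_summable; [easy|now apply Cmod_qexp_lt_1]).
  (* For |h| < Im t / 2 the factor e^(2 pi n |h|) costs at most half of the decay e^(-2 pi n Im t),
     which leaves the ratio e^(-pi Im t) in the majorant. *)
  apply (cder_series (fun n z => a n * Cpow (qexp z) n) (fun n => twopii * (Da a n * Cpow (qexp t) n))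
    (fun n => 2 * PI * (2 * PI) * (Cmod (Da (Da a) n) * exp (- (PI * Im t)) ^ n))%R t (Im t / 2)%R).
  - lra.
  - intros h Hh. apply growth_summable; [easy|]. apply Cmod_qexp_lt_1.
    pose proof (im_le_Cmod h) as Hi. apply Rabs_le_between in Hi.
    unfold Im in *; simpl. lra.
  - apply summable_scal, growth_summable; [easy|now apply Cmod_qexp_lt_1].
  - apply (ex_series_scal (V := R_NormedModule)). apply growth_ex_series; [easy|].
    split; [apply Rlt_le, exp_pos|]. rewrite <- exp_0. apply exp_increasing. nra.
  - intros n h Hh.
    replace (a n * Cpow (qexp (t + h)) n - a n * Cpow (qexp t) n - h * (twopii * (Da a n * Cpow (qexp t) n)))
      with (a n * Cpow (qexp t) n * (Cexp (twopii * (INR n * h)) - 1 - twopii * (INR n * h))).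
    2: { change (Cexp (twopii * (INR n * h))) with (qexp (INR n * h)).
         rewrite qexp_add, Cpow_mult_l, <- (qexp_nat n h). unfold Da. ring. }
    rewrite !Cmod_mult, Cmod_pow, Cmod_qexp.
    set (w := twopii * (INR n * h)).
    assert (Hw : Cmod w = (2 * PI * (INR n * Cmod h))%R).
    { unfold w. rewrite !Cmod_mult, Cmod_twopii, Cmod_RtoC_pos by apply pos_INR. easy. }
    eapply Rle_trans; [apply Rmult_le_compat_l; [|apply Cexp_bound2]|].
    { apply Rmult_le_pos; [apply Cmod_ge_0|]. apply pow_le, Rlt_le, exp_pos. }
    unfold Da. rewrite !Cmod_mult, !Cmod_RtoC_pos by apply pos_INR. rewrite Hw.
    assert (He : (exp (- (2 * PI * Im t)) ^ n * exp (2 * PI * (INR n * Cmod h)) <= exp (- (PI * Im t)) ^ n)%R).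
    { rewrite <- !Rpower_pow by apply exp_pos. unfold Rpower. rewrite !ln_exp, <- exp_plus.
      destruct (Rle_lt_or_eq_dec (INR n * - (2 * PI * Im t) + 2 * PI * (INR n * Cmod h)) (INR n * - (PI * Im t)))%R as [E|E].
      - pose proof (pos_INR n). assert (0 <= INR n * PI)%R by nra. nra.
      - now apply Rlt_le, exp_increasing.
      - rewrite E; lra. }
    pose proof (Cmod_ge_0 (a n)) as H0. pose proof (Cmod_ge_0 h) as H1. pose proof (pos_INR n) as H2.
    set (E1 := (exp (- (2 * PI * Im t)) ^ n)%R) in *. set (E2 := exp (2 * PI * (INR n * Cmod h))) in *.
    set (E3 := (exp (- (PI * Im t)) ^ n)%R) in *.
    replace (Cmod (a n) * E1 * (2 * PI * (INR n * Cmod h) * (2 * PI * (INR n * Cmod h)) * E2))%R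
      with ((Cmod (a n) * (2 * PI * (INR n * Cmod h) * (2 * PI * (INR n * Cmod h)))) * (E1 * E2))%R by ring.
    replace (Cmod h * Cmod h * (2 * PI * (2 * PI) * (INR n * (INR n * Cmod (a n)) * E3)))%R
      with ((Cmod (a n) * (2 * PI * (INR n * Cmod h) * (2 * PI * (INR n * Cmod h)))) * E3)%R by ring.
    apply Rmult_le_compat_l; [|easy]. apply Rmult_le_pos; [easy|].
    assert (0 <= 2 * PI * (INR n * Cmod h))%R by (apply Rmult_le_pos; [lra|now apply Rmult_le_pos]). nra.
Qed.

(** * Averages over roots of unity and bounds for coefficients *)

Lemma csum_Cser (f : nat -> nat -> C) (N : nat) : (forall j, summable (f j)) ->
  summable (fun k => csum (fun j => f j k) N) /\
  csum (fun j => Cser (f j)) N = Cser (fun k => csum (fun j => f j k) N).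
Proof.
  intros H. induction N as [|N [IH1 IH2]]; simpl.
  - split; [now apply finite_support_summable with 0%nat|now rewrite Cser_0].
  - rewrite IH2. split; [now apply summable_plus|now rewrite Cser_plus].
Qed.

Lemma geometric_csum (w : C) (N : nat) : (w - 1) * csum (Cpow w) N = Cpow w N - 1.
Proof. induction N as [|N IH]; simpl; [ring|]. rewrite Cmult_plus_distr_l, IH. ring. Qed.

Lemma sin_PI_frac_pos (m N : nat) : (0 < m < N)%nat -> (0 < sin (PI * (INR m / INR N)))%R.
Proof.
  intros H. assert (Hm : (0 < INR m)%R) by (apply lt_0_INR; lia).
  assert (Hn : (INR m < INR N)%R) by (apply lt_INR; lia). pose proof PI_RGT_0.
  assert (0 < INR m / INR N)%R by (apply Rdiv_lt_0_compat; lra).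
  assert (INR m / INR N < 1)%R by (apply Rlt_div_l; lra).
  apply sin_gt_0; nra.
Qed.

Lemma qexp_real (x : R) : qexp x = (cos (2 * (PI * x)), sin (2 * (PI * x)))%R.
Proof.
  unfold qexp, Cexp. replace (2 * PI * Ci * x) with ((0, 2 * (PI * x)) : C)%R.
  - simpl. rewrite exp_0. apply injective_projections; simpl; ring.
  - apply injective_projections; simpl; ring.
Qed.

Lemma qexp_frac_neq_1 (x : R) : sin (PI * x) <> 0%R -> qexp x <> 1.
Proof.
  intros H E. rewrite qexp_real in E. injection E as E _. rewrite cos_2a_sin in E. nra.
Qed.

(** Discrete orthogonality: the mean of the powers of e^(2 pi i (k-n)/N). It plays the part of the
    integral over a period in Cauchy's formula and is a Kronecker delta as soon as N exceeds both k
    and n. *)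
Definition kernel (N k n : nat) : C :=
  / INR N * csum (fun j => qexp ((INR k - INR n) * (INR j / INR N))) N.

Lemma kernel_pow (N k n : nat) :
  kernel N k n = / INR N * csum (Cpow (qexp ((INR k - INR n) / INR N))) N.
Proof.
  unfold kernel. f_equal. apply csum_ext. intros j _. rewrite <- qexp_nat. f_equal.
  unfold Cdiv. ring.
Qed.

Lemma kernel_diag (N n : nat) : (0 < N)%nat -> kernel N n n = 1.
Proof.
  intros HN. unfold kernel.
  rewrite (csum_ext _ (fun _ => 1)).
  - assert (E : csum (fun _ => 1) N = INR N).
    { clear HN. induction N as [|N IH]; [easy|]. rewrite S_INR, RtoC_plus, <- IH. easy. }
    rewrite E. field. apply RtoC_neq, not_0_INR. lia.
  - intros j _. replace ((INR n - INR n) * (INR j / INR N)) with (RtoC 0) by ring.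
    exact (qexp_INR 0).
Qed.

Lemma kernel_offdiag (N k n : nat) : k <> n -> (k < N)%nat -> (n < N)%nat -> kernel N k n = 0.
Proof.
  intros Hkn Hk Hn. rewrite kernel_pow. set (w := qexp _).
  assert (HN : INR N <> 0%R) by (apply not_0_INR; lia).
  assert (Hw1 : w <> 1).
  { unfold w. destruct (Nat.lt_ge_cases n k) as [H|H].
    - replace ((INR k - INR n) / INR N) with (RtoC (INR (k - n) / INR N)).
      + apply qexp_frac_neq_1, Rgt_not_eq, sin_PI_frac_pos. lia.
      + rewrite minus_INR by lia. rewrite RtoC_div, RtoC_minus by easy. easy.
    - replace ((INR k - INR n) / INR N) with (- RtoC (INR (n - k) / INR N)).
      + rewrite qexp_opp. intros E. apply (qexp_frac_neq_1 (INR (n - k) / INR N)).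
        * apply Rgt_not_eq, sin_PI_frac_pos. lia.
        * pose proof (qexp_neq_0 (INR (n - k) / INR N)%R) as Hz.
          transitivity (1 / / qexp (INR (n - k) / INR N)%R); [field; easy|]. rewrite E. field.
      + rewrite minus_INR by lia. rewrite RtoC_div, RtoC_minus by easy. unfold Cdiv. ring. }
  assert (HwN : Cpow w N = 1).
  { unfold w. rewrite <- qexp_nat.
    replace (INR N * ((INR k - INR n) / INR N)) with (INR k + - INR n) by (field; now apply RtoC_neq).
    rewrite qexp_add, qexp_opp, !qexp_INR. field. }
  pose proof (geometric_csum w N) as G. rewrite HwN in G.
  replace (csum (Cpow w) N) with ((w - 1) * csum (Cpow w) N / (w - 1)).
  - rewrite G. unfold Cdiv. ring.
  - field. intros E. apply Hw1. replace w with (w - 1 + 1) by ring. rewrite E. ring.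
Qed.

Lemma kernel_bound (N k n : nat) : (Cmod (kernel (S N) k n) <= 1)%R.
Proof.
  unfold kernel. pose proof (lt_0_INR (S N) (Nat.lt_0_succ N)) as HN.
  rewrite Cmod_mult, Cmod_inv, Cmod_RtoC_pos by (try apply RtoC_neq; lra).
  apply Rmult_le_reg_l with (INR (S N)); [easy|].
  rewrite <- Rmult_assoc, Rinv_r, Rmult_1_l by lra.
  eapply Rle_trans; [apply Cmod_csum|]. rewrite <- rsum_const. apply rsum_le. intros j _.
  rewrite Cmod_qexp. replace (Im _) with 0%R.
  - rewrite Rmult_0_r, Ropp_0, exp_0. lra.
  - unfold Im. replace ((INR k - INR n) * (INR j / INR (S N))) with (RtoC ((INR k - INR n) * (INR j / INR (S N)))).
    + easy.
    + rewrite RtoC_mult, RtoC_minus, RtoC_div by lra. easy.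
Qed.

Lemma qexp_split (x y : R) : qexp (x, y) = qexp x * qexp (0, y)%R.
Proof. rewrite <- qexp_add. f_equal. apply injective_projections; simpl; ring. Qed.

(* Averages over N-th roots of unity isolate the coefficients in residue classes mod N. *)
Lemma Fs_Cauchy (a : nat -> C) (y M : R) (n : nat) : growth a -> (0 < y)%R ->
  (forall x : R, (Cmod (Fs a (x, y)) <= M)%R) ->
  (Cmod (a n) * exp (- (2 * PI * y)) ^ n <= M)%R.
Proof.
  intros Ha Hy HM. set (q0 := qexp (0, y)%R).
  assert (Hq0 : Cmod q0 = exp (- (2 * PI * y))) by apply Cmod_qexp.
  assert (Hq1 : (Cmod q0 < 1)%R) by now apply Cmod_qexp_lt_1.
  pose proof (growth_summable a q0 Ha Hq1) as Sa.
  (* A Riemann sum for the n-th Fourier coefficient at height y. The factors [qexp] of real numbers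
     are unimodular, so it is bounded by M, and it converges to a_n q0^n. *)
  set (avg := fun N => / INR (S N) * csum (fun j => Fs a (INR j / INR (S N), y)%R * qexp (- (INR n * (INR j / INR (S N))%R))) (S N)).
  assert (Havg : forall N, summable (fun k => a k * Cpow q0 k * kernel (S N) k n) /\
                 avg N = Cser (fun k => a k * Cpow q0 k * kernel (S N) k n)).
  { intros N. split.
    - apply summable_le with (fun k => Cmod (a k * Cpow q0 k)); [|easy]. intros k.
      rewrite Cmod_mult. pose proof (kernel_bound N k n). pose proof (Cmod_ge_0 (a k * Cpow q0 k)). nra.
    - unfold avg.
      set (f := fun j k => a k * Cpow q0 k * qexp ((INR k - INR n) * (INR j / INR (S N)))).
      assert (Hf : forall j, summable (f j)).
      { intros j. apply summable_le with (fun k => Cmod (a k * Cpow q0 k)); [|easy]. intros k.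
        unfold f. rewrite Cmod_mult, Cmod_qexp.
        replace ((INR k - INR n) * (INR j / INR (S N))) with (RtoC ((INR k - INR n) * (INR j / INR (S N)))).
        - simpl Im. rewrite Rmult_0_r, Ropp_0, exp_0. lra.
        - rewrite RtoC_mult, RtoC_minus, RtoC_div by (apply not_0_INR; lia). easy. }
      rewrite (csum_ext _ (fun j => Cser (f j))).
      + destruct (csum_Cser f (S N) Hf) as [H1 H2]. rewrite H2, <- Cser_scal by easy.
        apply Cser_ext. intros k. unfold kernel. unfold f. rewrite csum_scal. ring.
      + intros j _. unfold Fs, Ps. rewrite Cmult_comm, <- Cser_scal.
        * apply Cser_ext. intros k. unfold f.
          replace ((INR k - INR n) * (INR j / INR (S N))) with (- (INR n * (INR j / INR (S N))%R) + INR k * RtoC (INR j / INR (S N))).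
          -- rewrite qexp_add, qexp_split, Cpow_mult_l, (qexp_nat k). fold q0. ring.
          -- rewrite RtoC_div by (apply not_0_INR; lia). ring.
        * apply growth_summable; [easy|]. now apply Cmod_qexp_lt_1. }
  assert (Hlim : is_clim avg (a n * Cpow q0 n)).
  { set (b := fun k => if Nat.eqb k n then a n * Cpow q0 n else 0).
    assert (Hb : summable b).
    { apply finite_support_summable with (S n). intros k Hk. unfold b. now replace (k =? n)%nat with false by (symmetry; apply Nat.eqb_neq; lia). }
    assert (Eb : Cser b = a n * Cpow q0 n).
    { rewrite (Cser_finite b (S n)).
      - rewrite (csum_single b n); [|lia|]; unfold b.
        + now rewrite Nat.eqb_refl.
        + intros k Hk. now replace (k =? n)%nat with false by (symmetry; now apply Nat.eqb_neq).
      - intros k Hk. unfold b. now replace (k =? n)%nat with false by (symmetry; apply Nat.eqb_neq; lia). }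
    apply is_clim_ext with (fun N => Cser (fun k => a k * Cpow q0 k * kernel (S N) k n - b k) + a n * Cpow q0 n).
    - intros N. destruct (Havg N) as [H1 H2]. rewrite Cser_minus by easy. rewrite H2, Eb. ring.
    - replace (a n * Cpow q0 n) with (0 + a n * Cpow q0 n) at 1 by ring.
      apply is_clim_plus; [|apply is_clim_const].
      (* The majorant 2 |a_k q0^k| allows the kernel to be replaced by its limit term by term. *)
      apply (tannery (fun N k => a k * Cpow q0 k * kernel (S N) k n - b k) (fun k => 2 * Cmod (a k * Cpow q0 k))%R).
      + intros N k. eapply Rle_trans; [apply Cmod_triangle_minus|]. rewrite Cmod_mult.
        pose proof (kernel_bound N k n). pose proof (Cmod_ge_0 (a k * Cpow q0 k)).
        assert (Cmod (b k) <= Cmod (a k * Cpow q0 k))%R; [|nra].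
        unfold b. destruct (Nat.eqb_spec k n) as [->|_]; [lra|]. now rewrite Cmod_0.
      + now apply (ex_series_scal (V := R_NormedModule) 2%R).
      + intros k. apply is_clim_eps. intros eps He. exists (k + n)%nat. intros N HN.
        unfold b. destruct (Nat.eqb_spec k n) as [->|Hk].
        * rewrite kernel_diag by lia. match goal with |- (Cmod ?x < _)%R => replace x with (RtoC 0) by ring end.
          now rewrite Cmod_0.
        * rewrite kernel_offdiag by (try easy; lia). match goal with |- (Cmod ?x < _)%R => replace x with (RtoC 0) by ring end.
          now rewrite Cmod_0. }
  replace (Cmod (a n) * exp (- (2 * PI * y)) ^ n)%R with (Cmod (a n * Cpow q0 n)) by (rewrite Cmod_mult, Cmod_pow, Hq0; easy).
  apply is_clim_Cmod_le with avg; [|exact Hlim]. intros N. unfold avg.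
  pose proof (lt_0_INR (S N) (Nat.lt_0_succ N)) as HN.
  rewrite Cmod_mult, Cmod_inv, Cmod_RtoC_pos by (try apply RtoC_neq; lra).
  apply Rmult_le_reg_l with (INR (S N)); [easy|].
  rewrite <- Rmult_assoc, Rinv_r, Rmult_1_l by lra.
  eapply Rle_trans; [apply Cmod_csum|]. rewrite <- rsum_const. apply rsum_le. intros j _.
  rewrite Cmod_mult, Cmod_qexp.
  replace (Im _) with 0%R by (unfold Im; simpl; ring).
  rewrite Rmult_0_r, Ropp_0, exp_0, Rmult_1_r. apply HM.
Qed.

(** * Partial fractions of 1/sin^2 and 1/sin^4 *)

(** This is -1/(4 sin^2 (pi z)), written in q because it is also the generating function of n q^n;
    see [Ps_id]. *)
Definition W (z : C) : C := qexp z / ((1 - qexp z) * (1 - qexp z)).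

(* csc2 z = pi^2 / sin^2 (pi z) = sum (z + k)^-2 and csc4 z = csc2^2 - (2 pi^2 / 3) csc2 = sum (z + k)^-4. *)
Definition csc2 (z : C) : C := twopii * twopii * W z.

Definition csc4 (z : C) : C := twopii * twopii * (twopii * twopii) * (W z * W z + W z / 6).

Lemma C1_neq_0 : RtoC 1 <> 0. Proof. apply RtoC_neq; lra. Qed.

Lemma Cminus_neq_0 (a b : C) : a <> b -> a - b <> 0.
Proof. intros H E. apply H. replace a with (a - b + b) by ring. rewrite E. ring. Qed.

Lemma qexp_half_shift (z : C) : qexp ((z + 1) / 2) = - qexp (z / 2).
Proof.
  replace ((z + 1) / 2) with (z / 2 + RtoC (/ 2)) by (rewrite RtoC_inv; [field|lra]).
  rewrite qexp_add, qexp_real. replace (2 * (PI * / 2))%R with PI by field.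
  rewrite cos_PI, sin_PI. replace ((-1, 0)%R : C) with (- RtoC 1); [ring|].
  apply injective_projections; simpl; ring.
Qed.

Lemma qexp_half_sqr (z : C) : qexp (z / 2) * qexp (z / 2) = qexp z.
Proof. rewrite <- qexp_add. f_equal. field. Qed.

(** With p = e^(pi i z) the two half arguments have q-values p and -p, while z itself has p^2; both
    identities are then rational identities in p. *)
Lemma W_half (z : C) : qexp z <> 1 ->
  W (z / 2) + W ((z + 1) / 2) = 4 * W z /\ W (z / 2) * W ((z + 1) / 2) = - W z.
Proof.
  intros H. unfold W. rewrite qexp_half_shift, <- (qexp_half_sqr z) in *.
  set (p := qexp (z / 2)) in *.
  assert (H1 : 1 - p <> 0).
  { intros E. apply H. replace p with (1 - (1 - p)) by ring. rewrite E. ring. }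
  assert (H2 : 1 - - p <> 0).
  { intros E. apply H. replace p with ((1 - - p) - 1) by ring. rewrite E. ring. }
  assert (H2' : 1 + p <> 0) by (intros E; apply H2; rewrite <- E; ring).
  assert (H3 : 1 - p * p <> 0).
  { replace (1 - p * p) with ((1 - p) * (1 - - p)) by ring. now apply Cmult_neq_0. }
  split; field; repeat split; try easy.
  all: intros E; first [apply H3; rewrite <- E; ring | apply H2; rewrite <- E; ring | apply H1; rewrite <- E; ring].
Qed.

Lemma csc2_half (z : C) : qexp z <> 1 -> csc2 (z / 2) + csc2 ((z + 1) / 2) = 4 * csc2 z.
Proof.
  intros H. destruct (W_half z H) as [H1 _]. unfold csc2.
  rewrite <- Cmult_plus_distr_l, H1. ring.
Qed.

Lemma csc4_half (z : C) : qexp z <> 1 -> csc4 (z / 2) + csc4 ((z + 1) / 2) = 16 * csc4 z.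
Proof.
  intros H. destruct (W_half z H) as [H1 H2]. unfold csc4.
  rewrite <- Cmult_plus_distr_l. set (u := W (z / 2)) in *. set (v := W ((z + 1) / 2)) in *.
  replace (u * u + u / 6 + (v * v + v / 6)) with ((u + v) * (u + v) - 2 * (u * v) + (u + v) / 6) by field.
  rewrite H1, H2. field.
Qed.

Lemma qexp_unit_root (z : C) (k j : nat) : qexp z <> 1 -> qexp ((z + INR k) / INR (2 ^ j)) <> 1.
Proof.
  intros H E. apply H. assert (Hn : INR (2 ^ j) <> 0%R) by (apply not_0_INR, Nat.pow_nonzero; lia).
  replace z with (INR (2 ^ j) * ((z + INR k) / INR (2 ^ j)) + - INR k) by (field; now apply RtoC_neq).
  rewrite qexp_add, qexp_nat, E, qexp_opp, qexp_INR, Cpow_1_l. field.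
Qed.

(** The engine of the partial fraction expansions: F(z) times c^j is a sum of F over 2^j points.
    Replacing F by its polar part there costs an error that is small against c^j, where c is 4 or
    16. *)
Lemma iterate_half (F : C -> C) (c : C) :
  (forall z, qexp z <> 1 -> F (z / 2) + F ((z + 1) / 2) = c * F z) ->
  forall j z, qexp z <> 1 -> csum (fun k => F ((z + INR k) / INR (2 ^ j))) (2 ^ j) = Cpow c j * F z.
Proof.
  intros HF j. induction j as [|j IH]; intros z Hz.
  - simpl. replace ((z + 0) / 1) with z by field. ring.
  - replace (2 ^ S j)%nat with (2 ^ j + 2 ^ j)%nat by (simpl; lia).
    rewrite csum_add, <- csum_plus, Cpow_S.
    rewrite (csum_ext _ (fun k => c * F ((z + INR k) / INR (2 ^ j)))).
    + rewrite csum_scal, IH by easy. ring.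
    + intros k _. rewrite <- HF by now apply qexp_unit_root.
      assert (Hn : RtoC (INR (2 ^ j)) <> 0) by (apply RtoC_neq, not_0_INR, Nat.pow_nonzero; lia).
      rewrite !plus_INR, !RtoC_plus. set (X := RtoC (INR (2 ^ j))) in *.
      replace (X + X) with (2 * X) by ring. f_equal; f_equal; field; exact Hn.
Qed.

Lemma exp_diff_ge (x : R) : (x * x <= (exp x - exp (- x)) * (exp x - exp (- x)))%R.
Proof.
  assert (H : forall x, (0 <= x)%R -> (x <= exp x - exp (- x))%R).
  { intros y Hy. pose proof (exp_ineq1_le y). assert (exp (- y) <= 1)%R; [|lra].
    rewrite <- exp_0. destruct (Rle_lt_or_eq_dec 0 y Hy) as [E|<-].
    - apply Rlt_le, exp_increasing. lra.
    - rewrite Ropp_0. lra. }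
  destruct (Rle_dec 0 x) as [Hx|Hx].
  - specialize (H x Hx). nra.
  - assert (Hx' : (0 <= - x)%R) by lra. specialize (H (- x)%R Hx'). rewrite Ropp_involutive in H. nra.
Qed.

(** The range 9/4 comes from |Re w| <= 9/16 and pi <= 4. It stays below pi, away from the next zero
    of the sine, and there y - y^3/6 is still at least y/8. *)
Lemma sin_sqr_ge (y : R) : (Rabs y <= 9 / 4)%R -> (y * y / 64 <= sin y * sin y)%R.
Proof.
  assert (H : forall y, (0 <= y <= 9 / 4)%R -> (y / 8 <= sin y)%R).
  { intros u Hu. destruct (pre_sin_bound u 0) as [H _]; [lra|lra|].
    unfold sin_approx, sin_term in H. simpl in H. nra. }
  intros Hy. apply Rabs_le_between in Hy. destruct (Rle_dec 0 y) as [E|E].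
  - specialize (H y). assert (H' : (y / 8 <= sin y)%R) by (apply H; lra). nra.
  - specialize (H (- y)%R). rewrite sin_neg in H. assert (H' : (- y / 8 <= - sin y)%R) by (apply H; lra). nra.
Qed.

(** Twice the hyperbolic sine: [sh] at pi i z is 2 i sin (pi z). *)
Definition sh (u : C) : C := Cexp u - Cexp (- u).

Lemma Cmod_sh (u : C) : (Rabs (Im u) <= 9 / 4)%R -> (Cmod u / 4 <= Cmod (sh u))%R.
Proof.
  intros Hu. destruct u as [x y]. unfold Im in Hu; simpl in Hu.
  pose proof (sin_sqr_ge y Hu) as H1. pose proof (exp_diff_ge x) as H2.
  apply Rsqr_incr_0; [|pose proof (Cmod_ge_0 (x, y)); lra|apply Cmod_ge_0].
  unfold Rsqr. replace (Cmod (x, y) / 4 * (Cmod (x, y) / 4))%R with (Cmod (x, y) * Cmod (x, y) / 16)%R by field.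
  rewrite !Cmod_sqr. unfold sh, Cexp, Re, Im; simpl. rewrite cos_neg, sin_neg.
  set (E := exp x) in *. set (E' := exp (- x)) in *.
  assert (HE : (E * E' = 1)%R) by (unfold E, E'; rewrite <- exp_plus, Rplus_opp_r; apply exp_0).
  pose proof (sin2_cos2 y) as H3. unfold Rsqr in H3.
  set (s := sin y) in *. set (c := cos y) in *.
  replace ((E * c + - (E' * c)) * (E * c + - (E' * c)) + (E * s + - (E' * - s)) * (E * s + - (E' * - s)))%R
    with ((E - E') * (E - E') * (s * s + c * c) + 4 * (E * E') * (s * s))%R by ring.
  rewrite H3, HE. nra.
Qed.

Lemma sh_approx (u : C) : (Cmod u <= 1)%R -> (Cmod (sh u - 2 * u) <= 6 * (Cmod u * Cmod u * Cmod u))%R.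
Proof.
  intros Hu. replace (sh u - 2 * u) with
    ((Cexp u - 1 - u - u * u / 2) - (Cexp (- u) - 1 - - u - - u * - u / 2)) by (unfold sh; field).
  eapply Rle_trans; [apply Cmod_triangle_minus|].
  pose proof (Cexp_bound3 u) as H1. pose proof (Cexp_bound3 (- u)) as H2. rewrite Cmod_opp in H2.
  assert (He : (exp (Cmod u) <= 3)%R).
  { eapply Rle_trans; [|apply exp_le_3]. destruct (Rle_lt_or_eq_dec _ _ Hu) as [E|E]; [|rewrite E; lra].
    now apply Rlt_le, exp_increasing. }
  pose proof (Cmod_ge_0 u). assert (0 <= Cmod u * Cmod u * Cmod u)%R by (apply Rmult_le_pos; nra).
  nra.
Qed.

Lemma W_sh (z : C) : qexp z <> 1 -> W z = / (sh (RtoC PI * Ci * z) * sh (RtoC PI * Ci * z)).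
Proof.
  intros Hz. unfold W, sh. set (u := RtoC PI * Ci * z).
  assert (E : qexp z = Cexp u * Cexp u) by (unfold qexp; rewrite <- Cexp_add; f_equal; unfold u; ring).
  rewrite Cexp_opp, E in *. set (p := Cexp u) in *. assert (Hp : p <> 0) by apply Cexp_neq_0.
  assert (H1 : 1 - p * p <> 0) by (apply Cminus_neq_0; congruence).
  assert (H2 : p * p - 1 <> 0) by (apply Cminus_neq_0; congruence).
  field. repeat split; easy.
Qed.

(** The strip contains the single pole 0. For |pi w| <= 1 the double poles cancel by the cubic
    Taylor estimate [sh_approx]; farther out both terms are bounded separately. The width 9/16 is
    the half-width 1/2 of a window plus 1/16 for its displacement by z. *)
Lemma csc2_near_pole : exists B, (0 < B)%R /\ forall w, (Rabs (Re w) <= 9 / 16)%R -> w <> 0 -> qexp w <> 1 ->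
  (Cmod (csc2 w - / (w * w)) <= B)%R.
Proof.
  pose proof PI_RGT_0 as Hpi. pose proof PI_4 as Hpi4.
  exists (2 * PI * (2 * PI) * 300)%R. split; [nra|]. intros w Hw Hw0 Hq.
  set (u := RtoC PI * Ci * w).
  assert (HPI : RtoC PI <> 0) by (apply RtoC_neq; lra).
  assert (Hu0 : u <> 0) by (unfold u; repeat apply Cmult_neq_0; [easy|apply Ci_neq_0|easy]).
  assert (Hsh : (Cmod u / 4 <= Cmod (sh u))%R).
  { apply Cmod_sh. unfold u. replace (Im (PI * Ci * w)) with (PI * Re w)%R by (unfold Re, Im; simpl; ring).
    rewrite Rabs_mult, Rabs_pos_eq by lra. pose proof (Rabs_pos (Re w)). nra. }
  assert (Hup : (0 < Cmod u)%R) by now apply Cmod_gt_0.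
  assert (Hs0 : sh u <> 0) by (apply Cmod_neq; lra).
  assert (E : csc2 w - / (w * w) = twopii * twopii * (/ (sh u * sh u) - / (4 * (u * u)))).
  { unfold csc2. rewrite W_sh by easy. fold u.
    replace (/ (w * w)) with (twopii * twopii * / (4 * (u * u))); [ring|].
    unfold twopii, u. field. repeat split; try easy; apply Ci_neq_0. }
  clearbody u. rewrite E, !Cmod_mult, Cmod_twopii. apply Rmult_le_compat_l; [nra|].
  assert (Hi : (/ (Cmod (sh u) * Cmod (sh u)) <= 16 / (Cmod u * Cmod u))%R).
  { apply Rle_trans with (/ (Cmod u / 4 * (Cmod u / 4)))%R.
    - apply Rinv_le_contravar; [nra|]. apply Rmult_le_compat; lra.
    - right. field. lra. }
  assert (E4 : Cmod (/ (4 * (u * u))) = (/ (4 * (Cmod u * Cmod u)))%R).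
  { rewrite Cmod_inv, !Cmod_mult, Cmod_RtoC_pos; [easy|lra|].
    repeat apply Cmult_neq_0; try easy. apply RtoC_neq; lra. }
  assert (Es : Cmod (/ (sh u * sh u)) = (/ (Cmod (sh u) * Cmod (sh u)))%R).
  { rewrite Cmod_inv, Cmod_mult by now apply Cmult_neq_0. easy. }
  destruct (Rle_dec (Cmod u) 1) as [H1|H1].
  - replace (/ (sh u * sh u) - / (4 * (u * u))) with ((2 * u - sh u) * (2 * u + sh u) * / (sh u * sh u) * / (4 * (u * u)))
      by (field; easy).
    pose proof (sh_approx u H1) as Ha. set (m := Cmod u) in *.
    assert (Ha' : (Cmod (2 * u - sh u) <= 6 * (m * m * m))%R) by (rewrite Cmod_minus_sym; exact Ha).
    assert (Hb : (Cmod (2 * u + sh u) <= 10 * m)%R).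
    { replace (2 * u + sh u) with (sh u - 2 * u + 4 * u) by ring.
      eapply Rle_trans; [apply Cmod_triangle|]. rewrite (Cmod_mult 4), Cmod_RtoC_pos by lra. fold m.
      assert (m * m * m <= m)%R by nra. lra. }
    rewrite !Cmod_mult, E4, Es.
    apply Rle_trans with (6 * (m * m * m) * (10 * m) * (16 / (m * m)) * / (4 * (m * m)))%R.
    + apply Rmult_le_compat_r; [apply Rlt_le, Rinv_0_lt_compat; nra|].
      apply Rmult_le_compat; [apply Rmult_le_pos; apply Cmod_ge_0| |apply Rmult_le_compat; try apply Cmod_ge_0; easy|exact Hi].
      apply Rlt_le, Rinv_0_lt_compat. assert (0 < Cmod (sh u))%R by lra. nra.
    + apply Rle_trans with 240%R; [right; field; lra|lra].
  - eapply Rle_trans; [apply Cmod_triangle_minus|].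
    rewrite E4, Es.
    assert (16 / (Cmod u * Cmod u) <= 16)%R by (apply Rle_div_l; nra).
    assert (/ (4 * (Cmod u * Cmod u)) <= 1)%R by (rewrite <- Rinv_1; apply Rinv_le_contravar; nra).
    lra.
Qed.

(** * Partial fraction expansions from sums over dyadic windows *)

Definition inv2 (x : C) : C := / (x * x).
Definition inv4 (x : C) : C := inv2 x * inv2 x.

Lemma window_sum (g : Z -> C) (M : nat) :
  csum (fun k => g (Z.of_nat k - Z.of_nat M)%Z) (2 * M + 1)
  = g 0%Z + csum (fun n => g (Z.of_nat (S n)) + g (- Z.of_nat (S n))%Z) M.
Proof.
  induction M as [|M IH].
  - simpl. ring.
  - replace (2 * S M + 1)%nat with (S (S (2 * M + 1))) by lia.
    rewrite csum_S_l. change (csum ?f (S ?n)) with (csum f n + f n).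
    rewrite (csum_ext _ (fun k => g (Z.of_nat k - Z.of_nat M)%Z)) by (intros n _; f_equal; lia).
    rewrite IH.
    replace (Z.of_nat 0 - Z.of_nat (S M))%Z with (- Z.of_nat (S M))%Z by lia.
    replace (Z.of_nat (S (2 * M + 1)) - Z.of_nat (S M))%Z with (Z.of_nat (S M)) by lia.
    change (csum ?f (S M)) with (csum f M + f M). ring.
Qed.

Lemma pow2_eventually_large (A : R) : exists N, forall i, (N <= i)%nat -> (A <= INR (2 ^ i))%R.
Proof.
  destruct (nfloor_ex (Rmax A 0)) as [n Hn]; [apply Rmax_r|].
  exists (S n). intros i Hi. apply Rle_trans with (INR (S n)).
  - rewrite S_INR. pose proof (Rmax_l A 0). lra.
  - apply le_INR. apply Nat.le_trans with i; [easy|]. apply Nat.lt_le_incl, Nat.pow_gt_lin_r. lia.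
Qed.

Definition paired (G : C -> C) (z : C) (n : nat) : C := G (z + INR (S n)) + G (z - INR (S n)).

(** The windows supplied by duplication have an even number of terms, from -M to M-1, whereas
    symmetric partial sums run from -M to M. The second estimate disposes of the extra term at M. As
    the paired series is already summable, the subsequence M = 2^i determines its sum. *)
Lemma pf_limit (F G : C -> C) (z : C) (K : R) :
  summable (paired G z) ->
  (exists N, forall i, (N <= i)%nat ->
    (Cmod (F z - csum (fun k => G (z + IZR (Z.of_nat k - Z.of_nat (2 ^ i)))%C) (2 * 2 ^ i)) <= K / INR (2 ^ i))%R /\
    (Cmod (G (z + INR (2 ^ i))%C) <= K / INR (2 ^ i))%R) ->
  Cser (paired G z) = F z - G z.
Proof.
  intros Hs [N HN].
  apply is_clim_unique with (fun i => csum (paired G z) (2 ^ i)).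
  - apply is_clim_subseq with (phi := fun i => (2 ^ i)%nat) (u := csum (paired G z)); [|now apply Cser_lim].
    intros P [n HP]. exists n. intros m Hm. apply HP. apply Nat.le_trans with m; [easy|].
    apply Nat.lt_le_incl, Nat.pow_gt_lin_r. lia.
  - apply is_clim_eps. intros eps He.
    destruct (pow2_eventually_large (2 * Rabs K / eps + 1)) as [N2 HN2].
    exists (N + N2)%nat. intros i Hi. destruct (HN i) as [H1 H2]; [lia|].
    specialize (HN2 i ltac:(lia)). set (M := (2 ^ i)%nat) in *.
    pose proof (window_sum (fun k => G (z + IZR k)) M) as Hw.
    rewrite Nat.add_1_r in Hw. change (csum ?f (S ?n)) with (csum f n + f n) in Hw at 1. cbv beta in Hw.
    replace (Z.of_nat (2 * M) - Z.of_nat M)%Z with (Z.of_nat M) in Hw by lia.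
    rewrite <- INR_IZR_INZ in Hw. replace (z + 0) with z in Hw by ring.
    rewrite (csum_ext (fun n => G (z + IZR (Z.of_nat (S n))) + G (z + IZR (- Z.of_nat (S n)))) (paired G z)) in Hw.
    2: { intros n _. unfold paired. rewrite opp_IZR, <- INR_IZR_INZ, RtoC_opp. easy. }
    replace (csum (paired G z) M - (F z - G z)) with
      (- (F z - csum (fun k => G (z + IZR (Z.of_nat k - Z.of_nat M))) (2 * M)) + G (z + INR M)).
    2: { replace (csum (paired G z) M) with (G z + csum (paired G z) M - G z) by ring. rewrite <- Hw. ring. }
    eapply Rle_lt_trans; [apply Cmod_triangle|]. rewrite Cmod_opp.
    assert (Hq : (0 <= Rabs K / eps)%R) by (apply Rmult_le_pos; [apply Rabs_pos|apply Rlt_le, Rinv_0_lt_compat; easy]).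
    assert (HM : (0 < INR M)%R) by lra.
    assert (K / INR M <= Rabs K / INR M)%R by (apply Rmult_le_compat_r; [apply Rlt_le, Rinv_0_lt_compat; easy|apply Rle_abs]).
    assert (2 * (Rabs K / INR M) < eps)%R; [|lra].
    apply Rmult_lt_reg_r with (INR M); [easy|].
    replace (2 * (Rabs K / INR M) * INR M)%R with (2 * Rabs K / eps * eps)%R by (field; lra). nra.
Qed.

Lemma qexp_IZR (k : Z) : qexp (IZR k) = 1.
Proof.
  destruct (Z_le_dec 0 k) as [H|H].
  - rewrite <- (Z2Nat.id k), <- INR_IZR_INZ by easy. apply qexp_INR.
  - replace k with (- Z.of_nat (Z.to_nat (- k)))%Z by lia.
    rewrite opp_IZR, RtoC_opp, qexp_opp, <- INR_IZR_INZ, qexp_INR. field.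
Qed.

Lemma qexp_add_IZR (z : C) (k : Z) : qexp (z + IZR k) = qexp z.
Proof. rewrite qexp_add, qexp_IZR. ring. Qed.

Section Windows.
Variables (z : C) (i : nat).
Hypothesis Hz : qexp z <> 1.
Hypothesis Hi : (8 * Rabs (Re z) <= INR (2 ^ i))%R.

Let M := (2 ^ i)%nat.
(** The 2^(i+1) points of the iterated duplication formula for z shifted by the integer -M, which
    centres them near 0. *)
Let w (k : nat) : C := (z + IZR (- Z.of_nat M) + INR k) / INR (2 ^ S i).

Lemma window_pos : (1 <= INR M)%R.
Proof. apply (le_INR 1). unfold M. pose proof (Nat.pow_nonzero 2 i). lia. Qed.

Lemma window_X : INR (2 ^ S i) = (2 * INR M)%R.
Proof. unfold M. simpl. rewrite !plus_INR. simpl. ring. Qed.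

Lemma window_eq (k : nat) :
  z + IZR (Z.of_nat k - Z.of_nat M) = RtoC (2 * INR M) * w k.
Proof.
  unfold w. rewrite window_X, minus_IZR, opp_IZR, <- !INR_IZR_INZ, RtoC_minus, RtoC_opp.
  pose proof window_pos. field. apply RtoC_neq. lra.
Qed.

Lemma window_neq_1 (k : nat) : qexp (w k) <> 1.
Proof. unfold w. apply qexp_unit_root. now rewrite qexp_add_IZR. Qed.

Lemma window_neq_0 (k : nat) : w k <> 0.
Proof. intros E. apply (window_neq_1 k). rewrite E. exact (qexp_INR 0). Qed.

Lemma window_Re (k : nat) : (k < 2 * M)%nat -> (Rabs (Re (w k)) <= 9 / 16)%R.
Proof.
  intros Hk. pose proof window_pos as HM. fold M in Hi.
  assert (E : (Re (z + IZR (Z.of_nat k - Z.of_nat M)))%C = (2 * INR M * Re (w k))%R).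
  { rewrite window_eq. apply re_scal_l. }
  rewrite minus_IZR, <- !INR_IZR_INZ, re_plus, re_RtoC in E.
  apply lt_INR in Hk. rewrite mult_INR in Hk. simpl in Hk. pose proof (pos_INR k).
  pose proof (Rle_abs (Re z)). pose proof (Rle_abs (- Re z)). rewrite Rabs_Ropp in *.
  apply Rabs_le. split; apply Rmult_le_reg_l with (2 * INR M)%R; lra.
Qed.

Lemma window_F (F : C -> C) (c : C) :
  (forall z, qexp z <> 1 -> F (z / 2) + F ((z + 1) / 2) = c * F z) ->
  (forall z z', qexp z = qexp z' -> F z = F z') ->
  csum (fun k => F (w k)) (2 * M) = Cpow c (S i) * F z.
Proof.
  intros H1 H2. rewrite (H2 z (z + IZR (- Z.of_nat M))) by now rewrite qexp_add_IZR.
  rewrite <- (iterate_half F c H1) by now rewrite qexp_add_IZR. easy.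
Qed.

(** By homogeneity of G, multiplying the error by c^(i+1) turns it into the sum of F - G over the 2M
    window points, each term being at most B. *)
Lemma window_error (F G : C -> C) (c : C) (B E : R) :
  (forall z, qexp z <> 1 -> F (z / 2) + F ((z + 1) / 2) = c * F z) ->
  (forall z z', qexp z = qexp z' -> F z = F z') ->
  c <> 0 ->
  (forall k, G (w k) = Cpow c (S i) * G (z + IZR (Z.of_nat k - Z.of_nat M))) ->
  (forall k, (k < 2 * M)%nat -> (Cmod (F (w k) - G (w k)) <= B)%R) ->
  (2 * INR M * B <= Cmod c ^ S i * E)%R ->
  (Cmod (F z - csum (fun k => G (z + IZR (Z.of_nat k - Z.of_nat M))%C) (2 * M)) <= E)%R.
Proof.
  intros H1 H2 Hc HG HB HE.
  assert (Hp : (0 < Cmod c ^ S i)%R) by (apply pow_lt; now apply Cmod_gt_0).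
  apply Rmult_le_reg_l with (Cmod c ^ S i)%R; [easy|].
  rewrite <- Cmod_pow, <- Cmod_mult at 1.
  replace (Cpow c (S i) * (F z - csum (fun k => G (z + IZR (Z.of_nat k - Z.of_nat M))) (2 * M)))
    with (csum (fun k => F (w k) + (-1) * G (w k)) (2 * M)).
  - eapply Rle_trans; [apply Cmod_csum|]. eapply Rle_trans; [|exact HE].
    replace (2 * INR M * B)%R with (rsum (fun _ => B) (2 * M)) by (rewrite rsum_const, mult_INR; simpl; ring).
    apply rsum_le. intros k Hk. replace (F (w k) + (-1) * G (w k)) with (F (w k) - G (w k)) by ring. now apply HB.
  - rewrite csum_plus, (window_F F c H1 H2), csum_scal.
    rewrite (csum_ext (fun n => G (w n)) (fun k => Cpow c (S i) * G (z + IZR (Z.of_nat k - Z.of_nat M)))) by (intros; apply HG).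
    rewrite csum_scal. ring.
Qed.
End Windows.

Lemma Cpow_4 (i : nat) : Cpow 4 i = RtoC (INR (2 ^ i) * INR (2 ^ i)).
Proof.
  induction i as [|i IH]; [simpl; f_equal; ring|].
  rewrite Cpow_S, IH. simpl Nat.pow. rewrite !plus_INR. simpl.
  rewrite <- RtoC_mult. f_equal. ring.
Qed.

Lemma inv2_scal (x : R) (w : C) : x <> 0%R -> w <> 0 -> inv2 w = RtoC (x * x) * inv2 (RtoC x * w).
Proof. intros Hx Hw. unfold inv2. rewrite RtoC_mult. field. split; [easy|now apply RtoC_neq]. Qed.

Lemma Cmod_inv2 (x : C) : x <> 0 -> Cmod (inv2 x) = (/ (Cmod x * Cmod x))%R.
Proof. intros Hx. unfold inv2. now rewrite Cmod_inv, Cmod_mult by now apply Cmult_neq_0. Qed.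

Lemma csc2_periodic (z z' : C) : qexp z = qexp z' -> csc2 z = csc2 z'.
Proof. intros E. unfold csc2, W. now rewrite E. Qed.

Lemma csc4_periodic (z z' : C) : qexp z = qexp z' -> csc4 z = csc4 z'.
Proof. intros E. unfold csc4, W. now rewrite E. Qed.

Lemma Cmod_add_nat_ge (z : C) (M : nat) : (Cmod z * 2 + 2 <= INR M)%R -> (INR M / 2 <= Cmod (z + INR M))%R.
Proof.
  intros H. pose proof (Cmod_triangle_rev (INR M) z) as H1. rewrite Cplus_comm in H1.
  rewrite Cmod_RtoC_pos in H1 by apply pos_INR. lra.
Qed.

Lemma csc2_series (z : C) : qexp z <> 1 -> summable (paired inv2 z) ->
  Cser (paired inv2 z) = csc2 z - inv2 z.
Proof.
  intros Hz Hs. destruct csc2_near_pole as [B [HB HB']].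
  apply (pf_limit csc2 inv2 z (B + 4)); [easy|].
  destruct (pow2_eventually_large (8 * Rabs (Re z) + Cmod z * 2 + 4)) as [N HN].
  pose proof (Rabs_pos (Re z)) as Hr. pose proof (Cmod_ge_0 z) as Hm.
  exists N. intros i Hi. specialize (HN i Hi). split.
  - apply (window_error z i Hz csc2 inv2 4 B); [exact csc2_half|exact csc2_periodic|apply RtoC_neq; lra| | |].
    + intros k. pose proof (window_neq_0 z i Hz k) as Hw. rewrite (window_eq z i), Cpow_4.
      rewrite window_X in *. apply inv2_scal; [|exact Hw]. lra.
    + intros k Hk. apply HB'; [apply window_Re; [lra|easy]|now apply window_neq_0|now apply window_neq_1].
    + rewrite <- Cmod_pow, Cpow_4, window_X, Cmod_RtoC_pos by nra.
      assert (0 < INR (2 ^ i))%R by lra.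
      replace (2 * INR (2 ^ i) * (2 * INR (2 ^ i)) * ((B + 4) / INR (2 ^ i)))%R with (4 * INR (2 ^ i) * (B + 4))%R by (field; lra).
      nra.
  - pose proof (Cmod_add_nat_ge z (2 ^ i)) as H. assert (H' : (INR (2 ^ i) / 2 <= Cmod (z + INR (2 ^ i)))%R) by (apply H; lra).
    rewrite Cmod_inv2 by (apply Cmod_neq; lra).
    apply Rle_trans with (/ (INR (2 ^ i) / 2 * (INR (2 ^ i) / 2)))%R.
    + apply Rinv_le_contravar; [nra|]. apply Rmult_le_compat; lra.
    + apply Rmult_le_reg_r with (INR (2 ^ i)); [lra|].
      replace ((B + 4) / INR (2 ^ i) * INR (2 ^ i))%R with (B + 4)%R by (field; lra).
      replace (/ (INR (2 ^ i) / 2 * (INR (2 ^ i) / 2)) * INR (2 ^ i))%R with (4 / INR (2 ^ i))%R by (field; lra).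
      apply Rle_div_l; nra.
Qed.

(** Writing b = csc2 - inv2, which is bounded, the difference csc4 - inv4 is controlled by a
    multiple of 1 + |inv2|, hence by a multiple of (2M)^2/d^2 at the window points. With 2M terms
    against 16^(i+1) = (2M)^4 the total error is of order 1/M, so this crude bound suffices. *)
Lemma csc4_series (z : C) (d : R) : (0 < d <= 1)%R -> (forall k : Z, (d <= Cmod (z + IZR k))%R) ->
  qexp z <> 1 -> summable (paired inv4 z) ->
  Cser (paired inv4 z) = csc4 z - inv4 z.
Proof.
  intros Hd Hdz Hz Hs. destruct csc2_near_pole as [B [HB HB']].
  pose proof PI_RGT_0 as Hpi.
  set (K := (2 * B + B * B + 2 * PI * (2 * PI) / 6 * (1 + B))%R).
  set (D := (/ (d * d))%R).
  assert (HD : (1 <= D)%R) by (unfold D; rewrite <- Rinv_1; apply Rinv_le_contravar; nra).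
  assert (HK : (0 < K)%R) by (unfold K; nra).
  apply (pf_limit csc4 inv4 z (K * D + 16)); [easy|].
  destruct (pow2_eventually_large (8 * Rabs (Re z) + Cmod z * 2 + 4)) as [N HN].
  pose proof (Rabs_pos (Re z)) as Hr. pose proof (Cmod_ge_0 z) as Hm.
  exists N. intros i Hi. specialize (HN i Hi). split.
  - set (M := INR (2 ^ i)) in *.
    apply (window_error z i Hz csc4 inv4 16 (2 * M * (2 * M) * (K * D))); [exact csc4_half|exact csc4_periodic|apply RtoC_neq; lra| | |].
    + intros k. pose proof (window_neq_0 z i Hz k) as Hw. rewrite (window_eq z i).
      replace (Cpow 16 (S i)) with (Cpow 4 (S i) * Cpow 4 (S i)) by (rewrite <- Cpow_mult_l; f_equal; rewrite <- RtoC_mult; f_equal; ring).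
      rewrite Cpow_4. rewrite window_X in *. unfold inv4.
      rewrite (inv2_scal (2 * INR (2 ^ i)) _ ltac:(fold M; lra) Hw). ring.
    + intros k Hk. set (w := (_ / _)%C).
      assert (Hb := HB' w (window_Re z i ltac:(fold M; lra) k Hk) (window_neq_0 z i Hz k) (window_neq_1 z i Hz k)).
      assert (Hw : w <> 0) by exact (window_neq_0 z i Hz k).
      assert (Hinv : (Cmod (inv2 w) <= 2 * M * (2 * M) * D)%R).
      { rewrite (inv2_scal (2 * M)) by (easy || lra). rewrite Cmod_mult, Cmod_RtoC_pos by nra.
        apply Rmult_le_compat_l; [nra|]. unfold M, w. rewrite <- (window_eq z i).
        pose proof (Hdz (Z.of_nat k - Z.of_nat (2 ^ i))%Z) as H1.
        rewrite Cmod_inv2 by (apply Cmod_neq; lra). apply Rinv_le_contravar; [nra|]. apply Rmult_le_compat; lra. }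
      set (be := csc2 w - inv2 w). assert (Hbe : (Cmod be <= B)%R) by exact Hb.
      replace (csc4 w - inv4 w) with (2 * (be * inv2 w) + be * be + twopii * twopii / 6 * (inv2 w + be)).
      2: { unfold be, inv4, csc4, csc2. field. }
      set (P := (2 * M * (2 * M) * D)%R) in *.
      assert (HP : (1 <= P)%R) by (unfold P; assert (1 <= 2 * M * (2 * M))%R by nra; nra).
      replace (2 * M * (2 * M) * (K * D))%R with (K * P)%R by (unfold P; ring).
      assert (H6 : Cmod (twopii * twopii / 6) = (2 * PI * (2 * PI) / 6)%R).
      { rewrite Cmod_div, Cmod_mult, Cmod_twopii, Cmod_RtoC_pos; try easy; try lra. apply RtoC_neq; lra. }
      pose proof (Cmod_ge_0 be). pose proof (Cmod_ge_0 (inv2 w)).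
      eapply Rle_trans; [apply Cmod_triangle|]. rewrite (Cmod_mult (twopii * twopii / 6)), H6.
      assert (T1 : (Cmod (2 * (be * inv2 w) + be * be) <= 2 * B * P + B * B * P)%R).
      { eapply Rle_trans; [apply Cmod_triangle|]. rewrite !Cmod_mult, Cmod_RtoC_pos by lra.
        assert (Cmod be * Cmod (inv2 w) <= B * P)%R by (apply Rmult_le_compat; easy).
        assert (Cmod be * Cmod be <= B * B)%R by (apply Rmult_le_compat; easy).
        assert (B * B <= B * B * P)%R by nra. lra. }
      assert (T2 : (Cmod (inv2 w + be) <= (1 + B) * P)%R).
      { eapply Rle_trans; [apply Cmod_triangle|]. nra. }
      assert (T3 : (2 * PI * (2 * PI) / 6 * Cmod (inv2 w + be) <= 2 * PI * (2 * PI) / 6 * ((1 + B) * P))%R).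
      { apply Rmult_le_compat_l; [nra|easy]. }
      unfold K. lra.
    + fold M. replace (Cmod 16 ^ S i)%R with (2 * M * (2 * M) * (2 * M * (2 * M)))%R.
      * assert (0 < M)%R by lra.
        replace (2 * M * (2 * M) * (2 * M * (2 * M)) * ((K * D + 16) / M))%R with (16 * (M * M * M) * (K * D + 16))%R by (field; lra).
        replace (2 * M * (2 * M * (2 * M) * (K * D)))%R with (8 * (M * M * M) * (K * D))%R by ring.
        assert (0 < M * M * M)%R by (apply Rmult_lt_0_compat; nra). assert (0 < K * D)%R by nra. nra.
      * replace (RtoC 16) with (RtoC 4 * RtoC 4) by (rewrite <- RtoC_mult; f_equal; ring).
        rewrite <- Cmod_pow, Cpow_mult_l, Cmod_mult, Cpow_4, window_X. fold M. rewrite Cmod_RtoC_pos by nra. easy.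
  - pose proof (Cmod_add_nat_ge z (2 ^ i)) as H. assert (H' : (INR (2 ^ i) / 2 <= Cmod (z + INR (2 ^ i)))%R) by (apply H; lra).
    unfold inv4. rewrite Cmod_mult, !Cmod_inv2 by (apply Cmod_neq; lra).
    set (M := INR (2 ^ i)) in *.
    assert (H1 : (/ (Cmod (z + M) * Cmod (z + M)) <= / (M / 2 * (M / 2)))%R).
    { apply Rinv_le_contravar; [nra|]. apply Rmult_le_compat; lra. }
    assert (H2 : (/ (M / 2 * (M / 2)) <= 1)%R) by (rewrite <- Rinv_1; apply Rinv_le_contravar; nra).
    assert (H0 : (0 <= / (Cmod (z + M) * Cmod (z + M)))%R) by (apply Rlt_le, Rinv_0_lt_compat; nra).
    apply Rle_trans with (/ (M / 2 * (M / 2)))%R.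
    { set (a := (/ (Cmod (z + M) * Cmod (z + M)))%R) in *. set (b := (/ (M / 2 * (M / 2)))%R) in *. nra. }
    apply Rmult_le_reg_r with M; [lra|].
    replace ((K * D + 16) / M * M)%R with (K * D + 16)%R by (field; lra).
    replace (/ (M / 2 * (M / 2)) * M)%R with (4 / M)%R by (field; lra).
    assert (0 < K * D)%R by nra. apply Rle_div_l; nra.
Qed.

(** * Lambert series and lattice sums *)

(** Coefficients of the Lambert series of c_d q^(md) over m, d >= 1; with c_d = d^k this is the
    divisor function sigma_k. *)
Definition lam (c : nat -> C) (N : nat) : C :=
  csum (fun d => if Nat.eqb (N mod S d) 0 then c (S d) else 0) N.

Lemma growth_lam (c : nat -> C) : growth c -> growth (lam c).
Proof.
  intros (K & k & HK & H). apply growth_bounded with (S k) K. intros N. unfold lam.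
  eapply Rle_trans; [apply Cmod_csum|].
  apply Rle_trans with (rsum (fun _ => K * (INR N + 1) ^ k)%R N).
  - pose proof (pos_INR N). apply rsum_le. intros d Hd. destruct (_ =? _)%nat.
    + eapply Rle_trans; [apply H|]. apply Rmult_le_compat_l; [easy|]. apply pow_incr.
      pose proof (pos_INR (S d)). assert (INR (S d) <= INR N)%R by (apply le_INR; lia). lra.
    + rewrite Cmod_0. apply Rmult_le_pos; [easy|]. apply pow_le. lra.
  - rewrite rsum_const. simpl. pose proof (pos_INR N). pose proof (pow_INR_ge_1 N k). nra.
Qed.

(** Spreads a series over the positive multiples of p, which rewrites one line of a Lambert series
    as a power series in q. *)
Definition sparse {A : Type} (zero : A) (p : nat) (f : nat -> A) (N : nat) : A :=
  match N with O => zero | S n => if Nat.eqb (N mod p) 0 then f (N / p - 1)%nat else zero end.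

Lemma sparse_block {A : Type} (zero : A) (p : nat) (f : nat -> A) (M j : nat) : (0 < p)%nat ->
  (j < p)%nat -> sparse zero p f (S (p * M + j)) = if Nat.eqb (S j) p then f M else zero.
Proof.
  intros Hp Hj. unfold sparse. destruct (Nat.eqb_spec (S j) p) as [E|E].
  - replace (S (p * M + j)) with ((M + 1) * p)%nat by nia.
    rewrite Nat.Div0.mod_mul, Nat.div_mul by lia. simpl. f_equal. lia.
  - replace (S (p * M + j)) with (S j + M * p)%nat by nia.
    rewrite Nat.Div0.mod_add, Nat.mod_small by lia. easy.
Qed.

Lemma csum_block (g : nat -> C) (a p : nat) (v : C) : (0 < p)%nat ->
  (forall j, (j < p)%nat -> g (a + j)%nat = if Nat.eqb (S j) p then v else 0) ->
  csum (fun j => g (a + j)%nat) p = v.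
Proof.
  intros Hp H. destruct p as [|p]; [lia|]. simpl.
  rewrite csum_zero.
  - rewrite H by lia. rewrite Nat.eqb_refl. ring.
  - intros n Hn. rewrite H by lia. now replace (S n =? S p)%nat with false by (symmetry; apply Nat.eqb_neq; lia).
Qed.

Lemma csum_sparse (p : nat) (f : nat -> C) (M : nat) : (0 < p)%nat ->
  csum (sparse (RtoC 0) p f) (S (p * M)) = csum f M.
Proof.
  intros Hp. induction M as [|M IH].
  - rewrite Nat.mul_0_r. simpl. ring.
  - replace (S (p * S M)) with (S (p * M) + p)%nat by lia. rewrite csum_add, IH.
    change (csum f (S M)) with (csum f M + f M). f_equal.
    apply csum_block; [easy|]. intros j Hj. rewrite Nat.add_succ_l. now apply sparse_block.
Qed.

Lemma rsum_mono (a : nat -> R) (N M : nat) : (forall n, (0 <= a n)%R) -> (N <= M)%nat -> (rsum a N <= rsum a M)%R.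
Proof. intros Ha H. induction H as [|M H IH]; [lra|]. simpl. specialize (Ha M). lra. Qed.

Lemma csum_RtoC (a : nat -> R) (N : nat) : csum (fun n => RtoC (a n)) N = rsum a N.
Proof. induction N as [|N IH]; simpl; [easy|]. now rewrite IH, RtoC_plus. Qed.

Lemma Cser_sparse (p : nat) (f : nat -> C) : (0 < p)%nat -> summable f ->
  summable (sparse (RtoC 0) p f) /\ Cser (sparse (RtoC 0) p f) = Cser f /\
  (Series (fun N => Cmod (sparse (RtoC 0) p f N)) <= Series (fun n => Cmod (f n)))%R.
Proof.
  intros Hp Hf.
  assert (Habs : forall N, RtoC (Cmod (sparse (RtoC 0) p f N)) = sparse (RtoC 0) p (fun n => RtoC (Cmod (f n))) N).
  { intros [|n]; simpl; [now rewrite Cmod_0|]. destruct (_ =? _)%nat; [easy|now rewrite Cmod_0]. }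
  assert (Hb : forall N, (rsum (fun N => Cmod (sparse (RtoC 0) p f N)) N <= Series (fun n => Cmod (f n)))%R).
  { intros N. apply Rle_trans with (rsum (fun N => Cmod (sparse (RtoC 0) p f N)) (S (p * N))).
    - apply rsum_mono; [intros; apply Cmod_ge_0|nia].
    - assert (E : rsum (fun N => Cmod (sparse (RtoC 0) p f N)) (S (p * N)) = rsum (fun n => Cmod (f n)) N).
      { assert (E' : RtoC (rsum (fun N => Cmod (sparse (RtoC 0) p f N)) (S (p * N))) = rsum (fun n => Cmod (f n)) N).
        - rewrite <- !csum_RtoC. rewrite (csum_ext _ _ _ (fun n _ => Habs n)). now apply csum_sparse.
        - now injection E'. }
      rewrite E. apply rsum_le_Series; [intros; apply Cmod_ge_0|easy]. }
  assert (Hs : summable (sparse (RtoC 0) p f)) by (apply ex_series_bounded with (2 := Hb); intros; apply Cmod_ge_0).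
  repeat split; [easy| |].
  - apply is_clim_unique with (fun M => csum f M).
    + apply is_clim_ext with (fun M => csum (sparse (RtoC 0) p f) (S (p * M))); [intros; now apply csum_sparse|].
      apply is_clim_subseq with (phi := fun M => S (p * M)) (u := csum (sparse (RtoC 0) p f)); [|now apply Cser_lim].
      intros P [N HP]. exists N. intros m Hm. apply HP. nia.
    + now apply Cser_lim.
  - pose proof (is_lim_rsum _ Hs) as Hl.
    exact (is_lim_seq_le _ (fun _ => Series (fun n => Cmod (f n))) _ _ Hb Hl (is_lim_seq_const _)).
Qed.

(** Two exchanges of summation: first m with d, then, after each sum over m has been spread over the
    multiples of d, the divisor d with the exponent N. *)
Lemma Lambert (c : nat -> C) (q : C) : growth c -> (Cmod q < 1)%R ->
  let T := fun m d => c (S d) * Cpow q (S m * S d) in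
  (forall m, summable (T m)) /\ summable (fun m => Cser (T m)) /\ Cser (fun m => Cser (T m)) = Ps (lam c) q.
Proof.
  intros Hc Hq T. set (r := Cmod q) in *. assert (Hr : (0 <= r)%R) by apply Cmod_ge_0.
  assert (HcS : ex_series (fun d => Cmod (c (S d)) * r ^ S d)%R).
  { apply (ex_series_incr_1 (fun d => Cmod (c d) * r ^ d)%R). now apply growth_ex_series. }
  (* Since (m+1)(d+1) = m + (d+1) + md, dropping r^(md) <= 1 leaves a majorant that is a product of
     a function of m and a function of d. *)
  assert (HT : forall m d, (Cmod (T m d) <= r ^ m * (Cmod (c (S d)) * r ^ S d))%R).
  { intros m d. unfold T. rewrite Cmod_mult, Cmod_pow. fold r.
    replace (S m * S d)%nat with (m + S d + m * d)%nat by nia. rewrite !pow_add.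
    assert (Hp : (r ^ (m * d) <= 1)%R) by (rewrite <- (pow1 (m * d)); apply pow_incr; lra).
    assert (0 <= r ^ m)%R by now apply pow_le. assert (0 <= r ^ S d)%R by now apply pow_le.
    pose proof (Cmod_ge_0 (c (S d))) as Hc0.
    replace (Cmod (c (S d)) * (r ^ m * r ^ S d * r ^ (m * d)))%R with (r ^ m * (Cmod (c (S d)) * r ^ S d) * r ^ (m * d))%R by ring.
    rewrite <- (Rmult_1_r (r ^ m * (Cmod (c (S d)) * r ^ S d))) at 2.
    apply Rmult_le_compat_l; [|easy]. apply Rmult_le_pos; [easy|now apply Rmult_le_pos]. }
  assert (HTs : forall m, summable (T m)).
  { intros m. apply summable_le with (fun d => r ^ m * (Cmod (c (S d)) * r ^ S d))%R; [apply HT|].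
    now apply (ex_series_scal (V := R_NormedModule) (r ^ m)%R). }
  destruct (fubini T (fun m => r ^ m * Series (fun d => Cmod (c (S d)) * r ^ S d))%R HTs) as (Hcol & Hr1 & Hr2 & E1).
  { intros m. rewrite <- Series_scal_l. apply Series_le; [|now apply (ex_series_scal (V := R_NormedModule) (r ^ m)%R)].
    intros d. split; [apply Cmod_ge_0|apply HT]. }
  { apply ex_series_scal_r, ex_series_geom. now rewrite Rabs_pos_eq. }
  split; [easy|]. split; [easy|]. rewrite E1.
  set (a := fun d => sparse (RtoC 0) (S d) (fun m => T m d)).
  assert (Ha : forall d, summable (a d) /\ Cser (a d) = Cser (fun m => T m d) /\
    (Series (fun N => Cmod (a d N)) <= Series (fun m => Cmod (T m d)))%R).
  { intros d. apply Cser_sparse; [lia|apply Hcol]. }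
  destruct (fubini a (fun d => / (1 - r) * (Cmod (c (S d)) * r ^ S d))%R) as (_ & _ & _ & E2).
  - intros d. apply Ha.
  - intros d. eapply Rle_trans; [apply Ha|].
    apply Rle_trans with (Series (fun m => r ^ m * (Cmod (c (S d)) * r ^ S d)))%R.
    + apply Series_le; [intros m; split; [apply Cmod_ge_0|apply HT]|].
      apply ex_series_scal_r, ex_series_geom. now rewrite Rabs_pos_eq.
    + rewrite Series_scal_r, Series_geom by now rewrite Rabs_pos_eq. lra.
  - now apply (ex_series_scal (V := R_NormedModule) (/ (1 - r))%R).
  - transitivity (Cser (fun d => Cser (a d))); [apply Cser_ext; intros d; symmetry; apply Ha|].
    rewrite E2. apply Cser_ext. intros N. unfold lam. rewrite (Cser_finite _ N).
    + rewrite Cmult_comm, <- csum_scal. apply csum_ext. intros d Hd. unfold a, sparse, T.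
      destruct N as [|n]; [lia|]. destruct (Nat.eqb_spec (S n mod S d) 0) as [E|E]; [|ring].
      apply Nat.Div0.div_exact in E.
      assert (S n / S d <> 0)%nat by (intros E0; rewrite E0 in E; lia).
      replace (S (S n / S d - 1) * S d)%nat with (S n); [ring|].
      replace (S (S n / S d - 1)) with (S n / S d)%nat by lia. lia.
    + intros d Hd. unfold a, sparse. destruct N as [|n]; [easy|].
      destruct (Nat.eqb_spec (S n mod S d) 0) as [E|E]; [|easy].
      destruct (Nat.eq_dec d n) as [->|Hn]; [lia|]. rewrite Nat.mod_small in E by lia. easy.
Qed.

Lemma growth_INR_pow (k : nat) : growth (fun n => RtoC (INR n ^ k)).
Proof.
  apply growth_bounded with k 1%R. intros n. pose proof (pos_INR n).
  rewrite Cmod_RtoC_pos by now apply pow_le. rewrite Rmult_1_l. apply pow_incr. lra.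
Qed.

Lemma growth_1 : growth (fun _ => RtoC 1).
Proof. apply growth_bounded with 0%nat 1%R. intros n. rewrite Cmod_1. simpl. lra. Qed.

Lemma Ps_ext (a b : nat -> C) (q : C) : (forall n, a n = b n) -> Ps a q = Ps b q.
Proof. intros H. apply Cser_ext. intros n. now rewrite H. Qed.

Lemma one_minus_neq_0 (q : C) : (Cmod q < 1)%R -> 1 - q <> 0.
Proof.
  intros H E. assert (E' : q = 1) by (replace q with (1 - (1 - q)) by ring; rewrite E; ring).
  rewrite E', Cmod_1 in H. lra.
Qed.

Lemma Ps_geom (q : C) : (Cmod q < 1)%R -> Ps (fun _ => 1) q = / (1 - q).
Proof.
  intros Hq. pose proof (Ps_incr _ q growth_1 Hq) as E. cbv beta in E.
  pose proof (one_minus_neq_0 q Hq) as Hn.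
  transitivity ((Ps (fun _ => 1) q - q * Ps (fun _ => 1) q) / (1 - q)); [field; easy|].
  replace (Ps (fun _ => 1) q - q * Ps (fun _ => 1) q) with (RtoC 1) by (rewrite E at 1; ring). field. easy.
Qed.

Lemma Ps_id (q : C) : (Cmod q < 1)%R -> Ps (fun n => RtoC (INR n ^ 1)) q = q / ((1 - q) * (1 - q)).
Proof.
  intros Hq. pose proof (one_minus_neq_0 q Hq) as Hn.
  rewrite Ps_incr by (easy || apply growth_INR_pow).
  rewrite (Ps_ext _ (conv (fun _ => 1) (fun _ => 1))).
  - rewrite <- Ps_mult by (easy || apply growth_1). rewrite Ps_geom by easy. simpl.
    replace (RtoC (0 * 1)) with (RtoC 0) by (f_equal; ring). field. easy.
  - intros n. unfold conv. rewrite pow_1. induction n as [|n IH].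
    + simpl. ring.
    + change (csum ?f (S (S n))) with (csum f (S n) + 1 * 1). rewrite <- IH, (S_INR (S n)), RtoC_plus. ring.
Qed.

Lemma csum_i_Nmi (N : nat) : conv (fun n => RtoC (INR n ^ 1)) (fun n => RtoC (INR n ^ 1)) N = RtoC ((INR N ^ 3 - INR N) / 6).
Proof.
  unfold conv.
  rewrite (csum_ext _ (fun i => RtoC (INR i * INR N - INR i * INR i))).
  - rewrite csum_RtoC. f_equal.
    assert (H : forall M x, rsum (fun i => INR i * x - INR i * INR i)%R (S M)
              = (INR M * (INR M + 1) / 2 * x - INR M * (INR M + 1) * (2 * INR M + 1) / 6)%R).
    { induction M as [|M IH]; intros x; [simpl; field|].
      change (rsum ?f (S (S M))) with (rsum f (S M) + f (S M))%R. rewrite IH, S_INR. field. }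
    rewrite H. field.
  - intros i Hi. rewrite !pow_1, minus_INR by lia. rewrite <- RtoC_mult. f_equal. ring.
Qed.

(** The convolution of n with itself is (N^3 - N)/6, so cubes are six times the square of the series
    of n q^n plus that series. *)
Lemma Ps_cube (q : C) : (Cmod q < 1)%R ->
  Ps (fun n => RtoC (INR n ^ 3)) q = 6 * (q / ((1 - q) * (1 - q)) * (q / ((1 - q) * (1 - q)))) + q / ((1 - q) * (1 - q)).
Proof.
  intros Hq. rewrite <- Ps_id by easy.
  rewrite Ps_mult by (easy || apply growth_INR_pow).
  rewrite <- Ps_scal by (try easy; apply growth_conv; apply growth_INR_pow).
  rewrite <- Ps_plus; [|apply growth_scal, growth_conv; apply growth_INR_pow|apply growth_INR_pow|easy].
  apply Ps_ext. intros n. rewrite csum_i_Nmi, <- RtoC_mult, <- RtoC_plus. f_equal. field.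
Qed.

Definition S1 (t : C) : C := Fs (lam (fun n => RtoC (INR n ^ 1))) t.
Definition S3 (t : C) : C := Fs (lam (fun n => RtoC (INR n ^ 3))) t.

(** With F proportional to [csc2] or [csc4] this is the passage from lattice sums to q-expansions:
    the row of height m t has a closed form in q^m, and the rows together form a Lambert series. *)
Lemma Lambert_rows (k : nat) (t : C) (F : C -> C) : (0 < k)%nat -> (0 < Im t)%R ->
  (forall z, (0 < Im z)%R -> Ps (fun n => RtoC (INR n ^ k)) (qexp z) = F z) ->
  summable (fun m => F (INR (S m) * t)) /\
  Cser (fun m => F (INR (S m) * t)) = Fs (lam (fun n => RtoC (INR n ^ k))) t.
Proof.
  intros Hk Ht HF.
  destruct (Lambert (fun n => RtoC (INR n ^ k)) (qexp t)) as (H1 & H2 & H3);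
    [apply growth_INR_pow|now apply Cmod_qexp_lt_1|].
  assert (E : forall m, Cser (fun d => RtoC (INR (S d) ^ k) * Cpow (qexp t) (S m * S d)) = F (INR (S m) * t)).
  { intros m.
    assert (Hz : (0 < Im (INR (S m) * t))%R).
    { rewrite im_scal_l. apply Rmult_lt_0_compat; [apply lt_0_INR; lia|easy]. }
    rewrite <- HF by easy. unfold Ps. symmetry. rewrite Cser_incr_1.
    - replace (RtoC (INR 0 ^ k) * Cpow (qexp (INR (S m) * t)) 0) with (RtoC 0) by (simpl INR; rewrite pow_i by easy; ring).
      rewrite Cplus_0_l. apply Cser_ext. intros d.
      rewrite qexp_nat, <- Cpow_mult_r. easy.
    - apply growth_summable; [apply growth_INR_pow|now apply Cmod_qexp_lt_1]. }
  split.
  - now apply (summable_ext _ _ E).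
  - unfold Fs. rewrite <- H3. apply Cser_ext. intros m. now rewrite E.
Qed.

Lemma csc2_rows (t : C) : (0 < Im t)%R ->
  summable (fun m => csc2 (INR (S m) * t)) /\
  Cser (fun m => csc2 (INR (S m) * t)) = twopii * twopii * S1 t.
Proof.
  intros Ht. destruct (Lambert_rows 1 t W) as [H1 H2]; [lia|easy| |].
  - intros z Hz. apply Ps_id. now apply Cmod_qexp_lt_1.
  - split; [now apply summable_scal|]. unfold csc2. rewrite Cser_scal by easy. unfold S1. now rewrite H2.
Qed.

Lemma csc4_rows (t : C) : (0 < Im t)%R ->
  summable (fun m => csc4 (INR (S m) * t)) /\
  Cser (fun m => csc4 (INR (S m) * t)) = twopii * twopii * (twopii * twopii) / 6 * S3 t.
Proof.
  intros Ht. destruct (Lambert_rows 3 t (fun z => 6 * (W z * W z) + W z)) as [H1 H2]; [lia|easy| |].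
  - intros z Hz. apply Ps_cube. now apply Cmod_qexp_lt_1.
  - assert (E : forall z, csc4 z = twopii * twopii * (twopii * twopii) / 6 * (6 * (W z * W z) + W z)).
    { intros z. unfold csc4. field. }
    split.
    + apply summable_ext with (fun m => twopii * twopii * (twopii * twopii) / 6 *
        (6 * (W (INR (S m) * t) * W (INR (S m) * t)) + W (INR (S m) * t))); [intros m; now rewrite E|].
      now apply summable_scal.
    + rewrite (Cser_ext _ (fun m => twopii * twopii * (twopii * twopii) / 6 *
        (6 * (W (INR (S m) * t) * W (INR (S m) * t)) + W (INR (S m) * t)))) by (intros m; apply E).
      rewrite Cser_scal by easy. unfold S3. now rewrite H2.
Qed.

(** * The majorant 1/n^2 and the values zeta(2), zeta(4) *)

Definition i2 (n : nat) : R := (/ (INR (S n) * INR (S n)))%R.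

Lemma INR_S_pos (n : nat) : (1 <= INR (S n))%R.
Proof. apply (le_INR 1). lia. Qed.

Lemma i2_pos (n : nat) : (0 < i2 n)%R.
Proof. pose proof (INR_S_pos n). apply Rinv_0_lt_compat. nra. Qed.

Lemma ex_series_i2 : ex_series i2.
Proof.
  apply ex_series_bounded with 2%R; [intros; apply Rlt_le, i2_pos|].
  assert (H : forall N, (rsum i2 N <= 2 - 2 / INR (S N))%R).
  { induction N as [|N IH]; [simpl; lra|].
    change (rsum i2 (S N)) with (rsum i2 N + i2 N)%R.
    assert (i2 N <= 2 / INR (S N) - 2 / INR (S (S N)))%R; [|lra].
    unfold i2. rewrite (S_INR (S N)). pose proof (INR_S_pos N).
    set (x := INR (S N)) in *.
    replace (2 / x - 2 / (x + 1))%R with (/ (x * x) * (2 * x / (x + 1)))%R by (field; lra).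
    rewrite <- (Rmult_1_r (/ (x * x))) at 1. apply Rmult_le_compat_l; [apply Rlt_le, Rinv_0_lt_compat; nra|].
    apply Rle_div_r; lra. }
  intros N. specialize (H N). pose proof (INR_S_pos N).
  assert (0 < 2 / INR (S N))%R by (apply Rdiv_lt_0_compat; lra). lra.
Qed.

Lemma INR_S_neq_0 (n : nat) : RtoC (INR (S n)) <> 0.
Proof. apply RtoC_neq. pose proof (INR_S_pos n). lra. Qed.

Lemma Cmod_inv2_INR (n : nat) : Cmod (inv2 (INR (S n))) = i2 n.
Proof. rewrite Cmod_inv2 by apply INR_S_neq_0. rewrite Cmod_RtoC_pos by apply pos_INR. easy. Qed.

Lemma summable_inv2_INR : summable (fun n => inv2 (INR (S n))).
Proof. apply summable_le with i2; [intros n; rewrite Cmod_inv2_INR; lra|apply ex_series_i2]. Qed.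

Lemma i2_le_1 (n : nat) : (i2 n <= 1)%R.
Proof. unfold i2. rewrite <- Rinv_1. apply Rinv_le_contravar; [lra|]. pose proof (INR_S_pos n). nra. Qed.

Lemma summable_inv4_INR : summable (fun n => inv4 (INR (S n))).
Proof.
  apply summable_le with i2; [|apply ex_series_i2]. intros n. unfold inv4.
  rewrite Cmod_mult, Cmod_inv2_INR. pose proof (i2_le_1 n). pose proof (i2_pos n). nra.
Qed.

Lemma csum_even_odd (f : nat -> C) (N : nat) :
  csum f (2 * N) = csum (fun n => f (2 * n)%nat) N + csum (fun n => f (2 * n + 1)%nat) N.
Proof.
  induction N as [|N IH]; [simpl; ring|].
  replace (2 * S N)%nat with (S (S (2 * N))) by lia.
  change (csum f (S (S (2 * N)))) with (csum f (2 * N) + f (2 * N)%nat + f (S (2 * N))).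
  change (csum ?g (S N)) with (csum g N + g N). cbv beta.
  replace (S (2 * N)) with (2 * N + 1)%nat by lia. rewrite IH. ring.
Qed.

(** Because of the index shift, position 2n carries the odd integer 2n+1 and position 2n+1 the even
    integer 2(n+1). With c = 2^s the even part reproduces the whole series divided by c. *)
Lemma odd_even_series (f o : nat -> C) (c : C) : c <> 0 -> summable f -> summable o ->
  (forall n, f (2 * n)%nat = o n / c) -> (forall n, f (2 * n + 1)%nat = f n / c) ->
  c * Cser f = Cser o + Cser f.
Proof.
  intros Hc Hf Ho H1 H2.
  assert (E : Cser f = / c * (Cser o + Cser f)).
  { apply is_clim_unique with (fun N => csum f (2 * N)).
    - apply is_clim_subseq with (phi := fun N => (2 * N)%nat) (u := csum f); [|now apply Cser_lim].
      intros P [N HP]. exists N. intros m Hm. apply HP. lia.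
    - apply is_clim_ext with (fun N => / c * (csum o N + csum f N)).
      + intros N. rewrite csum_even_odd, Cmult_plus_distr_l, <- !csum_scal. f_equal; apply csum_ext; intros n _;
          rewrite ?H1, ?H2; unfold Cdiv; ring.
      + apply is_clim_scal, is_clim_plus; now apply Cser_lim. }
  rewrite E at 1. field. easy.
Qed.

Lemma qexp_half : qexp (/ 2) = - (1).
Proof.
  replace (/ 2) with ((0 + 1) / 2) by field. rewrite qexp_half_shift.
  replace (0 / 2) with (RtoC 0) by field. f_equal. exact (qexp_INR 0).
Qed.

Lemma qexp_half_neq_1 : qexp (/ 2) <> 1.
Proof. rewrite qexp_half. intros E. injection E as E. lra. Qed.

Lemma W_of_half : W (/ 2) = - / 4.
Proof. unfold W. rewrite qexp_half. field. Qed.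

(* At z = 1/2 the symmetric sum telescopes into twice the sum over odd half-integers. *)
Lemma half_series (G : C -> C) (S : C) : (forall x, G (- x) = G x) ->
  summable (fun n => G (/ 2 + INR n)) -> Cser (paired G (/ 2)) = S - G (/ 2) ->
  2 * Cser (fun n => G (/ 2 + INR n)) = S.
Proof.
  intros HG Hs E.
  assert (E2 : Cser (paired G (/ 2)) = 2 * Cser (fun n => G (/ 2 + INR n)) - G (/ 2)).
  { rewrite (Cser_ext _ (fun n => G (/ 2 + INR (Datatypes.S n)) + G (/ 2 + INR n))).
    - rewrite Cser_plus; [|now apply (summable_incr_1 (fun n => G (/ 2 + INR n)))|easy].
      rewrite (Cser_incr_1 (fun n => G (/ 2 + INR n))) by easy. simpl (INR 0).
      replace (/ 2 + 0) with (/ 2) by ring. ring.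
    - intros n. unfold paired. f_equal. rewrite <- HG. f_equal. rewrite S_INR, RtoC_plus. field. }
  rewrite E in E2. replace S with (S - G (/ 2) + G (/ 2)) by ring. rewrite E2. ring.
Qed.

Lemma inv2_opp (x : C) : inv2 (- x) = inv2 x.
Proof. unfold inv2. f_equal. ring. Qed.

Lemma half_INR_neq_0 (n : nat) : / 2 + INR n <> 0.
Proof.
  replace (/ 2 + INR n) with (RtoC (/ 2 + INR n)).
  - apply RtoC_neq. pose proof (pos_INR n). lra.
  - rewrite RtoC_plus, RtoC_inv; [easy|lra].
Qed.

Lemma inv2_half_bound (n : nat) : (Cmod (inv2 (/ 2 + INR n)) <= 4 * i2 n)%R.
Proof.
  rewrite Cmod_inv2 by apply half_INR_neq_0.
  replace (/ 2 + INR n) with (RtoC (/ 2 + INR n)) by (rewrite RtoC_plus, RtoC_inv; [easy|lra]).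
  pose proof (pos_INR n). rewrite Cmod_RtoC_pos by lra. unfold i2.
  replace (4 * / (INR (S n) * INR (S n)))%R with (/ (INR (S n) / 2 * (INR (S n) / 2)))%R by (field; pose proof (INR_S_pos n); lra).
  pose proof (INR_S_pos n). apply Rinv_le_contravar; [nra|]. rewrite S_INR. nra.
Qed.

Lemma summable_inv2_half : summable (fun n => inv2 (/ 2 + INR n)).
Proof.
  apply summable_le with (fun n => 4 * i2 n)%R; [apply inv2_half_bound|].
  apply (ex_series_scal (V := R_NormedModule) 4%R), ex_series_i2.
Qed.

Lemma summable_inv4_half : summable (fun n => inv4 (/ 2 + INR n)).
Proof.
  apply summable_le with (fun n => 16 * i2 n)%R;
    [|apply (ex_series_scal (V := R_NormedModule) 16%R), ex_series_i2].
  intros n. unfold inv4. rewrite Cmod_mult. pose proof (inv2_half_bound n). pose proof (i2_le_1 n).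
  pose proof (i2_pos n). pose proof (Cmod_ge_0 (inv2 (/ 2 + INR n))). nra.
Qed.

Lemma summable_paired_half (G : C -> C) : (forall x, G (- x) = G x) ->
  summable (fun n => G (/ 2 + INR n)) -> summable (paired G (/ 2)).
Proof.
  intros HG Hs. apply summable_ext with (fun n => G (/ 2 + INR (S n)) + G (/ 2 + INR n)).
  - intros n. unfold paired. f_equal. rewrite <- HG. f_equal. rewrite S_INR, RtoC_plus. field.
  - apply summable_plus; [now apply (summable_incr_1 (fun n => G (/ 2 + INR n)))|easy].
Qed.

Lemma INR_double (n : nat) : RtoC (INR (2 * n)) = 2 * INR n.
Proof. rewrite mult_INR, RtoC_mult. easy. Qed.

Lemma inv2_mult (x y : C) : x <> 0 -> y <> 0 -> inv2 (x * y) = inv2 x * inv2 y.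
Proof. intros Hx Hy. unfold inv2. field. split; easy. Qed.

Lemma INR_even_index (n : nat) : RtoC (INR (S (2 * n))) = 2 * (/ 2 + INR n).
Proof. rewrite S_INR, RtoC_plus, INR_double. field. Qed.

Lemma INR_odd_index (n : nat) : RtoC (INR (S (2 * n + 1))) = 2 * INR (S n).
Proof. rewrite !S_INR, plus_INR, !RtoC_plus, INR_double. simpl. field. Qed.

Lemma C2_neq_0 : RtoC 2 <> 0. Proof. apply RtoC_neq; lra. Qed.

Lemma twopii_sqr : twopii * twopii = - (4 * (RtoC PI * RtoC PI)).
Proof. unfold twopii. replace (2 * PI * Ci * (2 * PI * Ci)) with (4 * (PI * PI) * (Ci * Ci)) by ring. rewrite Ci_sqr. ring. Qed.

(** Twice the sum of (n + 1/2)^-2 is csc2 (1/2) = pi^2, and this half-integer sum is 4 - 1 = 3 times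
    the sum over the integers. [zeta4] follows the same route with 16 - 1. *)
Lemma zeta2 : Cser (fun n => inv2 (INR (S n))) = RtoC PI * RtoC PI / 6.
Proof.
  assert (H := half_series inv2 (csc2 (/ 2)) inv2_opp summable_inv2_half
    (csc2_series (/ 2) qexp_half_neq_1 (summable_paired_half inv2 inv2_opp summable_inv2_half))).
  assert (H2 : 4 * Cser (fun n => inv2 (INR (S n))) = Cser (fun n => inv2 (/ 2 + INR n)) + Cser (fun n => inv2 (INR (S n)))).
  { apply odd_even_series; [apply RtoC_neq; lra|apply summable_inv2_INR|apply summable_inv2_half| |].
    - intros n. rewrite INR_even_index, inv2_mult by (apply C2_neq_0 || apply half_INR_neq_0). unfold inv2 at 1. field.
    - intros n. rewrite INR_odd_index, inv2_mult by (apply C2_neq_0 || apply INR_S_neq_0). unfold inv2 at 1. field. }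
  set (Z := Cser (fun n => inv2 (INR (S n)))) in *. set (O := Cser (fun n => inv2 (/ 2 + INR n))) in *.
  replace Z with ((4 * Z - Z) / 3) by field. rewrite H2.
  replace (O + Z - Z) with (2 * O / 2) by field. rewrite H. unfold csc2. rewrite W_of_half, twopii_sqr. field.
Qed.

Lemma zeta4 : Cser (fun n => inv4 (INR (S n))) = RtoC PI * RtoC PI * (RtoC PI * RtoC PI) / 90.
Proof.
  assert (Hev : forall x, inv4 (- x) = inv4 x) by (intros x; unfold inv4; now rewrite inv2_opp).
  assert (Hd : forall k : Z, (/ 2 <= Cmod (/ 2 + IZR k))%R).
  { intros k. replace (/ 2 + IZR k) with (RtoC (/ 2 + IZR k)) by (rewrite RtoC_plus, RtoC_inv; [easy|lra]).
    rewrite Cmod_R. destruct (Z_le_dec 0 k) as [Hk|Hk].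
    - apply IZR_le in Hk. rewrite Rabs_pos_eq; lra.
    - assert (Hk' : (k <= -1)%Z) by lia. apply IZR_le in Hk'. rewrite Rabs_left; lra. }
  assert (H := half_series inv4 (csc4 (/ 2)) Hev summable_inv4_half
    (csc4_series (/ 2) (/ 2) ltac:(lra) Hd qexp_half_neq_1 (summable_paired_half inv4 Hev summable_inv4_half))).
  assert (H2 : 16 * Cser (fun n => inv4 (INR (S n))) = Cser (fun n => inv4 (/ 2 + INR n)) + Cser (fun n => inv4 (INR (S n)))).
  { apply odd_even_series; [apply RtoC_neq; lra|apply summable_inv4_INR|apply summable_inv4_half| |].
    - intros n. unfold inv4. rewrite INR_even_index, inv2_mult by (apply C2_neq_0 || apply half_INR_neq_0). unfold inv2 at 1 3. field.
    - intros n. unfold inv4. rewrite INR_odd_index, inv2_mult by (apply C2_neq_0 || apply INR_S_neq_0). unfold inv2 at 1 3. field. }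
  set (Z := Cser (fun n => inv4 (INR (S n)))) in *. set (O := Cser (fun n => inv4 (/ 2 + INR n))) in *.
  replace Z with ((16 * Z - Z) / 15) by field. rewrite H2.
  replace (O + Z - Z) with (2 * O / 2) by field. rewrite H. unfold csc4. rewrite W_of_half, twopii_sqr. field.
Qed.

(** * Transformation of E4 *)

Lemma lattice_bound (t : C) : (0 < Im t)%R -> exists d, (0 < d <= 1)%R /\ forall m n : R,
  (d * (m * m + n * n) <= Cmod (m * t + n)%C * Cmod (m * t + n)%C)%R.
Proof.
  intros Ht. destruct t as [x y]. unfold Im in Ht; simpl in Ht.
  (* From n^2 <= 2 (mx + n)^2 + 2 (mx)^2; the remaining m^2 (1 + 2x^2) is absorbed by m^2 y^2. *)
  set (K := (2 + (1 + 2 * (x * x)) / (y * y))%R).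
  assert (Hy : (0 < y * y)%R) by nra.
  assert (Hq : (0 < (1 + 2 * (x * x)) / (y * y))%R) by (apply Rdiv_lt_0_compat; nra).
  exists (/ K)%R. split.
  - split; [apply Rinv_0_lt_compat; unfold K; lra|].
    rewrite <- Rinv_1. apply Rinv_le_contravar; [lra|unfold K; lra].
  - intros m n. rewrite Cmod_sqr. unfold Re, Im; simpl.
    replace (m * x - 0 * y + n)%R with (m * x + n)%R by ring.
    replace (m * y + 0 * x + 0)%R with (m * y)%R by ring.
    apply Rmult_le_reg_l with K; [unfold K; lra|].
    rewrite <- Rmult_assoc, Rinv_r, Rmult_1_l by (unfold K; lra).
    assert (E : (K * (m * y * (m * y)) = 2 * (m * y * (m * y)) + m * m * (1 + 2 * (x * x)))%R).
    { unfold K. field. lra. }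
    rewrite Rmult_plus_distr_l, E.
    assert (2 * ((m * x + n) * (m * x + n)) <= K * ((m * x + n) * (m * x + n)))%R.
    { apply Rmult_le_compat_r; [apply Rle_0_sqr|unfold K; lra]. }
    assert (0 <= m * y * (m * y))%R by nra.
    assert (0 <= (m * x + n + m * x) * (m * x + n + m * x))%R by apply Rle_0_sqr. lra.
Qed.

Lemma Cmod_prod_ge (p q : C) (e : R) : (0 <= e)%R ->
  (e <= Cmod p * Cmod p)%R -> (e <= Cmod q * Cmod q)%R -> (e <= Cmod (p * q))%R.
Proof.
  intros He Hp Hq. rewrite Cmod_mult. pose proof (Cmod_ge_0 p). pose proof (Cmod_ge_0 q).
  apply Rsqr_incr_0; [|easy|nra]. unfold Rsqr.
  replace (Cmod p * Cmod q * (Cmod p * Cmod q))%R with (Cmod p * Cmod p * (Cmod q * Cmod q))%R by ring.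
  apply Rmult_le_compat; easy.
Qed.

Lemma Cinv_bound (p : C) (e : R) : (0 < e)%R -> (e <= Cmod p)%R -> (Cmod (/ p) <= / e)%R.
Proof.
  intros He Hp. rewrite Cmod_inv by (apply Cmod_neq; lra). now apply Rinv_le_contravar.
Qed.

Lemma fubini_product (u : nat -> nat -> C) (K : R) :
  (forall m n, (Cmod (u m n) <= K * (i2 m * i2 n))%R) ->
  (forall m, summable (u m)) /\ (forall n, summable (fun m => u m n)) /\
  summable (fun m => Cser (u m)) /\ summable (fun n => Cser (fun m => u m n)) /\
  Cser (fun m => Cser (u m)) = Cser (fun n => Cser (fun m => u m n)).
Proof.
  intros H.
  assert (Hs : forall m, ex_series (fun n => K * (i2 m * i2 n))%R).
  { intros m. apply (ex_series_scal (V := R_NormedModule) K), (ex_series_scal (V := R_NormedModule) (i2 m)), ex_series_i2. }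
  assert (Hu : forall m, summable (u m)) by (intros m; now apply summable_le with (fun n => K * (i2 m * i2 n))%R).
  destruct (fubini u (fun m => K * Series i2 * i2 m)%R Hu) as (H1 & H2 & H3 & H4).
  - intros m. apply Rle_trans with (Series (fun n => K * (i2 m * i2 n))%R).
    + apply Series_le; [|easy]. intros n. split; [apply Cmod_ge_0|easy].
    + rewrite !Series_scal_l. right. ring.
  - apply (ex_series_scal (V := R_NormedModule) (K * Series i2)%R), ex_series_i2.
  - repeat split; easy.
Qed.

(** Only the rows m >= 1 and the columns n <> 0 enter. The column n = 0 appears as the zeta term in
    [S1_lattice] and [S3_lattice], and the row m = 0 as the constant term of the Eisenstein
    series. *)
Definition lat (G : C -> C) (t : C) (m n : nat) : C := paired G (INR (S m) * t) n.

Lemma i2_prod (m n : nat) (d : R) : (0 < d)%R ->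
  (/ (d * (INR (S m) * INR (S n)) * (d * (INR (S m) * INR (S n)))) = / (d * d) * (i2 m * i2 n))%R.
Proof.
  intros Hd. unfold i2. pose proof (INR_S_pos m). pose proof (INR_S_pos n). field. lra.
Qed.

(** The first bound is AB <= A^2 + B^2/4. Asking only for |s| >= B/2 leaves room for the shifts by
    one half in [quart]. *)
Lemma lattice_term (t : C) (d : R) (m : nat) (s : R) : (0 < d)%R ->
  (forall m n : R, (d * (m * m + n * n) <= Cmod (m * t + n)%C * Cmod (m * t + n)%C)%R) ->
  forall n, (INR (S n) / 2 <= Rabs s)%R ->
  (d * (INR (S m) * INR (S n)) <= Cmod (INR (S m) * t + s) * Cmod (INR (S m) * t + s))%R /\
  (d / 4 * (INR (S n) * INR (S n)) <= Cmod (INR (S m) * t + s) * Cmod (INR (S m) * t + s))%R /\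
  (d * (INR (S m) * INR (S m)) <= Cmod (INR (S m) * t + s) * Cmod (INR (S m) * t + s))%R.
Proof.
  intros Hd Hb n Hs. specialize (Hb (INR (S m)) s). pose proof (INR_S_pos m). pose proof (INR_S_pos n).
  set (A := INR (S m)) in *. set (B := INR (S n)) in *.
  assert (H2 : (B * B / 4 <= s * s)%R).
  { rewrite <- (Rabs_pos_eq (s * s)), Rabs_mult by nra. pose proof (Rabs_pos s). nra. }
  assert (H3 : (A * B <= A * A + s * s)%R).
  { pose proof (Rle_0_sqr (A - B / 2)) as Hq. unfold Rsqr in Hq. lra. }
  repeat split; eapply Rle_trans; try exact Hb.
  - apply Rmult_le_compat_l; lra.
  - replace (d / 4 * (B * B))%R with (d * (B * B / 4))%R by field. apply Rmult_le_compat_l; nra.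
  - apply Rmult_le_compat_l; nra.
Qed.

Lemma Rabs_opp_INR (n : nat) : Rabs (- INR n) = INR n.
Proof. rewrite Rabs_Ropp. apply Rabs_pos_eq, pos_INR. Qed.

Lemma inv2_bounds (t : C) (d : R) (m n : nat) (s : R) : (0 < d)%R ->
  (forall m n : R, (d * (m * m + n * n) <= Cmod (m * t + n)%C * Cmod (m * t + n)%C)%R) ->
  (INR (S n) / 2 <= Rabs s)%R ->
  (Cmod (inv2 (INR (S m) * t + s)) <= / (d * (INR (S m) * INR (S n))))%R /\
  (Cmod (inv2 (INR (S m) * t + s)) <= 4 / d * i2 n)%R.
Proof.
  intros Hd Hb Hs. destruct (lattice_term t d m s Hd Hb n Hs) as (H1 & H2 & _).
  pose proof (INR_S_pos m). pose proof (INR_S_pos n). unfold inv2.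
  split.
  - apply Cinv_bound; [apply Rmult_lt_0_compat; nra|]. apply Cmod_prod_ge; [|easy|easy].
    apply Rmult_le_pos; nra.
  - replace (4 / d * i2 n)%R with (/ (d / 4 * (INR (S n) * INR (S n))))%R by (unfold i2; field; lra).
    apply Cinv_bound; [apply Rmult_lt_0_compat; nra|]. apply Cmod_prod_ge; [|easy|easy].
    apply Rmult_le_pos; nra.
Qed.

Lemma summable_lat2 (t : C) (m : nat) : (0 < Im t)%R -> summable (lat inv2 t m).
Proof.
  intros Ht. destruct (lattice_bound t Ht) as [d [[Hd _] Hb]].
  apply summable_le with (fun n => 8 / d * i2 n)%R; [|apply (ex_series_scal (V := R_NormedModule) (8 / d)%R), ex_series_i2].
  intros n. unfold lat, paired. pose proof (pos_INR (S n)).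
  assert (H1 := proj2 (inv2_bounds t d m n (INR (S n)) Hd Hb ltac:(rewrite Rabs_pos_eq; lra))).
  assert (H2 := proj2 (inv2_bounds t d m n (- INR (S n)) Hd Hb ltac:(rewrite Rabs_opp_INR; lra))).
  eapply Rle_trans; [apply Cmod_triangle|]. unfold Cminus. rewrite <- RtoC_opp.
  replace (8 / d * i2 n)%R with (4 / d * i2 n + 4 / d * i2 n)%R by (field; lra). lra.
Qed.

Lemma lat4_bound (t : C) : (0 < Im t)%R -> exists K, forall m n, (Cmod (lat inv4 t m n) <= K * (i2 m * i2 n))%R.
Proof.
  intros Ht. destruct (lattice_bound t Ht) as [d [[Hd _] Hb]].
  exists (2 * / (d * d))%R. intros m n. unfold lat, paired. pose proof (pos_INR (S n)).
  assert (H1 := proj1 (inv2_bounds t d m n (INR (S n)) Hd Hb ltac:(rewrite Rabs_pos_eq; lra))).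
  assert (H2 := proj1 (inv2_bounds t d m n (- INR (S n)) Hd Hb ltac:(rewrite Rabs_opp_INR; lra))).
  eapply Rle_trans; [apply Cmod_triangle|]. unfold Cminus. rewrite <- RtoC_opp.
  unfold inv4. rewrite !Cmod_mult, Rmult_assoc, <- i2_prod by easy.
  set (e := (d * (INR (S m) * INR (S n)))%R) in *. rewrite Rinv_mult.
  pose proof (Cmod_ge_0 (inv2 (INR (S m) * t + INR (S n)))).
  pose proof (Cmod_ge_0 (inv2 (INR (S m) * t + RtoC (- INR (S n))))). nra.
Qed.

Lemma Im_scal_pos (m : nat) (t : C) : (0 < Im t)%R -> (0 < Im (INR (S m) * t))%R.
Proof. intros Ht. rewrite im_scal_l. pose proof (INR_S_pos m). nra. Qed.

Lemma upper_qexp_neq_1 (z : C) : (0 < Im z)%R -> qexp z <> 1.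
Proof. intros Hz E. pose proof (Cmod_qexp_lt_1 z Hz) as H. rewrite E, Cmod_1 in H. lra. Qed.

Lemma upper_neq_0 (z : C) : (0 < Im z)%R -> z <> 0.
Proof. intros Hz E. rewrite E in Hz. unfold Im in Hz; simpl in Hz. lra. Qed.

Lemma Im_neg_inv (t : C) : (0 < Im t)%R -> (0 < Im (- / t))%R.
Proof.
  intros Ht. destruct t as [x y]. unfold Im in *; simpl in *.
  replace (- (- y / (x * (x * 1) + y * (y * 1))))%R with (y / (x * x + y * y))%R by (field; nra).
  apply Rdiv_lt_0_compat; nra.
Qed.

(** The substitution transposes the lattice, as m (-1/t) + n = (nt - m)/t. Pairing n with -n and the
    evenness of the summand keep both indices positive afterwards. *)
Lemma lat2_S (t : C) (m n : nat) : (0 < Im t)%R -> lat inv2 (- / t) m n = t * t * lat inv2 t n m.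
Proof.
  intros Ht. pose proof (upper_neq_0 t Ht) as Ht0. unfold lat, paired.
  assert (H : forall s : R, s <> 0%R -> inv2 (INR (S m) * - / t + s) = t * t * inv2 (s * t - INR (S m))).
  { intros s Hs. assert (Hn : s * t - INR (S m) <> 0).
    { intros E. assert (E' : Im (s * t - INR (S m)) = 0%R) by now rewrite E.
      unfold Cminus in E'. rewrite im_plus, im_scal_l in E'. unfold Im in *; simpl in *.
      assert (s * snd t = 0)%R by lra. apply Rmult_integral in H. lra. }
    unfold inv2. replace (INR (S m) * - / t + s) with ((s * t - INR (S m)) / t) by (field; easy). field. split; easy. }
  pose proof (INR_S_pos n).
  unfold Cminus at 1. rewrite <- RtoC_opp. rewrite !H by lra.
  rewrite RtoC_opp. rewrite <- (inv2_opp (- INR (S n) * t - INR (S m))).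
  replace (- (- INR (S n) * t - INR (S m))) with (INR (S n) * t + INR (S m)) by ring. ring.
Qed.

Lemma lat4_S (t : C) (m n : nat) : (0 < Im t)%R -> lat inv4 (- / t) m n = t * t * (t * t) * lat inv4 t n m.
Proof.
  intros Ht. pose proof (upper_neq_0 t Ht) as Ht0. unfold lat, paired.
  assert (H : forall s : R, s <> 0%R -> inv4 (INR (S m) * - / t + s) = t * t * (t * t) * inv4 (s * t - INR (S m))).
  { intros s Hs. assert (Hn : s * t - INR (S m) <> 0).
    { intros E. assert (E' : Im (s * t - INR (S m)) = 0%R) by now rewrite E.
      unfold Cminus in E'. rewrite im_plus, im_scal_l in E'. unfold Im in *; simpl in *.
      assert (s * snd t = 0)%R by lra. apply Rmult_integral in H. lra. }
    unfold inv4, inv2. replace (INR (S m) * - / t + s) with ((s * t - INR (S m)) / t) by (field; easy). field. split; easy. }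
  pose proof (INR_S_pos n).
  unfold Cminus at 1. rewrite <- RtoC_opp. rewrite !H by lra.
  rewrite RtoC_opp. unfold inv4 at 2. rewrite <- (inv2_opp (- INR (S n) * t - INR (S m))).
  replace (- (- INR (S n) * t - INR (S m))) with (INR (S n) * t + INR (S m)) by ring. unfold inv4. ring.
Qed.

Lemma S3_lattice (t : C) : (0 < Im t)%R ->
  twopii * twopii * (twopii * twopii) / 6 * S3 t
  = RtoC PI * RtoC PI * (RtoC PI * RtoC PI) / 90 * inv4 t + Cser (fun m => Cser (lat inv4 t m)).
Proof.
  intros Ht. destruct (csc4_rows t Ht) as [_ E]. rewrite <- E.
  destruct (lat4_bound t Ht) as [K HK]. destruct (fubini_product _ K HK) as (H1 & _ & H3 & _ & _).
  pose proof (upper_neq_0 t Ht) as Ht0.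
  assert (E4 : forall m, csc4 (INR (S m) * t) = inv4 t * inv4 (INR (S m)) + Cser (lat inv4 t m)).
  { intros m. pose proof (Im_scal_pos m t Ht) as Hz.
    change (lat inv4 t m) with (paired inv4 (INR (S m) * t)). rewrite (csc4_series (INR (S m) * t) (Rmin 1 (Im (INR (S m) * t)))).
    - unfold inv4. rewrite inv2_mult by (apply INR_S_neq_0 || easy). ring.
    - split; [apply Rmin_glb_lt; lra|apply Rmin_l].
    - intros k. eapply Rle_trans; [apply Rmin_r|]. eapply Rle_trans; [|apply im_le_Cmod].
      rewrite im_plus. simpl. rewrite Rplus_0_r. apply Rle_abs.
    - now apply upper_qexp_neq_1.
    - apply H1. }
  rewrite (Cser_ext _ _ E4), Cser_plus, Cser_scal, zeta4; [ring|apply summable_inv4_INR| |easy].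
  apply summable_scal, summable_inv4_INR.
Qed.

Lemma PI_C_neq_0 : RtoC PI <> 0.
Proof. apply RtoC_neq. pose proof PI_RGT_0. lra. Qed.

Lemma S3_S (t : C) : (0 < Im t)%R ->
  1 + 240 * S3 (- / t) = t * t * (t * t) * (1 + 240 * S3 t).
Proof.
  intros Ht. pose proof (upper_neq_0 t Ht) as Ht0. pose proof PI_C_neq_0 as Hpi.
  pose proof (S3_lattice t Ht) as E1. pose proof (S3_lattice (- / t) (Im_neg_inv t Ht)) as E2.
  destruct (lat4_bound t Ht) as [K HK]. destruct (fubini_product _ K HK) as (_ & H2 & _ & H4 & H5).
  rewrite (Cser_ext (fun m => Cser (lat inv4 (- / t) m)) (fun m => t * t * (t * t) * Cser (fun n => lat inv4 t n m))) in E2.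
  2: { intros m. rewrite <- Cser_scal by apply H2. apply Cser_ext. intros n. now apply lat4_S. }
  rewrite Cser_scal, <- H5 in E2 by easy.
  replace (inv4 (- / t)) with (t * t * (t * t)) in E2 by (unfold inv4, inv2; field; easy).
  unfold inv4, inv2 in E1.
  set (k4 := RtoC PI * RtoC PI * (RtoC PI * RtoC PI)) in *.
  replace (twopii * twopii * (twopii * twopii)) with (16 * k4) in * by (rewrite twopii_sqr; unfold k4; ring).
  set (B := Cser _) in *.
  assert (Hk : k4 <> 0) by (unfold k4; repeat apply Cmult_neq_0; easy).
  assert (E3 : S3 (- / t) = 6 / (16 * k4) * (k4 / 90 * (t * t * (t * t)) + t * t * (t * t) * B)).
  { rewrite <- E2. field. easy. }
  replace B with (16 * k4 / 6 * S3 t - k4 / 90 * (/ (t * t) * / (t * t))) in E3 by (rewrite E1; ring).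
  rewrite E3. field. split; easy.
Qed.

(** * Transformation of E2 *)

(* On the line Re v = 1/2 the partial sums of the cotangent series are Riemann sums of an arctangent integral. *)
Definition arc_dens (y s : R) : R := (y / (y * y + s * s))%R.

Lemma arc_dens_decr (y a b : R) : (0 < y)%R -> (0 <= a <= b)%R -> (arc_dens y b <= arc_dens y a)%R.
Proof.
  intros Hy Hab. unfold arc_dens. apply Rmult_le_compat_l; [lra|]. apply Rinv_le_contravar; nra.
Qed.

Lemma atan_increment (y : R) (j : nat) : (0 < y)%R ->
  (arc_dens y (INR (S j)) <= atan (INR (S j) / y) - atan (INR j / y) <= arc_dens y (INR j))%R.
Proof.
  intros Hy. pose proof (pos_INR j) as Hj.
  destruct (MVT_gen (fun s => atan (s / y)) (INR j) (INR (S j)) (fun s => arc_dens y s)) as [c [Hc E]].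
  - intros x _. unfold arc_dens. auto_derive; [easy|]. field. split; [nra|lra].
  - intros x _. apply continuity_pt_filterlim, (ex_derive_continuous (fun s => atan (s / y))).
    auto_derive. easy.
  - rewrite E, S_INR in *. rewrite Rmin_left, Rmax_right in Hc by lra.
    replace (INR j + 1 - INR j)%R with 1%R by ring. rewrite Rmult_1_r.
    split; apply arc_dens_decr; lra.
Qed.

(** For a decreasing density any Riemann sum of mesh 1 differs from the integral by at most the
    value at 0, here 1/y, wherever the sample points lie. Induction works on the sharper bound that
    subtracts the density at M. *)
Lemma arc_sum (y : R) (s : nat -> R) (M : nat) : (0 < y)%R ->
  (forall j, (INR j <= s j <= INR (S j))%R) ->
  (Rabs (rsum (fun j => arc_dens y (s j)) M - atan (INR M / y)) <= / y)%R.
Proof.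
  intros Hy Hs.
  assert (H : (Rabs (rsum (fun j => arc_dens y (s j)) M - atan (INR M / y)) <= arc_dens y 0 - arc_dens y (INR M))%R).
  { induction M as [|M IH].
    - simpl. unfold Rdiv. rewrite Rmult_0_l, atan_0, Rminus_0_r, Rabs_R0. lra.
    - change (rsum ?f (S M)) with (rsum f M + f M)%R. cbv beta.
      destruct (atan_increment y M Hy) as [H1 H2]. destruct (Hs M) as [H3 H4]. pose proof (pos_INR M).
      pose proof (arc_dens_decr y (INR M) (s M) Hy ltac:(lra)).
      pose proof (arc_dens_decr y (s M) (INR (S M)) Hy ltac:(lra)).
      apply Rabs_le_between in IH. apply Rabs_le_between. lra. }
  eapply Rle_trans; [exact H|].
  assert (0 <= arc_dens y (INR M))%R.
  { unfold arc_dens. pose proof (pos_INR M). apply Rlt_le, Rdiv_lt_0_compat; nra. }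
  replace (/ y)%R with (arc_dens y 0) by (unfold arc_dens; field; lra). lra.
Qed.

(** Partial sums of pi cot (pi v) with the poles -i and i+1 paired, hence symmetric about Re v =
    1/2; on that line each pair is -2i times a value of [arc_dens]. *)
Definition Tsum (v : C) (M : nat) : C := csum (fun i => / (v + INR i) + / (v - INR (S i))) M.

Lemma Tsum_center (y : R) (M : nat) : (0 < y)%R ->
  Tsum (RtoC (/ 2) + RtoC y * Ci) M = - (2 * Ci) * rsum (fun j => arc_dens y (INR j + / 2)) M.
Proof.
  intros Hy. unfold Tsum. rewrite <- csum_RtoC, <- csum_scal. apply csum_ext. intros j _.
  unfold arc_dens. pose proof (pos_INR j).
  set (s := (INR j + / 2)%R).
  replace (RtoC (/ 2) + y * Ci + INR j) with (RtoC s + y * Ci) by (unfold s; rewrite RtoC_plus; ring).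
  replace (RtoC (/ 2) + y * Ci - INR (S j)) with (- RtoC s + y * Ci)
    by (unfold s; rewrite S_INR, !RtoC_plus, RtoC_inv by lra; field).
  assert (Hs : (y * y + s * s <> 0)%R) by (unfold s; nra).
  rewrite RtoC_div by easy.
  assert (H1 : RtoC s + y * Ci <> 0).
  { intros E. apply (f_equal Im) in E. unfold Im in E; simpl in E. lra. }
  assert (H2 : - RtoC s + y * Ci <> 0).
  { intros E. apply (f_equal Im) in E. unfold Im in E; simpl in E. lra. }
  assert (E : RtoC (y * y + s * s) = - ((RtoC s + y * Ci) * (- RtoC s + y * Ci))).
  { rewrite RtoC_plus, !RtoC_mult.
    transitivity (s * s - y * y * (Ci * Ci)); [rewrite Ci_sqr; ring|ring]. }
  rewrite E. field. repeat split; try easy.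
Qed.

Lemma Cmod_of_parts (p : C) (y i : R) : (0 < y)%R -> (0 <= i)%R ->
  (y * y <= Im p * Im p)%R -> (i * i <= Re p * Re p)%R -> (y * y + i * i <= Cmod p * Cmod p)%R.
Proof. intros. rewrite Cmod_sqr. lra. Qed.

Lemma inv_diff_bound (p p' : C) (y i : R) : (0 < y)%R -> (0 <= i)%R ->
  Im p = y -> Im p' = y -> (i * i <= Re p * Re p)%R -> (i * i <= Re p' * Re p')%R ->
  (Cmod (/ p - / p') <= Cmod (p' - p) * / (y * y + i * i))%R.
Proof.
  intros Hy Hi E E' H H'.
  assert (Hp : (y * y + i * i <= Cmod (p * p'))%R).
  { apply Cmod_prod_ge; [nra| |]; apply Cmod_of_parts; try easy; rewrite ?E, ?E'; lra. }
  assert (H0 : (0 < y * y + i * i)%R) by nra.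
  assert (Hn : p <> 0) by (intros Z; rewrite Z in E; unfold Im in E; simpl in E; lra).
  assert (Hn' : p' <> 0) by (intros Z; rewrite Z in E'; unfold Im in E'; simpl in E'; lra).
  replace (/ p - / p') with ((p' - p) * / (p * p')) by (field; easy).
  rewrite Cmod_mult. apply Rmult_le_compat_l; [apply Cmod_ge_0|]. now apply Cinv_bound.
Qed.

Lemma Tsum_compare (x y : R) (M : nat) : (0 < y)%R -> (0 <= x <= 1)%R ->
  (Cmod (Tsum (RtoC x + RtoC y * Ci) M - Tsum (RtoC (/ 2) + RtoC y * Ci) M) <= / y * rsum (fun j => arc_dens y (INR j)) M)%R.
Proof.
  intros Hy Hx. set (v := RtoC x + y * Ci). set (v' := RtoC (/ 2) + y * Ci).
  assert (Hd : (Cmod (v' - v) <= / 2)%R).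
  { replace (v' - v) with (RtoC (/ 2 - x)) by (unfold v, v'; rewrite RtoC_minus; ring).
    rewrite Cmod_R. apply Rabs_le. lra. }
  replace (Tsum v M - Tsum v' M) with
    (csum (fun i => (/ (v + INR i) + / (v - INR (S i))) + (-1) * (/ (v' + INR i) + / (v' - INR (S i)))) M)
    by (rewrite csum_plus, csum_scal; unfold Tsum; ring).
  eapply Rle_trans; [apply Cmod_csum|]. rewrite <- rsum_scal. apply rsum_le. intros j _.
  pose proof (pos_INR j) as Hj.
  replace (/ (v + INR j) + / (v - INR (S j)) + (-1) * (/ (v' + INR j) + / (v' - INR (S j))))
    with ((/ (v + INR j) - / (v' + INR j)) + (/ (v - INR (S j)) - / (v' - INR (S j)))) by ring.
  eapply Rle_trans; [apply Cmod_triangle|].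
  pose proof (S_INR j) as HS.
  assert (B1 := inv_diff_bound (v + INR j) (v' + INR j) y (INR j) Hy Hj).
  assert (B2 := inv_diff_bound (v - INR (S j)) (v' - INR (S j)) y (INR j) Hy Hj).
  replace (v' + INR j - (v + INR j)) with (v' - v) in B1 by ring.
  replace (v' - INR (S j) - (v - INR (S j))) with (v' - v) in B2 by ring.
  assert (E : (/ y * arc_dens y (INR j) = / (y * y + INR j * INR j))%R) by (unfold arc_dens; field; split; [nra|lra]).
  rewrite E.
  assert (Hpos : (0 < / (y * y + INR j * INR j))%R) by (apply Rinv_0_lt_compat; nra).
  assert (C1 : (Cmod (/ (v + INR j) - / (v' + INR j)) <= Cmod (v' - v) * / (y * y + INR j * INR j))%R).
  { apply B1; unfold v, v', Re, Im; simpl; try ring; nra. }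
  assert (C2 : (Cmod (/ (v - INR (S j)) - / (v' - INR (S j))) <= Cmod (v' - v) * / (y * y + INR j * INR j))%R).
  { apply B2; unfold v, v', Re, Im; rewrite HS; simpl; try ring; nra. }
  nra.
Qed.

Lemma Tsum_bound (x y : R) (M : nat) : (1 <= y)%R -> (0 <= x <= 1)%R ->
  (Cmod (Tsum (RtoC x + RtoC y * Ci) M + 2 * Ci * atan (INR M / y)) <= 6 / y)%R.
Proof.
  intros Hy Hx.
  assert (H1 := arc_sum y (fun j => INR j + / 2)%R M ltac:(lra) ltac:(intros j; rewrite S_INR; lra)).
  assert (H2 := arc_sum y (fun j => INR j) M ltac:(lra) ltac:(intros j; rewrite S_INR; lra)).
  pose proof (Tsum_compare x y M ltac:(lra) Hx) as H3.
  rewrite (Tsum_center y M) in H3 by lra.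
  set (A := Tsum _ M) in *. set (r1 := rsum _ M) in H1. fold r1 in H3. set (r2 := rsum _ M) in H2. fold r2 in H3.
  assert (Hy' : (0 < / y)%R) by (apply Rinv_0_lt_compat; lra).
  assert (Hy1 : (/ y <= 1)%R) by (rewrite <- Rinv_1; apply Rinv_le_contravar; lra).
  pose proof (atan_bound (INR M / y)) as Hat. pose proof PI_4 as Hpi.
  replace (A + 2 * Ci * atan (INR M / y)) with
    ((A - - (2 * Ci) * r1) - 2 * Ci * RtoC (r1 - atan (INR M / y))) by (rewrite RtoC_minus; ring).
  eapply Rle_trans; [apply Cmod_triangle_minus|].
  rewrite !Cmod_mult, Cmod_Ci, (Cmod_RtoC_pos 2), Cmod_R by lra.
  apply Rabs_le_between in H2.
  (* From r2 <= 1/y + atan with y >= 1, where the arctangent is below pi/2 <= 2. *)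
  assert (Hr2 : (r2 <= 3)%R) by lra.
  assert (/ y * r2 <= / y * 3)%R by (apply Rmult_le_compat_l; lra).
  unfold Rdiv. lra.
Qed.

Lemma is_clim_inv_nat (v : C) : is_clim (fun n => / (v + INR n)) 0.
Proof.
  apply is_clim_eps. intros eps He.
  destruct (nfloor_ex (Rmax (2 / eps + Cmod v + 1) 0)) as [N HN]; [apply Rmax_r|].
  exists (S N). intros n Hn. pose proof (Rmax_l (2 / eps + Cmod v + 1) 0) as Hm.
  assert (Hn' : (2 / eps + Cmod v + 1 <= INR n)%R).
  { apply le_INR in Hn. rewrite S_INR in Hn. lra. }
  assert (Hp : (2 / eps <= Cmod (v + INR n))%R).
  { pose proof (Cmod_triangle_rev (INR n) v) as H. rewrite Cplus_comm, Cmod_RtoC_pos in H by apply pos_INR. lra. }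
  assert (H2 : (0 < 2 / eps)%R) by (apply Rdiv_lt_0_compat; lra).
  replace (/ (v + INR n) - 0) with (/ (v + INR n)) by ring.
  eapply Rle_lt_trans; [apply (Cinv_bound _ _ H2 Hp)|].
  replace (/ (2 / eps))%R with (eps / 2)%R by (field; lra). lra.
Qed.

Lemma is_clim_inv_nat_minus (v : C) : is_clim (fun n => / (v - INR n)) 0.
Proof.
  apply is_clim_ext with (fun n => (-1) * / (- v + INR n)).
  - intros n. destruct (Ceq_dec (v - INR n) 0) as [E|E].
    + replace (- v + INR n) with (- (v - INR n)) by ring. rewrite E. replace (- 0) with (RtoC 0) by ring.
      unfold Cinv; simpl. apply injective_projections; simpl; unfold Rdiv; ring.
    + field. split; [easy|]. intros E'. apply E. replace (v - INR n) with (- (- v + INR n)) by ring. rewrite E'. ring.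
  - replace (RtoC 0) with ((-1) * 0) by ring. apply is_clim_scal, is_clim_inv_nat.
Qed.

(** Shifting v by 1 changes a partial sum only by terms at the two ends, which tend to 0. The limit
    is thus periodic and Re v may be taken in [0,1]. *)
Lemma Tsum_shift (v L : C) : is_clim (Tsum (v + 1)) L <-> is_clim (Tsum v) L.
Proof.
  assert (E : forall M, Tsum (v + 1) M = Tsum v M + (/ (v + INR M) - / (v - INR M))).
  { intros M. induction M as [|M IH].
    - unfold Tsum; simpl. replace (v + 0) with v by ring. replace (v - 0) with v by ring. ring.
    - change (Tsum (v + 1) (S M)) with (Tsum (v + 1) M + (/ (v + 1 + INR M) + / (v + 1 - INR (S M)))).
      change (Tsum v (S M)) with (Tsum v M + (/ (v + INR M) + / (v - INR (S M)))).
      rewrite IH. replace (v + 1 + INR M) with (v + INR (S M)) by (rewrite S_INR, RtoC_plus; ring).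
      replace (v + 1 - INR (S M)) with (v - INR M) by (rewrite S_INR, RtoC_plus; ring). ring. }
  assert (H0 : is_clim (fun M => / (v + INR M) - / (v - INR M)) 0).
  { replace (RtoC 0) with (RtoC 0 - 0) by ring. apply is_clim_minus; [apply is_clim_inv_nat|apply is_clim_inv_nat_minus]. }
  split; intros H.
  - apply is_clim_ext with (fun M => Tsum (v + 1) M - (/ (v + INR M) - / (v - INR M))); [intros M; rewrite E; ring|].
    replace L with (L - 0) by ring. now apply is_clim_minus.
  - apply is_clim_ext with (fun M => Tsum v M + (/ (v + INR M) - / (v - INR M))); [intros M; now rewrite E|].
    replace L with (L + 0) by ring. now apply is_clim_plus.
Qed.

Lemma Tsum_shift_nat (v L : C) (n : nat) : is_clim (Tsum (v + INR n)) L <-> is_clim (Tsum v) L.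
Proof.
  induction n as [|n IH].
  - simpl. now replace (v + 0) with v by ring.
  - rewrite <- IH, <- (Tsum_shift (v + INR n)).
    now replace (v + INR (S n)) with (v + INR n + 1) by (rewrite S_INR, RtoC_plus; ring).
Qed.

Lemma Tsum_reduce (v L : C) : is_clim (Tsum v) L ->
  exists x, (0 <= x <= 1)%R /\ is_clim (Tsum (RtoC x + RtoC (Im v) * Ci)) L.
Proof.
  intros H. destruct v as [x y].
  assert (Hv : forall u w, (u, w) = RtoC u + RtoC w * Ci) by (intros; apply injective_projections; simpl; ring).
  pose proof (archimed x) as Ha.
  set (k := (up x - 1)%Z). assert (Hk : (0 <= x - IZR k <= 1)%R) by (unfold k; rewrite minus_IZR; lra).
  exists (x - IZR k)%R. split; [easy|]. simpl Im.
  destruct (Z_le_dec 0 k) as [Hz|Hz].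
  - apply (proj1 (Tsum_shift_nat (RtoC (x - IZR k) + RtoC y * Ci) L (Z.to_nat k))). rewrite INR_IZR_INZ, Z2Nat.id by easy.
    replace (RtoC (x - IZR k) + y * Ci + IZR k) with ((x, y) : C); [exact H|]. rewrite Hv, RtoC_minus. ring.
  - apply (proj2 (Tsum_shift_nat (x, y) L (Z.to_nat (- k)))) in H. rewrite INR_IZR_INZ, Z2Nat.id, opp_IZR, RtoC_opp in H by lia.
    replace (RtoC (x - IZR k) + y * Ci) with ((x, y) + - IZR k); [exact H|]. rewrite Hv, RtoC_minus. ring.
Qed.

Lemma atan_lim (y : R) : (0 < y)%R -> is_lim_seq (fun M => atan (INR M / y)) (PI / 2)%R.
Proof.
  intros Hy. apply is_lim_seq_spec. intros eps.
  set (d := Rmin eps (PI / 4)). pose proof PI_RGT_0.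
  assert (Hd : (0 < d)%R) by (apply Rmin_glb_lt; [apply cond_pos|lra]).
  assert (Hd2 : (d <= PI / 4)%R) by apply Rmin_r. assert (Hd3 : (d <= eps)%R) by apply Rmin_l.
  destruct (nfloor_ex (Rmax (y * tan (PI / 2 - d)) 0)) as [N HN]; [apply Rmax_r|].
  exists (S N). intros n Hn.
  assert (Hn' : (tan (PI / 2 - d) < INR n / y)%R).
  { apply (proj1 (Rlt_div_r _ _ _ Hy)). apply le_INR in Hn. rewrite S_INR in Hn.
    pose proof (Rmax_l (y * tan (PI / 2 - d)) 0). lra. }
  apply atan_increasing in Hn'. rewrite atan_tan in Hn' by lra.
  pose proof (atan_bound (INR n / y)). rewrite Rabs_left; lra.
Qed.

Lemma Tsum_limit (v L : C) : (1 <= Im v)%R -> is_clim (Tsum v) L -> (Cmod (L + Ci * PI) <= 6 / Im v)%R.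
Proof.
  intros Hv H. destruct (Tsum_reduce v L H) as [x [Hx Hl]].
  apply is_clim_Cmod_le with (fun M => Tsum (RtoC x + Im v * Ci) M + 2 * Ci * atan (INR M / Im v)).
  - intros M. now apply Tsum_bound.
  - apply is_clim_plus; [easy|].
    replace (Ci * PI) with (2 * Ci * RtoC (PI / 2)) by (rewrite RtoC_div by lra; field).
    apply is_clim_scal. apply is_clim_Re_Im; simpl; [apply atan_lim; lra|apply is_lim_seq_const].
Qed.

Lemma Tsum_paired (v : C) (M : nat) :
  Tsum v (S M) = / v + csum (paired Cinv v) M + / (v - INR (S M)).
Proof.
  induction M as [|M IH].
  - unfold Tsum; simpl. replace (v + 0) with v by ring. ring.
  - change (Tsum v (S (S M))) with (Tsum v (S M) + (/ (v + INR (S M)) + / (v - INR (S (S M))))).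
    rewrite IH. change (csum (paired Cinv v) (S M)) with (csum (paired Cinv v) M + (/ (v + INR (S M)) + / (v - INR (S M)))).
    ring.
Qed.

(** The limit -i pi of pi cot (pi v) for large Im v is the origin of the inhomogeneous term 12 t/(2
    pi i) in the transformation of E2. *)
Lemma cot_limit (v : C) : (1 <= Im v)%R -> summable (paired Cinv v) ->
  (Cmod (/ v + Cser (paired Cinv v) + Ci * PI) <= 6 / Im v)%R.
Proof.
  intros Hv Hs. apply Tsum_limit; [easy|]. apply is_clim_incr_1.
  apply is_clim_ext with (fun M => / v + csum (paired Cinv v) M + / (v - INR (S M))).
  - intros M. now rewrite Tsum_paired.
  - replace (/ v + Cser (paired Cinv v)) with (/ v + Cser (paired Cinv v) + 0) by ring.
    apply is_clim_plus; [apply is_clim_plus; [apply is_clim_const|now apply Cser_lim]|].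
    apply (is_clim_incr_1 (fun M => / (v - INR M))), is_clim_inv_nat_minus.
Qed.

(** * A telescoping comparison sum for E2 *)

Definition phi (t : C) (m : nat) (x : R) : C := / (INR (S m) * t - x) - / (INR (S m) * t + x).

(* The difference of phi at consecutive half-integers: it telescopes in n and agrees with
   the non-summable lattice term up to O(1/(m n)^2). *)
Definition tele (t : C) (m n : nat) : C :=
  phi t m (INR (S n) + / 2) - phi t m (INR n + / 2).

Lemma lattice_neq_0 (t : C) (m : nat) (s : R) : (0 < Im t)%R -> INR (S m) * t + s <> 0.
Proof.
  intros Ht E. apply (f_equal Im) in E. rewrite im_plus, im_scal_l in E.
  unfold Im in *; simpl in *. pose proof (INR_S_pos m) as H. simpl in H. nra.
Qed.

Lemma lattice_neq_0' (t : C) (m : nat) (s : R) : (0 < Im t)%R -> INR (S m) * t - s <> 0.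
Proof. intros Ht. unfold Cminus. rewrite <- RtoC_opp. now apply lattice_neq_0. Qed.

(** This is 1/(a^2 - 1/4) = 1/(a - 1/2) - 1/(a + 1/2), the substitute for 1/a^2 that telescopes over
    integer translates of a. *)
Definition quart (a : C) : C := / ((a + RtoC (/ 2)) * (a + RtoC (- / 2))).

Lemma tele_eq (t : C) (m n : nat) : (0 < Im t)%R ->
  tele t m n = quart (INR (S m) * t + INR (S n)) + quart (INR (S m) * t + RtoC (- INR (S n))).
Proof.
  intros Ht. unfold tele, phi, quart.
  assert (H := lattice_neq_0 t m). assert (H' := lattice_neq_0' t m).
  set (a := INR (S m) * t) in *.
  pose proof (H (INR (S n) + / 2)%R Ht) as A1. pose proof (H' (INR (S n) + / 2)%R Ht) as A2.
  pose proof (H (INR n + / 2)%R Ht) as A3. pose proof (H' (INR n + / 2)%R Ht) as A4.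
  rewrite S_INR, ?RtoC_plus, ?RtoC_opp, ?RtoC_plus in *. set (N := RtoC (INR n)) in *. set (h := RtoC (/ 2)) in *.
  assert (Eh : RtoC 1 = h + h) by (unfold h; rewrite <- RtoC_plus; f_equal; field).
  rewrite Eh in *.
  replace (a + (N + (h + h)) + h) with (a + (N + (h + h) + h)) by ring.
  replace (a + (N + (h + h)) + - h) with (a + (N + h)) by ring.
  replace (a + - (N + (h + h)) + h) with (a - (N + h)) by ring.
  replace (a + - (N + (h + h)) + - h) with (a - (N + (h + h) + h)) by ring.
  set (P1 := a + (N + (h + h) + h)) in *. set (P2 := a + (N + h)) in *.
  set (P3 := a - (N + h)) in *. set (P4 := a - (N + (h + h) + h)) in *.
  assert (D1 : P1 - P2 = 1) by (unfold P1, P2; rewrite Eh; ring).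
  assert (D2 : P3 - P4 = 1) by (unfold P3, P4; rewrite Eh; ring).
  transitivity ((P3 - P4) / (P3 * P4) + (P1 - P2) / (P1 * P2)); [field; repeat split; easy|].
  rewrite D1, D2. field. repeat split; easy.
Qed.

Lemma quart_bounds (t : C) (d : R) (m n : nat) (s : R) : (0 < d)%R ->
  (forall m n : R, (d * (m * m + n * n) <= Cmod (m * t + n)%C * Cmod (m * t + n)%C)%R) ->
  (INR (S n) <= Rabs s)%R ->
  (d * (INR (S m) * INR (S n)) <= Cmod ((INR (S m) * t + s + RtoC (/ 2)) * (INR (S m) * t + s + RtoC (- / 2))))%R /\
  (Cmod (quart (INR (S m) * t + s)) <= 4 / d * i2 n)%R /\
  (Cmod (quart (INR (S m) * t + s)) <= 4 / d * i2 m)%R.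
Proof.
  intros Hd Hb Hs. pose proof (INR_S_pos m). pose proof (INR_S_pos n).
  assert (A : forall e : R, (Rabs e <= / 2)%R -> (INR (S n) / 2 <= Rabs (s + e))%R).
  { intros e He. pose proof (Rabs_triang (s + e) (- e)) as T. rewrite Rabs_Ropp in T.
    replace (s + e + - e)%R with s in T by ring. lra. }
  destruct (lattice_term t d m (s + / 2) Hd Hb n) as (H1 & H2 & H3); [apply A; rewrite Rabs_pos_eq; lra|].
  destruct (lattice_term t d m (s + - / 2) Hd Hb n) as (H4 & H5 & H6); [apply A; rewrite Rabs_Ropp, Rabs_pos_eq; lra|].
  rewrite !RtoC_plus, !Cplus_assoc in *.
  split; [|split].
  - apply Cmod_prod_ge; [|easy|easy]. apply Rmult_le_pos; nra.
  - replace (4 / d * i2 n)%R with (/ (d / 4 * (INR (S n) * INR (S n))))%R by (unfold i2; field; lra).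
    apply Cinv_bound; [apply Rmult_lt_0_compat; nra|]. apply Cmod_prod_ge; [|easy|easy].
    apply Rmult_le_pos; nra.
  - apply Rle_trans with (/ (d * (INR (S m) * INR (S m))))%R.
    + apply Cinv_bound; [apply Rmult_lt_0_compat; nra|]. apply Cmod_prod_ge; [|easy|easy].
      apply Rmult_le_pos; nra.
    + replace (4 / d * i2 m)%R with (/ (d / 4 * (INR (S m) * INR (S m))))%R by (unfold i2; field; lra).
      apply Rinv_le_contravar; [apply Rmult_lt_0_compat; nra|]. nra.
Qed.

(** The difference 1/a^2 - 1/(a^2 - 1/4) = -1/(4 a^2 (a^2 - 1/4)) has order four. It is absolutely
    summable over the lattice, so only the telescoping part is sensitive to the order of
    summation. *)
Lemma defect_bound (t : C) : (0 < Im t)%R ->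
  exists K, forall m n, (Cmod (lat inv2 t m n - tele t m n) <= K * (i2 m * i2 n))%R.
Proof.
  intros Ht. destruct (lattice_bound t Ht) as [d [[Hd _] Hb]].
  exists (/ 2 * / (d * d))%R. intros m n.
  rewrite tele_eq by easy. unfold lat, paired. unfold Cminus at 1 2. rewrite <- RtoC_opp.
  pose proof (pos_INR (S n)) as HSn. pose proof (INR_S_pos m). pose proof (INR_S_pos n).
  assert (B : forall s : R, (INR (S n) <= Rabs s)%R ->
    (Cmod (inv2 (INR (S m) * t + s) - quart (INR (S m) * t + s)) <= / 4 * / (d * (INR (S m) * INR (S n)) * (d * (INR (S m) * INR (S n)))))%R).
  { intros s Hs. destruct (quart_bounds t d m n s Hd Hb Hs) as (H1 & _ & _).
    destruct (inv2_bounds t d m n s Hd Hb ltac:(lra)) as (H2 & _).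
    set (e := (d * (INR (S m) * INR (S n)))%R) in *.
    assert (He : (0 < e)%R) by (unfold e; apply Rmult_lt_0_compat; nra).
    pose proof (lattice_neq_0 t m s Ht) as Ha.
    assert (Hq : (INR (S m) * t + s + RtoC (/ 2)) * (INR (S m) * t + s + RtoC (- / 2)) <> 0) by (apply Cmod_neq; lra).
    set (a := INR (S m) * t + s) in *.
    replace (inv2 a - quart a) with (- / 4 * (inv2 a * quart a)).
    - rewrite !Cmod_mult, Cmod_opp, Cmod_inv, Cmod_RtoC_pos by (try lra; apply RtoC_neq; lra).
      apply Rmult_le_compat_l; [lra|]. rewrite Rinv_mult.
      apply Rmult_le_compat; try apply Cmod_ge_0; [easy|]. now apply Cinv_bound.
    - unfold inv2, quart in *. set (q := (a + RtoC (/ 2)) * (a + RtoC (- / 2))) in *.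
      assert (E : q = a * a - / 4).
      { unfold q. rewrite RtoC_opp, RtoC_inv by lra. field. }
      replace (/ 4) with (a * a - q) by (rewrite E; ring). field. split; easy. }
  assert (B1 := B (INR (S n)) ltac:(rewrite Rabs_pos_eq; lra)).
  assert (B2 := B (- INR (S n))%R ltac:(rewrite Rabs_opp_INR; lra)).
  rewrite Rmult_assoc, <- i2_prod by easy.
  set (e := (/ (d * (INR (S m) * INR (S n)) * (d * (INR (S m) * INR (S n)))))%R) in *.
  match goal with |- (Cmod (?x1 + ?x2 + - (?y1 + ?y2)) <= _)%R => replace (x1 + x2 + - (y1 + y2)) with ((x1 - y1) + (x2 - y2)) by ring end.
  eapply Rle_trans; [apply Cmod_triangle|]. lra.
Qed.

Lemma tele_bounds (t : C) : (0 < Im t)%R -> exists K, forall m n,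
  (Cmod (tele t m n) <= K * i2 n)%R /\ (Cmod (tele t m n) <= K * i2 m)%R.
Proof.
  intros Ht. destruct (lattice_bound t Ht) as [d [[Hd _] Hb]].
  exists (8 / d)%R. intros m n. rewrite tele_eq by easy. pose proof (pos_INR (S n)).
  destruct (quart_bounds t d m n (INR (S n)) Hd Hb ltac:(rewrite Rabs_pos_eq; lra)) as (_ & H1 & H2).
  destruct (quart_bounds t d m n (- INR (S n)) Hd Hb ltac:(rewrite Rabs_opp_INR; lra)) as (_ & H3 & H4).
  split; (eapply Rle_trans; [apply Cmod_triangle|]).
  - replace (8 / d * i2 n)%R with (4 / d * i2 n + 4 / d * i2 n)%R by (field; lra). lra.
  - replace (8 / d * i2 m)%R with (4 / d * i2 m + 4 / d * i2 m)%R by (field; lra). lra.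
Qed.

Lemma tele_csum (t : C) (m N : nat) : csum (tele t m) N = phi t m (INR N + / 2) - phi t m (/ 2).
Proof.
  induction N as [|N IH].
  - simpl. replace (0 + / 2)%R with (/ 2)%R by ring. ring.
  - change (csum (tele t m) (S N)) with (csum (tele t m) N + tele t m N). rewrite IH. unfold tele. ring.
Qed.

Lemma phi_row_limit (t : C) (m : nat) : (0 < Im t)%R -> is_clim (fun N => phi t m (INR N + / 2)) 0.
Proof.
  intros Ht. set (a := INR (S m) * t).
  apply is_clim_ext with (fun N => / ((a - RtoC (/ 2)) - INR N) - / ((a + RtoC (/ 2)) + INR N)).
  - intros N. unfold phi. fold a. rewrite RtoC_plus. f_equal; f_equal; ring.
  - replace (RtoC 0) with (RtoC 0 - 0) by ring. apply is_clim_minus; [apply is_clim_inv_nat_minus|apply is_clim_inv_nat].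
Qed.

Lemma tele_row (t : C) (m : nat) : (0 < Im t)%R ->
  summable (tele t m) /\ Cser (tele t m) = - phi t m (/ 2).
Proof.
  intros Ht. destruct (tele_bounds t Ht) as [K HK].
  assert (Hs : summable (tele t m)).
  { apply summable_le with (fun n => K * i2 n)%R; [intros n; apply HK|].
    apply (ex_series_scal (V := R_NormedModule) K), ex_series_i2. }
  split; [easy|]. apply Cser_unique; [easy|].
  apply is_clim_ext with (fun N => phi t m (INR N + / 2) - phi t m (/ 2)); [intros N; now rewrite tele_csum|].
  replace (- phi t m (/ 2)) with (0 - phi t m (/ 2)) by ring.
  apply is_clim_minus; [now apply phi_row_limit|apply is_clim_const].
Qed.

Lemma tele_col_summable (t : C) (n : nat) : (0 < Im t)%R -> summable (fun m => tele t m n).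
Proof.
  intros Ht. destruct (tele_bounds t Ht) as [K HK].
  apply summable_le with (fun m => K * i2 m)%R; [intros m; apply HK|].
  apply (ex_series_scal (V := R_NormedModule) K), ex_series_i2.
Qed.

Lemma phi_half_summable (t : C) : (0 < Im t)%R -> summable (fun m => phi t m (/ 2)).
Proof.
  intros Ht. destruct (lattice_bound t Ht) as [d [[Hd _] Hb]].
  apply summable_le with (fun m => / d * i2 m)%R; [|apply (ex_series_scal (V := R_NormedModule) (/ d)%R), ex_series_i2].
  intros m. pose proof (INR_S_pos m).
  pose proof (Hb (INR (S m)) (/ 2)%R) as H1. pose proof (Hb (INR (S m)) (- / 2)%R) as H2.
  assert (E : phi t m (/ 2) = / ((INR (S m) * t + RtoC (/ 2)) * (INR (S m) * t + RtoC (- / 2)))).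
  { pose proof (lattice_neq_0 t m (/ 2) Ht). pose proof (lattice_neq_0' t m (/ 2) Ht).
    unfold phi. rewrite RtoC_opp. fold (INR (S m) * t - RtoC (/ 2)).
    set (p := INR (S m) * t + RtoC (/ 2)) in *. set (p' := INR (S m) * t - RtoC (/ 2)) in *.
    assert (D : p - p' = 1).
    { unfold p, p'. replace (INR (S m) * t + RtoC (/ 2) - (INR (S m) * t - RtoC (/ 2))) with (RtoC (/ 2) + RtoC (/ 2)) by ring.
      rewrite <- RtoC_plus. f_equal. field. }
    transitivity ((p - p') / (p * p')); [field; split; easy|]. rewrite D. field. split; easy. }
  rewrite E. replace (/ d * i2 m)%R with (/ (d * (INR (S m) * INR (S m))))%R by (unfold i2; field; lra).
  apply Cinv_bound; [apply Rmult_lt_0_compat; nra|].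
  apply Cmod_prod_ge; [apply Rmult_le_pos; nra| |]; nra.
Qed.

Lemma phi_paired (t : C) (m : nat) (x : R) : (0 < Im t)%R ->
  phi t m x = / t * paired Cinv (- x / t) m.
Proof.
  intros Ht. pose proof (upper_neq_0 t Ht) as Ht0.
  pose proof (lattice_neq_0 t m x Ht) as H1. pose proof (lattice_neq_0' t m x Ht) as H2.
  unfold phi, paired.
  replace (- x / t + INR (S m)) with ((INR (S m) * t - x) / t) by (field; easy).
  replace (- x / t - INR (S m)) with (- (INR (S m) * t + x) / t) by (field; easy).
  field. repeat split; try easy.
Qed.

(** As a sum over m, [phi] is 1/t times the cotangent series at v = -x/t without its central term.
    Since Im v grows linearly with x, [cot_limit] applies and the central term 1/v disappears. *)
Lemma phi_col_limit (t : C) : (0 < Im t)%R -> (forall N, summable (fun m => phi t m (INR N + / 2))) ->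
  is_clim (fun N => Cser (fun m => phi t m (INR N + / 2))) (- (Ci * PI) / t).
Proof.
  intros Ht Hs. pose proof (upper_neq_0 t Ht) as Ht0.
  set (v := fun N => - RtoC (INR N + / 2) / t).
  assert (Hv : forall N, summable (paired Cinv (v N))).
  { intros N. apply summable_ext with (fun m => t * phi t m (INR N + / 2)).
    - intros m. rewrite phi_paired by easy. unfold v. field. easy.
    - now apply summable_scal. }
  assert (Hy : (0 < Im (- / t))%R) by now apply Im_neg_inv.
  assert (HIm : forall N, Im (v N) = ((INR N + / 2) * Im (- / t))%R).
  { intros N. rewrite <- im_scal_l. f_equal. unfold v. field. easy. }
  apply is_clim_ext with (fun N => / t * (Cser (paired Cinv (v N)))).
  { intros N. rewrite <- Cser_scal by easy. apply Cser_ext. intros m. now rewrite phi_paired. }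
  replace (- (Ci * PI) / t) with (/ t * (- (Ci * PI))) by (field; easy). apply is_clim_scal.
  apply is_clim_eps. intros eps He.
  set (y := Im (- / t)) in *.
  destruct (nfloor_ex (Rmax ((1 + 6 / eps + Cmod t / eps) * (2 / y) + Cmod t * 2 / eps) 0)) as [N HN]; [apply Rmax_r|].
  exists (S N). intros n Hn.
  pose proof (Rmax_l ((1 + 6 / eps + Cmod t / eps) * (2 / y) + Cmod t * 2 / eps) 0) as Hm.
  apply le_INR in Hn. rewrite S_INR in Hn. pose proof (Cmod_ge_0 t) as Hct.
  assert (P1 : (0 < 6 / eps)%R) by (apply Rdiv_lt_0_compat; lra).
  assert (P2 : (0 <= Cmod t / eps)%R) by (apply Rmult_le_pos; [easy|apply Rlt_le, Rinv_0_lt_compat; easy]).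
  assert (P3 : (0 < 2 / y)%R) by (apply Rdiv_lt_0_compat; lra).
  assert (P4 : (0 <= Cmod t * 2 / eps)%R) by (replace (Cmod t * 2 / eps)%R with (2 * (Cmod t / eps))%R by (field; lra); lra).
  assert (Hn1 : ((1 + 6 / eps + Cmod t / eps) * (2 / y) < INR n)%R) by lra.
  assert (Hn2 : (Cmod t * 2 / eps < INR n)%R) by nra.
  assert (Hbig : (2 * (1 + 6 / eps + Cmod t / eps) < Im (v n))%R).
  { rewrite HIm. fold y. replace (2 * (1 + 6 / eps + Cmod t / eps))%R with ((1 + 6 / eps + Cmod t / eps) * (2 / y) * y)%R by (field; lra).
    apply Rmult_lt_compat_r; lra. }
  pose proof (cot_limit (v n) ltac:(lra) (Hv n)) as H.
  assert (Hvn : v n <> 0) by (apply upper_neq_0; lra).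
  replace (Cser (paired Cinv (v n)) - - (Ci * PI)) with (/ v n + Cser (paired Cinv (v n)) + Ci * PI - / v n) by ring.
  eapply Rle_lt_trans; [apply Cmod_triangle_minus|].
  assert (H6 : (6 / Im (v n) < eps / 2)%R).
  { apply (proj2 (Rlt_div_l 6 (eps / 2) (Im (v n)) ltac:(lra))).
    assert (12 / eps < Im (v n))%R by (replace (12 / eps)%R with (2 * (6 / eps))%R by (field; lra); lra).
    replace 6%R with (eps / 2 * (12 / eps))%R by (field; lra). apply Rmult_lt_compat_l; lra. }
  assert (H7 : (Cmod (/ v n) <= eps / 2)%R).
  { assert (Hle : (Im (v n) <= Cmod (v n))%R) by (eapply Rle_trans; [apply Rle_abs|apply im_le_Cmod]).
    eapply Rle_trans; [apply (Cinv_bound (v n) (2 / eps)); [apply Rdiv_lt_0_compat; lra|]|].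
    - replace (2 / eps)%R with (/ 3 * (6 / eps))%R by (field; lra). lra.
    - right. field. lra. }
  lra.
Qed.

Lemma S1_lattice (t : C) : (0 < Im t)%R ->
  twopii * twopii * S1 t = RtoC PI * RtoC PI / 6 * inv2 t + Cser (fun m => Cser (lat inv2 t m)) /\
  summable (fun m => Cser (lat inv2 t m)).
Proof.
  intros Ht. destruct (csc2_rows t Ht) as [Hs E]. pose proof (upper_neq_0 t Ht) as Ht0.
  assert (E2 : forall m, Cser (lat inv2 t m) = csc2 (INR (S m) * t) - inv2 t * inv2 (INR (S m))).
  { intros m. pose proof (Im_scal_pos m t Ht) as Hz.
    change (lat inv2 t m) with (paired inv2 (INR (S m) * t)). rewrite csc2_series.
    - rewrite inv2_mult by (apply INR_S_neq_0 || easy). ring.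
    - now apply upper_qexp_neq_1.
    - now apply summable_lat2. }
  assert (Hs2 : summable (fun m => inv2 t * inv2 (INR (S m)))) by apply summable_scal, summable_inv2_INR.
  split.
  - rewrite (Cser_ext _ _ E2), Cser_minus by easy. rewrite Cser_scal by apply summable_inv2_INR.
    rewrite zeta2, E. ring.
  - apply summable_ext with (fun m => csc2 (INR (S m) * t) - inv2 t * inv2 (INR (S m))); [intros; now rewrite E2|].
    now apply summable_minus.
Qed.

Lemma lat2_swap (t : C) : (0 < Im t)%R ->
  (forall n, summable (fun m => lat inv2 t m n)) ->
  summable (fun m => Cser (lat inv2 t m)) ->
  summable (fun n => Cser (fun m => lat inv2 t m n)) ->
  Cser (fun n => Cser (fun m => lat inv2 t m n)) = Cser (fun m => Cser (lat inv2 t m)) - Ci * PI / t.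
Proof.
  intros Ht Hcol Hr Hc. destruct (defect_bound t Ht) as [K HK].
  destruct (fubini_product (fun m n => lat inv2 t m n - tele t m n) K HK) as (D1 & D2 & D3 & D4 & D5).
  set (D := fun m n => lat inv2 t m n - tele t m n).
  change (summable (fun m => Cser (D m))) in D3. change (summable (fun n => Cser (fun m => D m n))) in D4.
  change (Cser (fun m => Cser (D m)) = Cser (fun n => Cser (fun m => D m n))) in D5.
  assert (ER : forall m, Cser (lat inv2 t m) = Cser (D m) + - phi t m (/ 2)).
  { intros m. destruct (tele_row t m Ht) as [H1 H2]. rewrite <- H2, <- Cser_plus; [|apply D1|exact H1].
    apply Cser_ext. intros n. unfold D. ring. }
  assert (EC : forall n, Cser (fun m => lat inv2 t m n) = Cser (fun m => D m n) + Cser (fun m => tele t m n)).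
  { intros n. rewrite <- Cser_plus; [|apply D2|now apply tele_col_summable].
    apply Cser_ext. intros m. unfold D. ring. }
  pose proof (phi_half_summable t Ht) as Hphi.
  assert (Hphi' : summable (fun m => - phi t m (/ 2))).
  { apply summable_ext with (fun m => (-1) * phi t m (/ 2)); [intros; ring|]. now apply summable_scal. }
  assert (HT : summable (fun n => Cser (fun m => tele t m n))).
  { apply summable_ext with (fun n => Cser (fun m => lat inv2 t m n) - Cser (fun m => D m n)).
    - intros n. rewrite EC. ring.
    - now apply summable_minus. }
  rewrite (Cser_ext _ _ ER), (Cser_ext _ _ EC), !Cser_plus, D5 by easy.
  assert (Hpart : forall N, summable (fun m => phi t m (INR N + / 2)) /\
    csum (fun n => Cser (fun m => tele t m n)) N = Cser (fun m => phi t m (INR N + / 2)) - Cser (fun m => phi t m (/ 2))).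
  { intros N. destruct (csum_Cser (fun n m => tele t m n) N (fun n => tele_col_summable t n Ht)) as [H1 H2].
    assert (H3 : summable (fun m => phi t m (INR N + / 2))).
    { apply summable_ext with (fun m => csum (fun n => tele t m n) N + phi t m (/ 2)).
      - intros m. change (csum (fun n => tele t m n) N) with (csum (tele t m) N). rewrite tele_csum. ring.
      - now apply summable_plus. }
    split; [easy|]. rewrite H2, <- Cser_minus by easy. apply Cser_ext. intros m. apply tele_csum. }
  assert (HL : Cser (fun n => Cser (fun m => tele t m n)) = - (Ci * PI) / t - Cser (fun m => phi t m (/ 2))).
  { apply Cser_unique; [easy|].
    apply is_clim_ext with (fun N => Cser (fun m => phi t m (INR N + / 2)) - Cser (fun m => phi t m (/ 2))).
    - intros N. symmetry. apply Hpart.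
    - apply is_clim_minus; [|apply is_clim_const]. apply phi_col_limit; [easy|]. intros N. apply Hpart. }
  rewrite HL. rewrite (Cser_ext (fun m => - phi t m (/ 2)) (fun m => (-1) * phi t m (/ 2))) by (intros; ring).
  rewrite Cser_scal by easy. unfold Cdiv. ring.
Qed.

Lemma S1_S (t : C) : (0 < Im t)%R ->
  1 - 24 * S1 (- / t) = t * t * (1 - 24 * S1 t) + 12 * t / twopii.
Proof.
  intros Ht. pose proof (upper_neq_0 t Ht) as Ht0. pose proof PI_C_neq_0 as Hpi.
  destruct (S1_lattice t Ht) as [E1 R1]. pose proof (Im_neg_inv t Ht) as Ht'.
  destruct (S1_lattice (- / t) Ht') as [E2 R2].
  assert (Hcol : forall n, summable (fun m => lat inv2 t m n)).
  { intros n. apply summable_ext with (fun m => / (t * t) * lat inv2 (- / t) n m).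
    - intros m. rewrite lat2_S by easy. field. easy.
    - apply summable_scal. now apply summable_lat2. }
  assert (Er : forall m, Cser (lat inv2 (- / t) m) = t * t * Cser (fun n => lat inv2 t n m)).
  { intros m. rewrite <- Cser_scal by apply Hcol. apply Cser_ext. intros n. now apply lat2_S. }
  assert (Hc : summable (fun n => Cser (fun m => lat inv2 t m n))).
  { apply summable_ext with (fun m => / (t * t) * Cser (lat inv2 (- / t) m)).
    - intros m. rewrite Er. field. easy.
    - now apply summable_scal. }
  rewrite (Cser_ext _ _ Er), Cser_scal, (lat2_swap t) in E2 by easy.
  replace (inv2 (- / t)) with (t * t) in E2 by (unfold inv2; field; easy).
  unfold inv2 at 1 in E1. set (B := Cser _) in *.
  assert (Hk := twopii_neq_0).
  assert (E3 : S1 (- / t) = / (twopii * twopii) * (PI * PI / 6 * (t * t) + t * t * (B - Ci * PI / t))).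
  { rewrite <- E2. field. easy. }
  replace B with (twopii * twopii * S1 t - PI * PI / 6 * / (t * t)) in E3 by (rewrite E1; ring).
  rewrite E3. rewrite twopii_sqr. unfold twopii.
  pose proof Ci_neq_0 as Hi.
  replace (12 * t / (2 * PI * Ci)) with (- (6 * t * Ci) / PI).
  - field. repeat split; easy.
  - transitivity (12 * t * - (Ci * Ci) / (2 * PI * Ci)); [field; split; easy|]. rewrite Ci_sqr. field. split; easy.
Qed.

(** * The modular group *)

Lemma cder_unique (f : C -> C) (z l m : C) : cder f z l -> cder f z m -> l = m.
Proof.
  intros Hl Hm.
  destruct (Ceq_dec l m) as [E|E]; [easy|exfalso].
  assert (Hp : (0 < Cmod (l - m))%R) by (apply Cmod_gt_0; now apply Cminus_neq_0).
  destruct (Hl (Cmod (l - m) / 4)%R) as [d1 [Hd1 H1]]; [lra|].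
  destruct (Hm (Cmod (l - m) / 4)%R) as [d2 [Hd2 H2]]; [lra|].
  set (h := (Rmin d1 d2 / 2)%R). assert (Hmin : (0 < Rmin d1 d2)%R) by now apply Rmin_glb_lt.
  pose proof (Rmin_l d1 d2). pose proof (Rmin_r d1 d2).
  assert (Hh : Cmod (RtoC h) = h) by (apply Cmod_RtoC_pos; unfold h; lra).
  specialize (H1 (RtoC h)). specialize (H2 (RtoC h)). rewrite Hh in *.
  specialize (H1 ltac:(unfold h; lra)). specialize (H2 ltac:(unfold h; lra)).
  assert (H3 : (Cmod (RtoC h * (l - m)) <= Cmod (l - m) / 2 * h)%R).
  { replace (RtoC h * (l - m)) with ((f (z + h) - f z - h * m) - (f (z + h) - f z - h * l)) by ring.
    eapply Rle_trans; [apply Cmod_triangle_minus|]. lra. }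
  rewrite Cmod_mult, Hh in H3. assert (0 < h)%R by (unfold h; lra). nra.
Qed.

Lemma Im_segment (z h : C) (s : R) : (0 < Im z)%R -> (0 < Im (z + h))%R -> (0 <= s <= 1)%R ->
  (0 < Im (z + s * h))%R.
Proof.
  intros H1 H2 Hs. rewrite im_plus, im_scal_l in *.
  destruct (Rle_dec 0 (Im h)); [nra|].
  assert (s * Im h >= Im h)%R by nra. lra.
Qed.

Lemma upper_const (f : C -> C) : (forall t, (0 < Im t)%R -> cder f t 0) ->
  forall t u, (0 < Im t)%R -> (0 < Im u)%R -> f t = f u.
Proof.
  intros H t u Ht Hu.
  assert (E : (Cmod (f (t + (u - t))%C - f t) <= 0 * Cmod (u - t))%R).
  { apply (cder_MVI f (fun _ => 0)).
    - intros s Hs. apply H. apply Im_segment; try easy. now replace (t + (u - t)) with u by ring.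
    - intros s Hs. rewrite Cmod_0. lra. }
  replace (t + (u - t)) with u in E by ring. rewrite Rmult_0_l in E.
  assert (E0 : Cmod (f u - f t) = 0%R) by (pose proof (Cmod_ge_0 (f u - f t)); lra).
  apply Cmod_eq_0 in E0. replace (f u) with (f u - f t + f t) by ring. rewrite E0. ring.
Qed.

(** * Limits at the cusp *)

Definition tends (f : C -> C) (l : C) : Prop :=
  forall eps : R, (0 < eps)%R -> exists Y : R, forall t, (Y < Im t)%R -> (Cmod (f t - l) < eps)%R.

(** The method behind [exp_clog] and [discriminant]: a zero derivative makes the function constant,
    and the cusp shows which constant it is. *)
Lemma tends_const_eq (f : C -> C) (l : C) : (forall t, (0 < Im t)%R -> cder f t 0) -> tends f l ->
  forall t, (0 < Im t)%R -> f t = l.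
Proof.
  intros Hd Hl t Ht. destruct (Ceq_dec (f t) l) as [E|E]; [easy|exfalso].
  assert (Hp : (0 < Cmod (f t - l))%R) by (apply Cmod_gt_0; now apply Cminus_neq_0).
  destruct (Hl _ Hp) as [Y HY].
  set (u := (0, Rmax 0 Y + 1)%R : C). pose proof (Rmax_l 0 Y). pose proof (Rmax_r 0 Y).
  assert (Hu : Im u = (Rmax 0 Y + 1)%R) by easy.
  specialize (HY u ltac:(lra)). rewrite (upper_const f Hd u t) in HY by lra. lra.
Qed.

Lemma tends_ext (f g : C -> C) (l : C) : (forall t, (0 < Im t)%R -> f t = g t) -> tends f l -> tends g l.
Proof.
  intros H Hf eps He. destruct (Hf eps He) as [Y HY]. exists (Rmax 0 Y). intros t Ht.
  pose proof (Rmax_l 0 Y). pose proof (Rmax_r 0 Y). rewrite <- H by lra. apply HY. lra.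
Qed.

Lemma tends_eq (f : C -> C) (l m : C) : l = m -> tends f l -> tends f m.
Proof. now intros ->. Qed.

Lemma tends_const (c : C) : tends (fun _ => c) c.
Proof. intros eps He. exists 0%R. intros t _. replace (c - c) with (RtoC 0) by ring. now rewrite Cmod_0. Qed.

Lemma tends_plus (f g : C -> C) (l m : C) : tends f l -> tends g m -> tends (fun t => f t + g t) (l + m).
Proof.
  intros Hf Hg eps He. destruct (Hf (eps / 2)%R) as [Y1 H1]; [lra|]. destruct (Hg (eps / 2)%R) as [Y2 H2]; [lra|].
  exists (Rmax Y1 Y2). intros t Ht. pose proof (Rmax_l Y1 Y2). pose proof (Rmax_r Y1 Y2).
  specialize (H1 t ltac:(lra)). specialize (H2 t ltac:(lra)).
  replace (f t + g t - (l + m)) with ((f t - l) + (g t - m)) by ring.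
  eapply Rle_lt_trans; [apply Cmod_triangle|]. lra.
Qed.

Lemma tends_cont (f G : C -> C) (l m : C) : tends f l -> cder G l m -> tends (fun t => G (f t)) (G l).
Proof.
  intros Hf HG eps He. destruct (cder_cont G l m HG eps He) as [d [Hd H]].
  destruct (Hf d Hd) as [Y HY]. exists Y. intros t Ht. specialize (H _ (HY t Ht)).
  now replace (l + (f t - l)) with (f t) in H by ring.
Qed.

Lemma tends_mult (f g : C -> C) (l m : C) : tends f l -> tends g m -> tends (fun t => f t * g t) (l * m).
Proof.
  intros Hf Hg.
  assert (Hsq : forall u k, tends u k -> tends (fun t => u t * u t) (k * k)).
  { intros u k Hu. exact (tends_cont u (fun x => x * x) k _ Hu (cder_sqr k)). }
  assert (Hs : forall c u k, tends u k -> tends (fun t => c * u t) (c * k)).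
  { intros c u k Hu. exact (tends_cont u (fun x => c * x) k _ Hu (cder_scal c _ _ _ (cder_id k))). }
  apply tends_ext with (fun t => / 4 * ((f t + g t) * (f t + g t) + (-1) * ((f t + (-1) * g t) * (f t + (-1) * g t)))).
  { intros t _. field. }
  replace (l * m) with (/ 4 * ((l + m) * (l + m) + (-1) * ((l + (-1) * m) * (l + (-1) * m)))) by field.
  apply Hs, tends_plus; [apply Hsq; now apply tends_plus|]. apply Hs, Hsq, tends_plus; [easy|now apply Hs].
Qed.

Lemma tends_inv (f : C -> C) (l : C) : l <> 0 -> tends f l -> tends (fun t => / f t) (/ l).
Proof. intros Hl Hf. exact (tends_cont f Cinv l _ Hf (cder_inv l Hl)). Qed.

Lemma exp_neg_small (eps : R) : (0 < eps)%R -> exists Y, (0 <= Y)%R /\ forall y, (Y < y)%R -> (exp (- y) < eps)%R.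
Proof.
  intros He. exists (/ eps)%R. assert (0 < / eps)%R by now apply Rinv_0_lt_compat. split; [lra|]. intros y Hy.
  rewrite exp_Ropp. rewrite <- (Rinv_inv eps). apply Rinv_lt_contravar.
  - apply Rmult_lt_0_compat; [easy|apply exp_pos].
  - pose proof (exp_ineq1_le y). lra.
Qed.

Lemma tends_qexp : tends qexp 0.
Proof.
  intros eps He. destruct (exp_neg_small eps He) as [Y [HY0 HY]]. exists Y. intros t Ht.
  replace (qexp t - 0) with (qexp t) by ring. rewrite Cmod_qexp. pose proof PI2_3_2. apply HY. nra.
Qed.

Lemma tends_Fs (a : nat -> C) : growth a -> tends (Fs a) (a 0%nat).
Proof.
  intros Ha. assert (Hs := growth_shift a Ha).
  destruct (Ps_bounded (fun n => a (S n)) (/ 2) Hs ltac:(lra)) as [M [HM0 HM]].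
  intros eps He.
  destruct (tends_qexp (/ 2)%R ltac:(lra)) as [Y1 H1]. destruct (tends_qexp (eps / (M + 1))%R) as [Y2 H2]; [apply Rdiv_lt_0_compat; lra|].
  exists (Rmax 0 (Rmax Y1 Y2)). intros t Ht. pose proof (Rmax_l 0 (Rmax Y1 Y2)). pose proof (Rmax_r 0 (Rmax Y1 Y2)).
  pose proof (Rmax_l Y1 Y2). pose proof (Rmax_r Y1 Y2).
  specialize (H1 t ltac:(lra)). specialize (H2 t ltac:(lra)). replace (qexp t - 0) with (qexp t) in * by ring.
  unfold Fs. rewrite Ps_incr by (easy || lra).
  replace (a 0%nat + qexp t * Ps (fun n => a (S n)) (qexp t) - a 0%nat) with (qexp t * Ps (fun n => a (S n)) (qexp t)) by ring.
  rewrite Cmod_mult. specialize (HM (qexp t) ltac:(lra)). apply Rlt_div_r in H2; [|lra].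
  pose proof (Cmod_ge_0 (qexp t)). pose proof (Cmod_ge_0 (Ps (fun n => a (S n)) (qexp t))). nra.
Qed.

(** * Generators of the modular group *)

Lemma SL2Z_ext (g h : SL2Z) : sa g = sa h -> sb g = sb h -> sc g = sc h -> sd g = sd h -> g = h.
Proof.
  destruct g as [a b c d e], h as [a' b' c' d' e']; simpl. intros -> -> -> ->. f_equal.
  apply UIP_dec, Z.eq_dec.
Qed.

Definition gS : SL2Z := mkSL2Z 0 (-1) 1 0 eq_refl.
Lemma gT_det (k : Z) : (1 * 1 - k * 0 = 1)%Z. Proof. ring. Qed.
Definition gT (k : Z) : SL2Z := mkSL2Z 1 k 0 1 (gT_det k).
Lemma ginv_det (g : SL2Z) : (sd g * sa g - (- sb g) * (- sc g) = 1)%Z.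
Proof. pose proof (sdet g). nia. Qed.
Definition ginv (g : SL2Z) : SL2Z := mkSL2Z (sd g) (- sb g) (- sc g) (sa g) (ginv_det g).
Definition gI : SL2Z := gT 0.

(** Euclid's algorithm on the first column: with k the quotient of a by c, the matrix is T^k S times
    one whose lower left entry is minus the remainder. When c = 0 only translations and S^2 = -1
    occur. *)
Lemma gen_ind (G : SL2Z -> Prop) :
  G gS -> G (gT 1) -> G (gT (-1)) -> (forall g h, G g -> G h -> G (SL2Z_mul g h)) -> forall g, G g.
Proof.
  intros HS HT HT' Hm.
  assert (HT0 : G gI).
  { replace gI with (SL2Z_mul (gT 1) (gT (-1))) by (apply SL2Z_ext; easy). now apply Hm. }
  assert (HTk : forall k, G (gT k)).
  { intros k. destruct (Z_le_dec 0 k) as [Hk|Hk].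
    - rewrite <- (Z2Nat.id k) by easy. induction (Z.to_nat k) as [|n IH]; [easy|].
      replace (gT (Z.of_nat (S n))) with (SL2Z_mul (gT 1) (gT (Z.of_nat n))) by (apply SL2Z_ext; cbn [sa sb sc sd SL2Z_mul gT]; lia).
      now apply Hm.
    - replace k with (- Z.of_nat (Z.to_nat (- k)))%Z by lia. induction (Z.to_nat (- k)) as [|n IH]; [easy|].
      replace (gT (- Z.of_nat (S n))) with (SL2Z_mul (gT (-1)) (gT (- Z.of_nat n))) by (apply SL2Z_ext; cbn [sa sb sc sd SL2Z_mul gT]; lia).
      now apply Hm. }
  assert (H : forall n g, (Z.abs_nat (sc g) < n)%nat -> G g).
  { induction n as [|n IH]; [lia|]. intros g Hg. pose proof (sdet g) as Hdet.
    destruct (Z.eq_dec (sc g) 0) as [Hc|Hc].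
    - rewrite Hc in Hdet. assert (Had : (sa g * sd g = 1)%Z) by lia.
      apply Z.eq_mul_1 in Had as Ha'.
      destruct Ha' as [Ha|Ha].
      + assert (Hd : sd g = 1%Z) by nia.
        replace g with (gT (sb g)) by (apply SL2Z_ext; cbn; lia). apply HTk.
      + assert (Hd : sd g = (-1)%Z) by nia.
        replace g with (SL2Z_mul (SL2Z_mul gS gS) (gT (- sb g))) by (apply SL2Z_ext; cbn [sa sb sc sd SL2Z_mul gT gS]; lia).
        apply Hm; [now apply Hm|apply HTk].
    - set (k := (sa g / sc g)%Z).
      assert (Hdet' : (sc g * (k * sd g - sb g) - sd g * (k * sc g - sa g) = 1)%Z) by nia.
      pose proof (Z.div_mod (sa g) (sc g) Hc) as Hdm. fold k in Hdm.
      pose proof (Z.mod_bound_or (sa g) (sc g) Hc) as Hb.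
      replace g with (SL2Z_mul (gT k) (SL2Z_mul gS (mkSL2Z (sc g) (sd g) (k * sc g - sa g) (k * sd g - sb g) Hdet')))
        by (apply SL2Z_ext; cbn [sa sb sc sd SL2Z_mul gT gS]; lia).
      apply Hm; [apply HTk|]. apply Hm; [easy|]. apply IH. cbn [sc]. lia. }
  intros g. apply (H (S (Z.abs_nat (sc g)))). lia.
Qed.

Lemma jfac_neq_0 (g : SL2Z) (t : C) : (0 < Im t)%R -> jfac g t <> 0.
Proof.
  intros Ht E. unfold jfac in E. pose proof (sdet g) as Hd.
  assert (E1 : (IZR (sc g) * Im t = 0)%R).
  { apply (f_equal Im) in E. rewrite im_plus, im_scal_l in E. unfold Im in *; simpl in *. lra. }
  apply Rmult_integral in E1. destruct E1 as [E1|E1]; [|lra]. apply eq_IZR in E1.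
  rewrite E1 in E. replace (0 * t + IZR (sd g)) with (RtoC (IZR (sd g))) in E by ring.
  injection E as E. apply eq_IZR in E. rewrite E, E1 in Hd. lia.
Qed.

Lemma Im_mob (g : SL2Z) (t : C) : (0 < Im t)%R ->
  Im (mob g t) = (Im t / (Cmod (jfac g t) * Cmod (jfac g t)))%R.
Proof.
  intros Ht. pose proof (jfac_neq_0 g t Ht) as Hj. apply Cmod_gt_0 in Hj as Hp.
  assert (Hm : (0 < Cmod (jfac g t) * Cmod (jfac g t))%R) by nra.
  pose proof (sdet g) as Hd. apply (f_equal IZR) in Hd. rewrite minus_IZR, !mult_IZR in Hd.
  apply (Rmult_eq_reg_r (Cmod (jfac g t) * Cmod (jfac g t))); [|lra].
  replace (Im t / (Cmod (jfac g t) * Cmod (jfac g t)) * (Cmod (jfac g t) * Cmod (jfac g t)))%R with (Im t) by (field; lra).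
  unfold mob. fold (jfac g t). rewrite Cmod_sqr in *. unfold jfac in *. destruct t as [x y].
  unfold Re, Im in *; simpl in *.
  set (a := IZR (sa g)) in *. set (b := IZR (sb g)) in *. set (c := IZR (sc g)) in *. set (d := IZR (sd g)) in *.
  ring_simplify in Hm.
  transitivity ((a * d - b * c) * y)%R; [|rewrite Hd; ring]. field.
  replace ((c * x - 0 * y + d) ^ 2 + (c * y + 0 * x + 0) ^ 2)%R with (c ^ 2 * x ^ 2 + 2 * c * x * d + c ^ 2 * y ^ 2 + d ^ 2)%R by ring.
  try (apply Rgt_not_eq; lra).
Qed.

Lemma mob_upper (g : SL2Z) (t : C) : (0 < Im t)%R -> (0 < Im (mob g t))%R.
Proof.
  intros Ht. rewrite Im_mob by easy. pose proof (jfac_neq_0 g t Ht) as Hj. apply Cmod_gt_0 in Hj as Hp.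
  apply Rdiv_lt_0_compat; nra.
Qed.

Lemma mob_mul (g h : SL2Z) (t : C) : (0 < Im t)%R ->
  mob (SL2Z_mul g h) t = mob g (mob h t) /\ jfac (SL2Z_mul g h) t = jfac g (mob h t) * jfac h t.
Proof.
  intros Ht. pose proof (jfac_neq_0 h t Ht) as H1. pose proof (jfac_neq_0 g (mob h t) (mob_upper h t Ht)) as H2.
  assert (E : jfac (SL2Z_mul g h) t = jfac g (mob h t) * jfac h t).
  { unfold jfac, mob in *. cbn [sc sd SL2Z_mul]. rewrite !plus_IZR, !mult_IZR, !RtoC_plus, !RtoC_mult. field. easy. }
  split; [|exact E].
  pose proof (jfac_neq_0 (SL2Z_mul g h) t Ht) as H3.
  unfold mob at 1. fold (jfac (SL2Z_mul g h) t). rewrite E.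
  unfold mob at 2. fold (jfac g (mob h t)).
  set (j := jfac g (mob h t)) in *.
  assert (En : IZR (sa (SL2Z_mul g h)) * t + IZR (sb (SL2Z_mul g h)) = (IZR (sa g) * mob h t + IZR (sb g)) * jfac h t).
  { unfold jfac, mob in *. cbn [sa sb SL2Z_mul]. rewrite !plus_IZR, !mult_IZR, !RtoC_plus, !RtoC_mult. field. easy. }
  rewrite En. field. split; easy.
Qed.

Lemma mob_gS (t : C) : mob gS t = - / t.
Proof.
  unfold mob; simpl. replace (RtoC (-1)) with (- RtoC 1) by (rewrite <- RtoC_opp; easy).
  replace (0 * t + - (1)) with (- RtoC 1) by ring.
  replace (1 * t + 0) with t by ring. unfold Cdiv. ring.
Qed.

Lemma jfac_gS (t : C) : jfac gS t = t.
Proof. unfold jfac; simpl. ring. Qed.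

Lemma mob_gT (k : Z) (t : C) : mob (gT k) t = t + IZR k.
Proof. unfold mob; simpl. field. Qed.

Lemma jfac_gT (k : Z) (t : C) : jfac (gT k) t = 1.
Proof. unfold jfac; simpl. ring. Qed.

Lemma mob_ginv (g : SL2Z) (t : C) : (0 < Im t)%R -> mob (ginv g) (mob g t) = t.
Proof.
  intros Ht. rewrite <- (proj1 (mob_mul (ginv g) g t Ht)).
  replace (SL2Z_mul (ginv g) g) with gI.
  - unfold gI. rewrite mob_gT. ring.
  - pose proof (sdet g). apply SL2Z_ext; cbn [sa sb sc sd SL2Z_mul gI gT ginv]; lia.
Qed.

(** * Reduction to the fundamental domain *)

Definition in_FD (t : C) : Prop := (0 < Im t)%R /\ (Rabs (Re t) <= / 2)%R /\ (1 <= Cmod t)%R.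

Lemma translate_strip (t : C) : exists k : Z, (Rabs (Re (t + IZR k)) <= / 2)%R.
Proof.
  pose proof (archimed (Re t - / 2)) as [H1 H2]. exists (- up (Re t - / 2))%Z.
  rewrite re_plus, re_RtoC, opp_IZR. apply Rabs_le. lra.
Qed.

Lemma Im_add_IZR (t : C) (k : Z) : Im (t + IZR k) = Im t.
Proof. rewrite im_plus. unfold Im at 2; simpl. ring. Qed.

Lemma mob_compose (g h : SL2Z) (t : C) : (0 < Im t)%R -> mob g (mob h t) = mob (SL2Z_mul g h) t.
Proof. intros Ht. symmetry. now apply mob_mul. Qed.

Lemma Im_S (t : C) : (0 < Im t)%R -> Im (- / t) = (Im t / (Cmod t * Cmod t))%R.
Proof. intros Ht. rewrite <- mob_gS, Im_mob, jfac_gS by easy. easy. Qed.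

(* S doubles the height as long as it is at most 1/2 (after a translation to the strip). *)
Lemma FD_climb (n : nat) : forall t : C, (/ 2 < Im t * 2 ^ n)%R -> (0 < Im t)%R ->
  exists g, (/ 2 < Im (mob g t))%R /\ (Rabs (Re (mob g t)) <= / 2)%R.
Proof.
  induction n as [|n IH]; intros t H Ht.
  - destruct (translate_strip t) as [k Hk]. exists (gT k). rewrite mob_gT. split; [|easy].
    rewrite Im_add_IZR. simpl in H. lra.
  - destruct (translate_strip t) as [k Hk]. set (u := t + IZR k) in *.
    assert (Hu : Im u = Im t) by apply Im_add_IZR.
    destruct (Rlt_dec (/ 2) (Im u)) as [Hy|Hy].
    + exists (gT k). rewrite mob_gT. split; easy.
    + assert (Hm : (Cmod u * Cmod u <= / 2)%R).
      { rewrite Cmod_sqr. apply Rabs_le_between in Hk. nra. }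
      assert (Hu0 : u <> 0) by (apply upper_neq_0; lra). apply Cmod_gt_0 in Hu0.
      destruct (IH (- / u)) as [g [Hg1 Hg2]].
      * rewrite Im_S by lra. apply Rlt_le_trans with (Im t * 2 ^ S n)%R; [easy|].
        assert (Hp : (0 < 2 ^ n)%R) by (apply pow_lt; lra). change (2 ^ S n)%R with (2 * 2 ^ n)%R.
        replace (Im t * (2 * 2 ^ n))%R with (Im t * 2 * 2 ^ n)%R by ring. apply Rmult_le_compat_r; [lra|].
        rewrite Hu. apply (proj1 (Rle_div_r (Im t * 2) (Im t) (Cmod u * Cmod u) ltac:(nra))).
        assert (Im t * (Cmod u * Cmod u) <= Im t * / 2)%R by (apply Rmult_le_compat_l; lra). lra.
      * apply Im_neg_inv; lra.
      * exists (SL2Z_mul g (SL2Z_mul gS (gT k))).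
        rewrite <- !mob_compose by (try easy; apply mob_upper; easy).
        rewrite mob_gT, mob_gS. split; easy.
Qed.

(** With u = x + iy it reads |nu - 1| >= |u|, that is, n - 1/u lies outside the open unit disc. The
    value n = 0 is where |u| < 1 enters, n = 1 and n = -1 use |x| <= 1/2, and the other integers use
    y > 1/2. *)
Lemma FD_last_step (x y n : R) : (Rabs x <= / 2)%R -> (/ 2 < y)%R ->
  (n = 0 /\ x * x + y * y < 1 \/ n = 1 \/ n = -1 \/ 2 <= n \/ n <= -2)%R ->
  (x * x + y * y <= (n * x - 1) * (n * x - 1) + n * y * (n * y))%R.
Proof.
  intros Hx Hy Hn. apply Rabs_le_between in Hx.
  destruct Hn as [[-> H]|[->|[->|H]]]; [lra|nra|nra|].
  assert (Hn2 : (4 <= n * n)%R) by nra.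
  assert (Hy2 : (/ 4 <= y * y)%R) by nra.
  assert (Hk : (3 <= n * n - 1)%R) by lra.
  assert ((n * n - 1) * (/ 4) <= (n * n - 1) * (y * y))%R by (apply Rmult_le_compat_l; lra).
  (* the quadratic form (n^2-1) x^2 - 2 n x + 1 + (n^2-1)/4 is positive as soon as n^2 >= 3 *)
  assert (0 <= (n * n - 1) * (x * x) - 2 * n * x + 1 + (n * n - 1) / 4)%R; [|nra].
  apply Rmult_le_reg_l with (n * n - 1)%R; [lra|].
  replace ((n * n - 1) * ((n * n - 1) * (x * x) - 2 * n * x + 1 + (n * n - 1) / 4))%R
    with (((n * n - 1) * x - n) * ((n * n - 1) * x - n) + (n * n - 3) * (n * n + 1) / 4)%R by field.
  pose proof (Rle_0_sqr ((n * n - 1) * x - n)) as Hs. unfold Rsqr in Hs. nra.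
Qed.

(** Once Im u > 1/2 in the strip, at most one more inversion followed by a translation is needed; no
    point of maximal height in the orbit has to be found. *)
Lemma FD_exists (t : C) : (0 < Im t)%R -> exists g, in_FD (mob g t).
Proof.
  intros Ht.
  assert (Hn : exists n, (/ 2 < Im t * 2 ^ n)%R).
  { destruct (nfloor_ex (/ Im t)) as [N HN]; [apply Rlt_le, Rinv_0_lt_compat; easy|].
    exists (S N). assert (H1 : (/ Im t < 2 ^ S N)%R).
    { eapply Rlt_le_trans; [apply HN|]. rewrite <- (pow_INR 2). rewrite <- S_INR. apply le_INR.
      apply Nat.lt_le_incl, Nat.pow_gt_lin_r. lia. }
    assert (H2 : (Im t * / Im t < Im t * 2 ^ S N)%R) by now apply Rmult_lt_compat_l.
    rewrite Rinv_r in H2 by lra. lra. }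
  destruct Hn as [n Hn]. destruct (FD_climb n t Hn Ht) as [g [H1 H2]].
  set (u := mob g t) in *. destruct (Rle_dec 1 (Cmod u)) as [Hc|Hc].
  - exists g. repeat split; try easy. fold u. lra.
  - assert (Hu : (0 < Im u)%R) by lra. destruct (translate_strip (- / u)) as [k Hk].
    exists (SL2Z_mul (gT k) (SL2Z_mul gS g)).
    rewrite <- !mob_compose by (try easy; apply mob_upper; easy). fold u. rewrite mob_gS, mob_gT.
    repeat split; [rewrite Im_add_IZR; now apply Im_neg_inv|easy|].
    assert (Hu0 : u <> 0) by now apply upper_neq_0. apply Cmod_gt_0 in Hu0 as Hup.
    apply Rmult_le_reg_r with (Cmod u); [easy|]. rewrite <- Cmod_mult, Rmult_1_l.
    replace ((- / u + IZR k) * u) with (IZR k * u - 1) by (field; easy).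
    apply Rsqr_incr_0; try apply Cmod_ge_0. unfold Rsqr. rewrite !Cmod_sqr.
    replace (Re (IZR k * u - 1)) with (IZR k * Re u - 1)%R by (unfold Re, Im; simpl; ring).
    replace (Im (IZR k * u - 1)) with (IZR k * Im u)%R by (unfold Re, Im; simpl; ring).
    apply FD_last_step; [easy|easy|].
    assert (Hk' : (k = 0 \/ k = 1 \/ k = -1 \/ 2 <= k \/ k <= -2)%Z) by lia.
    destruct Hk' as [->|[->|[->|[Hk'|Hk']]]].
    + left. split; [easy|]. rewrite <- Cmod_sqr. pose proof (Cmod_ge_0 u). nra.
    + right; left; easy.
    + right; right; left; easy.
    + right; right; right; left. now apply (IZR_le 2).
    + right; right; right; right. now apply (IZR_le _ (-2)).
Qed.

(** 433/500 is a rational number just below sqrt 3 / 2. *)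
Lemma FD_height (t : C) : in_FD t -> (433 / 500 <= Im t)%R.
Proof.
  intros (H1 & H2 & H3). apply Rabs_le_between in H2.
  assert (1 <= Cmod t * Cmod t)%R by nra. rewrite Cmod_sqr in H. nra.
Qed.

(** * Ramanujan's differential equations *)

Definition d0 (n : nat) : C := match n with O => 1 | _ => 0 end.
Definition lam1 : nat -> C := lam (fun n => RtoC (INR n ^ 1)).
Definition lam3 : nat -> C := lam (fun n => RtoC (INR n ^ 3)).
(* q-coefficients of the Eisenstein series E2, E4, E6, the last one defined as E2 E4 - 3 D E4 with D = q d/dq. *)
Definition cP (n : nat) : C := d0 n + (-24) * lam1 n.
Definition cQ (n : nat) : C := d0 n + 240 * lam3 n.
Definition cR (n : nat) : C := conv cP cQ n + (-3) * Da cQ n.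

Definition eP : C -> C := Fs cP.
Definition eQ : C -> C := Fs cQ.
Definition eR : C -> C := Fs cR.

Lemma growth_d0 : growth d0.
Proof.
  apply growth_bounded with 0%nat 1%R. intros [|n]; simpl; [rewrite Cmod_1|rewrite Cmod_0]; lra.
Qed.

Lemma growth_lam1 : growth lam1. Proof. apply growth_lam, growth_INR_pow. Qed.
Lemma growth_lam3 : growth lam3. Proof. apply growth_lam, growth_INR_pow. Qed.

Lemma growth_cP : growth cP.
Proof. apply growth_plus; [apply growth_d0|apply growth_scal, growth_lam1]. Qed.

Lemma growth_cQ : growth cQ.
Proof. apply growth_plus; [apply growth_d0|apply growth_scal, growth_lam3]. Qed.

Lemma growth_cR : growth cR.
Proof.
  apply growth_plus; [apply growth_conv; [apply growth_cP|apply growth_cQ]|].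
  apply growth_scal, growth_Da, growth_cQ.
Qed.

Lemma Fs_plus (a b : nat -> C) (t : C) : growth a -> growth b -> (0 < Im t)%R ->
  Fs (fun n => a n + b n) t = Fs a t + Fs b t.
Proof. intros. apply Ps_plus; try easy. now apply Cmod_qexp_lt_1. Qed.

Lemma Fs_scal (c : C) (a : nat -> C) (t : C) : growth a -> (0 < Im t)%R ->
  Fs (fun n => c * a n) t = c * Fs a t.
Proof. intros. apply Ps_scal; try easy. now apply Cmod_qexp_lt_1. Qed.

Lemma Fs_mult (a b : nat -> C) (t : C) : growth a -> growth b -> (0 < Im t)%R ->
  Fs (conv a b) t = Fs a t * Fs b t.
Proof. intros. symmetry. apply Ps_mult; try easy. now apply Cmod_qexp_lt_1. Qed.

Lemma Fs_d0 (t : C) : Fs d0 t = 1.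
Proof.
  unfold Fs, Ps. rewrite (Cser_finite _ 1).
  - simpl. ring.
  - intros [|n] Hn; [lia|]. simpl. ring.
Qed.

Lemma eP_S1 (t : C) : (0 < Im t)%R -> eP t = 1 - 24 * S1 t.
Proof.
  intros Ht. unfold eP, cP. rewrite Fs_plus, Fs_scal, Fs_d0 by
    (try easy; try apply growth_d0; try apply growth_scal; apply growth_lam1). unfold S1. fold lam1.
  replace (RtoC (-24)) with (- RtoC 24) by (rewrite <- RtoC_opp; easy). ring.
Qed.

Lemma eQ_S3 (t : C) : (0 < Im t)%R -> eQ t = 1 + 240 * S3 t.
Proof.
  intros Ht. unfold eQ, cQ. now rewrite Fs_plus, Fs_scal, Fs_d0 by
    (try easy; try apply growth_d0; try apply growth_scal; apply growth_lam3).
Qed.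

Lemma eP_S (t : C) : (0 < Im t)%R -> eP (- / t) = t * t * eP t + 12 * t / twopii.
Proof. intros Ht. rewrite !eP_S1 by (try apply Im_neg_inv; easy). now apply S1_S. Qed.

Lemma eQ_S (t : C) : (0 < Im t)%R -> eQ (- / t) = Cpow t 4 * eQ t.
Proof. intros Ht. rewrite !eQ_S3 by (try apply Im_neg_inv; easy). rewrite S3_S by easy. simpl. ring. Qed.

Lemma eR_eq (t : C) : (0 < Im t)%R -> eR t = eP t * eQ t - 3 * Fs (Da cQ) t.
Proof.
  intros Ht. unfold eR, cR. pose proof growth_cP. pose proof growth_cQ.
  rewrite Fs_plus, Fs_scal, Fs_mult by (try easy; try apply growth_conv; try apply growth_scal; try apply growth_Da; easy).
  unfold eP, eQ. replace (RtoC (-3)) with (- RtoC 3) by (rewrite <- RtoC_opp; easy). ring.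
Qed.

Lemma cder_neg_inv (t : C) : (0 < Im t)%R -> cder (fun x => - / x) t (/ (t * t)).
Proof.
  intros Ht. pose proof (upper_neq_0 t Ht). apply cder_eq with (- - / (t * t)); [ring|].
  apply cder_opp. now apply cder_inv.
Qed.

Lemma upper_ball (t x : C) : (Cmod (x - t) < Im t)%R -> (0 < Im x)%R.
Proof.
  intros H. pose proof (im_le_Cmod (x - t)) as H1. apply Rabs_le_between in H1.
  unfold Cminus in H1. rewrite im_plus, im_opp in H1. unfold Cminus in H. lra.
Qed.

(* Differentiate F(-1/t) = t^k F(t). *)
Lemma Da_S (a : nat -> C) (k : nat) : growth a ->
  (forall t, (0 < Im t)%R -> Fs a (- / t) = Cpow t (S k) * Fs a t) ->
  forall t, (0 < Im t)%R ->
  Fs (Da a) (- / t) = Cpow t (k + 3) * Fs (Da a) t + INR (S k) * Cpow t (k + 2) * Fs a t / twopii.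
Proof.
  intros Ha H t Ht. pose proof (upper_neq_0 t Ht) as Ht0. pose proof twopii_neq_0 as Hk.
  assert (D1 : cder (fun x => Fs a (- / x)) t (/ (t * t) * (twopii * Fs (Da a) (- / t)))).
  { apply (cder_comp (fun x => - / x) (Fs a)); [now apply cder_neg_inv|].
    apply cder_Fs; [easy|now apply Im_neg_inv]. }
  assert (D2 : cder (fun x => Fs a (- / x)) t (INR (S k) * Cpow t k * 1 * Fs a t + Cpow t (S k) * (twopii * Fs (Da a) t))).
  { apply cder_ext_loc with (fun x => Cpow x (S k) * Fs a x) (Im t); [easy| |].
    - intros x Hx. symmetry. apply H. now apply upper_ball with t.
    - apply (cder_mult (fun x => Cpow x (S k)) (Fs a)).
      + apply (cder_pow (fun x => x)), cder_id.
      + now apply cder_Fs. }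
  pose proof (cder_unique _ _ _ _ D1 D2) as E.
  replace (Fs (Da a) (- / t)) with (t * t / twopii * (/ (t * t) * (twopii * Fs (Da a) (- / t)))) by (field; split; easy).
  rewrite E, !Cpow_add_r. simpl. field. easy.
Qed.

(** The inhomogeneous terms of E2 E4 and of 3 D E4 cancel: up to the factor -3, E6 is here the Serre
    derivative of E4. In this way no lattice sum of weight 6 is required. *)
Lemma eR_S (t : C) : (0 < Im t)%R -> eR (- / t) = Cpow t 6 * eR t.
Proof.
  intros Ht. pose proof (Im_neg_inv t Ht) as Ht'. pose proof twopii_neq_0 as Hk.
  rewrite !eR_eq by easy. rewrite eP_S, eQ_S by easy.
  rewrite (Da_S cQ 3 growth_cQ eQ_S t Ht). unfold eQ. simpl.
  replace (RtoC (1 + 1 + 1 + 1)) with (RtoC 4) by (f_equal; ring). field. easy.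
Qed.

(* E4^2 - E2 E6 + 2 D E6 has weight 8 and a double zero at the cusp, so it vanishes: Ramanujan's equation for E6. *)
Definition cF (n : nat) : C := conv cQ cQ n + ((-1) * conv cP cR n + 2 * Da cR n).

Lemma growth_cF : growth cF.
Proof.
  pose proof growth_cP. pose proof growth_cQ. pose proof growth_cR.
  apply growth_plus; [now apply growth_conv|]. apply growth_plus; apply growth_scal; [now apply growth_conv|now apply growth_Da].
Qed.

Lemma cF_eq (t : C) : (0 < Im t)%R ->
  Fs cF t = eQ t * eQ t - eP t * eR t + 2 * Fs (Da cR) t.
Proof.
  intros Ht. pose proof growth_cP. pose proof growth_cQ. pose proof growth_cR. unfold cF.
  rewrite Fs_plus; [|now apply growth_conv| |easy].
  2: { apply growth_plus; apply growth_scal; [now apply growth_conv|now apply growth_Da]. }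
  rewrite Fs_plus by (try easy; apply growth_scal; (now apply growth_conv) || (now apply growth_Da)).
  rewrite !Fs_scal by (try easy; (now apply growth_conv) || (now apply growth_Da)).
  rewrite !Fs_mult by easy. unfold eP, eQ, eR.
  replace (RtoC (-1)) with (- RtoC 1) by (rewrite <- RtoC_opp; easy). ring.
Qed.

Lemma cF_S (t : C) : (0 < Im t)%R -> Fs cF (- / t) = Cpow t 8 * Fs cF t.
Proof.
  intros Ht. pose proof (Im_neg_inv t Ht) as Ht'. pose proof twopii_neq_0 as Hk.
  rewrite !cF_eq by easy. rewrite eP_S, eQ_S, eR_S by easy.
  rewrite (Da_S cR 5 growth_cR eR_S t Ht). unfold eR. simpl.
  replace (RtoC (1 + 1 + 1 + 1 + 1 + 1)) with (RtoC 6) by (f_equal; ring). field. easy.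
Qed.

Lemma conv_0 (a b : nat -> C) : conv a b 0 = a 0%nat * b 0%nat.
Proof. unfold conv; simpl. ring. Qed.

Lemma conv_1 (a b : nat -> C) : conv a b 1 = a 0%nat * b 1%nat + a 1%nat * b 0%nat.
Proof. unfold conv; simpl. ring. Qed.

Lemma lam_0 (c : nat -> C) : lam c 0 = 0. Proof. reflexivity. Qed.
Lemma lam_1 (c : nat -> C) : lam c 1 = c 1%nat. Proof. unfold lam; simpl. ring. Qed.

Lemma cP_0 : cP 0 = 1. Proof. unfold cP, lam1. rewrite lam_0. simpl. ring. Qed.
Lemma cQ_0 : cQ 0 = 1. Proof. unfold cQ, lam3. rewrite lam_0. simpl. ring. Qed.
Lemma cP_1 : cP 1 = - (24).
Proof.
  unfold cP, lam1. rewrite lam_1. simpl d0. replace (INR 1 ^ 1)%R with 1%R by (simpl; ring).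
  replace (RtoC (-24)) with (- RtoC 24) by (rewrite <- RtoC_opp; easy). ring.
Qed.
Lemma cQ_1 : cQ 1 = 240.
Proof.
  unfold cQ, lam3. rewrite lam_1. simpl d0. replace (INR 1 ^ 3)%R with 1%R by (simpl; ring). ring.
Qed.
Lemma Da_0 (a : nat -> C) : Da a 0 = 0. Proof. unfold Da; simpl. ring. Qed.
Lemma Da_1 (a : nat -> C) : Da a 1 = a 1%nat. Proof. unfold Da; simpl. ring. Qed.
Lemma cR_0 : cR 0 = 1.
Proof. unfold cR. rewrite conv_0, Da_0, cP_0, cQ_0. ring. Qed.
Lemma cR_1 : cR 1 = - (504).
Proof.
  unfold cR. rewrite conv_1, Da_1, cP_0, cQ_0, cP_1, cQ_1.
  replace (RtoC (-3)) with (- RtoC 3) by (rewrite <- RtoC_opp; easy). ring.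
Qed.
Lemma cF_0 : cF 0 = 0.
Proof.
  unfold cF. rewrite !conv_0, Da_0, cP_0, cQ_0, cR_0.
  replace (RtoC (-1)) with (- RtoC 1) by (rewrite <- RtoC_opp; easy). ring.
Qed.
Lemma cF_1 : cF 1 = 0.
Proof.
  unfold cF. rewrite !conv_1, Da_1, cP_0, cQ_0, cR_0, cP_1, cQ_1, cR_1.
  replace (RtoC (-1)) with (- RtoC 1) by (rewrite <- RtoC_opp; easy). ring.
Qed.

(** * Vanishing in weight 8 with a double zero at the cusp *)

Lemma exp_ge_quad (x : R) : (0 <= x)%R -> (1 + x + x * x / 2 <= exp x)%R.
Proof.
  intros Hx.
  assert (H : (exp 0 - 1 - 0 - 0 * 0 / 2 <= exp x - 1 - x - x * x / 2)%R).
  { destruct (MVT_gen (fun u => exp u - 1 - u - u * u / 2)%R 0 x (fun u => exp u - 1 - u)%R) as [c [Hc E]].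
    - intros u _. auto_derive; [easy|field].
    - intros u _. apply continuity_pt_filterlim, (ex_derive_continuous (fun u => exp u - 1 - u - u * u / 2)%R).
      auto_derive. easy.
    - rewrite Rmin_left, Rmax_right in Hc by lra. pose proof (exp_ineq1_le c).
      assert (0 <= (exp c - 1 - c) * (x - 0))%R by (apply Rmult_le_pos; lra). lra. }
  rewrite exp_0 in H. lra.
Qed.

Lemma pow4_le_exp (u : R) : (0 <= u)%R -> (u ^ 4 <= exp (2 * u))%R.
Proof.
  intros Hu. replace (2 * u)%R with (u / 2 + u / 2 + u / 2 + u / 2)%R by field.
  rewrite !exp_plus. pose proof (exp_ge_quad (u / 2) ltac:(lra)) as H.
  assert (H1 : (u <= exp (u / 2))%R) by nra.
  set (e := exp (u / 2)) in *. assert (H2 : (u * u <= e * e)%R) by nra.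
  replace (u ^ 4)%R with (u * u * (u * u))%R by ring. replace (e * e * e * e)%R with (e * e * (e * e))%R by ring.
  apply Rmult_le_compat; nra.
Qed.

Lemma PI_gt_3 : (3 < PI)%R. Proof. pose proof PI2_3_2. lra. Qed.

(** The exponent 4 is half the weight: Im scales by |ct+d|^-2 and |F| by |ct+d|^8, so the product is
    invariant under the group. *)
Definition Phi (a : nat -> C) (t : C) : R := (Im t ^ 4 * Cmod (Fs a t))%R.

Section Weight8.
Variable a : nat -> C.
Hypothesis Ha : growth a.
Hypothesis Ha0 : a 0%nat = 0.
Hypothesis Ha1 : a 1%nat = 0.
Hypothesis HS : forall t, (0 < Im t)%R -> Fs a (- / t) = Cpow t 8 * Fs a t.

Lemma Phi_invariant (g : SL2Z) : forall t, (0 < Im t)%R -> Phi a (mob g t) = Phi a t.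
Proof.
  revert g. apply (gen_ind (fun g => forall t, (0 < Im t)%R -> Phi a (mob g t) = Phi a t)).
  - intros t Ht. pose proof (upper_neq_0 t Ht) as Ht0. apply Cmod_gt_0 in Ht0.
    rewrite mob_gS. unfold Phi. rewrite HS, Im_S, Cmod_mult, Cmod_pow by easy.
    field. lra.
  - intros t Ht. rewrite mob_gT. unfold Phi. now rewrite Im_add_IZR, Fs_shift.
  - intros t Ht. rewrite mob_gT. unfold Phi. rewrite Im_add_IZR.
    rewrite <- (Fs_shift a (t + IZR (-1))). do 3 f_equal.
    replace (RtoC (-1)) with (- RtoC 1) by (rewrite <- RtoC_opp; easy). ring.
  - intros g h Hg Hh t Ht. rewrite (proj1 (mob_mul g h t Ht)), Hg by now apply mob_upper. now apply Hh.
Qed.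

Lemma Phi_reduce (B : R) : (forall t, in_FD t -> (Phi a t <= B)%R) -> forall t, (0 < Im t)%R -> (Phi a t <= B)%R.
Proof.
  intros H t Ht. destruct (FD_exists t Ht) as [g Hg]. rewrite <- (Phi_invariant g t Ht). now apply H.
Qed.

Lemma Phi_bounded : exists B, (0 <= B)%R /\ forall t, (0 < Im t)%R -> (Phi a t <= B)%R.
Proof.
  assert (G1 := growth_shift a Ha).
  destruct (Ps_bounded (fun n => a (S n)) (/ 2) G1 ltac:(lra)) as [M [HM0 HM]].
  exists M. split; [easy|]. apply Phi_reduce. intros t Ht. pose proof (FD_height t Ht) as Hy.
  set (y := Im t) in *. pose proof PI_gt_3 as Hpi.
  assert (Hq : (Cmod (qexp t) <= exp (- (6 * y)))%R).
  { rewrite Cmod_qexp. fold y. apply Rlt_le, exp_increasing. nra. }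
  assert (Hq2 : (exp (- (6 * y)) <= / 2)%R).
  { rewrite exp_Ropp. apply Rinv_le_contravar; [lra|]. pose proof (exp_ineq1_le (6 * y)). lra. }
  unfold Phi. fold y. unfold Fs. rewrite Ps_incr, Ha0, Cplus_0_l, Cmod_mult by (easy || lra).
  assert (H4 : (y ^ 4 * exp (- (6 * y)) <= 1)%R).
  { pose proof (pow4_le_exp y ltac:(lra)) as H. rewrite exp_Ropp.
    apply Rmult_le_reg_r with (exp (6 * y)); [apply exp_pos|].
    rewrite Rmult_assoc, Rinv_l, Rmult_1_r, Rmult_1_l by (apply Rgt_not_eq, exp_pos).
    eapply Rle_trans; [exact H|]. apply Rlt_le, exp_increasing. lra. }
  specialize (HM (qexp t) ltac:(lra)).
  set (p := Cmod (Ps (fun n => a (S n)) (qexp t))) in *. assert (0 <= p)%R by apply Cmod_ge_0.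
  assert (0 <= y ^ 4)%R by (apply pow_le; lra). pose proof (Cmod_ge_0 (qexp t)).
  assert (y ^ 4 * Cmod (qexp t) <= 1)%R by (eapply Rle_trans; [|exact H4]; now apply Rmult_le_compat_l).
  assert (0 <= y ^ 4 * Cmod (qexp t))%R by now apply Rmult_le_pos. nra.
Qed.

(* If y^4 |F| <= B on H, the Cauchy estimates at height 1/n give |a_n| <= B n^4 e^(2 pi);
   summing over n >= 2 on the fundamental domain improves B to B/2. *)
Lemma Phi_contract (B : R) : (0 <= B)%R -> (forall t, (0 < Im t)%R -> (Phi a t <= B)%R) ->
  forall t, (0 < Im t)%R -> (Phi a t <= B / 2)%R.
Proof.
  intros HB0 HB. apply Phi_reduce. intros t Ht. pose proof (FD_height t Ht) as Hy.
  assert (Hpos : (0 < Im t)%R) by lra.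
  assert (Hcoef : forall n, (1 <= n)%nat -> (Cmod (a n) <= B * INR n ^ 4 * exp (2 * PI))%R).
  { intros n Hn. assert (Hn1 : (1 <= INR n)%R) by now apply (le_INR 1).
    assert (Hyn : (0 < / INR n)%R) by (apply Rinv_0_lt_compat; lra).
    pose proof (Fs_Cauchy a (/ INR n) (B * INR n ^ 4) n Ha Hyn) as H.
    assert (H' : (Cmod (a n) * exp (- (2 * PI * / INR n)) ^ n <= B * INR n ^ 4)%R).
    { apply H. intros x. assert (H0 := HB (x, / INR n)%R Hyn). unfold Phi in H0. simpl Im in H0.
      apply Rmult_le_reg_l with ((/ INR n) ^ 4)%R; [now apply pow_lt|]. eapply Rle_trans; [exact H0|].
      right. field. lra. }
    replace (exp (- (2 * PI * / INR n)) ^ n)%R with (/ exp (2 * PI))%R in H'.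
    - apply Rmult_le_reg_r with (/ exp (2 * PI))%R; [apply Rinv_0_lt_compat, exp_pos|].
      eapply Rle_trans; [exact H'|]. right. field. apply Rgt_not_eq, exp_pos.
    - rewrite <- exp_Ropp, <- Rpower_pow by apply exp_pos. unfold Rpower. rewrite ln_exp. f_equal. field. lra. }
  (* With u = n y >= 1 the n-th term is at most B u^4 e^(2 pi (1-u)) <= B e^(2u) e^(6(1-u)) = B e^6
     r^n. *)
  set (y := Im t) in *. set (r := exp (- (4 * y))). pose proof PI_gt_3 as Hpi.
  assert (Hr0 : (0 < r)%R) by apply exp_pos.
  assert (Hr1 : (r <= / 10)%R).
  { unfold r. rewrite exp_Ropp. apply Rinv_le_contravar; [lra|].
    pose proof (exp_ge_quad (4 * y) ltac:(lra)). nra. }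
  (* The geometric series from n = 2 is at most e^6 r^2/(1-r) <= (9/20)(10/9) = 1/2, which is the
     contraction factor. *)
  assert (Hr2 : (exp 6 * (r * r) <= 9 / 20)%R).
  { unfold r. rewrite <- !exp_plus. replace (6 + (- (4 * y) + - (4 * y)))%R with (- (8 * y - 6))%R by ring.
    rewrite exp_Ropp. replace (9 / 20)%R with (/ (20 / 9))%R by field. apply Rinv_le_contravar; [lra|].
    pose proof (exp_ge_quad (8 * y - 6) ltac:(lra)). nra. }
  pose proof (growth_summable a (qexp t) Ha (Cmod_qexp_lt_1 t Hpos)) as Hs.
  unfold Phi, Fs, Ps. fold y.
  assert (Hs1 : summable (fun n => a (S n) * Cpow (qexp t) (S n))) by now apply (summable_incr_1 (fun n => a n * Cpow (qexp t) n)).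
  rewrite (Cser_incr_1 _ Hs), (Cser_incr_1 _ Hs1).
  rewrite Ha0, Ha1, !Cmult_0_l, !Cplus_0_l.
  rewrite <- (Cmod_RtoC_pos (y ^ 4)) by (apply pow_le; lra). rewrite <- Cmod_mult, <- Cser_scal.
  2: { now apply (summable_incr_1 (fun n => a (S n) * Cpow (qexp t) (S n))). }
  eapply Rle_trans; [apply (Cmod_Cser_le _ (fun n => B * exp 6 * (r * r) * r ^ n)%R)|].
  - intros n. rewrite !Cmod_mult, Cmod_pow, Cmod_qexp, Cmod_RtoC_pos by (apply pow_le; lra). fold y.
    set (N := S (S n)). assert (HN : (2 <= INR N)%R) by (apply (le_INR 2); lia).
    assert (E : (exp (- (2 * PI * y)) ^ N = exp (- (2 * PI * (INR N * y))))%R).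
    { rewrite <- Rpower_pow by apply exp_pos. unfold Rpower. rewrite ln_exp. f_equal. ring. }
    rewrite E.
    apply Rle_trans with (y ^ 4 * (B * INR N ^ 4 * exp (2 * PI) * exp (- (2 * PI * (INR N * y)))))%R.
    { apply Rmult_le_compat_l; [apply pow_le; lra|]. apply Rmult_le_compat_r; [apply Rlt_le, exp_pos|]. apply Hcoef. lia. }
    replace (y ^ 4 * (B * INR N ^ 4 * exp (2 * PI) * exp (- (2 * PI * (INR N * y)))))%R
      with (B * ((INR N * y) ^ 4 * (exp (2 * PI) * exp (- (2 * PI * (INR N * y))))))%R by ring.
    rewrite <- exp_plus. set (u := (INR N * y)%R). assert (Hu : (1 <= u)%R) by (unfold u; nra).
    replace (B * exp 6 * (r * r) * r ^ n)%R with (B * (exp 6 * r ^ N))%R by (unfold N; simpl; ring).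
    apply Rmult_le_compat_l; [easy|].
    assert (Er : (r ^ N = exp (- (4 * u)))%R).
    { unfold r. rewrite <- Rpower_pow by apply exp_pos. unfold Rpower. rewrite ln_exp. f_equal. unfold u. ring. }
    rewrite Er.
    apply Rle_trans with (exp (2 * u) * exp (6 * (1 - u)))%R.
    + apply Rmult_le_compat; [apply pow_le; lra|apply Rlt_le, exp_pos|apply pow4_le_exp; lra|].
      destruct (Rle_lt_or_eq_dec (2 * PI + - (2 * PI * u)) (6 * (1 - u))) as [H|H]; [nra| |rewrite H; lra].
      now apply Rlt_le, exp_increasing.
    + rewrite <- !exp_plus. right. f_equal. ring.
  - apply (ex_series_scal (V := R_NormedModule) (B * exp 6 * (r * r))%R), ex_series_geom. rewrite Rabs_pos_eq; lra.
  - rewrite Series_scal_l, Series_geom by (rewrite Rabs_pos_eq; lra).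
    assert (/ (1 - r) <= 10 / 9)%R.
    { replace (10 / 9)%R with (/ (9 / 10))%R by field. apply Rinv_le_contravar; lra. }
    assert (0 < / (1 - r))%R by (apply Rinv_0_lt_compat; lra).
    replace (B * exp 6 * (r * r) * / (1 - r))%R with (B * (exp 6 * (r * r) * / (1 - r)))%R by ring.
    replace (B / 2)%R with (B * (9 / 20 * (10 / 9)))%R by field.
    apply Rmult_le_compat_l; [easy|]. apply Rmult_le_compat; try lra.
    pose proof (exp_pos 6). nra.
Qed.

Lemma weight8_vanish (t : C) : (0 < Im t)%R -> Fs a t = 0.
Proof.
  intros Ht. destruct Phi_bounded as [B [HB0 HB]].
  assert (H : forall n t, (0 < Im t)%R -> (Phi a t <= B / 2 ^ n)%R).
  { induction n as [|n IH]; intros u Hu; [simpl; rewrite Rdiv_1_r; now apply HB|].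
    replace (B / 2 ^ S n)%R with (B / 2 ^ n / 2)%R by (simpl; field; apply pow_nonzero; lra).
    apply Phi_contract; try easy.
    apply Rmult_le_pos; [easy|]. apply Rlt_le, Rinv_0_lt_compat, pow_lt. lra. }
  assert (H0 : (Phi a t <= 0)%R).
  { apply Rnot_lt_le. intros Hp.
    destruct (nfloor_ex (B / Phi a t)) as [N HN]; [apply Rmult_le_pos; [easy|apply Rlt_le, Rinv_0_lt_compat; easy]|].
    specialize (H (S N) t Ht).
    assert (Hpw : (INR N + 1 <= 2 ^ S N)%R).
    { rewrite <- (pow_INR 2), <- S_INR. apply le_INR, Nat.lt_le_incl, Nat.pow_gt_lin_r. lia. }
    apply Rle_div_r in H; [|apply pow_lt; lra].
    assert (H1 : (B < (INR N + 1) * Phi a t)%R) by (apply (proj1 (Rlt_div_l B (INR N + 1) (Phi a t) Hp)); lra).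
    nra. }
  unfold Phi in H0. assert (0 < Im t ^ 4)%R by now apply pow_lt. pose proof (Cmod_ge_0 (Fs a t)).
  apply Cmod_eq_0. nra.
Qed.
End Weight8.

Lemma ramanujan_R (t : C) : (0 < Im t)%R -> 2 * Fs (Da cR) t = eP t * eR t - eQ t * eQ t.
Proof.
  intros Ht. pose proof (weight8_vanish cF growth_cF cF_0 cF_1 cF_S t Ht) as H.
  rewrite cF_eq in H by easy.
  replace (2 * Fs (Da cR) t) with (eQ t * eQ t - eP t * eR t + 2 * Fs (Da cR) t - eQ t * eQ t + eP t * eR t) by ring.
  rewrite H. ring.
Qed.

Lemma cder_eQ (t : C) : (0 < Im t)%R -> cder eQ t (twopii * ((eP t * eQ t - eR t) / 3)).
Proof.
  intros Ht. apply cder_eq with (twopii * Fs (Da cQ) t).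
  - rewrite eR_eq by easy. field.
  - apply cder_Fs; [apply growth_cQ|easy].
Qed.

Lemma cder_eR (t : C) : (0 < Im t)%R -> cder eR t (twopii * ((eP t * eR t - eQ t * eQ t) / 2)).
Proof.
  intros Ht. apply cder_eq with (twopii * Fs (Da cR) t).
  - rewrite <- ramanujan_R by easy. field.
  - apply cder_Fs; [apply growth_cR|easy].
Qed.

(** * The eta function *)

(** The divisor sum taken over the complementary divisor. In this form N * clog (N/m) = m holds term
    by term, so q d/dq turns it into sigma_1 without reindexing divisors. *)
Definition colam (c : nat -> C) (N : nat) : C :=
  csum (fun m => if Nat.eqb (N mod S m) 0 then c (N / S m)%nat else 0) N.

Lemma growth_colam (c : nat -> C) : growth c -> growth (colam c).
Proof.
  intros (K & k & HK & H). apply growth_bounded with (S k) K. intros N. unfold colam.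
  eapply Rle_trans; [apply Cmod_csum|].
  apply Rle_trans with (rsum (fun _ => K * (INR N + 1) ^ k)%R N).
  - pose proof (pos_INR N). apply rsum_le. intros d Hd. destruct (_ =? _)%nat.
    + eapply Rle_trans; [apply H|]. apply Rmult_le_compat_l; [easy|]. apply pow_incr.
      pose proof (pos_INR (N / S d)). assert (INR (N / S d) <= INR N)%R by (apply le_INR, Nat.Div0.div_le_upper_bound; nia). lra.
    + rewrite Cmod_0. apply Rmult_le_pos; [easy|]. apply pow_le. lra.
  - rewrite rsum_const. simpl. pose proof (pos_INR N). pose proof (pow_INR_ge_1 N k). nra.
Qed.

Lemma Lambert_co (c : nat -> C) (q : C) : growth c -> (Cmod q < 1)%R ->
  Cser (fun m => Cser (fun d => c (S d) * Cpow q (S m * S d))) = Ps (colam c) q.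
Proof.
  intros Hc Hq. destruct (Lambert c q Hc Hq) as (HT & _ & _).
  set (T := fun m d => c (S d) * Cpow q (S m * S d)) in *.
  set (r := Cmod q) in *. assert (Hr : (0 <= r)%R) by apply Cmod_ge_0.
  assert (HcS : ex_series (fun d => Cmod (c (S d)) * r ^ S d)%R).
  { apply (ex_series_incr_1 (fun d => Cmod (c d) * r ^ d)%R). now apply growth_ex_series. }
  assert (HTb : forall m d, (Cmod (T m d) <= r ^ m * (Cmod (c (S d)) * r ^ S d))%R).
  { intros m d. unfold T. rewrite Cmod_mult, Cmod_pow. fold r.
    replace (S m * S d)%nat with (m + S d + m * d)%nat by nia. rewrite !pow_add.
    assert (Hp : (r ^ (m * d) <= 1)%R) by (rewrite <- (pow1 (m * d)); apply pow_incr; lra).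
    assert (0 <= r ^ m)%R by now apply pow_le. assert (0 <= r ^ S d)%R by now apply pow_le.
    pose proof (Cmod_ge_0 (c (S d))) as Hc0.
    replace (Cmod (c (S d)) * (r ^ m * r ^ S d * r ^ (m * d)))%R with (r ^ m * (Cmod (c (S d)) * r ^ S d) * r ^ (m * d))%R by ring.
    rewrite <- (Rmult_1_r (r ^ m * (Cmod (c (S d)) * r ^ S d))) at 2.
    apply Rmult_le_compat_l; [|easy]. apply Rmult_le_pos; [easy|now apply Rmult_le_pos]. }
  set (a := fun m => sparse (RtoC 0) (S m) (fun d => T m d)).
  assert (Ha : forall m, summable (a m) /\ Cser (a m) = Cser (fun d => T m d) /\
    (Series (fun N => Cmod (a m N)) <= Series (fun d => Cmod (T m d)))%R).
  { intros m. apply Cser_sparse; [lia|apply HT]. }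
  destruct (fubini a (fun m => r ^ m * Series (fun d => Cmod (c (S d)) * r ^ S d))%R) as (_ & _ & _ & E2).
  - intros m. apply Ha.
  - intros m. eapply Rle_trans; [apply Ha|]. rewrite <- Series_scal_l.
    apply Series_le; [|now apply (ex_series_scal (V := R_NormedModule) (r ^ m)%R)].
    intros d. split; [apply Cmod_ge_0|apply HTb].
  - apply ex_series_scal_r, ex_series_geom. now rewrite Rabs_pos_eq.
  - transitivity (Cser (fun m => Cser (a m))); [apply Cser_ext; intros m; symmetry; apply Ha|].
    rewrite E2. apply Cser_ext. intros N. unfold colam. rewrite (Cser_finite _ N).
    + rewrite Cmult_comm, <- csum_scal. apply csum_ext. intros m Hm. unfold a, sparse, T.
      destruct N as [|n]; [lia|]. destruct (Nat.eqb_spec (S n mod S m) 0) as [E|E]; [|ring].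
      apply Nat.Div0.div_exact in E.
      assert (S n / S m <> 0)%nat by (intros E0; rewrite E0 in E; lia).
      replace (S (S n / S m - 1)) with (S n / S m)%nat by lia. rewrite <- E. ring.
    + intros m Hm. unfold a, sparse. destruct N as [|n]; [easy|].
      destruct (Nat.eqb_spec (S n mod S m) 0) as [E|E]; [|easy].
      destruct (Nat.eq_dec m n) as [->|Hn]; [lia|]. rewrite Nat.mod_small in E by lia. easy.
Qed.

(* Coefficients of - log (1 - q). *)
Definition clog (n : nat) : C := match n with O => 0 | _ => / INR n end.

Lemma growth_clog : growth clog.
Proof.
  apply growth_bounded with 0%nat 1%R. intros [|n].
  - simpl. rewrite Cmod_0. lra.
  - unfold clog. pose proof (INR_S_pos n). rewrite Cmod_inv by apply INR_S_neq_0.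
    rewrite Cmod_RtoC_pos by apply pos_INR. simpl pow. rewrite !Rmult_1_r, <- Rinv_1. apply Rinv_le_contravar; lra.
Qed.

Lemma Da_clog (n : nat) : Da clog (S n) = 1.
Proof. unfold Da, clog. field. apply INR_S_neq_0. Qed.

Lemma Fs_Da_clog (t : C) : (0 < Im t)%R -> Fs (Da clog) t = qexp t / (1 - qexp t).
Proof.
  intros Ht. assert (Hq := Cmod_qexp_lt_1 t Ht). unfold Fs.
  rewrite Ps_incr by (try apply growth_Da, growth_clog; easy).
  rewrite (Ps_ext _ (fun _ => 1)) by apply Da_clog. rewrite Ps_geom by easy.
  rewrite Da_0. unfold Cdiv. ring.
Qed.

(** No branch of the logarithm is chosen: 1 - q times the exponential of the series has derivative 0
    and tends to 1 at the cusp. *)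
Lemma exp_clog (t : C) : (0 < Im t)%R -> Cexp (- Fs clog t) = 1 - qexp t.
Proof.
  intros Ht. assert (H1 : (1 - qexp t) * Cexp (Fs clog t) = 1).
  { apply (tends_const_eq (fun t => (1 - qexp t) * Cexp (Fs clog t))); [| |easy].
    - intros u Hu.
      pose proof (one_minus_neq_0 (qexp u) (Cmod_qexp_lt_1 u Hu)) as Hn.
      apply cder_eq with ((0 - twopii * qexp u) * Cexp (Fs clog u) + (1 - qexp u) * (twopii * Fs (Da clog) u * Cexp (Fs clog u))).
      { rewrite Fs_Da_clog by easy. field. easy. }
      apply (cder_mult (fun x => 1 - qexp x) (fun x => Cexp (Fs clog x))).
      + apply cder_minus; [apply cder_const|apply cder_qexp].
      + apply cder_exp, cder_Fs; [apply growth_clog|easy].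
    - apply tends_eq with ((1 + (-1) * 0) * Cexp (clog 0)); [simpl clog; rewrite Cexp_0; ring|].
      apply tends_ext with (fun t => (1 + (-1) * qexp t) * Cexp (Fs clog t)).
      { intros u _. replace (RtoC (-1)) with (- RtoC 1) by (rewrite <- RtoC_opp; easy). ring. }
      apply tends_mult.
      + apply tends_plus; [apply tends_const|]. apply tends_mult; [apply tends_const|apply tends_qexp].
      + exact (tends_cont (Fs clog) Cexp _ _ (tends_Fs clog growth_clog) (cder_Cexp _)). }
  rewrite Cexp_opp. pose proof (Cexp_neq_0 (Fs clog t)) as He.
  transitivity ((1 - qexp t) * Cexp (Fs clog t) / Cexp (Fs clog t)); [rewrite H1|]; field; easy.
Qed.

Lemma Lambert_clog (t : C) : (0 < Im t)%R ->
  summable (fun m => Fs clog (INR (S m) * t)) /\ Cser (fun m => Fs clog (INR (S m) * t)) = Fs (colam clog) t.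
Proof.
  intros Ht. pose proof (Cmod_qexp_lt_1 t Ht) as Hq.
  destruct (Lambert clog (qexp t) growth_clog Hq) as (H1 & H2 & _).
  pose proof (Lambert_co clog (qexp t) growth_clog Hq) as H3.
  assert (E : forall m, Cser (fun d => clog (S d) * Cpow (qexp t) (S m * S d)) = Fs clog (INR (S m) * t)).
  { intros m. pose proof (Im_scal_pos m t Ht) as Hz. unfold Fs, Ps. symmetry. rewrite Cser_incr_1.
    - simpl clog at 1. rewrite Cmult_0_l, Cplus_0_l. apply Cser_ext. intros d.
      rewrite qexp_nat, <- Cpow_mult_r. easy.
    - apply growth_summable; [apply growth_clog|now apply Cmod_qexp_lt_1]. }
  split.
  - now apply (summable_ext _ _ E).
  - unfold Fs at 2. rewrite <- H3. apply Cser_ext. intros m. now rewrite E.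
Qed.

Lemma eta_pp_exp (t : C) (N : nat) : (0 < Im t)%R ->
  eta_pp (qexp t) N = Cexp (- csum (fun m => Fs clog (INR (S m) * t)) N).
Proof.
  intros Ht. induction N as [|N IH].
  - simpl. replace (- 0) with (RtoC 0) by ring. now rewrite Cexp_0.
  - change (eta_pp (qexp t) (S N)) with (eta_pp (qexp t) N * (1 - Cpow (qexp t) (S N))).
    rewrite IH, <- qexp_nat, <- exp_clog by now apply Im_scal_pos.
    rewrite <- Cexp_add. f_equal. change (csum ?f (S N)) with (csum f N + f N). cbv beta. ring.
Qed.

Lemma is_clim_cont (u : nat -> C) (l m : C) (f : C -> C) : is_clim u l -> cder f l m -> is_clim (fun n => f (u n)) (f l).
Proof.
  intros Hu Hf. apply is_clim_eps. intros eps He. destruct (cder_cont f l m Hf eps He) as [d [Hd H]].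
  destruct (proj1 (is_clim_eps u l) Hu d Hd) as [N HN]. exists N. intros n Hn.
  specialize (H _ (HN n Hn)). now replace (l + (u n - l)) with (u n) in H by ring.
Qed.

Lemma is_clim_filterlim (u : nat -> C) (l : C) :
  is_clim u l <-> filterlim u eventually (locally (T := C_UniformSpace) l).
Proof.
  rewrite is_clim_eps. split.
  - intros H P [eps HP]. destruct (H eps (cond_pos eps)) as [N HN]. exists N. intros n Hn. apply HP.
    apply (C_NormedModule_mixin_compat1 l (u n) eps). exact (HN n Hn).
  (* Balls of the uniform structure on C are squares, comparable with discs up to the factor sqrt 2
     <= 2, hence the radius eps/2. *)
  - intros H eps He. assert (He' : (0 < eps / 2)%R) by lra.
    destruct (H (fun z => ball (M := C_UniformSpace) l (mkposreal _ He') z)) as [N HN].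
    { exists (mkposreal _ He'). easy. }
    exists N. intros n Hn. specialize (HN n Hn).
    pose proof (C_NormedModule_mixin_compat2 l (u n) (mkposreal _ He') HN) as Hb. simpl in Hb.
    eapply Rlt_le_trans; [exact Hb|].
    assert (sqrt 2 <= 2)%R by (rewrite <- (sqrt_square 2) at 2 by lra; apply sqrt_le_1; lra). nra.
Qed.

Lemma Clim_unique (u : nat -> C) (l : C) : is_clim u l -> Clim u = l.
Proof.
  intros H. unfold Clim. apply is_clim_unique with u; [|exact H]. apply is_clim_filterlim.
  apply (epsilon_spec (inhabits (RtoC 0)) (fun l : C => filterlim u eventually (locally (T := C_UniformSpace) l))).
  exists l. now apply is_clim_filterlim.
Qed.

(** A global logarithm of eta read off from the product. It makes eta visibly non-zero and gives its
    logarithmic derivative 2 pi i E2/24. *)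
Definition elog (t : C) : C := twopii * t / 24 - Fs (colam clog) t.

Lemma eta_exp (t : C) : (0 < Im t)%R -> eta t = Cexp (elog t).
Proof.
  intros Ht. unfold eta, elog. destruct (Lambert_clog t Ht) as [Hs E].
  rewrite (Clim_unique _ (Cexp (- Fs (colam clog) t))).
  - rewrite <- Cexp_add. f_equal.
  - apply is_clim_ext with (fun N => Cexp (- csum (fun m => Fs clog (INR (S m) * t)) N)).
    + intros N. now rewrite eta_pp_exp.
    + apply is_clim_cont with (m := Cexp (- Fs (colam clog) t)) (f := Cexp); [|apply cder_Cexp].
      rewrite <- E. apply is_clim_ext with (fun N => (-1) * csum (fun m => Fs clog (INR (S m) * t)) N).
      { intros n. replace (RtoC (-1)) with (- RtoC 1) by (rewrite <- RtoC_opp; easy). ring. }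
      replace (- Cser (fun m => Fs clog (INR (S m) * t))) with ((-1) * Cser (fun m => Fs clog (INR (S m) * t)))
        by (replace (RtoC (-1)) with (- RtoC 1) by (rewrite <- RtoC_opp; easy); ring).
      now apply is_clim_scal, Cser_lim.
Qed.

Lemma Da_colam_clog (N : nat) : Da (colam clog) N = lam1 N.
Proof.
  unfold Da, colam, lam1, lam. rewrite <- csum_scal. apply csum_ext. intros m Hm.
  destruct (Nat.eqb_spec (N mod S m) 0) as [E|E]; [|ring].
  apply Nat.Div0.div_exact in E. destruct (N / S m)%nat as [|k] eqn:Ek; [lia|].
  unfold clog. rewrite E at 1. rewrite mult_INR, RtoC_mult, pow_1. field. apply INR_S_neq_0.
Qed.

Lemma cder_elog (t : C) : (0 < Im t)%R -> cder elog t (twopii * (eP t / 24)).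
Proof.
  intros Ht. apply cder_eq with (twopii / 24 * 1 - twopii * Fs (Da (colam clog)) t).
  - rewrite eP_S1 by easy. unfold S1. fold lam1. unfold Fs. rewrite (Ps_ext _ _ _ Da_colam_clog). field.
  - unfold elog. apply cder_minus.
    + apply cder_ext with (fun x => twopii / 24 * x); [intros x; field|]. apply cder_scal, cder_id.
    + apply cder_Fs; [apply growth_colam, growth_clog|easy].
Qed.

Lemma eta_neq_0 (t : C) : (0 < Im t)%R -> eta t <> 0.
Proof. intros Ht. rewrite eta_exp by easy. apply Cexp_neq_0. Qed.

Lemma eta_pow_exp (t : C) (n : nat) : (0 < Im t)%R -> Cpow (eta t) n = Cexp (INR n * elog t).
Proof. intros Ht. now rewrite eta_exp, Cexp_nat. Qed.

Lemma cder_eta_pow (n : nat) (t : C) : (0 < Im t)%R ->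
  cder (fun x => Cpow (eta x) n) t (twopii * (INR n / 24 * eP t * Cpow (eta t) n)).
Proof.
  intros Ht. apply cder_ext_loc with (fun x => Cexp (INR n * elog x)) (Im t); [easy| |].
  - intros x Hx. rewrite eta_pow_exp; [easy|]. now apply upper_ball with t.
  - apply cder_eq with (INR n * (twopii * (eP t / 24)) * Cexp (INR n * elog t)).
    + rewrite <- eta_pow_exp by easy. field.
    + apply (cder_exp (fun x => INR n * elog x)), (cder_scal (INR n) elog). now apply cder_elog.
Qed.

Lemma eta_shift (t : C) : (0 < Im t)%R -> eta (t + 1) = Cexp (twopii / 24) * eta t.
Proof.
  intros Ht. assert (Ht' : (0 < Im (t + 1))%R) by (rewrite (Im_add_IZR t 1); easy).
  rewrite !eta_exp, <- Cexp_add by easy. f_equal. unfold elog. rewrite Fs_shift. field.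
Qed.

(** The quotient of the two sides has zero derivative, because the term 2/x produced by the
    inhomogeneous part of E2 is that of x^2. The constant is read off at the fixed point i, where
    x^2 = -1; the fourth power avoids the square root of t. *)
Lemma eta4_S (t : C) : (0 < Im t)%R -> Cpow (eta (- / t)) 4 = - (t * t) * Cpow (eta t) 4.
Proof.
  intros Ht. pose proof twopii_neq_0 as Hk.
  set (f := fun x => Cpow (eta (- / x)) 4 * / (x * x * Cpow (eta x) 4)).
  assert (Hn : forall x, (0 < Im x)%R -> x <> 0 /\ Cpow (eta x) 4 <> 0).
  { intros x Hx. split; [now apply upper_neq_0|]. now apply Cpow_nz, eta_neq_0. }
  assert (Hd : forall x, (0 < Im x)%R -> cder f x 0).
  { intros x Hx. destruct (Hn x Hx) as [Hx0 Hex]. pose proof (Im_neg_inv x Hx) as Hx'.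
    assert (Hg : x * x * Cpow (eta x) 4 <> 0) by (apply Cmult_neq_0; [now apply Cmult_neq_0|exact Hex]).
    set (E := Cpow (eta (- / x)) 4). set (e := Cpow (eta x) 4) in *.
    apply cder_eq with (/ (x * x) * (twopii * (INR 4 / 24 * eP (- / x) * E)) * / (x * x * e)
      + E * (- ((1 * x + x * 1) * e + x * x * (twopii * (INR 4 / 24 * eP x * e))) / ((x * x * e) * (x * x * e)))).
    - rewrite eP_S by easy. replace (RtoC (INR 4)) with (RtoC 4) by (simpl; f_equal; ring). field. repeat split; easy.
    - unfold f. apply (cder_mult (fun x => Cpow (eta (- / x)) 4) (fun x => / (x * x * Cpow (eta x) 4))).
      + apply (cder_comp (fun x => - / x) (fun x => Cpow (eta x) 4)); [now apply cder_neg_inv|now apply cder_eta_pow].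
      + apply (cder_Cinv (fun x => x * x * Cpow (eta x) 4)); [easy|].
        apply (cder_mult (fun x => x * x) (fun x => Cpow (eta x) 4)).
        * apply (cder_mult (fun x => x) (fun x => x)); apply cder_id.
        * now apply cder_eta_pow. }
  assert (HCi : (0 < Im Ci)%R) by (unfold Im; simpl; lra).
  pose proof (upper_const f Hd t Ci Ht HCi) as E.
  assert (EI : f Ci = -1).
  { unfold f. destruct (Hn Ci HCi) as [_ H4]. replace (- / Ci) with Ci.
    - rewrite Ci_sqr. set (e4 := Cpow (eta Ci) 4) in *. field. easy.
    - pose proof Ci_neq_0. transitivity (Ci * Ci / Ci); [field; easy|]. rewrite Ci_sqr.
      replace (RtoC (-1)) with (- RtoC 1) by (rewrite <- RtoC_opp; easy). field. easy. }
  rewrite EI in E. destruct (Hn t Ht) as [Ht0 Het]. unfold f in E.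
  transitivity (Cpow (eta (- / t)) 4 * / (t * t * Cpow (eta t) 4) * (t * t * Cpow (eta t) 4)).
  { set (e4 := Cpow (eta t) 4) in *. field; split; easy. }
  rewrite E. replace (RtoC (-1)) with (- RtoC 1) by (rewrite <- RtoC_opp; easy). ring.
Qed.

(** * The modular invariant *)

Lemma sig3_aux_csum (m d : nat) :
  csum (fun k => if Nat.eqb (m mod S k) 0 then RtoC (INR (S k) ^ 3) else 0) d = RtoC (INR (sig3_aux m d)).
Proof.
  induction d as [|k IH]; [easy|].
  change (csum ?f (S k)) with (csum f k + f k). rewrite IH. cbv beta.
  change (sig3_aux m (S k)) with ((if Nat.eqb (m mod (S k)) 0 then (S k) ^ 3 else 0) + sig3_aux m k)%nat.
  rewrite plus_INR, RtoC_plus. destruct (_ =? _)%nat.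
  - rewrite pow_INR. ring.
  - simpl (INR 0). ring.
Qed.

Lemma E4_eQ (t : C) : (0 < Im t)%R -> E4 t = eQ t.
Proof.
  intros Ht. rewrite eQ_S3 by easy. unfold E4. f_equal. f_equal.
  assert (Hs := growth_summable lam3 (qexp t) growth_lam3 (Cmod_qexp_lt_1 t Ht)).
  assert (E : forall N, E4_ps (qexp t) N = csum (fun n => lam3 (S n) * Cpow (qexp t) (S n)) N).
  { induction N as [|N IH]; [easy|].
    change (E4_ps (qexp t) (S N)) with (E4_ps (qexp t) N + RtoC (INR (sigma3 (S N))) * Cpow (qexp t) (S N)).
    rewrite IH. unfold sigma3. rewrite <- sig3_aux_csum. easy. }
  apply Clim_unique. unfold S3. fold lam3. unfold Fs, Ps. rewrite Cser_incr_1 by easy.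
  replace (lam3 0 * Cpow (qexp t) 0) with (RtoC 0) by (unfold lam3; rewrite lam_0; ring). rewrite Cplus_0_l.
  apply is_clim_ext with (csum (fun n => lam3 (S n) * Cpow (qexp t) (S n))); [intros; now rewrite E|].
  apply Cser_lim. now apply (summable_incr_1 (fun n => lam3 n * Cpow (qexp t) n)).
Qed.

Lemma Delta_neq_0 (t : C) : (0 < Im t)%R -> Defs.Delta t <> 0.
Proof. intros Ht. apply Cpow_nz. now apply eta_neq_0. Qed.

Lemma cder_Delta (t : C) : (0 < Im t)%R -> cder Defs.Delta t (twopii * (eP t * Defs.Delta t)).
Proof.
  intros Ht. apply cder_eq with (twopii * (INR 24 / 24 * eP t * Cpow (eta t) 24)).
  - replace (RtoC (INR 24)) with (RtoC 24) by (f_equal; simpl; ring). fold (Defs.Delta t). field.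
  - now apply cder_eta_pow.
Qed.

(** Coefficients of E4^3 - E6^2. The first two, 0 and 1728, suffice to compare it with Delta. *)
Definition cN (n : nat) : C := conv cQ (conv cQ cQ) n + (-1) * conv cR cR n.

Lemma growth_cN : growth cN.
Proof.
  pose proof growth_cQ. pose proof growth_cR.
  apply growth_plus; [|apply growth_scal]; repeat apply growth_conv; easy.
Qed.

Lemma cN_eq (t : C) : (0 < Im t)%R -> Fs cN t = Cpow (eQ t) 3 - Cpow (eR t) 2.
Proof.
  intros Ht. pose proof growth_cQ. pose proof growth_cR. unfold cN.
  rewrite Fs_plus, Fs_scal by (try easy; try apply growth_scal; repeat apply growth_conv; easy).
  rewrite !Fs_mult by (try easy; repeat apply growth_conv; easy). fold (eQ t) (eR t). simpl.
  replace (RtoC (-1)) with (- RtoC 1) by (rewrite <- RtoC_opp; easy). unfold eQ, eR. ring.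
Qed.

Lemma cN_0 : cN 0 = 0.
Proof.
  unfold cN. rewrite !conv_0, cQ_0, cR_0.
  replace (RtoC (-1)) with (- RtoC 1) by (rewrite <- RtoC_opp; easy). ring.
Qed.

Lemma cN_1 : cN 1 = 1728.
Proof.
  unfold cN. rewrite !conv_1, !conv_0, cQ_0, cR_0, cQ_1, cR_1.
  replace (RtoC (-1)) with (- RtoC 1) by (rewrite <- RtoC_opp; easy). ring.
Qed.

Lemma Cexp_elog_24 (t : C) : (0 < Im t)%R -> Defs.Delta t = qexp t * Cexp (- (24) * Fs (colam clog) t).
Proof.
  intros Ht. unfold Defs.Delta. rewrite eta_pow_exp by easy. unfold qexp. rewrite <- Cexp_add. f_equal.
  replace (RtoC (INR 24)) with (RtoC 24) by (f_equal; simpl; ring). unfold elog, twopii. field.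
Qed.

Lemma tends_qexp_fraction (a : nat -> C) : growth a -> a 0%nat = 0 ->
  tends (fun t => Fs a t / Defs.Delta t) (a 1%nat).
Proof.
  intros Ha H0.
  apply tends_ext with (fun t => Fs (fun n => a (S n)) t * / Cexp (- (24) * Fs (colam clog) t)).
  - intros t Ht. rewrite Cexp_elog_24 by easy. pose proof (qexp_neq_0 t).
    pose proof (Cexp_neq_0 (- (24) * Fs (colam clog) t)).
    unfold Fs at 3. rewrite Ps_incr, H0 by (try easy; now apply Cmod_qexp_lt_1). fold (Fs (fun n => a (S n)) t).
    field. split; easy.
  - apply tends_eq with (a 1%nat * / Cexp (- (24) * colam clog 0)).
    + change (colam clog 0) with (RtoC 0). replace (- (24) * 0) with (RtoC 0) by ring. rewrite Cexp_0. field.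
    + apply tends_mult; [exact (tends_Fs (fun n => a (S n)) (growth_shift a Ha))|].
      apply tends_inv; [apply Cexp_neq_0|].
      refine (tends_cont (fun t => - (24) * Fs (colam clog) t) Cexp _ _ _ (cder_Cexp _)).
      apply (tends_mult (fun _ => - (24)) (Fs (colam clog))); [apply tends_const|].
      apply tends_Fs, growth_colam, growth_clog.
Qed.

(** By Ramanujan's equations both sides satisfy D g = E2 g, so their quotient is constant; at the
    cusp it is the ratio of the coefficients of q. *)
Lemma discriminant (t : C) : (0 < Im t)%R -> Cpow (eQ t) 3 - Cpow (eR t) 2 = 1728 * Defs.Delta t.
Proof.
  intros Ht. pose proof (Delta_neq_0 t Ht) as HD.
  assert (E : (fun x => (Cpow (eQ x) 3 - Cpow (eR x) 2) / Defs.Delta x) t = 1728).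
  { apply (tends_const_eq (fun x => (Cpow (eQ x) 3 - Cpow (eR x) 2) / Defs.Delta x)); [| |easy].
    - intros x Hx. pose proof (Delta_neq_0 x Hx) as HDx.
      set (N' := INR 3 * Cpow (eQ x) 2 * (twopii * ((eP x * eQ x - eR x) / 3))
        - INR 2 * Cpow (eR x) 1 * (twopii * ((eP x * eR x - eQ x * eQ x) / 2))).
      apply cder_eq with ((N' * Defs.Delta x - (Cpow (eQ x) 3 - Cpow (eR x) 2) * (twopii * (eP x * Defs.Delta x))) / (Defs.Delta x * Defs.Delta x)).
      + unfold N'. replace (RtoC (INR 3)) with (RtoC 3) by (f_equal; simpl; ring).
        replace (RtoC (INR 2)) with (RtoC 2) by (f_equal; simpl; ring). simpl. field. easy.
      + apply (cder_div (fun x => Cpow (eQ x) 3 - Cpow (eR x) 2) Defs.Delta); [easy| |now apply cder_Delta].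
        apply (cder_minus (fun x => Cpow (eQ x) 3) (fun x => Cpow (eR x) 2)).
        * apply cder_pow. now apply cder_eQ.
        * apply cder_pow. now apply cder_eR.
    - rewrite <- cN_1. apply tends_ext with (fun t => Fs cN t / Defs.Delta t).
      + intros x Hx. now rewrite cN_eq.
      + apply tends_qexp_fraction; [apply growth_cN|apply cN_0]. }
  cbv beta in E. rewrite <- E. field. easy.
Qed.

Lemma J_eq (t : C) : (0 < Im t)%R -> J t = Cpow (eQ t) 3 / (1728 * Defs.Delta t).
Proof. intros Ht. unfold J. now rewrite E4_eQ. Qed.

Lemma J_minus_1 (t : C) : (0 < Im t)%R -> J t - 1 = Cpow (eR t) 2 / (1728 * Defs.Delta t).
Proof.
  intros Ht. rewrite J_eq by easy. pose proof (Delta_neq_0 t Ht) as HD.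
  replace (Cpow (eR t) 2) with (Cpow (eQ t) 3 - 1728 * Defs.Delta t) by (rewrite <- discriminant by easy; ring).
  set (D := Defs.Delta t) in *. field. easy.
Qed.

Lemma cder_J (t : C) : (0 < Im t)%R ->
  cder J t (- twopii * (Cpow (eQ t) 2 * eR t / (1728 * Defs.Delta t))).
Proof.
  intros Ht. pose proof (Delta_neq_0 t Ht) as HD.
  assert (H1728 : RtoC 1728 <> 0) by (apply RtoC_neq; lra).
  apply cder_ext_loc with (fun x => Cpow (eQ x) 3 / (1728 * Defs.Delta x)) (Im t); [easy| |].
  - intros x Hx. symmetry. apply J_eq. now apply upper_ball with t.
  - apply cder_eq with (((INR 3 * Cpow (eQ t) 2 * (twopii * ((eP t * eQ t - eR t) / 3))) * (1728 * Defs.Delta t)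
      - Cpow (eQ t) 3 * (1728 * (twopii * (eP t * Defs.Delta t)))) / ((1728 * Defs.Delta t) * (1728 * Defs.Delta t))).
    + replace (RtoC (INR 3)) with (RtoC 3) by (f_equal; simpl; ring). set (D := Defs.Delta t) in *. simpl. field. easy.
    + apply (cder_div (fun x => Cpow (eQ x) 3) (fun x => 1728 * Defs.Delta x)).
      * now apply Cmult_neq_0.
      * apply cder_pow. now apply cder_eQ.
      * apply cder_scal. now apply cder_Delta.
Qed.

Lemma eta_pow_S (n : nat) (t : C) : (0 < Im t)%R ->
  Cpow (eta (- / t)) (4 * n) = Cpow (- (t * t)) n * Cpow (eta t) (4 * n).
Proof. intros Ht. rewrite !Cpow_mult_r, eta4_S by easy. now rewrite Cpow_mult_l. Qed.

Lemma Delta_S (t : C) : (0 < Im t)%R -> Defs.Delta (- / t) = Cpow t 12 * Defs.Delta t.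
Proof. intros Ht. unfold Defs.Delta. change 24%nat with (4 * 6)%nat. rewrite (eta_pow_S 6 t Ht). simpl. ring. Qed.

Lemma J_S (t : C) : (0 < Im t)%R -> J (- / t) = J t.
Proof.
  intros Ht. pose proof (Im_neg_inv t Ht). rewrite !J_eq, eQ_S, Delta_S by easy.
  pose proof (upper_neq_0 t Ht). pose proof (Delta_neq_0 t Ht) as HD. set (D := Defs.Delta t) in *. simpl. field. split; easy.
Qed.

Lemma upper_shift (t : C) : (0 < Im t)%R -> (0 < Im (t + 1))%R.
Proof. intros Ht. now rewrite (Im_add_IZR t 1). Qed.

Lemma Cexp_root24 : Cpow (Cexp (twopii / 24)) 24 = 1.
Proof.
  rewrite <- Cexp_nat. replace (RtoC (INR 24)) with (RtoC 24) by (f_equal; simpl; ring).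
  replace (24 * (twopii / 24)) with (2 * PI * Ci * 1) by (unfold twopii; field). exact qexp_1.
Qed.

Lemma J_shift (t : C) : (0 < Im t)%R -> J (t + 1) = J t.
Proof.
  intros Ht. rewrite !J_eq by (try apply upper_shift; easy). unfold eQ. rewrite Fs_shift.
  assert (E : Defs.Delta (t + 1) = Defs.Delta t); [|now rewrite E].
  unfold Defs.Delta. rewrite eta_shift, Cpow_mult_l, Cexp_root24 by easy. ring.
Qed.

Lemma shift_back (t : C) : t + -1 + 1 = t.
Proof. replace (RtoC (-1)) with (- RtoC 1) by (rewrite <- RtoC_opp; easy). ring. Qed.

Lemma J_mob (g : SL2Z) : forall t, (0 < Im t)%R -> J (mob g t) = J t.
Proof.
  revert g. apply (gen_ind (fun g => forall t, (0 < Im t)%R -> J (mob g t) = J t)).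
  - intros t Ht. rewrite mob_gS. now apply J_S.
  - intros t Ht. rewrite mob_gT. now apply J_shift.
  - intros t Ht. rewrite mob_gT. rewrite <- (J_shift (t + IZR (-1))) by (rewrite Im_add_IZR; easy).
    now rewrite shift_back.
  - intros g h Hg Hh t Ht. rewrite (proj1 (mob_mul g h t Ht)), Hg by now apply mob_upper. now apply Hh.
Qed.

(** Only the existence of a non-zero multiplier is propagated along words in the generators. That it
    defines a character follows in [f_n_mob] from the non-vanishing of eta^4. *)
Lemma eta4_multiplier (g : SL2Z) : exists chi : C, chi <> 0 /\ forall t, (0 < Im t)%R ->
  Cpow (eta (mob g t)) 4 = chi * Cpow (jfac g t) 2 * Cpow (eta t) 4.
Proof.
  assert (Hw : Cpow (Cexp (twopii / 24)) 4 <> 0) by apply Cpow_nz, Cexp_neq_0.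
  revert g. apply (gen_ind (fun g => exists chi : C, chi <> 0 /\ forall t, (0 < Im t)%R ->
    Cpow (eta (mob g t)) 4 = chi * Cpow (jfac g t) 2 * Cpow (eta t) 4)).
  - exists (- RtoC 1). split.
    + intros E. apply C1_neq_0. replace (RtoC 1) with (- - RtoC 1) by ring. rewrite E. ring.
    + intros t Ht. rewrite mob_gS, jfac_gS, eta4_S by easy. simpl. ring.
  - exists (Cpow (Cexp (twopii / 24)) 4). split; [easy|].
    intros t Ht. rewrite mob_gT, jfac_gT, eta_shift, Cpow_mult_l, Cpow_1_l by easy. ring.
  - exists (/ Cpow (Cexp (twopii / 24)) 4). split.
    + intros E. apply C1_neq_0. rewrite <- (Cinv_r _ Hw), E. ring.
    + intros t Ht. rewrite mob_gT, jfac_gT, Cpow_1_l.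
      rewrite <- (shift_back t) at 2. rewrite (eta_shift (t + -1)) by (rewrite (Im_add_IZR t (-1)); easy).
      rewrite Cpow_mult_l. set (w := Cpow (Cexp (twopii / 24)) 4) in *. field. easy.
  - intros g h (c1 & H1 & E1) (c2 & H2 & E2). exists (c1 * c2). split; [now apply Cmult_neq_0|].
    intros t Ht. destruct (mob_mul g h t Ht) as [Em Ej].
    rewrite Em, Ej, E1, E2, Cpow_mult_l by (try easy; now apply mob_upper). ring.
Qed.

(** * Real coefficients and reflection in the imaginary axis *)

Lemma Cconj_csum (a : nat -> C) (N : nat) : (forall n, Cconj (a n) = a n) -> Cconj (csum a N) = csum a N.
Proof.
  intros H. induction N as [|N IH]; simpl; [apply injective_projections; simpl; ring|].
  rewrite Cplus_conj, IH, H. easy.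
Qed.

Lemma Cconj_R (x : R) : Cconj (RtoC x) = RtoC x.
Proof. unfold Cconj, RtoC; simpl. f_equal. ring. Qed.

Lemma lam_real (c : nat -> C) (n : nat) : (forall n, Cconj (c n) = c n) -> Cconj (lam c n) = lam c n.
Proof. intros H. apply Cconj_csum. intros k. destruct (_ =? _)%nat; [apply H|apply Cconj_R]. Qed.

Lemma conv_real (a b : nat -> C) (n : nat) : (forall n, Cconj (a n) = a n) -> (forall n, Cconj (b n) = b n) ->
  Cconj (conv a b n) = conv a b n.
Proof. intros Ha Hb. apply Cconj_csum. intros k. now rewrite Cmult_conj, Ha, Hb. Qed.

Lemma d0_real (n : nat) : Cconj (d0 n) = d0 n.
Proof. destruct n; simpl; apply Cconj_R. Qed.

Lemma cP_real (n : nat) : Cconj (cP n) = cP n.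
Proof. unfold cP, lam1. rewrite Cplus_conj, Cmult_conj, d0_real, lam_real, Cconj_R; [easy|]. intros; apply Cconj_R. Qed.

Lemma cQ_real (n : nat) : Cconj (cQ n) = cQ n.
Proof. unfold cQ, lam3. rewrite Cplus_conj, Cmult_conj, d0_real, lam_real, Cconj_R; [easy|]. intros; apply Cconj_R. Qed.

Lemma cR_real (n : nat) : Cconj (cR n) = cR n.
Proof.
  unfold cR, Da. rewrite Cplus_conj, !Cmult_conj, conv_real, cQ_real, !Cconj_R; [easy|apply cP_real|apply cQ_real].
Qed.

Lemma clog_real (n : nat) : Cconj (clog n) = clog n.
Proof.
  destruct n as [|n]; [apply Cconj_R|]. unfold clog. rewrite Cinv_conj by apply INR_S_neq_0. now rewrite Cconj_R.
Qed.

Lemma colam_real (n : nat) : Cconj (colam clog n) = colam clog n.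
Proof. apply Cconj_csum. intros k. destruct (_ =? _)%nat; [apply clog_real|apply Cconj_R]. Qed.

Lemma Im_reflect (t : C) : Im (- Cconj t) = Im t.
Proof. unfold Im; simpl. ring. Qed.

Lemma eQ_reflect (t : C) : eQ (- Cconj t) = Cconj (eQ t).
Proof. apply Fs_reflect, cQ_real. Qed.

Lemma eR_reflect (t : C) : eR (- Cconj t) = Cconj (eR t).
Proof. apply Fs_reflect, cR_real. Qed.

Lemma Delta_reflect (t : C) : (0 < Im t)%R -> Defs.Delta (- Cconj t) = Cconj (Defs.Delta t).
Proof.
  intros Ht. rewrite !Cexp_elog_24 by (try rewrite Im_reflect; easy).
  rewrite (Fs_reflect (colam clog) t colam_real), qexp_reflect, Cmult_conj. f_equal.
  rewrite <- Cexp_conj. f_equal. rewrite Cmult_conj, Copp_conj, Cconj_R. easy.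
Qed.

Lemma J_reflect (t : C) : (0 < Im t)%R -> J (- Cconj t) = Cconj (J t).
Proof.
  intros Ht. pose proof (Delta_neq_0 t Ht) as HD. rewrite !J_eq by (try rewrite Im_reflect; easy).
  rewrite eQ_reflect, Delta_reflect by easy. rewrite Cdiv_conj.
  - now rewrite Cpow_conj, Cmult_conj, Cconj_R.
  - apply Cmult_neq_0; [apply RtoC_neq; lra|easy].
Qed.

(** * Univalence near the cusp *)

Definition rest (a : nat -> C) (n : nat) : C := match n with S (S _) => a n | _ => 0 end.

Lemma growth_rest (a : nat -> C) : growth a -> growth (rest a).
Proof.
  intros (K & k & HK & H). exists K, k. split; [easy|]. intros [|[|n]]; [| |apply H]; simpl rest; rewrite Cmod_0;
    (apply Rmult_le_pos; [easy|]); apply pow_le; pose proof (pos_INR 0); pose proof (pos_INR 1); lra.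
Qed.

Lemma Ps_rest (a : nat -> C) (q : C) : growth a -> a 0%nat = 0 -> a 1%nat = 1 -> (Cmod q < 1)%R ->
  Ps a q = q + Ps (rest a) q.
Proof.
  intros Ha H0 H1 Hq. pose proof (growth_rest a Ha) as Hr.
  rewrite (Ps_incr a) by easy. rewrite (Ps_incr (fun n => a (S n))) by (try apply growth_shift; easy).
  rewrite (Ps_incr (rest a)) by easy. rewrite (Ps_incr (fun n => rest a (S n))) by (try apply growth_shift; easy).
  rewrite H0, H1. simpl rest. ring.
Qed.

(** Successive ratios (n+3)/(n+2) are at most 3/2, so the polynomial factor is absorbed into a
    geometric series. *)
Lemma pow_geometric_bound (m n : nat) (r : R) : (0 <= r)%R ->
  (INR (S (S n)) ^ m * r ^ S n <= 2 ^ m * r * ((3 / 2) ^ m * r) ^ n)%R.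
Proof.
  intros Hr. induction n as [|n IH].
  - right. simpl INR. simpl pow. replace (1 + 1)%R with 2%R by ring. ring.
  - apply Rle_trans with ((3 / 2) ^ m * r * (INR (S (S n)) ^ m * r ^ S n))%R.
    + assert (H : (INR (S (S (S n))) ^ m <= (3 / 2) ^ m * INR (S (S n)) ^ m)%R).
      { rewrite <- Rpow_mult_distr. apply pow_incr. pose proof (pos_INR n). rewrite !S_INR. lra. }
      replace ((3 / 2) ^ m * r * (INR (S (S n)) ^ m * r ^ S n))%R with ((3 / 2) ^ m * INR (S (S n)) ^ m * (r * r ^ S n))%R by ring.
      change (r ^ S (S n))%R with (r * r ^ S n)%R. apply Rmult_le_compat_r; [|easy].
      apply Rmult_le_pos; [easy|now apply pow_le].
    + change (((3 / 2) ^ m * r) ^ S n)%R with ((3 / 2) ^ m * r * ((3 / 2) ^ m * r) ^ n)%R.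
      replace (2 ^ m * r * ((3 / 2) ^ m * r * ((3 / 2) ^ m * r) ^ n))%R with ((3 / 2) ^ m * r * (2 ^ m * r * ((3 / 2) ^ m * r) ^ n))%R by ring.
      apply Rmult_le_compat_l; [|exact IH]. apply Rmult_le_pos; [apply pow_le; lra|easy].
Qed.

Lemma rest_Lipschitz (a : nat -> C) (m : nat) (r : R) (q p : C) : growth a -> (0 <= r < 1)%R ->
  ((3 / 2) ^ S m * r < 1)%R -> (forall n, (Cmod (a n) <= INR n ^ m)%R) ->
  (Cmod q <= r)%R -> (Cmod p <= r)%R ->
  (Cmod (Ps (rest a) q - Ps (rest a) p) <= Cmod (q - p)%C * (2 ^ S m * r / (1 - (3 / 2) ^ S m * r)))%R.
Proof.
  intros Ha Hr Hrho Hb Hq Hp. pose proof (growth_rest a Ha) as Hg.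
  eapply Rle_trans; [apply (Ps_Lipschitz (rest a) r q p); try easy; lra|].
  apply Rmult_le_compat_l; [apply Cmod_ge_0|].
  set (rho := ((3 / 2) ^ S m * r)%R) in *.
  assert (Hrho0 : (0 <= rho)%R) by (apply Rmult_le_pos; [apply pow_le|]; lra).
  assert (Hge : ex_series (fun n => 2 ^ S m * r * rho ^ n)%R).
  { apply (ex_series_scal (V := R_NormedModule) (2 ^ S m * r)%R), ex_series_geom. rewrite Rabs_pos_eq; lra. }
  assert (Hterm : forall n, (0 <= INR (S (S n)) * Cmod (rest a (S (S n))) * r ^ S n <= 2 ^ S m * r * rho ^ n)%R).
  { intros n. split.
    - apply Rmult_le_pos; [apply Rmult_le_pos; [apply pos_INR|apply Cmod_ge_0]|apply pow_le; lra].
    - eapply Rle_trans; [|apply pow_geometric_bound; lra].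
      apply Rmult_le_compat_r; [apply pow_le; lra|]. change (INR (S (S n)) ^ S m)%R with (INR (S (S n)) * INR (S (S n)) ^ m)%R.
      apply Rmult_le_compat_l; [apply pos_INR|apply Hb]. }
  rewrite Series_incr_1_aux by (simpl rest; rewrite Cmod_0; ring).
  eapply Rle_trans; [apply Series_le; [exact Hterm|exact Hge]|].
  rewrite Series_scal_l, Series_geom by (rewrite Rabs_pos_eq; lra). right. easy.
Qed.

Lemma lam_pow_bound (k n : nat) : (Cmod (lam (fun n => RtoC (INR n ^ k)) n) <= INR n ^ S k)%R.
Proof.
  unfold lam. eapply Rle_trans; [apply Cmod_csum|].
  apply Rle_trans with (rsum (fun _ => INR n ^ k)%R n); [|rewrite rsum_const; simpl; lra].
  apply rsum_le. intros d Hd. pose proof (pos_INR n). destruct (_ =? _)%nat.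
  - rewrite Cmod_RtoC_pos by (apply pow_le, pos_INR). apply pow_incr. split; [apply pos_INR|apply le_INR; lia].
  - rewrite Cmod_0. now apply pow_le.
Qed.

Lemma lam_pow_1 (k : nat) : lam (fun n => RtoC (INR n ^ k)) 1 = 1.
Proof. rewrite lam_1. simpl INR. now rewrite pow1. Qed.

(** One statement for three series: k = 0 with m = 3 or 1 gives sigma_3 and sigma_1, and k = 1 with
    m = 3 gives n sigma_3(n). The crude bound sigma_m(n) <= n^(m+1) suffices because |q| <= 1/160 at
    the heights in question. *)
Lemma q_lipschitz (k m : nat) (a : nat -> C) (L : R) (q p : C) :
  a = (fun n => RtoC (INR n ^ k) * lam (fun n => RtoC (INR n ^ m)) n) ->
  ((3 / 2) ^ S (k + S m) * / 160 < 1)%R ->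
  (2 ^ S (k + S m) * / 160 / (1 - (3 / 2) ^ S (k + S m) * / 160) <= L)%R ->
  (Cmod q <= / 160)%R -> (Cmod p <= / 160)%R ->
  (Cmod ((Ps a q - Ps a p) - (q - p)) <= L * Cmod (q - p)%C)%R /\ (Cmod (Ps a q) <= (1 + L) * Cmod q)%R.
Proof.
  intros Ea Hrho HL Hq Hp.
  assert (Ga : growth a).
  { destruct (growth_INR_pow k) as (K1 & k1 & HK1 & H1). destruct (growth_lam _ (growth_INR_pow m)) as (K2 & k2 & HK2 & H2).
    apply growth_bounded with (k1 + k2)%nat (K1 * K2)%R. intros n. rewrite Ea, Cmod_mult, pow_add.
    replace (K1 * K2 * ((INR n + 1) ^ k1 * (INR n + 1) ^ k2))%R with (K1 * (INR n + 1) ^ k1 * (K2 * (INR n + 1) ^ k2))%R by ring.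
    apply Rmult_le_compat; try apply Cmod_ge_0; [apply H1|apply H2]. }
  assert (Hb : forall n, (Cmod (a n) <= INR n ^ (k + S m))%R).
  { intros n. rewrite Ea, Cmod_mult, pow_add, Cmod_RtoC_pos by (apply pow_le, pos_INR).
    apply Rmult_le_compat_l; [apply pow_le, pos_INR|apply lam_pow_bound]. }
  assert (H0 : a 0%nat = 0) by (rewrite Ea, lam_0; ring).
  assert (H1 : a 1%nat = 1) by (rewrite Ea, lam_pow_1; simpl INR; rewrite pow1; ring).
  assert (Hgen : forall q p, (Cmod q <= / 160)%R -> (Cmod p <= / 160)%R -> (Cmod ((Ps a q - Ps a p) - (q - p)) <= L * Cmod (q - p)%C)%R).
  { intros q' p' Hq' Hp'. rewrite !(Ps_rest a) by (easy || lra).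
    replace (q' + Ps (rest a) q' - (p' + Ps (rest a) p') - (q' - p')) with (Ps (rest a) q' - Ps (rest a) p') by ring.
    eapply Rle_trans; [apply (rest_Lipschitz a (k + S m) (/ 160)); try easy; lra|].
    rewrite Rmult_comm. apply Rmult_le_compat_r; [apply Cmod_ge_0|exact HL]. }
  split; [now apply Hgen|].
  assert (Hz : (Cmod 0 <= / 160)%R) by (rewrite Cmod_0; lra).
  pose proof (Hgen q 0 Hq Hz) as H.
  assert (E0 : Ps a 0 = 0) by (rewrite Ps_incr by (try easy; rewrite Cmod_0; lra); rewrite H0; ring).
  rewrite E0 in H. replace (Ps a q - 0 - (q - 0)) with (Ps a q - q) in H by ring. replace (q - 0) with q in H by ring.
  replace (Ps a q) with (q + (Ps a q - q)) by ring. eapply Rle_trans; [apply Cmod_triangle|]. lra.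
Qed.

(** The true value is about 180. Splitting the exponent into 20 equal parts makes the quadratic
    lower bound for exp sharp enough. *)
Lemma exp_lower : (160 <= exp (6 * (433 / 500)))%R.
Proof.
  replace (6 * (433 / 500))%R with (INR 20 * (6 * (433 / 500) / 20))%R by (simpl; field).
  set (x := (6 * (433 / 500) / 20)%R).
  assert (H : (129 / 100 <= exp x)%R).
  { eapply Rle_trans; [|apply exp_ge_quad; unfold x; lra]. unfold x. lra. }
  replace (exp (INR 20 * x)) with (exp x ^ 20)%R.
  - apply Rle_trans with ((129 / 100) ^ 20)%R; [simpl; lra|apply pow_incr; lra].
  - rewrite <- Rpower_pow by apply exp_pos. unfold Rpower. now rewrite ln_exp.
Qed.

Lemma qexp_small (t : C) : (433 / 500 <= Im t)%R -> (Cmod (qexp t) <= / 160)%R.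
Proof.
  intros Ht. eapply Rle_trans; [apply (Cmod_qexp_le t _ Ht)|]. rewrite exp_Ropp.
  apply Rinv_le_contravar; [lra|]. eapply Rle_trans; [apply exp_lower|].
  apply Rlt_le, exp_increasing. pose proof PI_gt_3. nra.
Qed.

Lemma Ps_lam3_Lip (q p : C) : (Cmod q <= / 160)%R -> (Cmod p <= / 160)%R ->
  (Cmod ((Ps lam3 q - Ps lam3 p) - (q - p)) <= 22 / 100 * Cmod (q - p)%C)%R /\ (Cmod (Ps lam3 q) <= 122 / 100 * Cmod q)%R.
Proof.
  intros Hq Hp. rewrite !(Ps_ext lam3 (fun n => RtoC (INR n ^ 0) * lam (fun n => RtoC (INR n ^ 3)) n))
    by (intros n; unfold lam3; simpl (INR n ^ 0)%R; ring).
  replace (122 / 100)%R with (1 + 22 / 100)%R by field.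
  apply (q_lipschitz 0 3 _ (22 / 100)); [easy|simpl; lra| |easy|easy].
  apply Rle_div_l; simpl; lra.
Qed.

Lemma Ps_lam1_Lip (q p : C) : (Cmod q <= / 160)%R -> (Cmod p <= / 160)%R ->
  (Cmod ((Ps lam1 q - Ps lam1 p) - (q - p)) <= 6 / 100 * Cmod (q - p)%C)%R /\ (Cmod (Ps lam1 q) <= 106 / 100 * Cmod q)%R.
Proof.
  intros Hq Hp. rewrite !(Ps_ext lam1 (fun n => RtoC (INR n ^ 0) * lam (fun n => RtoC (INR n ^ 1)) n))
    by (intros n; unfold lam1; simpl (INR n ^ 0)%R; ring).
  replace (106 / 100)%R with (1 + 6 / 100)%R by field.
  apply (q_lipschitz 0 1 _ (6 / 100)); [easy|simpl; lra| |easy|easy].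
  apply Rle_div_l; simpl; lra.
Qed.

Lemma Ps_Dlam3_Lip (q p : C) : (Cmod q <= / 160)%R -> (Cmod p <= / 160)%R ->
  (Cmod ((Ps (Da lam3) q - Ps (Da lam3) p) - (q - p)) <= 44 / 100 * Cmod (q - p)%C)%R.
Proof.
  intros Hq Hp. rewrite !(Ps_ext (Da lam3) (fun n => RtoC (INR n ^ 1) * lam (fun n => RtoC (INR n ^ 3)) n))
    by (intros n; unfold Da, lam3; rewrite pow_1; ring).
  apply (q_lipschitz 1 3 _ (44 / 100)); [easy|simpl; lra| |easy|easy].
  apply Rle_div_l; simpl; lra.
Qed.

Lemma eQ_Lip (t u : C) : (433 / 500 <= Im t)%R -> (433 / 500 <= Im u)%R ->
  (Cmod (eQ t - eQ u - 240 * (qexp t - qexp u)) <= 53 * Cmod (qexp t - qexp u))%R.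
Proof.
  intros Ht Hu. destruct (Ps_lam3_Lip _ _ (qexp_small t Ht) (qexp_small u Hu)) as [H _].
  rewrite !eQ_S3 by lra. unfold S3, Fs. fold lam3.
  replace (1 + 240 * Ps lam3 (qexp t) - (1 + 240 * Ps lam3 (qexp u)) - 240 * (qexp t - qexp u))
    with (240 * (Ps lam3 (qexp t) - Ps lam3 (qexp u) - (qexp t - qexp u))) by ring.
  rewrite Cmod_mult, Cmod_RtoC_pos by lra. pose proof (Cmod_ge_0 (qexp t - qexp u)). lra.
Qed.

Lemma eR_formula (t : C) : (0 < Im t)%R -> eR t =
  (1 - 24 * Ps lam1 (qexp t)) * (1 + 240 * Ps lam3 (qexp t)) - 720 * Ps (Da lam3) (qexp t).
Proof.
  intros Ht. rewrite eR_eq, eP_S1, eQ_S3 by easy. unfold S1, S3, Fs. fold lam1 lam3.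
  rewrite (Ps_ext (Da cQ) (fun n => 240 * Da lam3 n)).
  - rewrite Ps_scal; [ring|apply growth_Da, growth_lam3|now apply Cmod_qexp_lt_1].
  - intros [|n]; unfold Da, cQ; simpl d0; [simpl INR|]; ring.
Qed.

(** For univalence the error has to stay below the linear coefficient 504. The contributions are 24
    * 0.06, 240 * 0.22 and 720 * 0.44 from the single series and about 93 from their product, in all
    less than 480. *)
Lemma eR_Lip (t u : C) : (433 / 500 <= Im t)%R -> (433 / 500 <= Im u)%R ->
  (Cmod (eR t - eR u + 504 * (qexp t - qexp u)) <= 480 * Cmod (qexp t - qexp u))%R.
Proof.
  intros Ht Hu. pose proof (qexp_small t Ht) as Hq. pose proof (qexp_small u Hu) as Hp.
  destruct (Ps_lam3_Lip _ _ Hq Hp) as [A3 B3]. destruct (Ps_lam1_Lip _ _ Hp Hq) as [_ B1'].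
  destruct (Ps_lam1_Lip _ _ Hq Hp) as [A1 B1].
  pose proof (Ps_Dlam3_Lip _ _ Hq Hp) as A5.
  rewrite !eR_formula by lra. set (q := qexp t) in *. set (p := qexp u) in *.
  set (x := Ps lam1 q) in *. set (x' := Ps lam1 p) in *. set (y := Ps lam3 q) in *. set (y' := Ps lam3 p) in *.
  set (z := Ps (Da lam3) q) in *. set (z' := Ps (Da lam3) p) in *.
  replace ((1 - 24 * x) * (1 + 240 * y) - 720 * z - ((1 - 24 * x') * (1 + 240 * y') - 720 * z') + 504 * (q - p))
    with ((- (24) * (x - x' - (q - p)) + 240 * (y - y' - (q - p))) + (- (5760) * ((x - x') * y + x' * (y - y')) - 720 * (z - z' - (q - p)))) by ring.
  set (d := Cmod (q - p)) in *. assert (Hd : (0 <= d)%R) by apply Cmod_ge_0.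
  assert (C1 : (Cmod (x - x') <= 106 / 100 * d)%R).
  { replace (x - x') with ((x - x' - (q - p)) + (q - p)) by ring. eapply Rle_trans; [apply Cmod_triangle|]. fold d. lra. }
  assert (C3 : (Cmod (y - y') <= 122 / 100 * d)%R).
  { replace (y - y') with ((y - y' - (q - p)) + (q - p)) by ring. eapply Rle_trans; [apply Cmod_triangle|]. fold d. lra. }
  assert (Hy : (Cmod y <= 122 / 16000)%R) by lra. assert (Hx' : (Cmod x' <= 106 / 16000)%R) by lra.
  assert (P1 : (Cmod ((x - x') * y) <= 106 / 100 * d * (122 / 16000))%R).
  { rewrite Cmod_mult. apply Rmult_le_compat; try apply Cmod_ge_0; easy. }
  assert (P2 : (Cmod (x' * (y - y')) <= 106 / 16000 * (122 / 100 * d))%R).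
  { rewrite Cmod_mult. apply Rmult_le_compat; try apply Cmod_ge_0; easy. }
  eapply Rle_trans; [apply Cmod_triangle|].
  eapply Rle_trans; [apply Rplus_le_compat; [apply Cmod_triangle|apply Cmod_triangle_minus]|].
  rewrite !(Cmod_mult (- _)), !Cmod_opp, (Cmod_mult 240), (Cmod_mult 720), !Cmod_RtoC_pos by lra.
  pose proof (Cmod_triangle ((x - x') * y) (x' * (y - y'))). lra.
Qed.

Lemma eQ_univalent (t u : C) : (433 / 500 <= Im t)%R -> (433 / 500 <= Im u)%R -> eQ t = eQ u -> qexp t = qexp u.
Proof.
  intros Ht Hu E. pose proof (eQ_Lip t u Ht Hu) as H. rewrite E in H.
  replace (eQ u - eQ u - 240 * (qexp t - qexp u)) with (- (240) * (qexp t - qexp u)) in H by ring.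
  rewrite Cmod_mult, Cmod_opp, Cmod_RtoC_pos in H by lra.
  assert (H0 : Cmod (qexp t - qexp u) = 0%R) by (pose proof (Cmod_ge_0 (qexp t - qexp u)); lra).
  apply Cmod_eq_0 in H0. replace (qexp t) with (qexp t - qexp u + qexp u) by ring. rewrite H0. ring.
Qed.

Lemma eR_univalent (t u : C) : (433 / 500 <= Im t)%R -> (433 / 500 <= Im u)%R -> eR t = eR u -> qexp t = qexp u.
Proof.
  intros Ht Hu E. pose proof (eR_Lip t u Ht Hu) as H. rewrite E in H.
  replace (eR u - eR u + 504 * (qexp t - qexp u)) with (504 * (qexp t - qexp u)) in H by ring.
  rewrite Cmod_mult, Cmod_RtoC_pos in H by lra.
  assert (H0 : Cmod (qexp t - qexp u) = 0%R) by (pose proof (Cmod_ge_0 (qexp t - qexp u)); lra).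
  apply Cmod_eq_0 in H0. replace (qexp t) with (qexp t - qexp u + qexp u) by ring. rewrite H0. ring.
Qed.

Lemma qexp_injective (t u : C) : qexp t = qexp u -> (Rabs (Re t - Re u) < 1)%R -> t = u.
Proof.
  intros E Hlt.
  assert (EI : Im t = Im u).
  { apply (f_equal Cmod) in E. rewrite !Cmod_qexp in E. apply exp_inv in E. pose proof PI_RGT_0. nra. }
  assert (ER : (Re t - Re u = 0)%R).
  { destruct (Req_dec (Re t - Re u) 0) as [H|H]; [easy|exfalso].
    apply (qexp_frac_neq_1 (Re t - Re u)).
    - pose proof PI_RGT_0. apply Rabs_def2 in Hlt. destruct (Rlt_dec 0 (Re t - Re u)) as [Hp|Hp].
      + apply Rgt_not_eq. apply sin_gt_0; nra.
      + apply Rlt_not_eq. apply sin_lt_0_var; nra.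
    - replace (RtoC (Re t - Re u)) with (t + - u).
      + rewrite qexp_add, qexp_opp, E. pose proof (qexp_neq_0 u). field. easy.
      + destruct t, u. unfold Re, Im in *; simpl in *. apply injective_projections; simpl; lra. }
  destruct t, u. unfold Re, Im in *; simpl in *. apply injective_projections; simpl; lra.
Qed.

(** * The zeros of E4 and E6 *)

Lemma Cmult_integral (a b : C) : a * b = 0 -> a = 0 \/ b = 0.
Proof.
  intros H. destruct (Ceq_dec a 0) as [E|E]; [now left|right].
  transitivity (/ a * (a * b)); [field; easy|]. rewrite H. ring.
Qed.

(** The corner e^(i pi/3) with positive real part. *)
Definition rho : C := (/ 2, sqrt 3 / 2)%R.

Lemma sqrt3_sqr : (sqrt 3 * sqrt 3 = 3)%R. Proof. apply sqrt_sqrt. lra. Qed.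

Lemma sqrt3_bounds : (433 / 250 <= sqrt 3 <= 2)%R.
Proof.
  pose proof sqrt3_sqr. pose proof (sqrt_pos 3). split; nra.
Qed.

Lemma rho_upper : (433 / 500 <= Im rho)%R.
Proof. unfold Im; simpl. pose proof sqrt3_bounds. lra. Qed.

Lemma rho_sqr : rho * rho = rho - 1.
Proof. pose proof sqrt3_sqr. unfold rho. apply injective_projections; simpl; nra. Qed.

(** Since -1/rho = rho - 1 and rho^4 = -rho, weight 4 and periodicity give (1 + rho) E4(rho) = 0. In
    the same way i^6 = -1 forces E6(i) = 0. *)
Lemma eQ_rho : eQ rho = 0.
Proof.
  pose proof rho_upper as Hu. pose proof rho_sqr as Hr.
  assert (Hn : rho <> 0) by (apply upper_neq_0; lra).
  assert (E1 : - / rho = rho + IZR (-1)).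
  { transitivity ((rho * rho - rho) / rho); [rewrite Hr; field; easy|].
    replace (RtoC (-1)) with (- RtoC 1) by (rewrite <- RtoC_opp; easy). field. easy. }
  assert (E2 : eQ (- / rho) = eQ rho).
  { rewrite E1. unfold eQ. rewrite <- (Fs_shift cQ (rho + IZR (-1))). now rewrite shift_back. }
  rewrite eQ_S in E2 by lra.
  assert (E4 : Cpow rho 4 = - rho).
  { replace (Cpow rho 4) with (rho * rho * (rho * rho)) by (simpl; ring). rewrite Hr.
    transitivity (rho * rho - 2 * rho + 1); [ring|]. rewrite Hr. ring. }
  rewrite E4 in E2.
  assert (E5 : (1 + rho) * eQ rho = 0) by (transitivity (eQ rho - - rho * eQ rho); [ring|rewrite E2; ring]).
  apply Cmult_integral in E5. destruct E5 as [E5|E5]; [|easy].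
  apply (f_equal Im) in E5. rewrite im_plus in E5. unfold Im in *; simpl in *. lra.
Qed.

Lemma eR_Ci : eR Ci = 0.
Proof.
  assert (H : (0 < Im Ci)%R) by (unfold Im; simpl; lra).
  pose proof (eR_S Ci H) as E. replace (- / Ci) with Ci in E.
  - replace (Cpow Ci 6) with (Ci * Ci * (Ci * Ci) * (Ci * Ci)) in E by (simpl; ring). rewrite Ci_sqr in E.
    replace (RtoC (-1)) with (- RtoC 1) in E by (rewrite <- RtoC_opp; easy).
    replace (eR Ci) with ((eR Ci + eR Ci) / 2) by field. rewrite E at 1. field.
  - pose proof Ci_neq_0. transitivity (Ci * Ci / Ci); [field; easy|]. rewrite Ci_sqr.
    replace (RtoC (-1)) with (- RtoC 1) by (rewrite <- RtoC_opp; easy). field. easy.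
Qed.

Lemma eQ_zero (t : C) : (433 / 500 <= Im t)%R -> (0 <= Re t <= / 2)%R -> eQ t = 0 -> t = rho.
Proof.
  intros H1 H2 E. apply qexp_injective.
  - apply eQ_univalent; [easy|apply rho_upper|]. now rewrite eQ_rho.
  - unfold rho, Re in *; simpl in *. apply Rabs_def1; lra.
Qed.

Lemma eR_zero (t : C) : (433 / 500 <= Im t)%R -> (0 <= Re t <= / 2)%R -> eR t = 0 -> t = Ci.
Proof.
  intros H1 H2 E. apply qexp_injective.
  - apply eR_univalent; [easy|unfold Im; simpl; lra|]. now rewrite eR_Ci.
  - unfold Ci, Re in *; simpl in *. apply Rabs_def1; lra.
Qed.

(** * J on the unit circle *)

Definition half_FD (t : C) : Prop := (0 <= Re t <= / 2)%R /\ (0 < Im t)%R /\ (1 <= Cmod t)%R.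

Lemma half_FD_height (t : C) : half_FD t -> (433 / 500 <= Im t)%R.
Proof. intros (H1 & H2 & H3). apply FD_height. repeat split; try easy. apply Rabs_le. lra. Qed.

Definition dJ (t : C) : C := - twopii * (Cpow (eQ t) 2 * eR t / (1728 * Defs.Delta t)).

Lemma dJ_neq_0 (t : C) : half_FD t -> t <> rho -> t <> Ci -> dJ t <> 0.
Proof.
  intros H H1 H2. pose proof (half_FD_height t H) as Hy. destruct H as (Hx & Hp & _).
  assert (HQ : eQ t <> 0) by (intros E; apply H1; now apply eQ_zero).
  assert (HR : eR t <> 0) by (intros E; apply H2; now apply eR_zero).
  unfold dJ. apply Cmult_neq_0.
  - intros E. apply twopii_neq_0. replace twopii with (- - twopii) by ring. rewrite E. ring.
  - apply Cmult_neq_0; [apply Cmult_neq_0; [now apply Cpow_nz|exact HR]|].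
    assert (HD : 1728 * Defs.Delta t <> 0) by (apply Cmult_neq_0; [apply RtoC_neq; lra|now apply Delta_neq_0]).
    intros E. apply C1_neq_0. rewrite <- (Cinv_r _ HD), E. ring.
Qed.

Lemma real_of_conj (z : C) : Cconj z = z -> z = RtoC (Re z).
Proof.
  destruct z as [x y]. intros E. injection E as E. unfold Re; simpl. apply injective_projections; simpl; lra.
Qed.

(** The three alternatives are the three sides of the half domain, each fixed by a reflection that
    is t -> -conj t up to an element of the group; J is invariant under the group and conjugated by
    the reflection. *)
Lemma J_real_of_fixed (t : C) : (0 < Im t)%R ->
  (- Cconj t = t \/ - Cconj t + 1 = t \/ - Cconj t = - / t) -> J t = RtoC (Re (J t)).
Proof.
  intros Ht H. apply real_of_conj. rewrite <- J_reflect by easy.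
  destruct H as [H|[H|H]].
  - now rewrite H.
  - rewrite <- J_shift by (rewrite Im_reflect; easy). now rewrite H.
  - rewrite H. now apply J_S.
Qed.

Lemma reflect_Re_0 (t : C) : Re t = 0%R -> - Cconj t = t.
Proof. destruct t as [x y]. unfold Re; simpl. intros ->. apply injective_projections; simpl; ring. Qed.

Lemma reflect_Re_half (t : C) : Re t = (/ 2)%R -> - Cconj t + 1 = t.
Proof. destruct t as [x y]. unfold Re; simpl. intros ->. apply injective_projections; simpl; field. Qed.

Lemma reflect_circle (t : C) : Cmod t = 1%R -> - Cconj t = - / t.
Proof.
  intros H. assert (Ht : t <> 0) by (apply Cmod_neq; lra). f_equal.
  pose proof (Cmod2_conj t) as E. rewrite H in E.
  transitivity (t * Cconj t / t); [field; easy|]. rewrite <- E. rewrite RtoC_pow. field. easy.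
Qed.

(** The hypothesis describes the lines Re t = 0 and Re t = 1/2. There Delta has the sign of q,
    positive on the first and negative on the second, which decides the sign of J - 1 = E6^2/(1728
    Delta) and of J = E4^3/(1728 Delta). *)
Lemma Delta_real (t : C) : (0 < Im t)%R -> (- Cconj t = t \/ - Cconj t + 1 = t) ->
  exists d : R, (0 < d)%R /\ Defs.Delta t = qexp t * d.
Proof.
  intros Ht H. rewrite Cexp_elog_24 by easy.
  assert (E : Fs (colam clog) t = RtoC (Re (Fs (colam clog) t))).
  { apply real_of_conj. rewrite <- (Fs_reflect _ t colam_real).
    destruct H as [H|H]; [now rewrite H|]. rewrite <- Fs_shift. now rewrite H. }
  rewrite E. set (x := Re _). exists (exp (- (24) * x)). split; [apply exp_pos|]. f_equal.
  replace (- (24) * x) with (RtoC (- (24) * x)) by (rewrite RtoC_mult; rewrite RtoC_opp; easy).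
  unfold Cexp; simpl. rewrite cos_0, sin_0. apply injective_projections; simpl; ring.
Qed.

Lemma qexp_imag (y : R) : qexp (0, y)%R = RtoC (exp (- (2 * PI * y))).
Proof.
  unfold qexp, Cexp. replace (2 * PI * Ci * (0, y)%R) with (RtoC (- (2 * PI * y))).
  - simpl. rewrite cos_0, sin_0. apply injective_projections; simpl; ring.
  - apply injective_projections; simpl; ring.
Qed.

Lemma J_imaginary_axis (t : C) : (0 < Im t)%R -> Re t = 0%R -> (1 <= Re (J t))%R.
Proof.
  intros Ht H0. pose proof (reflect_Re_0 t H0) as Hr.
  destruct (Delta_real t Ht (or_introl Hr)) as [d [Hd ED]].
  assert (ER : eR t = RtoC (Re (eR t))) by (apply real_of_conj; rewrite <- eR_reflect; now rewrite Hr).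
  pose proof (J_minus_1 t Ht) as EJ. rewrite ED, ER in EJ.
  assert (Eq : qexp t = RtoC (exp (- (2 * PI * Im t)))).
  { rewrite <- qexp_imag. f_equal. destruct t as [x y]. unfold Re, Im in *; simpl in *. now rewrite H0. }
  rewrite Eq in EJ. set (r := Re (eR t)) in *. set (e := exp (- (2 * PI * Im t))) in *.
  assert (He : (0 < e)%R) by apply exp_pos.
  assert (EJ' : J t - 1 = RtoC (r ^ 2 / (1728 * (e * d)))).
  { rewrite EJ, RtoC_div, !RtoC_mult, RtoC_pow; [easy|]. assert (0 < e * d)%R by nra. lra. }
  apply (f_equal Re) in EJ'. unfold Cminus in EJ'. rewrite re_plus, re_opp, !re_RtoC in EJ'.
  assert (0 <= r ^ 2 / (1728 * (e * d)))%R; [|lra].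
  apply Rmult_le_pos; [nra|]. apply Rlt_le, Rinv_0_lt_compat. nra.
Qed.

Lemma qexp_Re_half (t : C) : Re t = (/ 2)%R -> qexp t = RtoC (- exp (- (2 * PI * Im t))).
Proof.
  destruct t as [x y]. unfold Re, Im; simpl. intros ->. rewrite qexp_split, qexp_imag.
  replace (RtoC (/ 2)) with (/ 2) by (rewrite RtoC_inv; [easy|lra]). rewrite qexp_half, RtoC_opp. ring.
Qed.

(** Delta is negative here while E4 is positive: E4 vanishes at rho, q increases along the negative
    reals as t moves up, and by [eQ_Lip] E4 grows by at least 240 - 53 times that increase. *)
Lemma J_half_line (t : C) : Re t = (/ 2)%R -> (sqrt 3 / 2 < Im t)%R -> (Re (J t) < 0)%R.
Proof.
  intros H0 Hy. pose proof sqrt3_bounds. assert (Ht : (0 < Im t)%R) by lra.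
  pose proof (reflect_Re_half t H0) as Hr.
  destruct (Delta_real t Ht (or_intror Hr)) as [d [Hd ED]].
  assert (EQ : eQ t = RtoC (Re (eQ t))).
  { apply real_of_conj. rewrite <- eQ_reflect. rewrite <- Hr at 2. unfold eQ. now rewrite Fs_shift. }
  pose proof (J_eq t Ht) as EJ. rewrite ED, EQ in EJ.
  pose proof (qexp_Re_half t H0) as Eq. assert (Er : qexp rho = RtoC (- exp (- (2 * PI * Im rho)))) by now apply qexp_Re_half.
  set (r := Re (eQ t)) in *. set (e := exp (- (2 * PI * Im t))) in *. set (e0 := exp (- (2 * PI * Im rho))) in *.
  assert (He : (0 < e)%R) by apply exp_pos.
  assert (Hee : (e < e0)%R).
  { apply exp_increasing. unfold rho, Im in *; simpl in *. pose proof PI_RGT_0. nra. }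
  assert (Hpos : (0 < r)%R).
  { pose proof (eQ_Lip t rho ltac:(lra) rho_upper) as HL. rewrite eQ_rho, Eq, Er, EQ in HL.
    replace (r - 0 - 240 * (RtoC (- e) - RtoC (- e0))) with (RtoC (r - 240 * (- e - - e0))) in HL
      by (rewrite !RtoC_minus, RtoC_mult, RtoC_minus; ring).
    rewrite <- RtoC_minus, !Cmod_R in HL. rewrite (Rabs_pos_eq (- e - - e0)) in HL by lra.
    apply Rabs_le_between in HL. lra. }
  rewrite Eq in EJ.
  assert (Hed : (0 < e * d)%R) by nra.
  assert (EJ' : J t = RtoC (r ^ 3 / (1728 * (- e * d)))).
  { rewrite EJ, RtoC_div, !RtoC_mult, RtoC_pow; [easy|]. lra. }
  rewrite EJ', re_RtoC. replace (r ^ 3 / (1728 * (- e * d)))%R with (- (r ^ 3 / (1728 * (e * d))))%R by (field; lra).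
  assert (0 < r ^ 3 / (1728 * (e * d)))%R; [|lra].
  apply Rdiv_lt_0_compat; [now apply pow_lt|lra].
Qed.

(* Parametrizes the unit circle by real u while being holomorphic in u, so that J (cay u) has a complex derivative. *)
Definition cay (u : C) : C := (1 + Ci * u) / (1 - Ci * u).

Lemma cay_den (u : R) : 1 - Ci * u <> 0.
Proof. intros E. apply (f_equal Re) in E. unfold Re in E; simpl in E. lra. Qed.

Lemma cay_eq (u : R) : cay u = ((1 - u * u) / (1 + u * u), 2 * u / (1 + u * u))%R.
Proof.
  assert (H : (1 + u * u <> 0)%R) by nra.
  replace ((1 - u * u) / (1 + u * u), 2 * u / (1 + u * u))%R with ((RtoC (1 - u * u) + 2 * u * Ci) / RtoC (1 + u * u)).
  - unfold cay. pose proof (cay_den u).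
    assert (E : RtoC (1 + u * u) = (1 - Ci * u) * (1 + Ci * u)).
    { rewrite RtoC_plus, RtoC_mult. transitivity (1 - Ci * Ci * (u * u)); [rewrite Ci_sqr; ring|ring]. }
    assert (E' : RtoC (1 - u * u) + 2 * u * Ci = (1 + Ci * u) * (1 + Ci * u)).
    { rewrite RtoC_minus, RtoC_mult. transitivity (1 + 2 * u * Ci + Ci * Ci * (u * u)); [rewrite Ci_sqr; ring|ring]. }
    assert (H1 : 1 + Ci * u <> 0).
    { intros Z. apply (f_equal Re) in Z. unfold Re in Z; simpl in Z. lra. }
    rewrite E, E'. field. split; easy.
  - unfold Cdiv. rewrite <- RtoC_inv by easy. apply injective_projections; simpl; field; easy.
Qed.

Lemma Re_cay (u : R) : Re (cay u) = ((1 - u * u) / (1 + u * u))%R.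
Proof. now rewrite cay_eq. Qed.

Lemma Im_cay (u : R) : Im (cay u) = (2 * u / (1 + u * u))%R.
Proof. now rewrite cay_eq. Qed.

Lemma Cmod_cay (u : R) : Cmod (cay u) = 1%R.
Proof.
  rewrite cay_eq. unfold Cmod; simpl. transitivity (sqrt 1); [|apply sqrt_1]. f_equal. field. nra.
Qed.

Lemma cay_Im_pos (u : R) : (0 < u)%R -> (0 < Im (cay u))%R.
Proof. intros H. rewrite Im_cay. apply Rdiv_lt_0_compat; nra. Qed.

Lemma cder_cay (u : R) : exists l : C, l <> 0 /\ cder cay u l.
Proof.
  pose proof (cay_den u) as H. exists (2 * Ci / ((1 - Ci * u) * (1 - Ci * u))). split.
  - intros E. apply Ci_neq_0.
    transitivity (2 * Ci / ((1 - Ci * u) * (1 - Ci * u)) * ((1 - Ci * u) * (1 - Ci * u) / 2)); [field; easy|].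
    rewrite E. ring.
  - apply cder_eq with (((0 + Ci * 1) * (1 - Ci * u) - (1 + Ci * u) * (0 - Ci * 1)) / ((1 - Ci * u) * (1 - Ci * u))).
    + field. easy.
    + apply (cder_div (fun u => 1 + Ci * u) (fun u => 1 - Ci * u)); [easy| |].
      * apply cder_plus; [apply cder_const|apply cder_scal, cder_id].
      * apply cder_minus; [apply cder_const|apply cder_scal, cder_id].
Qed.

(** The parameter is the tangent of half the argument of t. *)
Lemma cay_of_circle (t : C) : Cmod t = 1%R -> (0 < Im t)%R -> t = cay (RtoC (Im t / (1 + Re t))) /\ (-1 < Re t)%R.
Proof.
  intros Hm Hy. assert (Hs : (Re t * Re t + Im t * Im t = 1)%R) by (rewrite <- Cmod_sqr, Hm; ring).
  assert (Hx : (-1 < Re t)%R) by nra. split; [|easy].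
  rewrite cay_eq. destruct t as [x y]. unfold Re, Im in *; simpl in *.
  assert (Hd : (1 + y / (1 + x) * (y / (1 + x)) = 2 / (1 + x))%R).
  { replace (y / (1 + x) * (y / (1 + x)))%R with (y * y / ((1 + x) * (1 + x)))%R by (field; lra).
    replace (y * y)%R with ((1 - x) * (1 + x))%R by lra. field. lra. }
  assert (Hd' : (1 - y / (1 + x) * (y / (1 + x)) = 2 * x / (1 + x))%R).
  { replace (y / (1 + x) * (y / (1 + x)))%R with (2 / (1 + x) - 1)%R by lra. field. lra. }
  rewrite Hd, Hd'. apply injective_projections; simpl; field; lra.
Qed.

(** The tangent of pi/6, half the argument of rho; the parameter of i is 1. *)
Definition arc_lo : R := (sqrt 3 / 3)%R.

Lemma arc_lo_bounds : (0 < arc_lo < 1)%R.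
Proof. unfold arc_lo. pose proof sqrt3_bounds. lra. Qed.

Lemma arc_lo_sqr : (arc_lo * arc_lo = / 3)%R.
Proof. unfold arc_lo. pose proof sqrt3_sqr. lra. Qed.

Lemma cay_1 : cay (RtoC 1) = Ci.
Proof. rewrite cay_eq. unfold Ci. apply injective_projections; simpl; field. Qed.

Lemma cay_arc_lo : cay (RtoC arc_lo) = rho.
Proof.
  rewrite cay_eq. unfold rho. rewrite arc_lo_sqr. unfold arc_lo. apply injective_projections; simpl; field.
Qed.

Lemma cay_half_FD (u : R) : (arc_lo <= u <= 1)%R -> half_FD (cay u).
Proof.
  intros H. pose proof arc_lo_bounds. pose proof arc_lo_sqr. assert (Hu : (/ 3 <= u * u <= 1)%R) by nra.
  split; [|split; [apply cay_Im_pos; lra|rewrite Cmod_cay; lra]]. rewrite Re_cay. split.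
  - apply Rmult_le_pos; [lra|]. apply Rlt_le, Rinv_0_lt_compat. lra.
  - apply Rle_div_l; lra.
Qed.

Lemma cay_interior (u : R) : (arc_lo < u < 1)%R -> cay u <> rho /\ cay u <> Ci.
Proof.
  intros H. pose proof arc_lo_bounds. pose proof arc_lo_sqr. assert (Hu : (/ 3 < u * u < 1)%R) by nra.
  split; intros E; apply (f_equal Re) in E; rewrite Re_cay in E; unfold rho, Ci, Re in E; simpl in E.
  - assert (1 - u * u = / 2 * (1 + u * u))%R by (rewrite <- E; field; lra). lra.
  - assert (1 - u * u = 0 * (1 + u * u))%R by (rewrite <- E; field; lra). lra.
Qed.

Lemma J_cay_real (u : R) : (0 < u)%R -> J (cay u) = RtoC (Re (J (cay u))).
Proof.
  intros H. apply (J_real_of_fixed _); [now apply cay_Im_pos|]. right; right. apply reflect_circle, Cmod_cay.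
Qed.

Lemma J_cay_derive (u : R) : (0 < u)%R -> exists l : C, l <> 0 /\
  forall c, is_derive (fun s : R => Re (c * J (cay s))) u (Re (c * (l * dJ (cay u)))).
Proof.
  intros H. destruct (cder_cay u) as [l [Hl Hd]]. exists l. split; [easy|]. intros c'.
  assert (D : cder (fun x => J (cay x)) (0 + u * 1) (l * dJ (cay u))).
  { replace (0 + u * 1) with (RtoC u) by ring. apply (cder_comp cay J); [easy|]. apply cder_J. now apply cay_Im_pos. }
  pose proof (cder_line_Re c' (fun x => J (cay x)) 0 1 _ u D) as HR. cbv beta in HR.
  replace (1 * (l * dJ (cay u))) with (l * dJ (cay u)) in HR by ring.
  eapply is_derive_ext; [|exact HR]. intros s. cbv beta. now replace (0 + s * 1) with (RtoC s) by ring.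
Qed.

(** Rolle's theorem yields a zero of the derivative of the real part. The imaginary part is
    identically 0 on the arc, so the complex derivative vanishes there as well, against [dJ_neq_0]
    at an interior point of the arc. *)
Lemma J_cay_injective (u v : R) : (arc_lo <= u)%R -> (u < v)%R -> (v <= 1)%R -> J (cay u) <> J (cay v).
Proof.
  intros Hu Huv Hv E. pose proof arc_lo_bounds.
  assert (Hex : forall s : R, (0 < s)%R -> ex_derive (fun s : R => Re (1 * J (cay s))) s).
  { intros s Hs. destruct (J_cay_derive s Hs) as [l [_ Hl]]. eexists. apply Hl. }
  assert (Hr : exists s, (u < s < v)%R /\ is_derive (fun s : R => Re (1 * J (cay s))) s 0%R).
  { set (f := fun s : R => Re (1 * J (cay s))) in *.
    assert (pr : forall x, (u < x < v)%R -> derivable_pt f x).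
    { intros x Hx. apply ex_derive_Reals_0, Hex. lra. }
    destruct (Rolle f u v pr) as [c [Pc HP]].
    - intros x Hx. apply continuity_pt_filterlim, (ex_derive_continuous f), Hex. lra.
    - easy.
    - unfold f. now rewrite E.
    - exists c. split; [easy|]. apply is_derive_Reals. now apply derive_pt_eq_1 with (pr := pr c Pc). }
  destruct Hr as [c [Hc Dc]]. destruct (J_cay_derive c ltac:(lra)) as [l [Hl D]].
  pose proof (is_derive_unique _ _ _ (D (RtoC 1))) as E1. rewrite (is_derive_unique _ _ _ Dc) in E1.
  assert (D0 : is_derive (fun s : R => Re (- Ci * J (cay s))) c 0%R).
  { apply (is_derive_ext_loc (fun _ : R => 0%R)).
    - assert (Hpos : (0 < c)%R) by lra. exists (mkposreal c Hpos). intros y Hy.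
      change (Rabs (y - c) < c)%R in Hy. apply Rabs_def2 in Hy.
      rewrite J_cay_real by lra. generalize (Re (J (cay y))). intros r. unfold Re, Ci; simpl. ring.
    - apply (is_derive_const (V := R_NormedModule)). }
  pose proof (is_derive_unique _ _ _ (D (- Ci))) as E2. rewrite (is_derive_unique _ _ _ D0) in E2.
  set (z := l * dJ (cay c)) in *.
  assert (Hz : z = 0).
  { destruct z as [x y]. unfold Re, Ci in E1, E2; simpl in E1, E2. apply injective_projections; simpl; lra. }
  unfold z in Hz. apply Cmult_integral in Hz. destruct Hz as [Hz|Hz]; [easy|].
  destruct (cay_interior c ltac:(lra)) as [N1 N2].
  apply (dJ_neq_0 (cay c)); [apply cay_half_FD; lra|assumption..].
Qed.

Lemma J_rho : J rho = 0.
Proof. rewrite J_eq, eQ_rho by (pose proof rho_upper; lra). unfold Cdiv. simpl. ring. Qed.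

Lemma J_Ci : J Ci = 1.
Proof.
  assert (H : (0 < Im Ci)%R) by (unfold Im; simpl; lra). pose proof (J_minus_1 Ci H) as E. rewrite eR_Ci in E.
  replace (J Ci) with (J Ci - 1 + 1) by ring. rewrite E. unfold Cdiv. simpl. ring.
Qed.


Lemma J_arc_surjective (x : R) : (0 < x < 1)%R -> exists u, (arc_lo < u < 1)%R /\ J (cay u) = RtoC x.
Proof.
  intros Hx. pose proof arc_lo_bounds as Ha.
  set (f := fun s : R => Re (1 * J (cay s))).
  assert (Hc : forall a, (arc_lo <= a <= 1)%R -> continuity_pt (fun s => f s - x)%R a).
  { intros a Hb. apply (continuity_pt_minus f (fun _ => x)); [|apply continuity_pt_const; intros ? ?; easy].
    destruct (J_cay_derive a ltac:(lra)) as [l [_ D]].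
    apply continuity_pt_filterlim, (ex_derive_continuous f). eexists. apply D. }
  assert (f0 : f arc_lo = 0%R) by (unfold f; rewrite cay_arc_lo, J_rho; unfold Re; simpl; ring).
  assert (f1 : f 1%R = 1%R) by (unfold f; rewrite cay_1, J_Ci; unfold Re; simpl; ring).
  destruct (Ranalysis5.IVT_interv (fun s => f s - x)%R arc_lo 1%R Hc ltac:(lra)) as [u [Hu E]]; cbv beta; try lra.
  assert (u <> arc_lo) by (intros ->; lra). assert (u <> 1%R) by (intros ->; lra).
  exists u. split; [lra|]. rewrite J_cay_real by lra. f_equal.
  replace (J (cay u)) with (1 * J (cay u)) by apply Cmult_1_l. change (f u = x). lra.
Qed.

(** * Maxima on cubes and the cusp of J *)

Definition cube (n : nat) (x : nat -> R) : Prop := forall i, (i < n)%nat -> (0 <= x i <= 1)%R.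

(** Points are infinite sequences, but only the first n coordinates are compared; on the cube this
    forces F to depend on them alone, as [ucont_ext] records. *)
Definition ucont (n : nat) (F : (nat -> R) -> R) : Prop :=
  forall eps, (0 < eps)%R -> exists d, (0 < d)%R /\ forall x y, cube n x -> cube n y ->
    (forall i, (i < n)%nat -> (Rabs (x i - y i) < d)%R) -> (Rabs (F x - F y) <= eps)%R.

Definition upd (x : nat -> R) (n : nat) (s : R) (i : nat) : R := if Nat.eqb i n then s else x i.

Lemma upd_same (x : nat -> R) (n : nat) (s : R) : upd x n s n = s.
Proof. unfold upd. now rewrite Nat.eqb_refl. Qed.

Lemma upd_other (x : nat -> R) (n i : nat) (s : R) : i <> n -> upd x n s i = x i.
Proof. intros H. unfold upd. now apply Nat.eqb_neq in H as ->. Qed.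

Lemma cube_upd (n : nat) (x : nat -> R) (s : R) : cube n x -> (0 <= s <= 1)%R -> cube (S n) (upd x n s).
Proof.
  intros Hx Hs i Hi. destruct (Nat.eq_dec i n) as [->|H]; [now rewrite upd_same|].
  rewrite upd_other by easy. apply Hx. lia.
Qed.

Lemma ucont_ext (n : nat) (F : (nat -> R) -> R) (x y : nat -> R) : ucont n F -> cube n x -> cube n y ->
  (forall i, (i < n)%nat -> x i = y i) -> F x = F y.
Proof.
  intros HF Hx Hy E. apply Rminus_diag_uniq. destruct (Req_dec (F x - F y) 0) as [H|H]; [easy|].
  apply Rabs_pos_lt in H. destruct (HF (Rabs (F x - F y) / 2)%R) as [d [Hd HH]]; [lra|].
  specialize (HH x y Hx Hy). enough (Rabs (F x - F y) <= Rabs (F x - F y) / 2)%R by lra.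
  apply HH. intros i Hi. rewrite E, Rminus_diag, Rabs_R0 by easy. easy.
Qed.

Definition clamp (s : R) : R := Rmax 0 (Rmin 1 s).

Lemma clamp_in (s : R) : (0 <= clamp s <= 1)%R.
Proof. unfold clamp, Rmax, Rmin. repeat destruct Rle_dec; lra. Qed.

Lemma clamp_id (s : R) : (0 <= s <= 1)%R -> clamp s = s.
Proof. unfold clamp, Rmax, Rmin. repeat destruct Rle_dec; lra. Qed.

Lemma clamp_Lip (s u : R) : (Rabs (clamp s - clamp u) <= Rabs (s - u))%R.
Proof. unfold clamp, Rmax, Rmin. repeat destruct Rle_dec; unfold Rabs; repeat destruct Rcase_abs; lra. Qed.

Lemma ucont_slice_max (n : nat) (F : (nat -> R) -> R) (x : nat -> R) : ucont (S n) F -> cube n x ->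
  exists s, (0 <= s <= 1)%R /\ forall u, (0 <= u <= 1)%R -> (F (upd x n u) <= F (upd x n s))%R.
Proof.
  intros HF Hx.
  (* Clamping extends the slice beyond [0,1], since continuity at the end points is meant from both
     sides. *)
  destruct (continuity_ab_maj (fun s => F (upd x n (clamp s))) 0 1 ltac:(lra)) as [s [Hm Hs]].
  - intros c _ eps He. destruct (HF (eps / 2)%R) as [d [Hd H]]; [lra|]. exists d. split; [easy|].
    intros u [_ Hu]. unfold R_dist in *. simpl in *. unfold R_dist in *.
    apply Rle_lt_trans with (eps / 2)%R; [|lra]. apply H; try (apply cube_upd; [easy|apply clamp_in]).
    intros i Hi. destruct (Nat.eq_dec i n) as [->|Hn].
    + rewrite !upd_same. eapply Rle_lt_trans; [apply clamp_Lip|easy].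
    + rewrite !upd_other, Rminus_diag, Rabs_R0 by easy. easy.
  - exists s. split; [easy|]. intros u Hu. specialize (Hm u Hu). cbv beta in Hm. now rewrite !clamp_id in Hm.
Qed.

(** Compactness by induction on the dimension: the maximum over the last coordinate is again
    uniformly continuous, as two maxima can each be compared at the other's maximizing value. Used
    for [Im J] with n = 2 and for the energy. *)
Lemma ucont_max (n : nat) : forall F, ucont n F -> exists x, cube n x /\ forall y, cube n y -> (F y <= F x)%R.
Proof.
  induction n as [|n IH]; intros F HF.
  - exists (fun _ => 0%R). split; [intros i Hi; lia|]. intros y Hy. right.
    apply (ucont_ext 0 F); [easy|easy|intros i Hi; lia|intros i Hi; lia].
  - set (M := fun x => epsilon (inhabits 0%R) (fun s => (0 <= s <= 1)%R /\
       forall u, (0 <= u <= 1)%R -> (F (upd x n u) <= F (upd x n s))%R)).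
    assert (HM : forall x, cube n x -> (0 <= M x <= 1)%R /\
       forall u, (0 <= u <= 1)%R -> (F (upd x n u) <= F (upd x n (M x)))%R).
    { intros x Hx. apply (epsilon_spec (inhabits 0%R) (fun s => (0 <= s <= 1)%R /\
       forall u, (0 <= u <= 1)%R -> (F (upd x n u) <= F (upd x n s))%R)). now apply ucont_slice_max. }
    destruct (IH (fun x => F (upd x n (M x)))) as [x [Hx Hmax]].
    + intros eps He. destruct (HF eps He) as [d [Hd H]]. exists d. split; [easy|]. intros x y Hx Hy Hxy.
      destruct (HM x Hx) as [Hx1 Hx2]. destruct (HM y Hy) as [Hy1 Hy2].
      assert (HH : forall s, (0 <= s <= 1)%R -> (Rabs (F (upd x n s) - F (upd y n s)) <= eps)%R).
      { intros s Hs. apply H; try now apply cube_upd. intros i Hi. destruct (Nat.eq_dec i n) as [->|Hn].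
        - rewrite !upd_same, Rminus_diag, Rabs_R0. easy.
        - rewrite !upd_other by easy. apply Hxy. lia. }
      pose proof (HH _ Hx1) as A1. pose proof (HH _ Hy1) as A2.
      apply Rabs_le_between in A1, A2. specialize (Hx2 _ Hy1). specialize (Hy2 _ Hx1). apply Rabs_le. lra.
    + destruct (HM x Hx) as [Hx1 Hx2]. exists (upd x n (M x)). split; [now apply cube_upd|]. intros y Hy.
      assert (Hy' : cube n y) by (intros i Hi; apply Hy; lia). destruct (HM y Hy') as [Hy1 Hy2].
      assert (Hyn : (0 <= y n <= 1)%R) by (apply Hy; lia).
      rewrite (ucont_ext (S n) F y (upd y n (y n))); try easy; [|now apply cube_upd|].
      * eapply Rle_trans; [apply Hy2, Hyn|]. now apply Hmax.
      * intros i Hi. destruct (Nat.eq_dec i n) as [->|Hn]; [now rewrite upd_same|now rewrite upd_other].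
Qed.

(** Fermat's rule in the directions 1 and i; this is all that is needed of the maximum principle. *)
Lemma local_max_Re (c : C) (f : C -> C) (t l : C) (r : R) : (0 < r)%R -> c <> 0 -> cder f t l ->
  (forall h, (Cmod h < r)%R -> (Re (c * f (t + h)%C) <= Re (c * f t)%C)%R) -> l = 0.
Proof.
  intros Hr Hc Hf Hm.
  assert (H : forall h, Cmod h = 1%R -> Re (c * (h * l)) = 0%R).
  { intros h Hh. assert (D : cder f (t + RtoC 0 * h) l) by (replace (t + RtoC 0 * h) with t by ring; easy).
    apply cder_line_Re with (c := c) in D.
    assert (pr : derivable_pt (fun s : R => Re (c * f (t + s * h))) 0).
    { apply ex_derive_Reals_0. eexists. exact D. }
    assert (D0 := deriv_maximum _ (-r) r 0 pr ltac:(lra) ltac:(lra)).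
    apply is_derive_unique in D. rewrite <- D. rewrite <- (Derive_Reals _ _ pr). apply D0.
    intros x H1 H2. replace (t + RtoC 0 * h) with t by ring. apply Hm.
    rewrite Cmod_mult, Hh, Cmod_R, Rmult_1_r. apply Rabs_def1; lra. }
  assert (E : c * l = 0).
  { pose proof (H 1 Cmod_1) as E1. pose proof (H Ci Cmod_Ci) as E2.
    replace (c * (1 * l)) with (c * l) in E1 by ring. replace (c * (Ci * l)) with (Ci * (c * l)) in E2 by ring.
    destruct (c * l) as [x y]. unfold Re, Ci in E1, E2; simpl in E1, E2. apply injective_projections; simpl; lra. }
  apply Cmult_integral in E. now destruct E.
Qed.

(** From E4^3 = 1 + 720 q + ... and q/Delta = 1 + 24 q + ..., with 744 = 720 + 24. *)
Lemma J_cusp : tends (fun t => J t - / (1728 * qexp t)) (744 / 1728).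
Proof.
  set (a := conv cQ (conv cQ cQ)). assert (Ga : growth a) by (repeat apply growth_conv; apply growth_cQ).
  set (b := colam clog). assert (Gb : growth b) by (apply growth_colam, growth_clog).
  set (E := fun t => Cexp (- (24) * Fs b t)).
  assert (Ha0 : a 0%nat = 1) by (unfold a; rewrite !conv_0, !cQ_0; ring).
  assert (Ha1 : a 1%nat = 720) by (unfold a; rewrite !conv_1, !conv_0, !cQ_0, !cQ_1; ring).
  assert (Hb0 : b 0%nat = 0) by easy.
  assert (Hb1 : b 1%nat = 1) by (unfold b, colam; simpl; field).
  assert (Hsplit : forall c t, growth c -> (0 < Im t)%R -> Fs c t = c 0%nat + qexp t * Fs (fun n => c (S n)) t).
  { intros c t Hc Ht. unfold Fs. apply Ps_incr; [easy|]. now apply Cmod_qexp_lt_1. }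
  assert (TE : tends E 1).
  { apply tends_eq with (Cexp (- (24) * b 0%nat)).
    - rewrite Hb0. replace (- (24) * 0) with (RtoC 0) by ring. apply Cexp_0.
    - apply (tends_cont (fun t => - (24) * Fs b t) Cexp _ (Cexp (- (24) * b 0%nat))); [|apply cder_Cexp].
      apply tends_mult; [apply tends_const|now apply tends_Fs]. }
  assert (T1 : tends (Fs (fun n => a (S n))) 720) by (rewrite <- Ha1; apply tends_Fs, growth_shift, Ga).
  assert (T2 : tends (fun t => - (24) * Fs (fun n => b (S n)) t) (- (24))).
  { apply tends_eq with (- (24) * b 1%nat); [rewrite Hb1; ring|].
    apply tends_mult; [apply tends_const|]. apply (tends_Fs (fun n => b (S n))). now apply growth_shift. }
  (* First order expansion of the exponential: its argument is q times a function u with limit -24,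
     and |u| <= 25 high up turns the factor eps/50 into eps/2. *)
  assert (T3 : tends (fun t => (E t - 1) / qexp t) (- (24))).
  { apply tends_eq with (- (24) + 0); [ring|].
    apply tends_ext with (fun t => - (24) * Fs (fun n => b (S n)) t + ((E t - 1) / qexp t - - (24) * Fs (fun n => b (S n)) t)); [intros; ring|].
    apply tends_plus; [easy|]. intros eps He.
    destruct (cder_Cexp 0 (eps / 50)%R ltac:(lra)) as [d [Hd H]].
    destruct (tends_mult (fun _ => - (24)) _ _ _ (tends_const _) (tends_Fs b Gb) d Hd) as [Y1 H1].
    destruct (T2 1%R ltac:(lra)) as [Y2 H2]. exists (Rmax 0 (Rmax Y1 Y2)). intros t Ht.
    apply Rmax_Rlt in Ht. destruct Ht as [Ht Ht2]. apply Rmax_Rlt in Ht2. destruct Ht2 as [Ht1 Ht2].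
    specialize (H1 t Ht1). specialize (H2 t Ht2). rewrite Hb0 in H1.
    replace (- (24) * Fs b t - - (24) * 0) with (- (24) * Fs b t) in H1 by ring.
    specialize (H _ H1). rewrite Cplus_0_l, Cexp_0 in H. fold (E t) in H.
    set (u := - (24) * Fs (fun n => b (S n)) t) in *.
    assert (Eu : - (24) * Fs b t = qexp t * u) by (unfold u; rewrite (Hsplit b t Gb Ht), Hb0; ring).
    rewrite Eu in H. pose proof (qexp_neq_0 t) as Hq. set (q := qexp t) in *.
    replace ((E t - 1) / q - u - 0) with ((E t - 1 - q * u * 1) / q) by (field; easy).
    rewrite Cmod_div by easy. apply Cmod_gt_0 in Hq. apply Rlt_div_l; [easy|].
    eapply Rle_lt_trans; [exact H|]. rewrite Cmod_mult.
    assert (Hu : (Cmod u <= 25)%R).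
    { replace u with ((u - - (24)) + - (24)) by ring. eapply Rle_trans; [apply Cmod_triangle|].
      rewrite Cmod_opp, Cmod_RtoC_pos by lra. lra. }
    apply Rle_lt_trans with (eps / 50 * (Cmod q * 25))%R; [|nra].
    apply Rmult_le_compat_l; [lra|]. apply Rmult_le_compat_l; lra. }
  apply tends_ext with (fun t => (Fs (fun n => a (S n)) t + (-1) * ((E t - 1) / qexp t)) * (/ 1728 * / E t)).
  - intros t Ht. rewrite J_eq, Cexp_elog_24 by easy. fold b. change (Cexp (- (24) * Fs b t)) with (E t).
    assert (HE : E t <> 0) by apply Cexp_neq_0. pose proof (qexp_neq_0 t) as Hq.
    assert (EQ : Cpow (eQ t) 3 = 1 + qexp t * Fs (fun n => a (S n)) t).
    { rewrite <- Ha0, <- Hsplit by easy. unfold a. rewrite !Fs_mult by (try apply growth_conv; try apply growth_cQ; easy).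
      unfold eQ. simpl. ring. }
    rewrite EQ. replace (RtoC (-1)) with (- RtoC 1) by (rewrite <- RtoC_opp; easy). field. split; easy.
  - apply tends_eq with ((720 + (-1) * - (24)) * (/ 1728 * / 1)).
    + replace (RtoC (-1)) with (- RtoC 1) by (rewrite <- RtoC_opp; easy). field.
    + apply (tends_mult (fun t => Fs (fun n => a (S n)) t + (-1) * ((E t - 1) / qexp t)) (fun t => / 1728 * / E t)).
      * apply (tends_plus (Fs (fun n => a (S n))) (fun t => (-1) * ((E t - 1) / qexp t))); [easy|].
        apply (tends_mult (fun _ => RtoC (-1)) (fun t => (E t - 1) / qexp t)); [apply tends_const|easy].
      * apply (tends_mult (fun _ => / 1728) (fun t => / E t)); [apply tends_const|]. apply tends_inv; [apply C1_neq_0|easy].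
Qed.

(** The principal part 1/(1728 q) has imaginary part of the sign of -sin (2 pi Re t), hence at most
    0 on this strip; the constant term is real and the remainder tends to 0. *)
Lemma J_cusp_Im (eps : R) : (0 < eps)%R -> exists Y, forall t, (Y < Im t)%R -> (0 <= Re t <= / 2)%R -> (Im (J t) < eps)%R.
Proof.
  intros He. destruct (J_cusp eps He) as [Y HY]. exists Y. intros t Ht Hx. specialize (HY t Ht).
  set (D := J t - / (1728 * qexp t) - 744 / 1728) in *.
  assert (E : J t = D + / 1728 * qexp (- t) + RtoC (744 / 1728)).
  { rewrite RtoC_div by lra. rewrite qexp_opp. unfold D. field. repeat split; try apply qexp_neq_0; apply RtoC_neq; lra. }
  assert (Hs : (Im (/ 1728 * qexp (- t)) <= 0)%R).
  { replace (/ 1728) with (RtoC (/ 1728)) by (rewrite RtoC_inv; [easy|lra]).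
    unfold qexp, Cexp. destruct t as [x y]. unfold Im, Re in *; simpl in *.
    match goal with |- context [sin ?z] => replace z with (- (2 * PI * x))%R by ring end. rewrite sin_neg.
    assert (0 <= sin (2 * PI * x))%R by (apply sin_ge_0; pose proof PI_RGT_0; nra).
    match goal with |- context [exp ?z] => pose proof (exp_pos z) end. nra. }
  rewrite E, !im_plus. pose proof (im_le_Cmod D) as HD. apply Rabs_le_between in HD.
  replace (Im (RtoC (744 / 1728))) with 0%R by easy. lra.
Qed.

(** * Injectivity of J *)

Lemma Rmax_Lip (a b c d : R) : (Rabs (Rmax a b - Rmax c d) <= Rmax (Rabs (a - c)) (Rabs (b - d)))%R.
Proof. unfold Rmax. repeat destruct Rle_dec; unfold Rabs in *; repeat destruct Rcase_abs; lra. Qed.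

Lemma J_continuity_2d (x y : R) : (0 < y)%R -> continuity_2d_pt (fun a b => Im (J (a, b))) x y.
Proof.
  intros Hy eps. destruct (cder_cont J (x, y) _ (cder_J (x, y) Hy) eps (cond_pos eps)) as [d [Hd H]].
  assert (Hd2 : (0 < d / 2)%R) by lra. exists (mkposreal _ Hd2). intros u v Hu Hv. simpl in Hu, Hv.
  set (h := (u - x, v - y)%R : C).
  assert (Eh : ((u, v) : C) = (x, y) + h) by (apply injective_projections; simpl; ring).
  assert (Hh : (Cmod h < d)%R).
  { eapply Rle_lt_trans; [apply Cmod_le_Re_Im|]. unfold h, Re, Im; simpl. lra. }
  specialize (H h Hh). rewrite Eh.
  eapply Rle_lt_trans; [|exact H]. pose proof (im_le_Cmod (J ((x, y) + h) - J (x, y))) as E.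
  unfold Cminus in E. rewrite im_plus, im_opp in E. exact E.
Qed.

Definition arc_height (a : R) : R := sqrt (1 - a * a).

Lemma arc_height_bounds (a : R) : (0 <= a <= / 2)%R -> (433 / 500 <= arc_height a <= 1)%R /\ (arc_height a * arc_height a = 1 - a * a)%R.
Proof.
  intros Ha. assert (E : (arc_height a * arc_height a = 1 - a * a)%R) by (apply sqrt_sqrt; nra).
  pose proof (sqrt_pos (1 - a * a)) as Hp. fold (arc_height a) in Hp. split; [split; nra|easy].
Qed.

Lemma arc_height_Lip (a b : R) : (0 <= a <= / 2)%R -> (0 <= b <= / 2)%R ->
  (Rabs (arc_height a - arc_height b) <= Rabs (a - b))%R.
Proof.
  intros Ha Hb. destruct (arc_height_bounds a Ha) as [H1 E1]. destruct (arc_height_bounds b Hb) as [H2 E2].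
  set (p := arc_height a) in *. set (q := arc_height b) in *.
  assert (E : ((p - q) * (p + q) = (b - a) * (a + b))%R) by lra.
  apply (f_equal Rabs) in E. rewrite !Rabs_mult, (Rabs_pos_eq (p + q)), (Rabs_pos_eq (a + b)) in E by lra.
  rewrite (Rabs_minus_sym b a) in E. pose proof (Rabs_pos (p - q)). pose proof (Rabs_pos (a - b)). nra.
Qed.

Lemma half_FD_iff (t : C) : half_FD t <-> (0 <= Re t <= / 2)%R /\ (arc_height (Re t) <= Im t)%R.
Proof.
  split.
  - intros H. pose proof (half_FD_height t H) as Hy. destruct H as (Hx & _ & Hm). split; [easy|].
    destruct (arc_height_bounds (Re t) Hx) as [H1 H2].
    assert (1 <= Cmod t * Cmod t)%R by nra. rewrite Cmod_sqr in H. nra.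
  - intros [Hx Hy]. destruct (arc_height_bounds (Re t) Hx) as [H1 H2]. split; [easy|]. split; [lra|].
    pose proof (Cmod_sqr t). pose proof (Cmod_ge_0 t). nra.
Qed.

Lemma half_FD_max (Y : R) : (1 <= Y)%R -> exists t, half_FD t /\ (Im t <= Y)%R /\
  forall s, half_FD s -> (Im s <= Y)%R -> (Im (J s) <= Im (J t))%R.
Proof.
  (* A map of the unit square onto the truncated half domain; points that would fall below the arc
     are lifted onto it by the maximum. *)
  intros HY. set (T := fun x : nat -> R => (x 0%nat / 2, Rmax (433 / 500 + x 1%nat * (Y - 433 / 500)) (arc_height (x 0%nat / 2)))%R : C).
  assert (HT : forall x, cube 2 x -> half_FD (T x) /\ (Im (T x) <= Y)%R).
  { intros x Hx. pose proof (Hx 0%nat ltac:(lia)) as H0. pose proof (Hx 1%nat ltac:(lia)) as H1.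
    destruct (arc_height_bounds (x 0%nat / 2) ltac:(lra)) as [H2 _]. split.
    - apply half_FD_iff. unfold T, Re, Im; simpl. split; [lra|apply Rmax_r].
    - unfold T, Im; simpl. apply Rmax_lub; nra. }
  destruct (ucont_max 2 (fun x => Im (J (T x)))) as [x [Hx Hm]].
  - intros eps He.
    destruct (uniform_continuity_2d (fun a b => Im (J (a, b))) 0 (/ 2) (433 / 500) Y
      (fun a b Ha Hb => J_continuity_2d a b ltac:(lra)) (mkposreal eps He)) as [d Hd].
    pose proof (cond_pos d) as Hdp. exists (d / (1 + Y))%R. split; [apply Rdiv_lt_0_compat; lra|]. intros x y Hx Hy Hxy.
    destruct (HT x Hx) as [Fx Yx]. destruct (HT y Hy) as [Fy Yy].
    pose proof (half_FD_height _ Fx) as Lx. pose proof (half_FD_height _ Fy) as Ly.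
    destruct Fx as [Rx _]. destruct Fy as [Ry _].
    assert (Hb : forall i, (i < 2)%nat -> (Rabs (x i - y i) * (1 + Y) < d)%R).
    { intros i Hi. apply Rlt_div_r; [lra|]. now apply Hxy. }
    pose proof (Hb 0%nat ltac:(lia)) as B0. pose proof (Hb 1%nat ltac:(lia)) as B1.
    pose proof (Rabs_pos (x 0%nat - y 0%nat)) as P0. pose proof (Rabs_pos (x 1%nat - y 1%nat)) as P1.
    assert (Hle : forall p c, (0 <= p)%R -> (c <= 1 + Y)%R -> (p * (1 + Y) < d)%R -> (p * c < d)%R).
    { intros p c Hp Hc Hl. eapply Rle_lt_trans; [|exact Hl]. now apply Rmult_le_compat_l. }
    assert (B0' : (Rabs (x 0%nat / 2 - y 0%nat / 2) < d)%R).
    { replace (x 0%nat / 2 - y 0%nat / 2)%R with ((x 0%nat - y 0%nat) * / 2)%R by field.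
      rewrite Rabs_mult, (Rabs_pos_eq (/ 2)) by lra. apply Hle; easy || lra. }
    apply Rlt_le. apply (Hd (Re (T y)) (Im (T y)) (Re (T x)) (Im (T x))); try assumption; try (split; assumption).
    unfold T, Im; simpl. eapply Rle_lt_trans; [apply Rmax_Lip|]. apply Rmax_lub_lt.
    + replace (433 / 500 + x 1%nat * (Y - 433 / 500) - (433 / 500 + y 1%nat * (Y - 433 / 500)))%R
        with ((x 1%nat - y 1%nat) * (Y - 433 / 500))%R by ring.
      rewrite Rabs_mult, (Rabs_pos_eq (Y - _)) by lra. apply Hle; easy || lra.
    + eapply Rle_lt_trans; [|exact B0']. apply arc_height_Lip; [exact Rx|exact Ry].
  - destruct (HT x Hx) as [Fx Yx]. exists (T x). split; [easy|]. split; [easy|]. intros s Hs HsY.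
    pose proof (half_FD_height s Hs) as Ls. pose proof (proj2 (proj1 (half_FD_iff s) Hs)) as As. destruct Hs as [Rs _].
    specialize (Hm (fun i => match i with O => 2 * Re s | _ => (Im s - 433 / 500) / (Y - 433 / 500) end)%R).
    cbv beta in Hm. set (z := T _) in Hm at 1. replace s with z; [apply Hm|].
    + intros [|[|i]] Hi; [lra| |lia]. split; [apply Rmult_le_pos; [lra|]|].
      * apply Rlt_le, Rinv_0_lt_compat. lra.
      * apply Rle_div_l; lra.
    + unfold z, T. replace (2 * Re s / 2)%R with (Re s) by field.
      replace (433 / 500 + (Im s - 433 / 500) / (Y - 433 / 500) * (Y - 433 / 500))%R with (Im s) by (field; lra).
      rewrite Rmax_left by easy. now destruct s.
Qed.

Lemma J_boundary_real (t : C) : half_FD t -> (Re t = 0 \/ Re t = / 2 \/ Cmod t = 1)%R -> Im (J t) = 0%R.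
Proof.
  intros (_ & Ht & _) H. rewrite J_real_of_fixed; [easy|easy|]. destruct H as [H|[H|H]].
  - left. now apply reflect_Re_0.
  - right; left. now apply reflect_Re_half.
  - right; right. now apply reflect_circle.
Qed.

Lemma interior_nbhd (t : C) : (0 < Re t < / 2)%R -> (1 < Cmod t)%R -> (0 < Im t)%R ->
  exists r, (0 < r)%R /\ forall h, (Cmod h < r)%R -> half_FD (t + h).
Proof.
  intros Hx Hm Hy. exists (Rmin (Rmin (Re t) (/ 2 - Re t)) (Rmin (Cmod t - 1) (Im t))).
  split; [repeat apply Rmin_glb_lt; lra|]. intros h Hh.
  apply Rmin_Rgt in Hh. destruct Hh as [Ha Hb]. apply Rmin_Rgt in Ha, Hb.
  pose proof (re_le_Cmod h) as H1. pose proof (im_le_Cmod h) as H2. apply Rabs_le_between in H1, H2.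
  pose proof (Cmod_triangle_rev t h). unfold half_FD. rewrite re_plus, im_plus. repeat split; lra.
Qed.

Lemma interior_critical (t : C) (Y : R) : (0 < Re t < / 2)%R -> (1 < Cmod t)%R -> (0 < Im t < Y)%R ->
  ~ (forall s, half_FD s -> (Im s <= Y)%R -> (Im (J s) <= Im (J t))%R).
Proof.
  intros Hx Hm Hy H. destruct (interior_nbhd t Hx Hm (proj1 Hy)) as [r [Hr Hn]].
  assert (Ft : half_FD t) by (unfold half_FD; lra).
  apply (dJ_neq_0 t Ft).
  - intros ->. unfold rho, Re in Hx; simpl in Hx. lra.
  - intros ->. unfold Ci, Re in Hx; simpl in Hx. lra.
  - apply (local_max_Re (- Ci) J t (dJ t) (Rmin r (Y - Im t))).
    + apply Rmin_glb_lt; lra.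
    + intros E. apply Ci_neq_0. replace Ci with (- - Ci) by ring. rewrite E. ring.
    + now apply cder_J.
    + intros h Hh. apply Rmin_Rgt in Hh. pose proof (im_le_Cmod h) as H2. apply Rabs_le_between in H2.
      assert (E : forall z, Re (- Ci * z) = Im z) by (intros [x y]; unfold Re, Im; simpl; ring).
      rewrite !E. apply H; [apply Hn; lra|]. rewrite im_plus. lra.
Qed.

(* Im J vanishes on the sides and the arc and is small at the top, and an interior maximum would be a zero of J'. *)
Lemma J_half_FD_Im (t : C) : half_FD t -> (Im (J t) <= 0)%R.
Proof.
  intros Ft. apply Rnot_lt_le. intros Hpos.
  destruct (J_cusp_Im _ Hpos) as [Y0 HY0]. set (Y := (Rmax 1 (Rmax (Im t) Y0) + 1)%R).
  assert (HY : (1 <= Y /\ Im t <= Y /\ Y0 < Y)%R).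
  { pose proof (Rmax_l 1 (Rmax (Im t) Y0)). pose proof (Rmax_r 1 (Rmax (Im t) Y0)).
    pose proof (Rmax_l (Im t) Y0). pose proof (Rmax_r (Im t) Y0). unfold Y. lra. }
  destruct (half_FD_max Y) as [m (Fm & Ym & Hm)]; [easy|].
  pose proof (Hm t Ft ltac:(easy)) as Htm.
  assert (Hb : ~ (Re m = 0 \/ Re m = / 2 \/ Cmod m = 1)%R).
  { intros Hb. pose proof (J_boundary_real m Fm Hb). lra. }
  assert (Hbx : (Re m <> 0)%R) by tauto. assert (Hbx' : (Re m <> / 2)%R) by tauto. assert (Hbm : (Cmod m <> 1)%R) by tauto.
  destruct Fm as (Fx & Fy & FM).
  assert (Hmy : (Im m < Y)%R).
  { apply Rnot_le_lt. intros H. specialize (HY0 m ltac:(lra) Fx). lra. }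
  apply (interior_critical m Y); try lra. exact Hm.
Qed.

(** Strictness: if the bound 0 were attained at an interior point, that point would itself be an
    interior maximum. *)
Lemma J_interior_Im (t : C) : (0 < Re t < / 2)%R -> (1 < Cmod t)%R -> (0 < Im t)%R -> (Im (J t) < 0)%R.
Proof.
  intros Hx Hm Hy. destruct (J_half_FD_Im t) as [H|H]; [unfold half_FD; lra|easy|exfalso].
  apply (interior_critical t (Im t + 1)); try lra. intros s Fs _. rewrite H. now apply J_half_FD_Im.
Qed.

(** A value in (0,1) is excluded on the imaginary axis, where J >= 1, on the line Re t = 1/2, where
    J <= 0, and inside, where J is not real. What remains is the arc, on which J is injective. *)
Lemma J_fiber_half (x u : R) (t : C) : (0 < x < 1)%R -> (arc_lo < u < 1)%R -> J (cay u) = RtoC x ->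
  half_FD t -> J t = RtoC x -> t = cay u.
Proof.
  intros Hx Hu Eu Ft Et. pose proof (half_FD_height t Ft) as Hy0. destruct Ft as (Fx & Fy & FM).
  assert (ER : Re (J t) = x) by (rewrite Et; apply re_RtoC).
  destruct (Req_dec (Re t) 0) as [H0|H0].
  { pose proof (J_imaginary_axis t Fy H0). lra. }
  destruct (Req_dec (Re t) (/ 2)) as [H1|H1].
  { exfalso. assert (Hs : (1 <= Cmod t * Cmod t)%R) by nra. rewrite Cmod_sqr, H1 in Hs.
    pose proof sqrt3_sqr. pose proof sqrt3_bounds.
    assert (Hy : (sqrt 3 / 2 <= Im t)%R) by nra.
    destruct Hy as [Hy|Hy]; [pose proof (J_half_line t H1 Hy); lra|].
    assert (E : t = rho).
    { apply injective_projections; [exact H1|symmetry; exact Hy]. }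
    rewrite E, J_rho, re_RtoC in ER. lra. }
  destruct (Req_dec (Cmod t) 1) as [H2|H2].
  - destruct (cay_of_circle t H2 Fy) as [E _]. set (v := (Im t / (1 + Re t))%R) in *.
    assert (Hs : (Re t * Re t + Im t * Im t = 1)%R) by (rewrite <- Cmod_sqr, H2; ring).
    assert (Hv0 : (0 < v)%R) by (apply Rdiv_lt_0_compat; lra).
    assert (Hv : (v * v * (1 + Re t) = 1 - Re t)%R).
    { unfold v. replace (Im t / (1 + Re t) * (Im t / (1 + Re t)) * (1 + Re t))%R with (Im t * Im t / (1 + Re t))%R by (field; lra).
      replace (Im t * Im t)%R with ((1 - Re t) * (1 + Re t))%R by lra. field. lra. }
    pose proof arc_lo_sqr. pose proof arc_lo_bounds.
    assert (Hv1 : (arc_lo <= v <= 1)%R) by (split; nra).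
    rewrite E in Et. destruct (Rtotal_order u v) as [L|[L|L]].
    + exfalso. apply (J_cay_injective u v); try lra. congruence.
    + now rewrite L.
    + exfalso. apply (J_cay_injective v u); try lra. congruence.
  - pose proof (J_interior_Im t ltac:(lra) ltac:(lra) Fy) as H. rewrite Et, im_RtoC in H. lra.
Qed.

(** A representative in the left half is first reflected; its reflection is [cay u], and on the unit
    circle reflecting is the same as applying S, so the orbit is unchanged. *)
Lemma J_fiber (x u : R) (t : C) : (0 < x < 1)%R -> (arc_lo < u < 1)%R -> J (cay u) = RtoC x ->
  (0 < Im t)%R -> J t = RtoC x -> sl2_equiv t (cay u).
Proof.
  intros Hx Hu Eu Ht Et. destruct (FD_exists t Ht) as [g (Fy & Fx & FM)]. set (s := mob g t) in *.
  assert (Es : J s = RtoC x) by (unfold s; now rewrite J_mob).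
  assert (Hst : t = mob (ginv g) s) by (symmetry; now apply mob_ginv).
  apply Rabs_le_between in Fx.
  destruct (Rle_lt_dec 0 (Re s)) as [H|H].
  - exists (ginv g). rewrite <- (J_fiber_half x u s Hx Hu Eu); [easy| |easy]. unfold half_FD. lra.
  - assert (Hw : - Cconj s = cay u).
    { apply (J_fiber_half x u (- Cconj s) Hx Hu Eu).
      - unfold half_FD. rewrite Im_reflect, Cmod_opp, Cmod_conj, re_opp, re_conj. lra.
      - rewrite J_reflect by easy. rewrite Es. apply Cconj_R. }
    pose proof arc_lo_bounds. assert (Hc : (0 < Im (cay u))%R) by (apply cay_Im_pos; lra).
    exists (SL2Z_mul (ginv g) gS). rewrite <- mob_compose by easy. rewrite mob_gS.
    replace (- / cay u) with s; [easy|].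
    rewrite <- (reflect_circle _ (Cmod_cay u)), <- Hw.
    destruct s as [a b]. apply injective_projections; simpl; ring.
Qed.

(** * Electrostatic equilibrium *)

Fixpoint rprod (f : nat -> R) (n : nat) : R :=
  match n with O => 1 | S k => rprod f k * f k end%R.

Lemma rprod_neq_0 (f : nat -> R) (n : nat) : (rprod f n <> 0)%R -> forall i, (i < n)%nat -> (f i <> 0)%R.
Proof.
  induction n as [|n IH]; intros H i Hi; [lia|]. simpl in H.
  destruct (Nat.eq_dec i n) as [->|Hn]; intros E.
  - apply H. rewrite E. ring.
  - apply IH with i; try lia; [|easy]. intros E'. apply H. rewrite E'. ring.
Qed.

Lemma rprod_pos (f : nat -> R) (n : nat) : (forall i, (i < n)%nat -> (0 < f i)%R) -> (0 < rprod f n)%R.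
Proof.
  induction n as [|n IH]; intros H; simpl; [lra|]. apply Rmult_lt_0_compat; [apply IH; intros; apply H; lia|apply H; lia].
Qed.

(** The bound 1 on the cube makes products stable without carrying constants along. *)
Definition bounded_ucont (n : nat) (F : (nat -> R) -> R) : Prop :=
  (forall x, cube n x -> (Rabs (F x) <= 1)%R) /\ ucont n F.

Lemma bounded_ucont_const (n : nat) : bounded_ucont n (fun _ => 1%R).
Proof.
  split; [intros; rewrite Rabs_R1; lra|]. intros eps He. exists 1%R. split; [lra|].
  intros x y _ _ _. rewrite Rminus_diag, Rabs_R0. lra.
Qed.

Lemma bounded_ucont_mult (n : nat) (F G : (nat -> R) -> R) :
  bounded_ucont n F -> bounded_ucont n G -> bounded_ucont n (fun x => F x * G x)%R.
Proof.
  intros [BF UF] [BG UG]. split.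
  - intros x Hx. rewrite Rabs_mult. specialize (BF x Hx). specialize (BG x Hx).
    pose proof (Rabs_pos (F x)). pose proof (Rabs_pos (G x)). nra.
  - intros eps He. destruct (UF (eps / 2)%R) as [d [Hd H]]; [lra|]. destruct (UG (eps / 2)%R) as [e [He' H']]; [lra|].
    exists (Rmin d e). split; [now apply Rmin_glb_lt|]. intros x y Hx Hy Hxy.
    specialize (H x y Hx Hy (fun i Hi => Rlt_le_trans _ _ _ (Hxy i Hi) (Rmin_l d e))).
    specialize (H' x y Hx Hy (fun i Hi => Rlt_le_trans _ _ _ (Hxy i Hi) (Rmin_r d e))).
    replace (F x * G x - F y * G y)%R with ((F x - F y) * G x + F y * (G x - G y))%R by ring.
    eapply Rle_trans; [apply Rabs_triang|]. rewrite !Rabs_mult. specialize (BF y Hy). specialize (BG x Hx).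
    pose proof (Rabs_pos (F y)). pose proof (Rabs_pos (G x)).
    pose proof (Rabs_pos (F x - F y)). pose proof (Rabs_pos (G x - G y)). nra.
Qed.

Lemma bounded_ucont_pow (n k : nat) (F : (nat -> R) -> R) : bounded_ucont n F -> bounded_ucont n (fun x => F x ^ k)%R.
Proof.
  intros HF. induction k as [|k IH]; [apply bounded_ucont_const|].
  apply (bounded_ucont_mult n F (fun x => F x ^ k)%R); easy.
Qed.

Lemma bounded_ucont_prod (n k : nat) (F : nat -> (nat -> R) -> R) :
  (forall a, (a < k)%nat -> bounded_ucont n (F a)) -> bounded_ucont n (fun x => rprod (fun a => F a x) k).
Proof.
  intros HF. induction k as [|k IH]; [apply bounded_ucont_const|].
  apply (bounded_ucont_mult n (fun x => rprod (fun a => F a x) k) (F k)); [apply IH; intros; apply HF; lia|apply HF; lia].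
Qed.

Lemma bounded_ucont_coord (n a : nat) : (a < n)%nat -> bounded_ucont n (fun x => x a).
Proof.
  intros Ha. split; [intros x Hx; specialize (Hx a Ha); apply Rabs_le; lra|].
  intros eps He. exists eps. split; [easy|]. intros x y _ _ H. specialize (H a Ha). lra.
Qed.

Lemma bounded_ucont_compl (n a : nat) : (a < n)%nat -> bounded_ucont n (fun x => 1 - x a)%R.
Proof.
  intros Ha. split; [intros x Hx; specialize (Hx a Ha); apply Rabs_le; lra|].
  intros eps He. exists eps. split; [easy|]. intros x y _ _ H. specialize (H a Ha).
  replace (1 - x a - (1 - y a))%R with (- (x a - y a))%R by ring. rewrite Rabs_Ropp. lra.
Qed.

Lemma bounded_ucont_diff (n a b : nat) : (a < n)%nat -> (b < n)%nat -> bounded_ucont n (fun x => x a - x b)%R.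
Proof.
  intros Ha Hb. split; [intros x Hx; pose proof (Hx a Ha); pose proof (Hx b Hb); apply Rabs_le; lra|].
  intros eps He. exists (eps / 2)%R. split; [lra|]. intros x y _ _ H. pose proof (H a Ha). pose proof (H b Hb).
  replace (x a - x b - (y a - y b))%R with ((x a - y a) - (x b - y b))%R by ring.
  eapply Rle_trans; [apply Rabs_triang|]. rewrite Rabs_Ropp. lra.
Qed.

Lemma upd_id (x : nat -> R) (i : nat) : upd x i (x i) = x.
Proof. apply functional_extensionality. intros k. unfold upd. destruct (Nat.eqb_spec k i) as [->|]; easy. Qed.

(** A logarithmic derivative in coordinate i in multiplied form, so that the product and power rules
    hold without division by F. *)
Definition log_der (i : nat) (x : nat -> R) (F : (nat -> R) -> R) (l : R) : Prop :=
  is_derive (fun s => F (upd x i s)) (x i) (F x * l)%R.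

Lemma log_der_eq (i : nat) (x : nat -> R) (F : (nat -> R) -> R) (l m : R) : l = m -> log_der i x F l -> log_der i x F m.
Proof. now intros ->. Qed.

Lemma log_der_const (i : nat) (x : nat -> R) (c : R) : log_der i x (fun _ => c) 0.
Proof. unfold log_der. rewrite Rmult_0_r. apply (is_derive_const (V := R_NormedModule)). Qed.

Lemma log_der_mult (i : nat) (x : nat -> R) (F G : (nat -> R) -> R) (l m : R) :
  log_der i x F l -> log_der i x G m -> log_der i x (fun x => F x * G x)%R (l + m)%R.
Proof.
  intros HF HG. unfold log_der.
  replace (F x * G x * (l + m))%R with (F x * l * G (upd x i (x i)) + F (upd x i (x i)) * (G x * m))%R by (rewrite !upd_id; ring).
  apply (is_derive_mult (K := R_AbsRing) (fun s => F (upd x i s)) (fun s => G (upd x i s))); try easy.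
  intros a b. apply Rmult_comm.
Qed.

Lemma log_der_pow (i : nat) (x : nat -> R) (F : (nat -> R) -> R) (l : R) (k : nat) :
  log_der i x F l -> log_der i x (fun x => F x ^ k)%R (INR k * l)%R.
Proof.
  intros HF. induction k as [|k IH].
  - apply log_der_eq with 0%R; [simpl; ring|]. apply (log_der_const i x 1).
  - apply log_der_eq with (l + INR k * l)%R; [rewrite S_INR; ring|]. now apply (log_der_mult i x F (fun x => F x ^ k)%R).
Qed.

Lemma log_der_prod (i : nat) (x : nat -> R) (k : nat) (F : nat -> (nat -> R) -> R) (l : nat -> R) :
  (forall a, (a < k)%nat -> log_der i x (F a) (l a)) -> log_der i x (fun x => rprod (fun a => F a x) k) (rsum l k).
Proof.
  intros HF. induction k as [|k IH]; [apply log_der_const|].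
  apply (log_der_mult i x (fun x => rprod (fun a => F a x) k) (F k)); [apply IH; intros; apply HF; lia|apply HF; lia].
Qed.

Definition kron (a i : nat) : R := if Nat.eqb a i then 1%R else 0%R.

Lemma is_derive_coord (a i : nat) (x : nat -> R) : is_derive (fun s => upd x i s a) (x i) (kron a i).
Proof.
  unfold upd, kron. destruct (Nat.eqb a i); [apply (is_derive_id (K := R_AbsRing))|apply (is_derive_const (V := R_NormedModule))].
Qed.

Lemma log_der_intro (i : nat) (x : nat -> R) (F : (nat -> R) -> R) (d : R) : (F x <> 0)%R ->
  is_derive (fun s => F (upd x i s)) (x i) d -> log_der i x F (d / F x).
Proof. intros H D. unfold log_der. now replace (F x * (d / F x))%R with d by (field; easy). Qed.

Lemma rsum_kron (c : nat -> R) (i n : nat) : (i < n)%nat -> rsum (fun a => kron a i * c a)%R n = c i.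
Proof.
  assert (H0 : forall n, (n <= i)%nat -> rsum (fun a => kron a i * c a)%R n = 0%R).
  { induction n0 as [|k IH]; intros Hk; [easy|]. simpl. rewrite IH by lia. unfold kron.
    replace (k =? i)%nat with false by (symmetry; apply Nat.eqb_neq; lia). ring. }
  induction n as [|n IH]; intros Hi; [lia|]. simpl. destruct (Nat.eq_dec i n) as [->|Hn].
  - rewrite H0 by lia. unfold kron. rewrite Nat.eqb_refl. ring.
  - rewrite IH by lia. unfold kron. replace (n =? i)%nat with false by (symmetry; apply Nat.eqb_neq; lia). ring.
Qed.

Lemma rsum_linear (a b : nat -> R) (c d : R) (n : nat) :
  rsum (fun i => c * a i + d * b i)%R n = (c * rsum a n + d * rsum b n)%R.
Proof. induction n as [|n IH]; simpl; [ring|]. rewrite IH. ring. Qed.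

(* The exponents 4, 3 and 12 (each pair occurs twice) are 6 times the charges 2/3, 1/2 and 2 imposed by the
   vanishing of the residues; the maximizer consists of the zeros of a Jacobi polynomial (Stieltjes). *)
Definition energy (n : nat) (x : nat -> R) : R :=
  rprod (fun a => x a ^ 4 * (1 - x a) ^ 3 * rprod (fun b => if Nat.eqb a b then 1 else (x a - x b) ^ 6) n)%R n.

Lemma energy_ucont (n : nat) : ucont n (energy n).
Proof.
  apply (bounded_ucont_prod n n (fun a x => x a ^ 4 * (1 - x a) ^ 3 * rprod (fun b => if Nat.eqb a b then 1 else (x a - x b) ^ 6) n)%R).
  intros a Ha. apply (bounded_ucont_mult n (fun x => x a ^ 4 * (1 - x a) ^ 3)%R).
  - apply (bounded_ucont_mult n (fun x => x a ^ 4)%R (fun x => (1 - x a) ^ 3)%R).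
    + now apply (bounded_ucont_pow n 4 (fun x => x a)), bounded_ucont_coord.
    + now apply (bounded_ucont_pow n 3 (fun x => 1 - x a)%R), bounded_ucont_compl.
  - apply (bounded_ucont_prod n n (fun b x => if Nat.eqb a b then 1 else (x a - x b) ^ 6)%R).
    intros b Hb. destruct (Nat.eqb a b); [apply bounded_ucont_const|].
    now apply (bounded_ucont_pow n 6 (fun x => x a - x b)%R), bounded_ucont_diff.
Qed.

Lemma energy_factors (n : nat) (x : nat -> R) : (energy n x <> 0)%R -> forall a, (a < n)%nat ->
  (x a <> 0)%R /\ (1 - x a <> 0)%R /\ forall b, (b < n)%nat -> a <> b -> (x a - x b <> 0)%R.
Proof.
  intros H a Ha. pose proof (rprod_neq_0 _ n H a Ha) as Hf. cbv beta in Hf.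
  assert (HP : (x a ^ 4 * (1 - x a) ^ 3 <> 0)%R) by (intros E; apply Hf; rewrite E; ring).
  assert (HV : (rprod (fun b => if Nat.eqb a b then 1 else (x a - x b) ^ 6) n <> 0)%R) by (intros E; apply Hf; rewrite E; ring).
  split; [intros E; apply HP; rewrite E; ring|]. split; [intros E; apply HP; rewrite E; ring|].
  intros b Hb Hab E. pose proof (rprod_neq_0 _ n HV b Hb) as HV'. cbv beta in HV'. apply Nat.eqb_neq in Hab. rewrite Hab in HV'.
  apply HV'. rewrite E. ring.
Qed.

Lemma energy_pos (n : nat) : exists x, cube n x /\ (0 < energy n x)%R.
Proof.
  exists (fun a => (INR a + 1) / (INR n + 1))%R. pose proof (pos_INR n) as Hn.
  assert (H : forall a, (a < n)%nat -> (0 < (INR a + 1) / (INR n + 1) < 1)%R).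
  { intros a Ha. apply lt_INR in Ha. pose proof (pos_INR a). split; [apply Rdiv_lt_0_compat; lra|]. apply Rlt_div_l; lra. }
  split; [intros a Ha; specialize (H a Ha); lra|]. apply rprod_pos. intros a Ha. pose proof (H a Ha) as H1.
  apply Rmult_lt_0_compat; [apply Rmult_lt_0_compat; apply pow_lt; lra|]. apply rprod_pos. intros b Hb.
  destruct (Nat.eqb_spec a b) as [|Hab]; [lra|].
  replace ((INR a + 1) / (INR n + 1) - (INR b + 1) / (INR n + 1))%R with ((INR a - INR b) / (INR n + 1))%R by (field; lra).
  assert (Hz : ((INR a - INR b) / (INR n + 1) <> 0)%R).
  { intros E. apply Hab, INR_eq. assert (INR a - INR b = 0 * (INR n + 1))%R by (rewrite <- E; field; lra). lra. }
  set (z := ((INR a - INR b) / (INR n + 1))%R) in *. replace (z ^ 6)%R with (Rsqr (z ^ 3)) by (unfold Rsqr; ring).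
  apply Rsqr_pos_lt, pow_nonzero, Hz.
Qed.

Lemma energy_log_der (n i : nat) (x : nat -> R) : (energy n x <> 0)%R -> (i < n)%nat ->
  log_der i x (energy n) (4 / x i - 3 / (1 - x i) + 12 * rsum (fun j => if Nat.eqb i j then 0 else / (x i - x j)) n)%R.
Proof.
  intros H Hi. pose proof (energy_factors n x H) as Hf.
  set (c := fun a b => if Nat.eqb a b then 0%R else (/ (x a - x b))%R).
  (* Each pair containing i occurs once in row i and once in column i; by antisymmetry the two
     contributions agree, and 6 becomes 12. *)
  assert (Hc : forall a, c a i = (- c i a)%R).
  { intros a. unfold c. rewrite (Nat.eqb_sym a i). destruct (Nat.eqb i a); [ring|].
    rewrite <- Rinv_opp. f_equal. ring. }
  apply log_der_eq with (rsum (fun a => (4 * (kron a i / x a) + 3 * (- kron a i / (1 - x a))) + rsum (fun b => 6 * ((kron a i - kron b i) * c a b)) n) n)%R.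
  - rewrite (rsum_ext _ (fun a => 1 * (kron a i * (4 / x a - 3 / (1 - x a) + 6 * rsum (c a) n)) + (-6) * c a i)%R).
    + rewrite rsum_linear, (rsum_kron (fun a => 4 / x a - 3 / (1 - x a) + 6 * rsum (c a) n)%R) by easy.
      rewrite (rsum_ext (fun a => c a i) (fun a => 0 * c i a + (-1) * c i a)%R) by (intros; rewrite Hc; ring).
      rewrite rsum_linear. change (fun j => if Nat.eqb i j then 0%R else (/ (x i - x j))%R) with (c i).
      change (fun a => c i a) with (c i). ring.
    + intros a Ha. destruct (Hf a Ha) as (H1 & H2 & _).
      rewrite (rsum_ext _ (fun b => (6 * kron a i) * c a b + (-6) * (kron b i * c a b))%R) by (intros; ring).
      rewrite rsum_linear, (rsum_kron (c a)) by easy. field. split; easy.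
  - apply (log_der_prod i x n (fun a x => x a ^ 4 * (1 - x a) ^ 3 * rprod (fun b => if Nat.eqb a b then 1 else (x a - x b) ^ 6) n)%R).
    intros a Ha. destruct (Hf a Ha) as (H1 & H2 & H3).
    apply (log_der_mult i x (fun x => x a ^ 4 * (1 - x a) ^ 3)%R); [apply (log_der_mult i x (fun x => x a ^ 4)%R (fun x => (1 - x a) ^ 3)%R)|].
    + apply log_der_eq with (INR 4 * (kron a i / x a))%R; [f_equal; simpl; ring|].
      apply (log_der_pow i x (fun x => x a)), (log_der_intro i x (fun x => x a)); [easy|apply is_derive_coord].
    + apply log_der_eq with (INR 3 * ((0 - kron a i) / (1 - x a)))%R; [f_equal; [simpl; ring|field; easy]|].
      apply (log_der_pow i x (fun x => 1 - x a)%R), (log_der_intro i x (fun x => 1 - x a)%R); [easy|].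
      apply (is_derive_minus (V := R_NormedModule) (fun _ => 1%R)); [apply (is_derive_const (V := R_NormedModule))|apply is_derive_coord].
    + apply (log_der_prod i x n (fun b x => if Nat.eqb a b then 1 else (x a - x b) ^ 6)%R).
      intros b Hb. unfold c. destruct (Nat.eqb_spec a b) as [->|Hab].
      * apply log_der_eq with 0%R; [ring|apply log_der_const].
      * apply log_der_eq with (INR 6 * ((kron a i - kron b i) / (x a - x b)))%R; [f_equal; simpl; ring|].
        apply (log_der_pow i x (fun x => x a - x b)%R), (log_der_intro i x (fun x => x a - x b)%R); [now apply H3|].
        apply (is_derive_minus (V := R_NormedModule)); apply is_derive_coord.
Qed.

(** The energy vanishes as soon as a coordinate is 0 or 1 or two coordinates agree, and it is
    positive somewhere. A maximizer is therefore interior with distinct coordinates, and its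
    logarithmic derivatives are 0. *)
Lemma equilibrium (n : nat) : exists x : nat -> R, (forall i, (i < n)%nat -> (0 < x i < 1)%R) /\
  (forall i j, (i < n)%nat -> (j < n)%nat -> i <> j -> x i <> x j) /\
  forall i, (i < n)%nat -> (4 / x i - 3 / (1 - x i) + 12 * rsum (fun j => if Nat.eqb i j then 0 else / (x i - x j)) n = 0)%R.
Proof.
  destruct (ucont_max n (energy n) (energy_ucont n)) as [x [Hx Hm]].
  destruct (energy_pos n) as [y [Hy Hpos]]. specialize (Hm y Hy) as Hxy.
  assert (H0 : (energy n x <> 0)%R) by lra. pose proof (energy_factors n x H0) as Hf.
  assert (Hin : forall i, (i < n)%nat -> (0 < x i < 1)%R).
  { intros i Hi. destruct (Hf i Hi) as (H1 & H2 & _). specialize (Hx i Hi). lra. }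
  exists x. split; [easy|]. split.
  - intros i j Hi Hj Hij E. destruct (Hf i Hi) as (_ & _ & H3). apply (H3 j Hj Hij). lra.
  - intros i Hi. pose proof (energy_log_der n i x H0 Hi) as D. unfold log_der in D.
    set (l := (4 / x i - _ + _)%R) in *.
    assert (pr : derivable_pt (fun s => energy n (upd x i s)) (x i)) by (apply ex_derive_Reals_0; eexists; exact D).
    specialize (Hin i Hi).
    assert (D0 := deriv_maximum _ 0 1 (x i) pr ltac:(lra) ltac:(lra)).
    enough (Hl : (energy n x * l = 0)%R) by (apply Rmult_integral in Hl; now destruct Hl).
    apply is_derive_unique in D. rewrite <- D. etransitivity; [symmetry; exact (Derive_Reals _ _ pr)|].
    apply D0. intros s H1 H2. rewrite upd_id. apply Hm. intros k Hk.
    unfold upd. destruct (Nat.eqb k i); [lra|now apply Hx].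
Qed.

(** * Taylor expansions *)

Definition cont0 (g : C -> C) : Prop :=
  forall eps : R, (0 < eps)%R -> exists d : R, (0 < d)%R /\ forall s, (Cmod s < d)%R -> (Cmod (g s - g 0) < eps)%R.

(** A Taylor expansion at 0 whose remainder is merely continuous. It is stable under sums, products
    and inverses, and unlike an expansion in o-notation it provides the quotient as a function. *)
Fixpoint jet (N : nat) (g : C -> C) : Prop :=
  match N with
  | O => cont0 g
  | S k => exists (r : R) (c : C) (g1 : C -> C), (0 < r)%R /\ (forall s, (Cmod s < r)%R -> g s = c + s * g1 s) /\ jet k g1
  end.

Lemma cont0_ext (g h : C -> C) (r : R) : (0 < r)%R -> (forall s, (Cmod s < r)%R -> g s = h s) -> cont0 g -> cont0 h.
Proof.
  intros Hr E Hg eps He. destruct (Hg eps He) as [d [Hd H]]. exists (Rmin d r). split; [now apply Rmin_glb_lt|].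
  intros s Hs. apply Rmin_Rgt in Hs. rewrite <- !E by (try rewrite Cmod_0; lra). apply H. lra.
Qed.

Lemma cder_cont0 (g : C -> C) (l : C) : cder g 0 l -> cont0 g.
Proof.
  intros H eps He. destruct (cder_cont g 0 l H eps He) as [d [Hd HH]]. exists d. split; [easy|].
  intros s Hs. specialize (HH s Hs). now rewrite Cplus_0_l in HH.
Qed.

Lemma cont0_const (c : C) : cont0 (fun _ => c).
Proof. intros eps He. exists 1%R. split; [lra|]. intros. replace (c - c) with (RtoC 0) by ring. now rewrite Cmod_0. Qed.

Lemma cont0_plus (g h : C -> C) : cont0 g -> cont0 h -> cont0 (fun s => g s + h s).
Proof.
  intros Hg Hh eps He. destruct (Hg (eps / 2)%R) as [d [Hd H]]; [lra|]. destruct (Hh (eps / 2)%R) as [e [He' H']]; [lra|].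
  exists (Rmin d e). split; [now apply Rmin_glb_lt|]. intros s Hs. apply Rmin_Rgt in Hs.
  specialize (H s ltac:(lra)). specialize (H' s ltac:(lra)).
  replace (g s + h s - (g 0 + h 0)) with ((g s - g 0) + (h s - h 0)) by ring.
  eapply Rle_lt_trans; [apply Cmod_triangle|]. lra.
Qed.

Lemma cont0_comp (g G : C -> C) (m : C) : cont0 g -> cder G (g 0) m -> cont0 (fun s => G (g s)).
Proof.
  intros Hg HG eps He. destruct (cder_cont G (g 0) m HG eps He) as [d [Hd H]].
  destruct (Hg d Hd) as [e [He' H']]. exists e. split; [easy|]. intros s Hs. specialize (H _ (H' s Hs)).
  now replace (g 0 + (g s - g 0)) with (g s) in H by ring.
Qed.

Lemma cont0_scal (c : C) (g : C -> C) : cont0 g -> cont0 (fun s => c * g s).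
Proof. intros Hg. exact (cont0_comp g (fun x => c * x) _ Hg (cder_scal c _ _ _ (cder_id _))). Qed.

Lemma cont0_mult (g h : C -> C) : cont0 g -> cont0 h -> cont0 (fun s => g s * h s).
Proof.
  intros Hg Hh. assert (Hsq : forall k, cont0 k -> cont0 (fun s => k s * k s)).
  { intros k Hk. exact (cont0_comp k (fun x => x * x) _ Hk (cder_sqr _)). }
  apply (cont0_ext (fun s => / 4 * ((g s + h s) * (g s + h s) + (-1) * ((g s + (-1) * h s) * (g s + (-1) * h s)))) _ 1%R); [lra| |].
  - intros s _. replace (RtoC (-1)) with (- RtoC 1) by (rewrite <- RtoC_opp; easy). field.
  - apply cont0_scal, (cont0_plus (fun s => (g s + h s) * (g s + h s))).
    + apply (Hsq (fun s => g s + h s)). now apply cont0_plus.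
    + apply (cont0_scal (-1)). apply (Hsq (fun s => g s + (-1) * h s)). apply cont0_plus; [easy|now apply cont0_scal].
Qed.

Lemma jet_cont0 (N : nat) : forall g, jet N g -> cont0 g.
Proof.
  induction N as [|N IH]; intros g H; [easy|]. destruct H as (r & c & g1 & Hr & E & H1).
  apply (cont0_ext (fun s => c + s * g1 s) g r Hr); [intros s Hs; symmetry; now apply E|].
  apply cont0_plus; [apply cont0_const|]. apply (cont0_mult (fun s => s)); [apply (cder_cont0 _ _ (cder_id 0))|now apply IH].
Qed.

Lemma jet_value (N : nat) (g : C -> C) (r : R) (c : C) (g1 : C -> C) : (0 < r)%R ->
  (forall s, (Cmod s < r)%R -> g s = c + s * g1 s) -> c = g 0.
Proof. intros Hr E. rewrite E by (now rewrite Cmod_0). ring. Qed.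

Lemma jet_pred (N : nat) : forall g, jet (S N) g -> jet N g.
Proof.
  induction N as [|N IH]; intros g H; [now apply (jet_cont0 1)|].
  destruct H as (r & c & g1 & Hr & E & H1). exists r, c, g1. split; [easy|]. split; [easy|]. now apply IH.
Qed.

Lemma jet_const (N : nat) : forall c, jet N (fun _ => c).
Proof.
  induction N as [|N IH]; intros c; [apply cont0_const|]. exists 1%R, c, (fun _ => 0). split; [lra|]. split; [intros; ring|apply IH].
Qed.

Lemma jet_plus (N : nat) : forall g h, jet N g -> jet N h -> jet N (fun s => g s + h s).
Proof.
  induction N as [|N IH]; intros g h; [apply cont0_plus|].
  intros (r & c & g1 & Hr & E & H1) (r' & c' & h1 & Hr' & E' & H1').
  exists (Rmin r r'), (c + c'), (fun s => g1 s + h1 s). split; [now apply Rmin_glb_lt|]. split; [|now apply IH].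
  intros s Hs. apply Rmin_Rgt in Hs. rewrite E, E' by lra. ring.
Qed.

Lemma jet_mult (N : nat) : forall g h, jet N g -> jet N h -> jet N (fun s => g s * h s).
Proof.
  induction N as [|N IH]; intros g h Hg Hh; [now apply cont0_mult|].
  pose proof (jet_pred N g Hg) as Hg0.
  destruct Hg as (r & c & g1 & Hr & E & H1). destruct Hh as (r' & c' & h1 & Hr' & E' & H1').
  exists (Rmin r r'), (c * c'), (fun s => g1 s * c' + g s * h1 s). split; [now apply Rmin_glb_lt|]. split.
  - intros s Hs. apply Rmin_Rgt in Hs. rewrite E, E' by lra. ring.
  - apply (jet_plus N (fun s => g1 s * c')); [apply (IH g1 (fun _ => c')); [easy|apply jet_const]|now apply IH].
Qed.

Lemma cont0_neq_0 (g : C -> C) : cont0 g -> g 0 <> 0 -> exists r, (0 < r)%R /\ forall s, (Cmod s < r)%R -> g s <> 0.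
Proof.
  intros Hg H0. apply Cmod_gt_0 in H0. destruct (Hg _ H0) as [d [Hd H]]. exists d. split; [easy|].
  intros s Hs E. specialize (H s Hs). rewrite E in H. replace (0 - g 0) with (- g 0) in H by ring. rewrite Cmod_opp in H. lra.
Qed.

Lemma jet_inv (N : nat) : forall g : C -> C, g 0 <> 0 -> jet N g -> jet N (fun s => / g s).
Proof.
  induction N as [|N IH]; intros g H0 Hg; [exact (cont0_comp g Cinv _ Hg (cder_inv _ H0))|].
  pose proof (jet_pred N g Hg) as Hg0. pose proof (jet_cont0 _ g Hg) as Hc.
  destruct (cont0_neq_0 g Hc H0) as [d [Hd Hn]].
  destruct Hg as (r & c & g1 & Hr & E & H1). pose proof (jet_value N g r c g1 Hr E) as Ec. rewrite <- Ec in H0.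
  exists (Rmin r d), (/ c), (fun s => - / c * (g1 s * / g s)). split; [now apply Rmin_glb_lt|]. split.
  - intros s Hs. apply Rmin_Rgt in Hs. specialize (Hn s ltac:(lra)).
    replace (s * (- / c * (g1 s * / g s))) with (- / c * ((s * g1 s) * / g s)) by ring.
    replace (s * g1 s) with (g s - c) by (rewrite E by lra; ring). field. split; easy.
  - apply (jet_mult N (fun _ => - / c)); [apply jet_const|]. apply jet_mult; [easy|]. apply IH; [now rewrite <- Ec|easy].
Qed.

Lemma jet_cder (g g1 : C -> C) (c : C) (r : R) : (0 < r)%R -> (forall s, (Cmod s < r)%R -> g s = c + s * g1 s) ->
  cont0 g1 -> cder g 0 (g1 0).
Proof.
  intros Hr E H1 eps He. destruct (H1 eps He) as [d [Hd H]]. exists (Rmin r d). split; [now apply Rmin_glb_lt|].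
  intros h Hh. apply Rmin_Rgt in Hh. rewrite Cplus_0_l. rewrite !E by (try rewrite Cmod_0; lra).
  replace (c + h * g1 h - (c + 0 * g1 0) - h * g1 0) with (h * (g1 h - g1 0)) by ring.
  rewrite Cmod_mult. specialize (H h ltac:(lra)). pose proof (Cmod_ge_0 h). nra.
Qed.

Lemma cder_monomial (c : C) (m : nat) (z : C) : cder (fun s => c * Cpow s (S m)) z (c * (INR (S m) * Cpow z m)).
Proof.
  apply cder_eq with (c * (INR (S m) * Cpow z m * 1)); [ring|]. apply cder_scal.
  apply (cder_pow (fun s => s)), cder_id.
Qed.

(** Division by a power through integration: peel the constant c off p, subtract its primitive c
    s^(m+1)/(m+1), and continue with s^(m+1) in place of s^m and one order less. *)
Lemma divide_power (N : nat) : forall (m : nat) (F p : C -> C) (r : R), (0 < r)%R -> F 0 = 0 ->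
  (forall s, (Cmod s < r)%R -> cder F s (Cpow s m * p s)) -> jet N p ->
  exists G, (forall s, F s = Cpow s (S m) * G s) /\ G 0 = p 0 / INR (S m) /\ jet N G.
Proof.
  induction N as [|N IH]; intros m F p r Hr F0 HF Hp; pose proof (INR_S_neq_0 m) as Hm.
  - set (G := fun s : C => if Ceq_dec s 0 then p 0 / INR (S m) else F s / Cpow s (S m)).
    assert (G0 : G 0 = p 0 / INR (S m)) by (unfold G; destruct (Ceq_dec 0 0) as [_|Z]; [easy|now destruct Z]).
    assert (GF : forall s, F s = Cpow s (S m) * G s).
    { intros s. unfold G. destruct (Ceq_dec s 0) as [->|Hs]; [rewrite F0; simpl; ring|].
      pose proof (Cpow_nz s (S m) Hs) as Hz. set (z := Cpow s (S m)) in *. field. exact Hz. }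
    exists G. split; [easy|]. split; [easy|]. intros eps He.
    destruct (Hp (eps / 2)%R ltac:(lra)) as [d [Hd H]]. exists (Rmin r d). split; [now apply Rmin_glb_lt|].
    intros s Hs. apply Rmin_Rgt in Hs.
    destruct (Ceq_dec s 0) as [->|Hs0]; [replace (G 0 - G 0) with (RtoC 0) by ring; now rewrite Cmod_0|].
    pose proof (Cmod_gt_0 s) as [Hs1 _]. specialize (Hs1 Hs0).
    (* After subtraction of the leading monomial the derivative is x^m (p x - p 0), which continuity
       of p makes small against |x|^m; the mean value inequality then yields the continuity of G at
       0. *)
    set (F2 := fun s => F s - p 0 / INR (S m) * Cpow s (S m)).
    assert (HM : (Cmod (F2 (0 + s)%C - F2 0%C) <= (eps / 2 * Cmod s ^ m) * Cmod s)%R).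
    { apply (cder_MVI F2 (fun x => Cpow x m * (p x - p 0)) 0 s (eps / 2 * Cmod s ^ m)%R).
      - intros x Hx. rewrite Cplus_0_l. assert (Hxs : (Cmod (x * s) <= Cmod s)%R).
        { rewrite Cmod_mult, Cmod_RtoC_pos by lra. nra. }
        apply cder_eq with (Cpow (x * s) m * p (x * s) - p 0 / INR (S m) * (INR (S m) * Cpow (x * s) m)).
        + set (z := Cpow (x * s) m). field. easy.
        + apply (cder_minus F); [apply HF; lra|apply cder_monomial].
      - intros x Hx. rewrite Cplus_0_l. assert (Hxs : (Cmod (x * s) <= Cmod s)%R).
        { rewrite Cmod_mult, Cmod_RtoC_pos by lra. nra. }
        rewrite Cmod_mult, Cmod_pow, Rmult_comm. apply Rmult_le_compat; try apply Cmod_ge_0.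
        + apply pow_le, Cmod_ge_0.
        + apply Rlt_le, H. lra.
        + apply pow_incr. split; [apply Cmod_ge_0|easy]. }
    rewrite Cplus_0_l in HM. unfold F2 in HM. rewrite F0, GF in HM.
    replace (Cpow s (S m) * G s - p 0 / INR (S m) * Cpow s (S m) - (0 - p 0 / INR (S m) * Cpow 0 (S m)))
      with (Cpow s (S m) * (G s - G 0)) in HM by (rewrite G0; simpl; ring).
    rewrite Cmod_mult, Cmod_pow in HM. simpl pow in HM.
    assert (Hpp : (0 < Cmod s * Cmod s ^ m)%R) by (apply Rmult_lt_0_compat; [easy|now apply pow_lt]).
    assert ((Cmod s * Cmod s ^ m) * Cmod (G s - G 0)%C <= (Cmod s * Cmod s ^ m) * (eps / 2))%R by lra.
    apply Rmult_le_reg_l in H0; [lra|easy].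
  - destruct Hp as (r' & c & p1 & Hr' & E & H1). pose proof (jet_value N p r' c p1 Hr' E) as Ec.
    destruct (IH (S m) (fun s => F s - c / INR (S m) * Cpow s (S m)) p1 (Rmin r r')) as (G & HG & G0 & JG).
    + now apply Rmin_glb_lt.
    + rewrite F0. simpl. ring.
    + intros s Hs. apply Rmin_Rgt in Hs.
      apply cder_eq with (Cpow s m * p s - c / INR (S m) * (INR (S m) * Cpow s m)).
      * rewrite E by lra. simpl Cpow. set (z := Cpow s m). field. easy.
      * apply (cder_minus F); [apply HF; lra|apply cder_monomial].
    + easy.
    + exists (fun s => c / INR (S m) + s * G s). split; [|split].
      * intros s. specialize (HG s). replace (F s) with (F s - c / INR (S m) * Cpow s (S m) + c / INR (S m) * Cpow s (S m)) by ring.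
        rewrite HG. simpl Cpow. ring.
      * rewrite Ec. ring.
      * exists 1%R, (c / INR (S m)), G. split; [lra|]. split; easy.
Qed.

(** Splitting off the constant term of p first keeps the order S N for the quotient. The derivative
    d/2 arises because p(0) + d s + ... integrates to s (p(0) + d s/2 + ...). *)
Lemma divide_once (N : nat) (F p : C -> C) (r : R) (d : C) : (0 < r)%R -> F 0 = 0 ->
  (forall s, (Cmod s < r)%R -> cder F s (p s)) -> jet (S N) p -> cder p 0 d ->
  exists G, (forall s, F s = s * G s) /\ G 0 = p 0 /\ jet (S N) G /\ cder G 0 (d / 2).
Proof.
  intros Hr F0 HF Hp Hd. destruct Hp as (r' & c & p1 & Hr' & E & H1). pose proof (jet_value N p r' c p1 Hr' E) as Ec.
  assert (Ed : p1 0 = d).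
  { apply (cder_unique p 0); [|easy]. apply (jet_cder p p1 c r' Hr' E). now apply (jet_cont0 N). }
  destruct (divide_power N 1 (fun s => F s - c * s) p1 (Rmin r r')) as (G & HG & G0 & JG).
  - now apply Rmin_glb_lt.
  - rewrite F0. ring.
  - intros s Hs. apply Rmin_Rgt in Hs. apply cder_eq with (p s - c * 1).
    + rewrite E by lra. simpl. ring.
    + apply (cder_minus F); [apply HF; lra|apply cder_scal, cder_id].
  - easy.
  - exists (fun s => c + s * G s). split; [|split; [|split]].
    + intros s. specialize (HG s). replace (F s) with (F s - c * s + c * s) by ring. rewrite HG. simpl Cpow. ring.
    + rewrite Ec. ring.
    + exists 1%R, c, G. split; [lra|]. split; easy.
    + apply cder_eq with (G 0); [rewrite G0, Ed; simpl INR; f_equal|].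
      apply (jet_cder _ G c 1%R); [lra|easy|now apply (jet_cont0 N)].
Qed.

(** Higher derivatives are exhibited rather than deduced from Cauchy's formula: derivatives of
    Fourier series are Fourier series, and those of powers of eta and of 1/Delta are multiples of
    the same function by E2, so induction on k closes. *)
Fixpoint smooth (k : nat) (f : C -> C) : Prop :=
  match k with
  | O => True
  | S j => exists f', (forall t, (0 < Im t)%R -> cder f t (f' t)) /\ smooth j f'
  end.

Lemma smooth_pred (k : nat) : forall f, smooth (S k) f -> smooth k f.
Proof. induction k as [|k IH]; intros f (f' & H & Hs); [easy|]. exists f'. split; [easy|now apply IH]. Qed.

Lemma smooth_const (k : nat) : forall c, smooth k (fun _ => c).
Proof. induction k as [|k IH]; intros c; [easy|]. exists (fun _ => 0). split; [intros; apply cder_const|apply IH]. Qed.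

Lemma smooth_plus (k : nat) : forall f g, smooth k f -> smooth k g -> smooth k (fun t => f t + g t).
Proof.
  induction k as [|k IH]; intros f g; [easy|]. intros (f' & Hf & Sf) (g' & Hg & Sg).
  exists (fun t => f' t + g' t). split; [|now apply IH]. intros t Ht. apply cder_plus; auto.
Qed.

Lemma smooth_mult (k : nat) : forall f g, smooth k f -> smooth k g -> smooth k (fun t => f t * g t).
Proof.
  induction k as [|k IH]; intros f g; [easy|]. intros Sf Sg.
  pose proof (smooth_pred k f Sf) as Sf0. pose proof (smooth_pred k g Sg) as Sg0.
  destruct Sf as (f' & Hf & Sf). destruct Sg as (g' & Hg & Sg).
  exists (fun t => f' t * g t + f t * g' t). split; [intros t Ht; apply cder_mult; auto|].
  apply (smooth_plus k (fun t => f' t * g t) (fun t => f t * g' t)); now apply IH.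
Qed.

Lemma smooth_scal (k : nat) (c : C) (f : C -> C) : smooth k f -> smooth k (fun t => c * f t).
Proof. intros H. apply (smooth_mult k (fun _ => c)); [apply smooth_const|easy]. Qed.

Lemma smooth_Fs (k : nat) : forall a, growth a -> smooth k (Fs a).
Proof.
  induction k as [|k IH]; intros a Ha; [easy|]. exists (fun t => twopii * Fs (Da a) t).
  split; [intros t Ht; now apply cder_Fs|]. now apply smooth_scal, IH, growth_Da.
Qed.

Lemma smooth_eta_pow (k n : nat) : smooth k (fun t => Cpow (eta t) n).
Proof.
  induction k as [|k IH]; [easy|]. exists (fun t => twopii * (INR n / 24 * eP t * Cpow (eta t) n)).
  split; [intros t Ht; now apply cder_eta_pow|].
  apply smooth_scal, (smooth_mult k (fun t => INR n / 24 * eP t)); [|easy]. apply smooth_scal, smooth_Fs, growth_cP.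
Qed.

Lemma smooth_inv_Delta (k : nat) : smooth k (fun t => / Defs.Delta t).
Proof.
  induction k as [|k IH]; [easy|]. exists (fun t => - twopii * (eP t * / Defs.Delta t)). split.
  - intros t Ht. pose proof (Delta_neq_0 t Ht) as HD.
    apply cder_eq with (- (twopii * (eP t * Defs.Delta t)) / (Defs.Delta t * Defs.Delta t)); [field; easy|].
    apply cder_Cinv; [easy|now apply cder_Delta].
  - apply smooth_scal, (smooth_mult k eP); [apply smooth_Fs, growth_cP|easy].
Qed.

Lemma smooth_dJ (k : nat) : smooth k dJ.
Proof.
  assert (H : smooth k (fun t => - twopii / 1728 * ((eQ t * eQ t) * eR t * / Defs.Delta t))).
  { apply smooth_scal, (smooth_mult k (fun t => (eQ t * eQ t) * eR t)); [|apply smooth_inv_Delta].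
    apply (smooth_mult k (fun t => eQ t * eQ t)); [apply (smooth_mult k eQ eQ); apply smooth_Fs, growth_cQ|apply smooth_Fs, growth_cR]. }
  destruct k as [|k]; [easy|]. destruct H as (f' & Hf & Sf). exists f'. split; [|easy]. intros t Ht.
  apply (cder_ext_loc _ dJ t (f' t) (Im t) Ht) in Hf; try easy.
  intros x Hx. apply upper_ball in Hx. pose proof (Delta_neq_0 x Hx) as HD. unfold dJ. simpl. set (D := Defs.Delta x) in *. field. easy.
Qed.

Lemma smooth_J (k : nat) : smooth k J.
Proof. destruct k as [|k]; [easy|]. exists dJ. split; [exact cder_J|apply smooth_dJ]. Qed.

Lemma cder_shift (f : C -> C) (t s l : C) : cder f (t + s) l -> cder (fun s => f (t + s)) s l.
Proof.
  intros H. apply cder_eq with (1 * l); [ring|]. apply (cder_comp (fun s => t + s) f); [|easy].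
  apply cder_eq with (0 + 1); [ring|]. apply cder_plus; [apply cder_const|apply cder_id].
Qed.

Lemma upper_shift_ball (t s : C) : (Cmod s < Im t)%R -> (0 < Im (t + s))%R.
Proof. intros H. apply (upper_ball t). now replace (t + s - t) with s by ring. Qed.

(** Taylor's formula by induction: the jet of the derivative is integrated by [divide_power]. *)
Lemma smooth_jet (k : nat) : forall (f : C -> C) (t : C), (0 < Im t)%R -> smooth (S k) f -> jet k (fun s => f (t + s)).
Proof.
  induction k as [|k IH]; intros f t Ht (f' & Hf & Sf).
  - apply (cder_cont0 _ (f' t)). apply cder_shift. replace (t + 0) with t by ring. now apply Hf.
  - destruct (divide_power k 0 (fun s => f (t + s) - f t) (fun s => f' (t + s)) (Im t) Ht) as (G & HG & _ & JG).
    + replace (t + 0) with t by ring. ring.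
    + intros s Hs. apply cder_eq with (f' (t + s) - 0); [simpl; ring|]. apply cder_minus; [|apply cder_const].
      apply cder_shift, Hf. now apply upper_shift_ball.
    + now apply IH.
    + exists 1%R, (f t), G. split; [lra|]. split; [|easy]. intros s _. specialize (HG s).
      replace (f (t + s)) with (f (t + s) - f t + f t) by ring. rewrite HG. simpl. ring.
Qed.

(** * Residues and the theorem *)

Lemma cder_holo (f : C -> C) (z l : C) : cder f z l -> holo_at f z.
Proof. intros H. exists l. now apply cder_is_derive. Qed.

(* With E = E0 + E1 s + ... and u = s v, the residue of E / u^2 is the linear coefficient of E / v^2. *)
Lemma double_pole_quotient (E u v : C -> C) (w e1 v1 : C) : (0 < Im w)%R -> smooth 4 E -> smooth 1 u ->
  (forall s, u (w + s) = s * v s) -> jet 3 v -> v 0 <> 0 -> E w <> 0 -> cder E w e1 -> cder v 0 v1 ->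
  e1 * v 0 = 2 * E w * v1 -> double_pole_zero_residue (fun z => E z / Cpow (u z) 2) w.
Proof.
  intros Hw SE Su Huv Jv v0 E0 HE Hv Hres.
  set (phi := fun s => E (w + s) * (/ v s * / v s)).
  assert (Jphi : jet 3 phi).
  { apply (jet_mult 3 (fun s => E (w + s))); [now apply smooth_jet|].
    apply (jet_mult 3 (fun s => / v s) (fun s => / v s)); now apply jet_inv. }
  (* The relation between [e1] and [v1] says exactly that E/v^2 has derivative 0 at the centre. *)
  assert (Dphi : cder phi 0 0).
  { apply cder_eq with (e1 * (/ v 0 * / v 0) + E (w + 0) * (- v1 / (v 0 * v 0) * / v 0 + / v 0 * (- v1 / (v 0 * v 0)))).
    - replace (w + 0) with w by ring. replace e1 with (2 * E w * v1 / v 0) by (rewrite <- Hres; field; easy). field. easy.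
    - apply (cder_mult (fun s => E (w + s)) (fun s => / v s * / v s)); [apply cder_shift; now replace (w + 0) with w by ring|].
      apply (cder_mult (fun s => / v s) (fun s => / v s)); now apply cder_Cinv. }
  destruct Jphi as (r1 & c0 & phi1 & Hr1 & E1 & J1). pose proof (jet_value 2 phi r1 c0 phi1 Hr1 E1) as Ec0.
  assert (Z1 : phi1 0 = 0).
  { apply (cder_unique phi 0); [|easy]. apply (jet_cder phi phi1 c0 r1 Hr1 E1). now apply (jet_cont0 2). }
  destruct J1 as (r2 & c1 & phi2 & Hr2 & E2 & J2). pose proof (jet_value 1 phi1 r2 c1 phi2 Hr2 E2) as Ec1.
  (* Two orders of the jet are spent on removing c0 and the vanishing linear term; the last one
     gives a derivative of the remainder at the centre, whence order 3. *)
  assert (D2 : exists l, cder phi2 0 l).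
  { destruct J2 as (r3 & c2 & phi3 & Hr3 & E3 & J3). exists (phi3 0). now apply (jet_cder phi2 phi3 c2 r3). }
  destruct D2 as [l2 D2].
  destruct (cont0_neq_0 v (jet_cont0 3 v Jv) v0) as (r3 & Hr3 & Hn).
  set (r := Rmin (Rmin r1 r2) (Rmin r3 (Im w))).
  assert (Hr : (0 < r)%R) by (unfold r; repeat apply Rmin_glb_lt; easy).
  assert (Hrr : forall x, (x < r)%R -> (x < r1 /\ x < r2 /\ x < r3 /\ x < Im w)%R).
  { intros x Hx. apply Rmin_Rgt in Hx. destruct Hx as [Ha Hb]. apply Rmin_Rgt in Ha, Hb. lra. }
  assert (Hf : forall z, (Cmod (z - w) < r)%R -> z <> w ->
    E z / Cpow (u z) 2 = c0 / Cpow (z - w) 2 + phi2 (z - w) /\ u z <> 0).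
  { intros z Hz Hzw. destruct (Hrr _ Hz) as (H1 & H2 & H3 & _). set (s := z - w) in *.
    assert (Es : z = w + s) by (unfold s; ring). assert (Hs : s <> 0) by (intros Z; apply Hzw; rewrite Es, Z; ring).
    specialize (Hn s H3). specialize (E1 s H1). rewrite E2, Ec1, Z1 in E1 by easy. unfold phi in E1.
    assert (Eu : u z = s * v s) by (rewrite Es; apply Huv). split.
    - assert (EE : E z = (c0 + s * (0 + s * phi2 s)) * (v s * v s)) by (rewrite <- E1, Es; field; easy).
      rewrite EE, Eu. simpl. field. split; easy.
    - rewrite Eu. now apply Cmult_neq_0. }
  exists c0, r. split.
  { rewrite Ec0. unfold phi. replace (w + 0) with w by ring. apply Cmult_neq_0; [easy|].
    intros Z. apply C1_neq_0. transitivity ((v 0 * v 0) * (/ v 0 * / v 0)); [field; easy|]. rewrite Z. ring. }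
  split; [easy|]. exists (fun z => phi2 (z - w)). split; [|intros z Hz Hzw; now apply Hf].
  intros z Hz. destruct (Ceq_dec z w) as [->|Hzw].
  - apply (cder_holo _ _ ((1 - 0) * l2)). apply (cder_comp (fun z => z - w) phi2); [apply cder_minus; [apply cder_id|apply cder_const]|].
    now replace (w - w) with (RtoC 0) by ring.
  (* The jets describe only the centre. Elsewhere in the disc the remainder is differentiable as the
     difference of the function and its polar part. *)
  - destruct SE as (E' & DE & _). destruct Su as (u' & Du & _). destruct (Hf z Hz Hzw) as [_ Hu].
    assert (Hzi : (0 < Im z)%R) by (apply (upper_ball w); now apply Hrr).
    assert (Hzw' : z - w <> 0) by (intros Z; apply Hzw; replace z with (z - w + w) by ring; rewrite Z; ring).
    pose proof (proj1 (Cmod_gt_0 _) Hzw') as Hp.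
    eapply cder_holo. apply (cder_ext_loc (fun z => E z / Cpow (u z) 2 - c0 / Cpow (z - w) 2) _ z _ (Rmin (Cmod (z - w)) (r - Cmod (z - w)))).
    + apply Rmin_glb_lt; lra.
    + intros x Hx. apply Rmin_Rgt in Hx. destruct (Hf x) as [Ex _].
      * replace (x - w) with ((x - z) + (z - w)) by ring. eapply Rle_lt_trans; [apply Cmod_triangle|]. lra.
      * intros ->. rewrite Cmod_minus_sym in Hx. lra.
      * rewrite Ex. ring.
    + apply (cder_minus (fun z => E z / Cpow (u z) 2) (fun z => c0 / Cpow (z - w) 2)).
      * apply (cder_div E (fun z => Cpow (u z) 2)); [now apply Cpow_nz|now apply DE|]. apply cder_pow. now apply Du.
      * apply (cder_div (fun _ => c0) (fun z => Cpow (z - w) 2)); [now apply Cpow_nz|apply cder_const|].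
        apply (cder_pow (fun z => z - w)), (cder_minus (fun z => z) (fun _ => w)); [apply cder_id|apply cder_const].
Qed.

(** Factors are numbered from 1 as in [prodJ], while the values [x] are numbered from 0; hence the
    shifts [S i] and [S j] below. *)
Fixpoint prod_except (w : nat -> C) (i n : nat) (t : C) : C :=
  match n with
  | O => 1
  | S k => prod_except w i k t * (if Nat.eqb i (S k) then 1 else J t - J (w (S k)))
  end.

Lemma prodJ_except_out (w : nat -> C) (i n : nat) (t : C) : (n < i)%nat -> prodJ w n t = prod_except w i n t.
Proof.
  induction n as [|n IH]; intros H; [easy|]. simpl prodJ. simpl prod_except. rewrite IH by lia.
  replace (i =? S n)%nat with false by (symmetry; apply Nat.eqb_neq; lia). easy.
Qed.

Lemma prodJ_except (w : nat -> C) (i n : nat) (t : C) : (1 <= i <= n)%nat ->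
  prodJ w n t = (J t - J (w i)) * prod_except w i n t.
Proof.
  induction n as [|n IH]; intros H; [lia|]. simpl prodJ. simpl prod_except.
  destruct (Nat.eqb_spec i (S n)) as [->|Hn].
  - rewrite (prodJ_except_out w (S n)) by lia. ring.
  - rewrite IH by lia. ring.
Qed.

Lemma smooth_J_minus (k : nat) (c : C) : smooth k (fun t => J t - c).
Proof. apply (smooth_plus k J (fun _ => - c)); [apply smooth_J|apply smooth_const]. Qed.

Lemma smooth_prodJ (k : nat) (w : nat -> C) (n : nat) : smooth k (prodJ w n).
Proof.
  induction n as [|n IH]; [exact (smooth_const k 1)|].
  apply (smooth_mult k (prodJ w n) (fun t => J t - J (w (S n)))); [easy|apply smooth_J_minus].
Qed.

Lemma smooth_prod_except (k : nat) (w : nat -> C) (i n : nat) : smooth k (prod_except w i n).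
Proof.
  induction n as [|n IH]; [exact (smooth_const k 1)|].
  apply (smooth_mult k (prod_except w i n) (fun t => if Nat.eqb i (S n) then 1 else J t - J (w (S n)))); [easy|].
  destruct (Nat.eqb i (S n)); [apply smooth_const|apply smooth_J_minus].
Qed.

Lemma prod_except_neq_0 (w : nat -> C) (i n : nat) (t : C) :
  (forall j, (1 <= j <= n)%nat -> j <> i -> J t <> J (w j)) -> prod_except w i n t <> 0.
Proof.
  induction n as [|n IH]; intros H; [exact C1_neq_0|]. simpl prod_except.
  apply Cmult_neq_0; [apply IH; intros j Hj; apply H; lia|].
  destruct (Nat.eqb_spec i (S n)) as [->|Hn]; [exact C1_neq_0|]. apply Cminus_neq_0. apply H; [lia|congruence].
Qed.

Lemma cder_prod_except (w : nat -> C) (i n : nat) (t : C) : (0 < Im t)%R ->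
  (forall j, (1 <= j <= n)%nat -> j <> i -> J t <> J (w j)) ->
  cder (prod_except w i n) t (prod_except w i n t * (dJ t * csum (fun j => if Nat.eqb i (S j) then 0 else / (J t - J (w (S j)))) n)).
Proof.
  intros Ht. induction n as [|n IH]; intros H.
  - apply cder_eq with (RtoC 0); [simpl; ring|]. exact (cder_const 1 t).
  - specialize (IH ltac:(intros j Hj; apply H; lia)).
    set (a := fun j => if Nat.eqb i (S j) then RtoC 0 else / (J t - J (w (S j)))) in *.
    change (csum a (S n)) with (csum a n + a n). simpl prod_except. unfold a at 2.
    destruct (Nat.eqb_spec i (S n)) as [->|Hn].
    + apply cder_eq with (prod_except w (S n) n t * (dJ t * csum a n) * 1 + prod_except w (S n) n t * 0); [ring|].
      apply (cder_mult (prod_except w (S n) n) (fun _ => 1)); [easy|apply cder_const].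
    + assert (Hj : J t - J (w (S n)) <> 0) by (apply Cminus_neq_0, H; [lia|congruence]).
      apply cder_eq with (prod_except w i n t * (dJ t * csum a n) * (J t - J (w (S n))) + prod_except w i n t * (dJ t - 0)).
      * field. exact Hj.
      * apply (cder_mult (prod_except w i n) (fun t => J t - J (w (S n)))); [easy|].
        apply (cder_minus J (fun _ => J (w (S n)))); [now apply cder_J|apply cder_const].
Qed.

Lemma cder_dJ (t : C) : (0 < Im t)%R -> eQ t <> 0 -> eR t <> 0 ->
  cder dJ t (dJ t * (twopii * (eP t / 6 - 2 * eR t / (3 * eQ t) - eQ t * eQ t / (2 * eR t)))).
Proof.
  intros Ht HQ HR. pose proof (Delta_neq_0 t Ht) as HD. unfold dJ.
  pose proof (cder_eQ t Ht) as DQ. pose proof (cder_eR t Ht) as DR. pose proof (cder_Delta t Ht) as DD.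
  set (Q' := twopii * ((eP t * eQ t - eR t) / 3)) in *. set (R' := twopii * ((eP t * eR t - eQ t * eQ t) / 2)) in *.
  set (D' := twopii * (eP t * Defs.Delta t)) in *.
  apply cder_eq with (- twopii * ((((INR 2 * Cpow (eQ t) 1 * Q') * eR t + Cpow (eQ t) 2 * R') * (1728 * Defs.Delta t)
     - (Cpow (eQ t) 2 * eR t) * (1728 * D')) / ((1728 * Defs.Delta t) * (1728 * Defs.Delta t)))).
  - replace (RtoC (INR 2)) with (RtoC 2) by (f_equal; simpl; ring). unfold Q', R', D'. simpl Cpow.
    set (D := Defs.Delta t) in *. set (k := twopii). field. repeat split; easy.
  - apply cder_scal. apply (cder_div (fun x => Cpow (eQ x) 2 * eR x) (fun x => 1728 * Defs.Delta x)).
    + apply Cmult_neq_0; [apply RtoC_neq; lra|easy].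
    + apply (cder_mult (fun x => Cpow (eQ x) 2) eR); [now apply cder_pow|easy].
    + now apply cder_scal.
Qed.

(* For x = J(t), eQ^3 / (1728 Delta) = x and eR^2 / (1728 Delta) = x - 1 turn the equilibrium equation into the
   vanishing of the residue of eta^4 / prodJ^2. *)
Lemma f_n_double_pole (n i : nat) (w : nat -> C) (x : nat -> R) : (i < n)%nat ->
  (forall j, (j < n)%nat -> (0 < Im (w (S j)))%R /\ J (w (S j)) = RtoC (x j)) ->
  (forall j, (j < n)%nat -> (0 < x j < 1)%R) ->
  (forall j k, (j < n)%nat -> (k < n)%nat -> j <> k -> x j <> x k) ->
  (4 / x i - 3 / (1 - x i) + 12 * rsum (fun j => if Nat.eqb i j then 0 else / (x i - x j)) n = 0)%R ->
  double_pole_zero_residue (f_n n w) (w (S i)).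
Proof.
  intros Hi Hw Hx Hd Heq. destruct (Hw i Hi) as [Hwi Ji]. set (t := w (S i)) in *. specialize (Hx i Hi).
  pose proof (Delta_neq_0 t Hwi) as HD.
  pose proof (J_eq t Hwi) as EJ. pose proof (J_minus_1 t Hwi) as EJ1. rewrite Ji in EJ, EJ1.
  assert (HQ : eQ t <> 0).
  { intros E. rewrite E in EJ. apply (RtoC_neq (x i)); [lra|]. rewrite EJ. unfold Cdiv. simpl. ring. }
  assert (HR : eR t <> 0).
  { intros E. rewrite E in EJ1. apply (RtoC_neq (x i - 1)); [lra|]. rewrite RtoC_minus, EJ1. unfold Cdiv. simpl. ring. }
  assert (Hne : forall j, (1 <= j <= n)%nat -> j <> S i -> J t <> J (w j)).
  { intros [|j] Hj Hji; [lia|]. rewrite Ji, (proj2 (Hw j ltac:(lia))). intros E. apply RtoC_inj in E. revert E. apply Hd; lia. }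
  pose proof (prod_except_neq_0 w (S i) n t Hne) as HV. pose proof (cder_prod_except w (S i) n t Hwi Hne) as DV.
  set (V := prod_except w (S i) n) in *.
  set (S := rsum (fun j => if Nat.eqb i j then 0 else / (x i - x j))%R n) in *.
  rewrite (csum_ext _ (fun j => RtoC (if Nat.eqb i j then 0 else / (x i - x j))%R)) in DV.
  2:{ intros j Hj. change (Nat.eqb (Datatypes.S i) (Datatypes.S j)) with (Nat.eqb i j).
      destruct (Nat.eqb_spec i j) as [->|Hij]; [easy|]. rewrite Ji, (proj2 (Hw j Hj)), RtoC_inv, RtoC_minus; [easy|].
      specialize (Hd i j Hi Hj Hij). lra. }
  rewrite csum_RtoC in DV. fold S in DV.
  pose proof (cder_dJ t Hwi HQ HR) as D2. set (J2 := dJ t * _) in D2.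
  (* J(t+s) - x_i = s G(s) with G(0) = J'(t) and G'(0) = J''(t)/2, the data for the quotient by the
     square. *)
  destruct (divide_once 3 (fun s => J (t + s) - x i) (fun s => dJ (t + s)) (Im t) J2 Hwi) as (G & HG & G0 & JG & DG).
  - replace (t + 0) with t by ring. rewrite Ji. ring.
  - intros s Hs. apply cder_eq with (dJ (t + s) - 0); [ring|]. apply cder_minus; [|apply cder_const].
    apply cder_shift, cder_J. now apply upper_shift_ball.
  - apply smooth_jet; [easy|apply smooth_dJ].
  - apply cder_shift. now replace (t + 0) with t by ring.
  - replace (t + 0) with t in G0 by ring.
    assert (HdJ : dJ t <> 0).
    { unfold dJ. apply Cmult_neq_0.
      - intros E. apply twopii_neq_0. replace twopii with (- - twopii) by ring. rewrite E. ring.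
      - intros E. apply (Cmult_neq_0 _ _ (Cpow_nz _ 2 HQ) HR).
        transitivity (Cpow (eQ t) 2 * eR t / (1728 * Defs.Delta t) * (1728 * Defs.Delta t)); [|rewrite E; ring].
        set (e := Cpow _ 2). field. easy. }
    apply (double_pole_quotient (fun z => Cpow (eta z) 4) (prodJ w n) (fun s => G s * V (t + s)) t
      (twopii * (INR 4 / 24 * eP t * Cpow (eta t) 4)) (J2 / 2 * V t + dJ t * (V t * (dJ t * S)))).
    + easy.
    + apply smooth_eta_pow.
    + apply smooth_prodJ.
    + intros s. rewrite (prodJ_except w (Datatypes.S i)) by lia. fold t. fold V. rewrite Ji, HG. ring.
    + apply (jet_mult 3 G (fun s => V (t + s))); [now apply (jet_pred 3)|]. apply smooth_jet; [easy|apply smooth_prod_except].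
    + replace (t + 0) with t by ring. rewrite G0. now apply Cmult_neq_0.
    + apply Cpow_nz. now apply eta_neq_0.
    + now apply cder_eta_pow.
    + apply cder_eq with (J2 / 2 * V (t + 0) + G 0 * (V t * (dJ t * S))); [replace (t + 0) with t by ring; now rewrite G0|].
      apply (cder_mult G (fun s => V (t + s))); [easy|]. apply cder_shift. now replace (t + 0) with t by ring.
    + replace (t + 0) with t by ring. rewrite G0. unfold J2.
      replace (RtoC (INR 4)) with (RtoC 4) by (f_equal; simpl; ring).
      set (e4 := Cpow (eta t) 4).
      (* The equilibrium equation solved for the sum over the other points. Afterwards x_i and 1 -
         x_i are replaced by E4^3/(1728 Delta) and -E6^2/(1728 Delta). *)
      assert (HS : RtoC S = (3 / (1 - x i) - 4 / x i) / 12).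
      { replace S with ((3 / (1 - x i) - 4 / x i) / 12)%R by lra.
        rewrite !RtoC_div, RtoC_minus, !RtoC_div, RtoC_minus by lra. easy. }
      assert (Ex1 : 1 - RtoC (x i) = - (Cpow (eR t) 2 / (1728 * Defs.Delta t))) by (rewrite <- EJ1; ring).
      rewrite Ex1, EJ in HS.
      assert (HS' : dJ t * RtoC S = twopii * (eQ t * eQ t / (4 * eR t) + eR t / (3 * eQ t))).
      { rewrite HS. unfold dJ. simpl Cpow. set (D := Defs.Delta t) in *. set (k := twopii). field. repeat split; easy. }
      rewrite HS'. set (k := twopii). set (d := dJ t) in *. set (VV := V t) in *. field. split; easy.
Qed.

Lemma f_n_mob (n : nat) (w : nat -> C) : exists chi : SL2Z -> C, is_character chi /\
  forall (g : SL2Z) (t : C), (0 < Im t)%R -> f_n n w (mob g t) = chi g * Cpow (jfac g t) 2 * f_n n w t.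
Proof.
  set (P := fun (g : SL2Z) (c : C) => c <> 0 /\ forall t, (0 < Im t)%R ->
    Cpow (eta (mob g t)) 4 = c * Cpow (jfac g t) 2 * Cpow (eta t) 4).
  set (chi := fun g => epsilon (inhabits (RtoC 0)) (P g)).
  assert (Hchi : forall g, P g (chi g)).
  { intros g. apply (epsilon_spec (inhabits (RtoC 0)) (P g)). apply eta4_multiplier. }
  exists chi. split; [split|].
  (* The multipliers were chosen separately for each matrix; evaluating at the single point i, where
     eta^4 and the automorphy factors are non-zero, makes them multiplicative. *)
  - intros g h. assert (Hi : (0 < Im Ci)%R) by (unfold Im, Ci; simpl; lra).
    pose proof (mob_upper h Ci Hi) as Hh. destruct (mob_mul g h Ci Hi) as [Em Ej].
    pose proof (proj2 (Hchi (SL2Z_mul g h)) Ci Hi) as E1. pose proof (proj2 (Hchi g) _ Hh) as E2.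
    pose proof (proj2 (Hchi h) Ci Hi) as E3. rewrite Em, E2, E3, Ej in E1.
    pose proof (Cpow_nz _ 4 (eta_neq_0 Ci Hi)) as He. pose proof (jfac_neq_0 g _ Hh) as J1. pose proof (jfac_neq_0 h _ Hi) as J2.
    set (e := Cpow (eta Ci) 4) in *. set (a := jfac g (mob h Ci)) in *. set (b := jfac h Ci) in *.
    set (cg := chi g) in *. set (ch := chi h) in *. set (cgh := chi (SL2Z_mul g h)) in *.
    transitivity ((cgh * Cpow (a * b) 2 * e) / (a * b * (a * b) * e)).
    + simpl. field. repeat split; easy.
    + rewrite <- E1. simpl. field. repeat split; easy.
  - intros g. apply Hchi.
  - intros g t Ht. unfold f_n.
    assert (E : prodJ w n (mob g t) = prodJ w n t).
    { clear -Ht. induction n as [|n IH]; simpl; [easy|]. now rewrite IH, J_mob. }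
    rewrite E, (proj2 (Hchi g) t Ht). unfold Cdiv. ring.
Qed.

(** * Non-vanishing of the denominator and behaviour at infinity *)

Lemma prodJ_neq_0 (w : nat -> C) (n : nat) (t : C) :
  (forall i, (1 <= i <= n)%nat -> J t <> J (w i)) -> prodJ w n t <> 0.
Proof.
  intros H. rewrite (prodJ_except_out w (S n)) by lia. apply prod_except_neq_0. intros j Hj _. now apply H.
Qed.

(** Delta, the 24th power of eta, tends to 0 at the cusp, so |eta| <= 1 high up; this avoids the
    fractional powers of q. *)
Lemma eta4_bounded : exists Y : R, forall t, (Y < Im t)%R -> (0 < Im t)%R -> (Cmod (Cpow (eta t) 4) <= 1)%R.
Proof.
  assert (T : tends Defs.Delta 0).
  { apply tends_ext with (fun t => qexp t * Cexp (- (24) * Fs (colam clog) t)).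
    - intros t Ht. now rewrite Cexp_elog_24.
    - apply tends_eq with (0 * Cexp (- (24) * colam clog 0%nat)); [ring|]. apply tends_mult; [apply tends_qexp|].
      apply (tends_cont (fun t => - (24) * Fs (colam clog) t) Cexp _ (Cexp (- (24) * colam clog 0%nat))); [|apply cder_Cexp].
      apply tends_mult; [apply tends_const|]. apply tends_Fs, growth_colam, growth_clog. }
  destruct (T 1%R ltac:(lra)) as [Y HY]. exists Y. intros t Ht _. specialize (HY t Ht).
  replace (Defs.Delta t - 0) with (Defs.Delta t) in HY by ring. unfold Defs.Delta in HY. rewrite Cmod_pow in *.
  set (m := Cmod (eta t)) in *. assert (Hm : (0 <= m)%R) by apply Cmod_ge_0.
  destruct (Rle_lt_dec m 1) as [H|H]; [rewrite <- (pow1 4); now apply pow_incr|].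
  pose proof (pow_R1_Rle m 24 ltac:(lra)). lra.
Qed.

Lemma J_large : exists Y : R, forall t, (Y < Im t)%R -> (2 <= Cmod (J t))%R.
Proof.
  (* 8640 = 5 * 1728 makes the principal part at least 5 in modulus; the constant 744/1728 and the
     remainder take away at most 1 each. *)
  destruct (J_cusp 1%R ltac:(lra)) as [Y1 H1]. destruct (tends_qexp (/ 8640)%R ltac:(lra)) as [Y2 H2].
  exists (Rmax Y1 Y2). intros t Ht. apply Rmax_Rlt in Ht. destruct Ht as [Ht1 Ht2].
  specialize (H1 t Ht1). specialize (H2 t Ht2). replace (qexp t - 0) with (qexp t) in H2 by ring.
  pose proof (qexp_neq_0 t) as Hq. apply Cmod_gt_0 in Hq as Hp.
  set (z := / (1728 * qexp t)) in *.
  assert (Hz : (5 <= Cmod z)%R).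
  { unfold z. assert (Hn : 1728 * qexp t <> 0) by (apply Cmult_neq_0; [apply RtoC_neq; lra|easy]).
    rewrite Cmod_inv, Cmod_mult, Cmod_RtoC_pos by (easy || lra). rewrite <- (Rinv_inv 5). apply Rinv_le_contravar; lra. }
  replace z with (J t + (- (J t - z - 744 / 1728) + - (744 / 1728))) in Hz by ring.
  assert (H3 : (Cmod (744 / 1728) <= 1)%R) by (rewrite <- RtoC_div by lra; rewrite Cmod_RtoC_pos; lra).
  pose proof (Cmod_triangle (J t) (- (J t - z - 744 / 1728) + - (744 / 1728))).
  pose proof (Cmod_triangle (- (J t - z - 744 / 1728)) (- (744 / 1728))) as H4. rewrite !Cmod_opp in H4. lra.
Qed.

Lemma prodJ_large (w : nat -> C) (n : nat) (t : C) : (2 <= Cmod (J t))%R ->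
  (forall i, (1 <= i <= n)%nat -> (Cmod (J (w i)) <= 1)%R) -> (1 <= Cmod (prodJ w n t))%R.
Proof.
  intros Ht. induction n as [|n IH]; intros H; simpl prodJ; [rewrite Cmod_1; apply Rle_refl|].
  rewrite Cmod_mult. specialize (IH ltac:(intros i Hi; apply H; lia)). specialize (H (S n) ltac:(lia)).
  pose proof (Cmod_triangle_rev (J t) (- J (w (S n)))) as H1. rewrite Cmod_opp in H1. unfold Cminus.
  rewrite <- (Rmult_1_l 1). apply Rmult_le_compat; lra.
Qed.

Theorem theorem7p2 :
  forall n : nat, (1 <= n)%nat ->
  exists w : nat -> C,
    (forall i, (1 <= i <= n)%nat -> upper_half (w i)) /\
    let f := f_n n w in
    let pole := fun t => exists i, (1 <= i <= n)%nat /\ sl2_equiv t (w i) in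
    (* weight 2 modular form with a character of SL_2(Z) *)
    (exists chi : SL2Z -> C, is_character chi /\
       forall (g : SL2Z) (t : C), upper_half t -> ~ pole t ->
         f (mob g t) = chi g * Cpow (jfac g t) 2 * f t) /\
    (* non-vanishing on H *)
    (forall t, upper_half t -> ~ pole t -> f t <> 0) /\
    (* double pole with zero residue at each w_i *)
    (forall i, (1 <= i <= n)%nat -> double_pole_zero_residue f (w i)) /\
    (* holomorphic elsewhere in H *)
    (forall t, upper_half t -> ~ pole t -> holo_at f t) /\
    (* holomorphic at infinity: bounded as Im tau -> +oo *)
    (exists (Y M : R), forall t, (Y < Im t)%R -> ~ pole t -> (Cmod (f t) <= M)%R).

Proof.
  intros n _. destruct (equilibrium n) as (x & Hx & Hd & Heq).
  set (U := fun j u => (arc_lo < u < 1)%R /\ J (cay (RtoC u)) = RtoC (x j)).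
  set (u := fun j => epsilon (inhabits 0%R) (U j)).
  assert (Hu : forall j, (j < n)%nat -> U j (u j)).
  { intros j Hj. apply (epsilon_spec (inhabits 0%R) (U j)). now apply J_arc_surjective, Hx. }
  (* [pred] matches the indices 1 to n of the points with the zero-based sequence [x]. *)
  set (w := fun k => cay (RtoC (u (pred k)))). pose proof arc_lo_bounds as Hlo.
  assert (Hw : forall j, (j < n)%nat -> (0 < Im (w (S j)))%R /\ J (w (S j)) = RtoC (x j)).
  { intros j Hj. destruct (Hu j Hj) as [H1 H2]. split; [apply cay_Im_pos; simpl; lra|exact H2]. }
  exists w. split; [intros [|j] Hj; [lia|]; apply Hw; lia|]. intros f pole.
  (* A zero of the denominator means J t = x_j for some j; as the fibre is one orbit, t would be
     equivalent to that point. *)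
  assert (Hoff : forall t, (0 < Im t)%R -> ~ pole t -> prodJ w n t <> 0).
  { intros t Ht Hp. apply prodJ_neq_0. intros [|j] Hj E; [lia|]. apply Hp. exists (S j). split; [easy|].
    assert (Hj' : (j < n)%nat) by lia. destruct (Hu j Hj') as [H1 H2].
    apply (J_fiber (x j)); [now apply Hx|easy|easy|easy|]. now rewrite E, (proj2 (Hw j Hj')). }
  split; [|split; [|split; [|split]]].
  - destruct (f_n_mob n w) as (chi & Hc & Hm). exists chi. split; [easy|]. intros g t Ht _. now apply Hm.
  - intros t Ht Hp E. apply (Cpow_nz _ 4 (eta_neq_0 t Ht)). pose proof (Cpow_nz _ 2 (Hoff t Ht Hp)) as Hz.
    transitivity (f t * Cpow (prodJ w n t) 2); [|rewrite E; ring].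
    unfold f, f_n. set (e := Cpow (eta t) 4). set (z := Cpow (prodJ w n t) 2) in *. field. exact Hz.
  - intros [|i] Hi; [lia|]. assert (i < n)%nat by lia. apply (f_n_double_pole n i w x); try assumption. now apply Heq.
  - intros t Ht Hp. destruct (smooth_eta_pow 1 4) as (e' & He & _). destruct (smooth_prodJ 1 w n) as (p' & Hp' & _).
    eapply cder_holo. apply (cder_div (fun z => Cpow (eta z) 4) (fun z => Cpow (prodJ w n z) 2)).
    + now apply Cpow_nz, Hoff.
    + now apply He.
    + now apply cder_pow, Hp'.
  (* High up |eta^4| <= 1, and every factor satisfies |J - x_j| >= 2 - 1, so M = 1 serves as the
     bound. *)
  - destruct eta4_bounded as [Y1 H1]. destruct J_large as [Y2 H2]. exists (Rmax 0 (Rmax Y1 Y2)), 1%R. intros t Ht _.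
    apply Rmax_Rlt in Ht. destruct Ht as [Ht0 Ht]. apply Rmax_Rlt in Ht. destruct Ht as [Ht1 Ht2].
    assert (HP : (1 <= Cmod (prodJ w n t))%R).
    { apply prodJ_large; [now apply H2|]. intros [|j] Hj; [lia|]. rewrite (proj2 (Hw j ltac:(lia))).
      specialize (Hx j ltac:(lia)). rewrite Cmod_RtoC_pos; lra. }
    unfold f, f_n. rewrite Cmod_div by (apply Cpow_nz, Cmod_neq; lra). rewrite (Cmod_pow (prodJ w n t)).
    specialize (H1 t Ht1 Ht0). apply Rle_div_l; [apply pow_lt; lra|]. pose proof (pow_R1_Rle _ 2 HP). lra.
Qed.
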